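(* Let $\mathbb{G}$ be a $k$-step Carnot group of homogeneous dimension $Q$ with homogeneous distance $\varrho$. Case (i). Let $S\subset\mathbb{G}$ be a hypersurface of class $C^1$ and let $x\in\mathrm{Int}(S\setminus C_S)$. Then $$\sigma_H^{n-1}(S\cap B_\varrho(x,r))\sim\kappa_\varrho(\nu_H(x))\,r^{Q-1}\qquad\text{as }r\to0^+,$$ where $\kappa_\varrho(\nu_H(x))=\sigma_H^{n-1}\big(\mathcal{I}(\nu_H(x))\cap B_\varrho(x,1)\big)$ and $\mathcal{I}(\nu_H(x))$ is the vertical hyperplane through $x$ orthogonal to $\nu_H(x)$. Case (ii). Let $x\in\mathrm{Int}(S\cap C_S)$ and let $\alpha\in\{h+1,\dots,n\}$ be such that, locally around $x$, $S$ can be represented as an $X_\alpha$-graph of class $C^i$, where $i=\mathrm{ord}(\alpha)\in\{2,\dots,k\}$; that is (assuming without loss of generality, by left translation, $x=0$), for small $r$ $$S\cap B_\varrho(0,r)\subset\exp\left\{(\zeta_1,\dots,\zeta_{\alpha-1},\psi(\zeta),\zeta_{\alpha+1},\dots,\zeta_n):\zeta=(\zeta_1,\dots,\zeta_{\alpha-1},0,\zeta_{\alpha+1},\dots,\zeta_n)\in e_\alpha^\perp\right\}$$ for some $C^i$ function $\psi:e_\alpha^\perp\cong\mathbb{R}^{n-1}\to\mathbb{R}$ with $\psi(0)=0$. If $$\frac{\partial^{(l)}\psi}{\partial\zeta_{j_1}\cdots\partial\zeta_{j_l}}(0)=0\quad\text{whenever}\quad\mathrm{ord}(j_1)+\dots+\mathrm{ord}(j_l)<i,\qquad(\ast)$$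 then $$\sigma_H^{n-1}(S\cap B_\varrho(x,r))\sim\kappa_\varrho(C_S(x))\,r^{Q-1}\qquad\text{as }r\to0^+,$$ where $\kappa_\varrho(C_S(x))=\sigma_H^{n-1}(S_\infty\cap B_\varrho(x,1))$, $S_\infty=\{(\zeta_1,\dots,\zeta_{\alpha-1},\widetilde\psi(\zeta),\zeta_{\alpha+1},\dots,\zeta_n):\zeta\in e_\alpha^\perp\}$ and $$\widetilde\psi(\zeta)=\sum_{l=1}^{i}\frac1{l!}\sum_{\substack{j_1,\dots,j_l\\ \mathrm{ord}(j_1)+\dots+\mathrm{ord}(j_l)=i}}\frac{\partial^{(l)}\psi}{\partial\zeta_{j_1}\cdots\partial\zeta_{j_l}}(0)\,\zeta_{j_1}\cdots\zeta_{j_l}.$$ Finally, if $(\ast)$ does not hold, then $S_\infty=\emptyset$ and $\kappa_\varrho(C_S(x))=0$.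
   Context: A $k$-step Carnot group $(\mathbb{G},\bullet)$ is an $n$-dimensional connected, simply connected, nilpotent Lie group (identity $0$) whose Lie algebra satisfies $\mathfrak{g}=H_1\oplus\dots\oplus H_k$, $[H_1,H_{i-1}]=H_i$ for $2\le i\le k$, $[H_1,H_k]=0$. $H:=H_1$ is regarded as a left-invariant subbundle of $T\mathbb{G}$; $h_i=\dim H_i$, $h=h_1$, $n_i=h_1+\dots+h_i$, $Q=\sum_i i\,h_i$. $X_1,\dots,X_n$ is a left-invariant frame with $X_j\in H_i$ for $n_{i-1}<j\le n_i$ (in this case $\mathrm{ord}(j):=i$), orthonormal for a fixed left-invariant Riemannian metric; $e_j=X_j(0)$ is the standard basis of $\mathbb{R}^n\cong\mathfrak{g}$. $\mathbb{G}$ is identified with $\mathfrak{g}$ by exponential coordinates; $x_H$ is the $H$-component of $x$; the dilation $\delta_t$ multiplies the $H_i$-component by $t^i$. $\varrho$ is a continuous left-invariant distance with $\varrho(\delta_tx,\delta_ty)=t\varrho(x,y)$, $B_\varrho(x,r)$ its open ball. $\nu$ is the Riemannian unit normal of $S$, $P_H$ orthogonal projection onto $H$, $C_S=\{x\in S:|P_H\nu|=0\}$ the characteristic set, $\nu_H=P_H\nu/|P_H\nu|$ off $C_S$, and $\sigma_H^{n-1}=|P_H\nu|\,\sigma_R^{n-1}$, with $\sigma_R^{n-1}$ the Riemannian measure. $\mathrm{Int}$ denotes interior points of $S$ (not in $\partial S$). The vertical hyperplane is $\mathcal{I}(\nu_H(x))=\{y:\langle y_H-x_H,\nu_H(x)\rangle=0\}$.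 The notation $f(r)\sim\kappa\,r^{Q-1}$ as $r\to0^+$ means $\lim_{r\to0^+}f(r)/r^{Q-1}=\kappa$. $S_\infty$ is the limit set of $\delta_{1/r}S$ as $r\to0^+$ (in the case $x=0$), with $\kappa_\varrho(C_S(x))$ the resulting limit $\lim_{r\to0^+}\sigma_H^{n-1}(S\cap B_\varrho(x,r))/r^{Q-1}$; for general $x$ one first left-translates $S$ by $x^{-1}$. The function $\psi$ need only be defined near $0\in e_\alpha^\perp$, and the indices $j_1,\dots,j_l$ range over $\{1,\dots,n\}\setminus\{\alpha\}$.
   Formalization: S_∞ is read as the limit of δ_{1/r}S among X_α-graphs over e_α^⊥, empty if none exists, and κ as σ_H(S_∞∩B); when (∗) fails nothing is claimed on the limit of σ_H(S∩B)/r^{Q-1}, as that limit need not be 0 (Engel group, x_4=x_1²) and the bare limit set always contains 0. *)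

(* Defs.v *)
From HB Require Import structures.
From mathcomp Require Import all_boot all_order all_algebra.
From mathcomp Require Import all_classical all_reals all_analysis.

Set Implicit Arguments.
Unset Strict Implicit.
Unset Printing Implicit Defensive.

Import Order.TTheory GRing.Theory Num.Theory.
Import numFieldNormedType.Exports.

Local Open Scope classical_set_scope.
Local Open Scope ring_scope.

(* The sigma-algebra generated by the coordinates, i.e. the Borel one. *)
Section RowMeasurable.
Context {R : realType} (p : nat).

Let coord (i : 'I_p) (x : 'rV[R]_p) : measurableTypeR R := x 0 i.

Let rv_set0 : g_sigma_preimage coord set0.
Proof. exact: sigma_algebra0. Qed.

Let rv_setC A : g_sigma_preimage coord A -> g_sigma_preimage coord (~` A).
Proof. exact: sigma_algebraC. Qed.

Let rv_bigcup (F : _^nat) : (forall i, g_sigma_preimage coord (F i)) ->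
  g_sigma_preimage coord (\bigcup_i (F i)).
Proof. exact: sigma_algebra_bigcup. Qed.

HB.instance Definition _ := @isMeasurable.Build
  (measure_tuple_display default_measure_display)
  'rV[R]_p (g_sigma_preimage coord) rv_set0 rv_setC rv_bigcup.

Lemma measurable_rV_coord (i : 'I_p) :
  measurable_fun setT (fun x : 'rV[R]_p => x 0 i : measurableTypeR R).
Proof.
move=> _ Y mY; rewrite setTI; apply: sub_sigma_algebra => /=.
rewrite -bigcup_seq/=; exists i => /=; first by rewrite mem_index_enum.
by exists Y => //; rewrite setTI.
Qed.

Lemma measurable_rVP d (T : measurableType d) (f : T -> 'rV[R]_p) :
  (forall i, measurable_fun setT (fun t => f t 0 i : measurableTypeR R)) ->
  measurable_fun setT f.
Proof.
move=> mf _ Y mY; rewrite setTI.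
suff : g_sigma_preimage coord `<=` [set A | measurable (f @^-1` A)] by exact.
apply: smallest_sub.
  split => /=.
  - by rewrite preimage_set0.
  - by move=> A mA; rewrite setTD preimage_setC; exact: measurableC.
  - by move=> F mF; rewrite preimage_bigcup; exact: bigcupT_measurable.
rewrite -bigcup_seq; apply: bigcup_sub => i _ A [B mB <-] /=.
by rewrite setTI -[X in measurable X]setTI; exact: mf.
Qed.

End RowMeasurable.

Section RowLebesgue.
Context {R : realType}.

Section step.
Variables (p : nat) (mu : {sigma_finite_measure set 'rV[R]_p -> \bar R}).

Definition rV_cons (u : measurableTypeR R * 'rV[R]_p) : 'rV[R]_p.+1 :=
  row_mx (const_mx u.1 : 'rV[R]_1) u.2.

Definition rV_uncons (x : 'rV[R]_p.+1) : measurableTypeR R * 'rV[R]_p :=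
  (x 0 ord0, rsubmx (x : 'rV[R]_(1 + p))).

Lemma rV_consK : cancel rV_cons rV_uncons.
Proof.
case=> a x; rewrite /rV_uncons /rV_cons /= row_mxKr; congr pair.
transitivity ((row_mx (const_mx a : 'rV[R]_1) x) 0 (lshift p ord0)).
  by congr (row_mx _ _ _ _); exact: val_inj.
by rewrite row_mxEl mxE.
Qed.

Lemma measurable_rV_cons : measurable_fun setT rV_cons.
Proof.
apply: measurable_rVP => i.
case: (@split_ordP 1 p i) => j ->.
- have E u : rV_cons u 0 (lshift p j) = u.1.
    by rewrite /rV_cons (@row_mxEl R 1 1 p) mxE.
  by under eq_fun do rewrite E; exact: measurable_fst.
- have E u : rV_cons u 0 (rshift 1 j) = u.2 0 j.
    by rewrite /rV_cons (@row_mxEr R 1 1 p).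
  under eq_fun do rewrite E.
  exact: (measurableT_comp (measurable_rV_coord j) measurable_snd).
Qed.

Lemma measurable_rV_uncons : measurable_fun setT rV_uncons.
Proof.
apply: measurable_fun_pair; first exact: measurable_rV_coord.
apply: measurable_rVP => i.
under eq_fun do rewrite mxE.
exact: measurable_rV_coord.
Qed.

Definition rV_step : set 'rV[R]_p.+1 -> \bar R :=
  pushforward ((@lebesgue_measure R) \x mu)%E rV_cons.

Let rV_step0 : rV_step set0 = 0%E.
Proof. by rewrite /rV_step /pushforward preimage_set0 measure0. Qed.

Let rV_step_ge0 A : (0 <= rV_step A)%E.
Proof. by rewrite /rV_step /pushforward measure_ge0. Qed.

Let measurable_preimage_cons A : measurable A -> measurable (rV_cons @^-1` A).
Proof. by move=> mA; rewrite -[X in measurable X]setTI; exact: measurable_rV_cons. Qed.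

Let rV_step_sigma_additive : semi_sigma_additive rV_step.
Proof.
move=> F mF tF mUF; rewrite /rV_step /pushforward preimage_bigcup.
apply: measure_semi_sigma_additive.
- by move=> i; exact: measurable_preimage_cons.
- apply/trivIsetP => /= i j _ _ ij; rewrite -preimage_setI.
  by move/trivIsetP : tF => /(_ _ _ _ _ ij) ->//; rewrite preimage_set0.
- by rewrite -preimage_bigcup; exact: measurable_preimage_cons.
Qed.

HB.instance Definition _ := isMeasure.Build _ _ _ rV_step
  rV_step0 rV_step_ge0 rV_step_sigma_additive.

Let rV_step_sigma_finite : sigma_finite setT rV_step.
Proof.
have /sigma_finiteP[F [TF ndF Foo]] := sigma_finiteT (@lebesgue_measure R).
have /sigma_finiteP[G [TG ndG Goo]] := sigma_finiteT mu.
exists (fun i => rV_uncons @^-1` (F i `*` G i)).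
  rewrite -preimage_bigcup (_ : \bigcup_i _ = setT) ?preimage_setT//.
  apply/seteqP; split => // -[a x] _.
  have [i _ Fia] : (\bigcup_i F i) a by rewrite -TF.
  have [j _ Gjx] : (\bigcup_i G i) x by rewrite -TG.
  exists (maxn i j) => //; split.
  - by move: a Fia; exact/subsetPset/ndF/leq_maxl.
  - by move: x Gjx; exact/subsetPset/ndG/leq_maxr.
move=> i; have [mFi Fioo] := Foo i; have [mGi Gioo] := Goo i; split.
  by rewrite -[X in measurable X]setTI; apply: measurable_rV_uncons => //;
    exact: measurableX.
rewrite /rV_step /pushforward -comp_preimage.
rewrite (_ : rV_uncons \o rV_cons = id); last exact/funext/rV_consK.
by rewrite preimage_id product_measure1E// lte_mul_pinfty// ge0_fin_numE.
Qed.

HB.instance Definition _ := Measure_isSigmaFinite.Build _ _ _ rV_step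
  rV_step_sigma_finite.

End step.

(* Lebesgue measure of R^p as an iterated product, a Dirac mass for p = 0. *)
Fixpoint lebesgue_rV (p : nat) : {sigma_finite_measure set 'rV[R]_p -> \bar R} :=
  match p with
  | 0 => \d_(0 : 'rV[R]_0)
  | q.+1 => rV_step (lebesgue_rV q)
  end.

End RowLebesgue.

Section Calculus.
Context {R : realType}.
Implicit Types p q : nat.

Definition basis_vec p (j : 'I_p) : 'rV[R]_p := delta_mx 0 j.

Definition partial p (j : 'I_p) (f : 'rV[R]_p -> R) : 'rV[R]_p -> R :=
  fun u => 'D_(basis_vec j) f u.

Definition iter_partial p (s : seq 'I_p) (f : 'rV[R]_p -> R) :
  'rV[R]_p -> R := foldr (@partial p) f s.

Fixpoint class_C (i p : nat) (U : set 'rV[R]_p) (f : 'rV[R]_p -> R) : Prop :=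
  {in U, continuous f} /\
  match i with
  | 0 => True
  | i'.+1 => forall j : 'I_p,
      (forall u, U u -> derivable f u (basis_vec j)) /\
      class_C i' U (partial j f)
  end.

Definition grad p (f : 'rV[R]_p -> R) (u : 'rV[R]_p) : 'rV[R]_p :=
  \row_j partial j f u.

Definition class_C1_map p q (U : set 'rV[R]_p) (Phi : 'rV[R]_p -> 'rV[R]_q) :=
  forall j : 'I_q, class_C 1 U (fun u => Phi u 0 j).

Definition jacobian p q (Phi : 'rV[R]_p -> 'rV[R]_q) (u : 'rV[R]_p) :
  'M[R]_(p, q) := \matrix_(a < p, j < q) partial a (fun v => Phi v 0 j) u.

Definition enorm p (u : 'rV[R]_p) : R := Num.sqrt (\sum_j u 0 j ^+ 2).

End Calculus.

Section Hypersurface.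
Context {R : realType} {n : nat}.
Implicit Types (S : set 'rV[R]_n) (x y v : 'rV[R]_n).

(* Hypersurfaces are embedded and may have a boundary; surface_interior is the
   set of the points that are not on it. *)
Definition surface_interior S : set 'rV[R]_n := [set x | S x /\
  exists (U : set 'rV[R]_n) (f : 'rV[R]_n -> R),
    [/\ open U, U x, class_C 1 U f, grad f x != 0 &
        S `&` U = [set y | f y = 0] `&` U]].

Definition surface_boundary S : set 'rV[R]_n := [set x | S x /\
  exists (U : set 'rV[R]_n) (f g : 'rV[R]_n -> R),
    [/\ open U /\ U x, class_C 1 U f /\ class_C 1 U g, g x = 0,
        row_free (col_mx (grad f x) (grad g x)) &
        S `&` U = [set y | f y = 0 /\ 0 <= g y] `&` U]].

Definition C1_hypersurface S : Prop :=
  S `<=` surface_interior S `|` surface_boundary S.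

(* One-sided curves, so that the velocities span the tangent space also at a
   boundary point. *)
Definition tangent S x v : Prop := exists gamma : R -> 'rV[R]_n,
  [/\ gamma 0 = x, is_derive (0 : R) (1 : R) gamma v &
      \forall t \near 0^'+, S (gamma t)].

End Hypersurface.

Section BakerCampbellHausdorff.
Context {R : realType} {n : nat}.
Variables (k : nat) (br : 'rV[R]_n -> 'rV[R]_n -> 'rV[R]_n).

(* [:: a1; ...; am] |-> [a1, [a2, ..., [a(m-1), am]]] *)
Fixpoint nested_bracket (w : seq 'rV[R]_n) : 'rV[R]_n :=
  match w with
  | [::] => 0
  | a :: w' => if w' is [::] then a else br a (nested_bracket w')
  end.

(* Dynkin's form of log (exp x exp y).  The omitted terms are brackets of more
   than k vectors, which vanish in a Lie algebra that is nilpotent of step k. *)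
Definition bch (x y : 'rV[R]_n) : 'rV[R]_n :=
  \sum_(1 <= m < k.+1) ((-1) ^+ m.-1 / m%:R) *:
    \sum_(rs : {ffun 'I_m -> 'I_k.+1 * 'I_k.+1} |
          [forall a, 0 < (rs a).1 + (rs a).2]%N)
      ((\sum_a ((rs a).1 + (rs a).2))%N%:R *
       \prod_a (((rs a).1)`! * ((rs a).2)`!)%N%:R)^-1 *:
      nested_bracket
        (flatten [seq nseq (rs a).1 x ++ nseq (rs a).2 y | a <- enum 'I_m]).

End BakerCampbellHausdorff.

(* A k-step Carnot group in exponential coordinates: its Lie algebra is R^n
   with the bracket below, H_i is spanned by the e_j with ord j = i, and the
   product is given by the Baker-Campbell-Hausdorff formula. *)
Record carnot_group (R : realType) (n k : nat) := CarnotGroup {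
  ord : 'I_n -> nat;
  bracket : 'rV[R]_n -> 'rV[R]_n -> 'rV[R]_n;
  layer (i : nat) : {vspace 'rV[R]_n} :=
    <<[seq basis_vec j | j <- enum 'I_n & ord j == i]>>%VS;
  bracket_layer (a b : nat) : {vspace 'rV[R]_n} :=
    <<[seq bracket (basis_vec i) (basis_vec j) |
        i <- [seq i <- enum 'I_n | ord i == a],
        j <- [seq j <- enum 'I_n | ord j == b]]>>%VS;
  ord_bounds : forall j, (1 <= ord j <= k)%N;
  ord_mono : forall i j : 'I_n, (i <= j)%N -> (ord i <= ord j)%N;
  ord_step : exists j, ord j = k;
  bracket_linear : forall u, linear (bracket u);
  bracket_alternating : forall u, bracket u u = 0;
  bracket_jacobi : forall u v w, bracket u (bracket v w) +
    bracket v (bracket w u) + bracket w (bracket u v) = 0;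
  bracket_stratified : forall i, (2 <= i <= k)%N ->
    bracket_layer 1 i.-1 = layer i;
  bracket_top : bracket_layer 1 k = 0%VS;
  (* Automatic for a nilpotent bracket (the Campbell-Baker-Hausdorff theorem);
     recorded so that the product visibly makes R^n a group. *)
  bch_assoc : associative (bch k bracket)
}.

Section CarnotGeometry.
Context {R : realType} {n k : nat} (G : carnot_group R n k).
Notation V := 'rV[R]_n.
Implicit Types (S : set V) (x y v : V).

Definition mulG : V -> V -> V := bch k (bracket G).

Definition hom_dim : nat := (\sum_(j < n) ord G j)%N.

Definition dil (t : R) (x : V) : V := \row_j (t ^+ ord G j * x 0 j).

(* Row j is X_j(x), the left-invariant field with X_j(0) = e_j. *)
Definition frame (x : V) : 'M[R]_n :=
  \matrix_(j < n, l < n)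
    'D_(1 : R) (fun t : R => mulG x (t *: basis_vec j) 0 l) 0.

(* Components of the tangent vector v at x with respect to X_1(x),..,X_n(x);
   the Riemannian metric is the Euclidean inner product of components. *)
Definition frame_comp (x v : V) : V := v *m invmx (frame x).

Definition inner (u v : V) : R := \sum_j u 0 j * v 0 j.

Definition hproj (u : V) : V := \row_j (if ord G j == 1%N then u 0 j else 0).

Record homogeneous_distance (rho : V -> V -> R) : Prop := {
  rho_eq0 : forall x y, rho x y = 0 <-> x = y;
  rho_sym : forall x y, rho x y = rho y x;
  rho_triangle : forall x y z, rho x z <= rho x y + rho y z;
  rho_continuous : continuous (fun p : V * V => rho p.1 p.2);
  rho_left_invariant : forall z x y, rho (mulG z x) (mulG z y) = rho x y;
  rho_dil : forall t x y, 0 < t -> rho (dil t x) (dil t y) = t * rho x y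
}.

Definition rball (rho : V -> V -> R) (x : V) (r : R) : set V :=
  [set y | rho x y < r].

(* Unit normals are given by their components in the frame X_1,..,X_n. *)
Definition is_unit_normal S x (nu : V) : Prop :=
  enorm nu = 1 /\ forall v, tangent S x v -> inner nu (frame_comp x v) = 0.

(* The sign is arbitrary, possibly varying with the point: nothing below
   depends on it. *)
Definition unit_normal S x : V := xget 0 [set nu | is_unit_normal S x nu].

Definition hnormal S x : V := hproj (unit_normal S x).

Definition char_set S : set V := [set x | S x /\ enorm (hnormal S x) = 0].

Definition nu_H S x : V := (enorm (hnormal S x))^-1 *: hnormal S x.

Definition gram p (Phi : 'rV[R]_p -> V) (u : 'rV[R]_p) : 'M[R]_p :=
  let J := jacobian Phi u *m invmx (frame (Phi u)) in J *m J^T.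

(* sigma is the (n-1)-dimensional Riemannian measure: on every C^1
   parametrized hypersurface it is given by the Riemannian area element. *)
Definition riemannian_surface_measure (sigma : {measure set V -> \bar R}) :=
  forall (U : set 'rV[R]_n.-1) (Phi : 'rV[R]_n.-1 -> V) (E : set V),
    open U -> class_C1_map U Phi -> {in U &, injective Phi} ->
    (forall u, U u -> row_free (jacobian Phi u)) ->
    measurable E -> E `<=` Phi @` U ->
    sigma E = (\int[@lebesgue_rV R n.-1]_(u in U `&` Phi @^-1` E)
                 (Num.sqrt (\det (gram Phi u)))%:E)%E.

Definition sigma_H (sigma : {measure set V -> \bar R}) S (E : set V) : \bar R :=
  (\int[sigma]_(y in S `&` E) (enorm (hnormal S y))%:E)%E.

Definition vertical_hyperplane x (nu : V) : set V :=
  [set y | inner (hproj (y - x)) nu = 0].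

Definition left_translate_inv x S : set V := [set y | S (mulG x y)].

Definition xgraph (alpha : 'I_n) (psi : 'rV[R]_n.-1 -> R) : set V :=
  [set y : V | y 0 alpha = psi (col' alpha y)].

Definition ord_sum (alpha : 'I_n) (s : seq 'I_n.-1) : nat :=
  (\sum_(j <- s) ord G (lift alpha j))%N.

Definition low_order_vanishing (alpha : 'I_n) (psi : 'rV[R]_n.-1 -> R) :=
  forall s : seq 'I_n.-1, s != [::] -> (ord_sum alpha s < ord G alpha)%N ->
    iter_partial s psi 0 = 0.

Definition psi_tilde (alpha : 'I_n) (psi : 'rV[R]_n.-1 -> R)
    (zeta : 'rV[R]_n.-1) : R :=
  \sum_(1 <= l < (ord G alpha).+1) (l`!%:R)^-1 *
    \sum_(s : l.-tuple 'I_n.-1 | ord_sum alpha s == ord G alpha)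
      iter_partial s psi 0 * \prod_(j <- s) zeta 0 j.

(* Lower and upper (Kuratowski) limits of the sets dil r^-1 S as r -> 0+ . *)
Definition lower_blowup S : set V := [set y | forall W, nbhs y W ->
  \forall r \near 0^'+, (W `&` dil r^-1 @` S) !=set0].

Definition upper_blowup S : set V := [set y | forall W, nbhs y W ->
  ~ \forall r \near 0^'+, W `&` dil r^-1 @` S = set0].

(* The limit of the sets dil r^-1 S as X_alpha-graphs over the whole of
   e_alpha^perp; empty when there is no such limit graph.  (As a bare set limit
   it would always contain 0 if 0 is in S.) *)
Definition S_infty (alpha : 'I_n) S : set V := [set y |
  exists phi : 'rV[R]_n.-1 -> R,
    [/\ lower_blowup S = xgraph alpha phi, upper_blowup S = xgraph alpha phi &
        xgraph alpha phi y]].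

Definition kappa_vert sigma rho x (nu : V) : \bar R :=
  sigma_H sigma (vertical_hyperplane x nu) (rball rho x 1).

Definition kappa_char sigma rho (alpha : 'I_n) S x : \bar R :=
  let Sinf := S_infty alpha (left_translate_inv x S) in
  sigma_H sigma Sinf (rball rho 0 1).

(* f(r) ~ kappa r^q, with a finite constant kappa. *)
Definition asymp_at0 (f : R -> \bar R) (kappa : \bar R) (q : nat) : Prop :=
  kappa \is a fin_num /\
  (fun r => f r * ((r ^+ q)^-1)%:E)%E @ 0^'+ --> kappa.

End CarnotGeometry.

(* Main.v *)
(** Left translation moves x to 0, and near 0 the translated surface is a graph
    y_a = psi(zeta) such that every derivative of psi of weighted order less than
    i = ord(a) vanishes at 0; in case (i) the direction a is horizontal, i = 1, and
    this only says psi(0) = 0.  The horizontal measure of a graph is the integral of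
    |P_H w| with respect to d zeta, where w lists the derivatives of y_a - psi along
    X_1, ..., X_n: the length of w cancels against the area element because the frame
    has determinant 1.  The change of variables zeta = delta_r v extracts the factor
    r^(Q-1) and replaces psi by psi_r(v) = r^(-i) psi(delta_r v), which converges
    locally uniformly, with its first derivatives, to the homogeneous Taylor
    polynomial of weight i.  Dominated convergence applies because balls are bounded
    and, by homogeneity, the unit sphere of rho cuts the limit graph in a null set.
    The convergence of psi_r also identifies S_infty; if a derivative of smaller
    weighted order is nonzero, psi_r blows up and no limit graph exists.

    A Carnot group is only required to have a bracket that is alternating and linear
    in its second variable.  Its bilinearity is a consequence of the associativity of
    the Baker-Campbell-Hausdorff product. *)

Require Import Defs.
From HB Require Import structures.
From mathcomp Require Import all_boot all_order all_algebra.
From mathcomp Require Import all_classical all_reals all_analysis.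
From mathcomp Require Import measurable_realfun.
From mathcomp Require Import ring lra zify.
Set Implicit Arguments.
Unset Strict Implicit.
Unset Printing Implicit Defensive.
Import Order.TTheory GRing.Theory Num.Theory.
Import numFieldNormedType.Exports.
Local Open Scope classical_set_scope.
Local Open Scope ring_scope.

(** * Calculus in R^p and weighted Taylor polynomials *)

(** Class [C^i] is expressed through partial derivatives indexed by ordered words, from which only
    the last letter can be split off. The Taylor estimates therefore run along rays and by induction
    on the weight, and even the partial derivatives of the limit polynomial are obtained as limits
    of rescaled derivatives. For bilinearity write [br = lbr + dev]. By the Jacobi identity any two
    maps [dev w], [dev z] compose to zero, and [dev w] commutes with left multiplication by [lbr].
    Associativity is read through linear forms [q] vanishing on all [lbr u (dev w v)]: in words of
    length at least 3 they see only [lbr], which is polynomial, so orders in t can be compared. This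
    gives [q (dev w v) = 0], and a descending induction on the number of outer horizontal brackets
    reaches all forms. Step one is separate, because its truncated product contains the word xy but
    not yx. In case (ii) the hypothesis is only an inclusion of the surface in the graph of [psi].
    Equality near the point comes from the implicit function theorem, once the derivative of a
    defining function along [X_a] is known not to vanish there. *)

Section Calc.
Context {R : realType}.
Implicit Types p : nat.

Lemma norm_coord_le p (u : 'rV[R]_p) j : `|u 0 j| <= `|u|.
Proof.
rewrite [leRHS]/Num.Def.normr/= mx_normrE.
exact: (le_bigmax _ (fun ij : 'I_1 * 'I_p => `|u ij.1 ij.2|) (0, j)).
Qed.

Lemma norm_rV_le p (u : 'rV[R]_p) (e : R) :
  0 <= e -> (forall j, `|u 0 j| <= e) -> `|u| <= e.
Proof.
move=> e0 ue; rewrite [leLHS]/Num.Def.normr/= mx_normrE.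
by apply: bigmax_le => // -[i j] _ /=; rewrite ord1.
Qed.

Lemma norm_rV_lt p (u : 'rV[R]_p) (e : R) :
  0 < e -> (forall j, `|u 0 j| < e) -> `|u| < e.
Proof.
move=> e0 ue; rewrite [ltLHS]/Num.Def.normr/= mx_normrE.
by apply: bigmax_lt => // -[i j] _ /=; rewrite ord1.
Qed.

Lemma norm_basis_vec p (j : 'I_p) : `|basis_vec j : 'rV[R]_p| <= 1.
Proof.
apply: norm_rV_le => // i; rewrite mxE eqxx/=.
by case: (i == j); rewrite /= ?normr1 ?normr0.
Qed.

(** Control on the symmetric interval |s| <= |a| lets one statement serve increments of either sign;
    each sign is the mean value theorem on its own segment. *)
Lemma mean_value_le (g dg : R -> R) (a M : R) :
  (forall s, `|s| <= `|a| -> is_derive (s : R) (1 : R) g (dg s)) ->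
  (forall s, `|s| <= `|a| -> `|dg s| <= M) ->
  `|g a - g 0| <= M * `|a|.
Proof.
move=> gd dM.
have cg s : `|s| <= `|a| -> {for s, continuous g}.
  move=> sa; have [? _] := gd _ sa.
  exact/differentiable_continuous/derivable1_diffP.
have wc b c : (forall s, b <= s <= c -> `|s| <= `|a|) ->
    {within `[b, c], continuous g}.
  move=> H; apply: derivable_within_continuous => s; rewrite in_itv/= => /H sa.
  by have [] := gd _ sa.
have [a0|a0] := leP 0 a.
  have H s : 0 <= s <= a -> `|s| <= `|a|.
    by case/andP => s0 sa; rewrite !ger0_norm.
  have [|c ci ->] := @MVT_segment R g dg 0 a a0 _ (wc _ _ H).
    move=> s; rewrite in_itv/= => /andP[s0 sa]; apply: gd; apply: H.
    by rewrite !ltW.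
  rewrite normrM subr0; apply: ler_wpM2r => //; apply: dM; apply: H.
  by move: ci; rewrite in_itv.
have H s : a <= s <= 0 -> `|s| <= `|a|.
  by case/andP => s0 sa; rewrite !ler0_norm ?lerN2// ltW.
have [|c ci E] := @MVT_segment R g dg a 0 (ltW a0) _ (wc _ _ H).
  move=> s; rewrite in_itv/= => /andP[s0 sa]; apply: gd; apply: H.
  by rewrite !ltW.
rewrite -normrN opprB E normrM sub0r normrN; apply: ler_wpM2r => //.
by apply: dM; apply: H; move: ci; rewrite in_itv.
Qed.

Lemma derive_line (V W : normedModType R) (f : V -> W) u v (t : R) :
  derivable f (u + t *: v) v ->
  is_derive t (1 : R) (fun s : R => f (u + s *: v)) ('D_v f (u + t *: v)).
Proof.
move=> df; suff E : (fun h : R => h^-1 *: (((fun s : R => f (u + s *: v)) \o shift t)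
    (h *: 1) - f (u + t *: v))) =
    (fun h : R => h^-1 *: ((f \o shift (u + t *: v)) (h *: v) - f (u + t *: v))).
  by split; [rewrite /derivable E|rewrite /derive E].
apply/funext => h /=; congr (_ *: (f _ - _)).
by rewrite scalerDl [_%:A]mulr1 addrCA.
Qed.

Lemma class_CE i p (U : set 'rV[R]_p) (f : 'rV[R]_p -> R) : class_C i U f ->
  {in U, continuous f}.
Proof. by case: i => [|i] []. Qed.

Lemma class_C_sub i p (U V : set 'rV[R]_p) (f : 'rV[R]_p -> R) : V `<=` U ->
  class_C i U f -> class_C i V f.
Proof.
move=> VU; elim: i f => [f [cf _]|i IH f [cf df]]; split => //.
- by move=> u /[!inE] /VU Uu; apply: cf; rewrite inE.
- by move=> u /[!inE] /VU Uu; apply: cf; rewrite inE.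
- by move=> j; have [d c] := df j; split; [move=> u /VU/d|exact: IH].
Qed.

Lemma class_CS i p (U : set 'rV[R]_p) (f : 'rV[R]_p -> R) :
  class_C i.+1 U f -> class_C i U f.
Proof.
elim: i f => [f []//|i IH f [cf df]]; split => // j.
by have [d c] := df j; split => //; exact: IH.
Qed.

Lemma class_C_le i j p (U : set 'rV[R]_p) (f : 'rV[R]_p -> R) : (i <= j)%N ->
  class_C j U f -> class_C i U f.
Proof.
move=> /subnK <-; elim: (j - i)%N => // d IH.
by rewrite addSn => /class_CS /IH.
Qed.

Lemma class_C_cont i p (U : set 'rV[R]_p) (f : 'rV[R]_p -> R) u :
  class_C i U f -> U u -> {for u, continuous f}.
Proof. by move=> /class_CE cf Uu; apply: cf; rewrite inE. Qed.

Definition lin_form p (c : 'I_p -> R) (v : 'rV[R]_p) : R := \sum_j v 0 j * c j.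

Lemma lin_form_linear p (c : 'I_p -> R) : linear (lin_form c).
Proof.
move=> a u v; rewrite /lin_form scaler_sumr -big_split/=.
by apply: eq_bigr => j _; rewrite !mxE mulrDl -mulrA.
Qed.

HB.instance Definition _ p (c : 'I_p -> R) :=
  GRing.isLinear.Build R 'rV[R]_p R _ (lin_form c) (@lin_form_linear p c).

Lemma cvg_sumr (T : Type) (F : set_system T) (FF : Filter F) (I : Type) (r : seq I)
   (P : pred I) (f : I -> T -> R) (l : I -> R) :
  (forall i, P i -> f i x @[x --> F] --> l i) ->
  \sum_(i <- r | P i) f i x @[x --> F] --> \sum_(i <- r | P i) l i.
Proof.
move=> fl; elim: r => [|a r IH].
  under eq_fun do rewrite big_nil; rewrite big_nil; exact: cvg_cst.
under eq_fun do rewrite big_cons; rewrite big_cons.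
by case: ifPn => // Pa; apply: cvgD => //; exact: fl.
Qed.

Lemma lin_form_continuous p (c : 'I_p -> R) : continuous (lin_form c).
Proof.
move=> u; apply: (@cvg_sumr _ (nbhs u)) => j _; apply: cvgM; last exact: cvg_cst.
exact: coord_continuous.
Qed.

Lemma cvg_rV T (F : set_system T) (FF : Filter F) p (f : T -> 'rV[R]_p) (l : 'rV[R]_p) :
  (forall j, f x 0 j @[x --> F] --> l 0 j) -> f x @[x --> F] --> l.
Proof.
move=> fl; apply/cvgrPdist_lt => e e0.
have : \forall x \near F, forall j, `|l 0 j - f x 0 j| < e.
  by apply: filter_forall => j; exact: (@cvgr_dist_lt _ _ _ _ _ _ _ (fl j)).
apply: filterS => x H; apply: norm_rV_lt => // j; rewrite !mxE; exact: H.
Qed.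

(** The points [trunc c h], for c from 0 to p, are the corners of the staircase path from 0 to [h].
    As the norm is the supremum norm, the whole path stays in the ball of radius |h|
    ([trunc_seg_norm]). *)
Definition trunc p (c : nat) (h : 'rV[R]_p) : 'rV[R]_p :=
  \row_j (if (j < c)%N then h 0 j else 0).

Lemma trunc_step p (c : 'I_p) (h : 'rV[R]_p) :
  trunc c.+1 h = trunc c h + h 0 c *: basis_vec c.
Proof.
apply/rowP => j; rewrite !mxE/=; have [->|jc] := eqVneq j c.
  by rewrite leqnn ltnn add0r mulr1.
have jc' : (j == c :> nat) = false by exact: negbTE.
by rewrite ltnS leq_eqVlt jc' mulr0 addr0.
Qed.

Lemma trunc_seg_norm p (c : 'I_p) (h : 'rV[R]_p) (s : R) : `|s| <= `|h 0 c| ->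
  `|trunc c h + s *: basis_vec c| <= `|h|.
Proof.
move=> sh; apply: norm_rV_le => // j; rewrite !mxE/=; have [->|jc] := eqVneq j c.
  by rewrite ltnn add0r mulr1 (le_trans sh)// norm_coord_le.
rewrite mulr0 addr0; case: ifP => _; last by rewrite normr0.
exact: norm_coord_le.
Qed.

(* Increments are split along the coordinate directions, so that only partial
   derivatives enter. *)
Lemma increment_le p (f : 'rV[R]_p -> R) (u h : 'rV[R]_p) (c : 'I_p -> R) (e : R) :
  0 <= e ->
  (forall j w, `|w| <= `|h| -> derivable f (u + w) (basis_vec j)) ->
  (forall j w, `|w| <= `|h| -> `|partial j f (u + w) - c j| <= e) ->
  `|f (u + h) - f u - lin_form c h| <= p%:R * e * `|h|.
Proof.
move=> e0 df dfe.
suff H : forall k, (k <= p)%N -> `|f (u + trunc k h) - f u -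
   \sum_(j < p | (j < k)%N) h 0 j * c j| <= k%:R * e * `|h|.
  have := H p (leqnn p).
  have -> : trunc p h = h by apply/rowP => j; rewrite mxE ltn_ord.
  by under eq_bigl => j do rewrite ltn_ord.
elim=> [_|k IH kp].
  rewrite big_pred0// mul0r mul0r subr0.
  suff -> : trunc 0 h = 0 by rewrite addr0 subrr normr0.
  by apply/rowP => j; rewrite !mxE.
pose ck := Ordinal kp.
rewrite (bigD1 ck)/= ?leqnn//.
under eq_bigl => j.
  have -> : (j < k.+1)%N && (j != ck) = (j < k)%N.
    by rewrite ltnS leq_eqVlt -(inj_eq val_inj)/= ; case: ltngtP.
  over.
rewrite (_ : trunc k.+1 h = trunc k h + h 0 ck *: basis_vec ck); last exact: (trunc_step ck).
(* Subtracting [s * c ck] makes the derivative along this edge the difference bounded by [e] in the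
   hypothesis. *)
pose g (s : R) := f (u + (trunc k h + s *: basis_vec ck)) - s * c ck.
have Hg : `|g (h 0 ck) - g 0| <= e * `|h 0 ck|.
  apply: (@mean_value_le g (fun s => partial ck f (u + (trunc k h + s *: basis_vec ck)) - c ck)).
  - move=> s sh; rewrite /g.
    have /(@derive_line _ _ _ (u + trunc k h)) H1 :
      derivable f (u + trunc k h + s *: basis_vec ck) (basis_vec ck).
      by rewrite -addrA; apply: df; exact: (trunc_seg_norm (c := ck)).
    apply: is_derive_eq; last first.
      by rewrite addrA.
    apply: is_deriveB.
    + by under eq_fun do rewrite addrA; exact: H1.
    + rewrite -[X in is_derive _ _ _ X]mul1r.
      have : is_derive s (1:R) (id * cst (c ck) : R -> R) (s *: (0:R) + c ck *: (1:R)).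
        exact: is_deriveM.
      rewrite scaler0 add0r mul1r => H; apply: is_derive_eq H _.
      by rewrite [_%:A]mulr1.
  - move=> s sh; apply: dfe; exact: (trunc_seg_norm (c := ck)).
rewrite /g scale0r addr0 mul0r subr0 in Hg.
have -> : f (u + (trunc k h + h 0 ck *: basis_vec ck)) - f u -
    (h 0 ck * c ck + \sum_(i < p | (i < k)%N) h 0 i * c i) =
  (f (u + (trunc k h + h 0 ck *: basis_vec ck)) - h 0 ck * c ck - f (u + trunc k h)) +
  (f (u + trunc k h) - f u - \sum_(i < p | (i < k)%N) h 0 i * c i).
  ring.
apply: (le_trans (ler_normD _ _)).
rewrite -natr1 mulrDl mul1r mulrDl addrC; apply: lerD; first exact/IH/ltnW.
by apply: (le_trans Hg); apply: ler_wpM2l => //; exact: norm_coord_le.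
Qed.

Lemma near_normP (V : normedModType R) (u : V) (P : set V) :
  (\forall w \near u, P w) <-> exists2 d : R, 0 < d & forall w, `|w - u| < d -> P w.
Proof.
split=> [/nbhs_ballP[d/= d0 dP]|[d d0 dP]]; last first.
  by apply/nbhs_ballP; exists d => // w; rewrite -ball_normE/= distrC => /dP.
by exists d => // w wd; apply: dP; rewrite -ball_normE/= distrC.
Qed.

Lemma diff_of_estimate (V W : normedModType R) (f : V -> W) (df : {linear V -> W}) (x : V) :
  continuous df ->
  (forall e : R, 0 < e -> \forall h \near (0 : V), `|f (x + h) - f x - df h| <= e * `|h|) ->
  differentiable f x /\ ('d f x = df :> (V -> W)).
Proof.
move=> cdf H.
have Ho : f \o shift x = cst (f x) + df +o_ 0 id.
  apply/eqaddoP => e e0; near=> h.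
  rewrite /= !fctE/= [h + x]addrC opprD addrA; near: h; exact: H.
have Hd := diff_unique cdf Ho.
by split => //; apply/diff_locallyP; rewrite Hd.
Unshelve. all: by end_near. Qed.

Lemma class_C1_diff p (U : set 'rV[R]_p) (f : 'rV[R]_p -> R) u :
  open U -> class_C 1 U f -> U u ->
  differentiable f u /\ (forall v, 'D_v f u = lin_form (fun j => partial j f u) v).
Proof.
move=> oU [_ fU] Uu; pose c j := partial j f u.
have [D Hd] : differentiable f u /\ ('d f u = lin_form c :> ('rV[R]_p -> R)).
  apply: diff_of_estimate; first exact: lin_form_continuous.
  move=> e e0.
  have p0 : 0 < p%:R + 1 :> R by rewrite ltr_wpDl.
  (* [increment_le] loses a factor p; dividing by p + 1 also covers p = 0. *)
  pose e1 := e / (p%:R + 1).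
  have e10 : 0 < e1 by rewrite divr_gt0.
  have : \forall w \near u, forall j, derivable f w (basis_vec j) /\
      `|partial j f w - c j| <= e1.
    suff /filter_forall : forall j, \forall w \near u, derivable f w (basis_vec j) /\
      `|partial j f w - c j| <= e1 by [].
    move=> j; near=> w.
    have Uw : U w by near: w; exact: open_nbhs_nbhs.
    have [d _] := fU j; split; first exact: d.
    rewrite distrC; near: w.
    have [_ cj] := fU j; have := @class_C_cont 0 _ _ _ _ cj Uu.
    by move/cvgrPdist_le => /(_ _ e10).
  move=> /near_normP[d d0 dP].
  apply/near_normP; exists d => // h; rewrite subr0 => hd.
  have H : `|f (u + h) - f u - lin_form c h| <= p%:R * e1 * `|h|.
    apply: increment_le; first exact: ltW.
    - move=> j w wh; have [] // := dP (u + w) _ j.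
      by rewrite addrAC subrr add0r (le_lt_trans wh).
    - move=> j w wh; have [] // := dP (u + w) _ j.
      by rewrite addrAC subrr add0r (le_lt_trans wh).
  apply: (le_trans H).
  apply: ler_wpM2r => //; rewrite /e1 mulrCA ler_piMr// ?ltW//.
  by rewrite ltr_pdivrMr// mul1r ltrDl.
split => // v; by rewrite deriveE// Hd.
Unshelve. all: by end_near. Qed.

Lemma is_derive_line0 (V W : normedModType R) (f : V -> W) u v d :
  is_derive (0:R) (1 : R) (fun s : R => f (u + s *: v)) d -> is_derive u v f d.
Proof.
suff E : (fun h : R => h^-1 *: (((fun s : R => f (u + s *: v)) \o shift 0)
    (h *: 1) - f (u + (0:R) *: v))) =
    (fun h : R => h^-1 *: ((f \o shift u) (h *: v) - f u)).
  by move=> [D1 D2]; split; [move: D1; rewrite /derivable E|move: D2; rewrite /derive E].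
apply/funext => h /=; congr (_ *: (f _ - f _)).
  by rewrite addr0 [_%:A]mulr1 addrC.
by rewrite scale0r addr0.
Qed.

Lemma is_derive_line0V (V W : normedModType R) (f : V -> W) u v d :
  is_derive u v f d -> is_derive (0:R) (1 : R) (fun s : R => f (u + s *: v)) d.
Proof.
move=> [D1 D2]; have /derive_line : derivable f (u + (0:R) *: v) v.
  by rewrite scale0r addr0.
by rewrite scale0r addr0 D2.
Qed.

Lemma is_derive_curve p (U : set 'rV[R]_p) (f : 'rV[R]_p -> R) (g : R -> 'rV[R]_p) t v :
  open U -> class_C 1 U f -> U (g t) -> is_derive t (1 : R) g v ->
  is_derive t (1 : R) (fun s => f (g s)) (lin_form (fun j => partial j f (g t)) v).
Proof.
move=> oU fU Ug [dg gv].
have [df fE] := class_C1_diff oU fU Ug.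
have dg' : differentiable g t by apply/derivable1_diffP.
have D : differentiable (f \o g) t by exact: differentiable_comp.
split; first exact/diff_derivable.
rewrite -[LHS]/('D_1 (f \o g) t) deriveE// diff_comp//= -[in 'd g t 1]deriveE// gv.
by rewrite -deriveE// fE.
Qed.

Lemma is_derive_rV p (g : R -> 'rV[R]_p) t (v : 'rV[R]_p) :
  (forall j, is_derive t (1 : R) (fun s => g s 0 j) (v 0 j)) ->
  is_derive t (1 : R) g v.
Proof.
move=> H; have D : derivable g t 1.
  by apply/derivable_mxP => i j; rewrite ord1; case: (H j).
split => //; rewrite derive_mx//; apply/rowP => j; rewrite mxE.
by case: (H j).
Qed.

Lemma is_derive_coord p (g : R -> 'rV[R]_p) t (v : 'rV[R]_p) j :
  is_derive t (1 : R) g v -> is_derive t (1 : R) (fun s => g s 0 j) (v 0 j).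
Proof.
move=> [D E]; have D' : derivable (fun s => g s 0 j) t 1 by exact: (derivable_mxP _ _ _).1 D 0 j.
by split => //; rewrite -E derive_mx// mxE.
Qed.

Lemma is_derive_partial p (f : 'rV[R]_p -> R) u j :
  derivable f u (basis_vec j) -> is_derive u (basis_vec j) f (partial j f u).
Proof. exact: derivableP. Qed.

Lemma is_derive_comp_partial p q (U : set 'rV[R]_p) (f : 'rV[R]_p -> R)
    (L : 'rV[R]_q -> 'rV[R]_p) w j :
  open U -> class_C 1 U f -> U (L w) ->
  (forall l, derivable (fun z => L z 0 l) w (basis_vec j)) ->
  is_derive w (basis_vec j) (fun z => f (L z))
    (lin_form (fun l => partial l f (L w)) (\row_l partial j (fun z => L z 0 l) w)).
Proof.
move=> oU fU UL dL; apply: is_derive_line0.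
have H : L w = L (w + (0:R) *: basis_vec j) by rewrite scale0r addr0.
rewrite [in X in is_derive _ _ _ X]H.
apply: (is_derive_curve oU fU (g := fun s => L (w + s *: basis_vec j))).
  by rewrite -H.
apply: is_derive_rV => l; rewrite mxE.
apply: (@is_derive_line0V _ _ (fun z => L z 0 l)).
exact: is_derive_partial.
Qed.

Lemma eq_on_continuous (T S : topologicalType) (W : set T) (F H : T -> S) w :
  open W -> W w -> (forall z, W z -> F z = H z) ->
  {for w, continuous H} -> {for w, continuous F}.
Proof.
move=> oW Ww FH cH; rewrite /prop_for /continuous_at FH//.
apply: cvg_trans cH; apply: near_eq_cvg; near=> z.
by rewrite -FH//; near: z; exact: open_nbhs_nbhs.
Unshelve. all: by end_near. Qed.

Lemma class_C1_comp p q (U : set 'rV[R]_p) (W : set 'rV[R]_q) (f : 'rV[R]_p -> R)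
    (L : 'rV[R]_q -> 'rV[R]_p) :
  open U -> open W -> class_C 1 U f -> (forall w, W w -> U (L w)) ->
  (forall l, class_C 1 W (fun z => L z 0 l)) ->
  class_C 1 W (fun z => f (L z)).
Proof.
move=> oU oW fU WU LW.
have cL w : W w -> {for w, continuous L}.
  move=> Ww; apply: (@cvg_rV _ (nbhs w)) => l; exact: class_C_cont (LW l) Ww.
have dL w j l : W w -> derivable (fun z => L z 0 l) w (basis_vec j).
  by move=> Ww; have [_ /(_ j)[d _]] := LW l; exact: d.
split.
  move=> w /[!inE] Ww; apply: (@continuous_comp _ _ _ L f); first exact: cL.
  exact: class_C_cont fU (WU _ Ww).
move=> j; split.
  move=> w Ww; have [] // := is_derive_comp_partial oU fU (WU _ Ww) (fun l => dL w j l Ww).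
split => // w /[!inE] Ww.
have E : forall w, W w -> partial j (fun z => f (L z)) w =
    \sum_l partial j (fun z => L z 0 l) w * partial l f (L w).
  move=> w' Ww'; rewrite [LHS]/partial.
  have [_ ->] := is_derive_comp_partial oU fU (WU _ Ww') (fun l => dL w' j l Ww').
  by apply: eq_bigr => l _; rewrite mxE.
apply: (eq_on_continuous oW Ww E).
apply: (@cvg_sumr _ (nbhs w)) => l _; apply: cvgM.
  have [_ /(_ j)[_ c]] := LW l; exact: (@class_C_cont 0 _ _ _ _ c Ww).
have [_ /(_ l)[_ c]] := fU.
apply: (@continuous_comp _ _ _ L (partial l f)); first exact: cL.
exact: (@class_C_cont 0 _ _ _ _ c (WU _ Ww)).
Qed.

End Calc.

(** * Weighted homogeneous Taylor polynomials *)

Section Taylor.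
Context {R : realType} {p : nat} (o : 'I_p -> nat).
Hypothesis o_gt0 : forall j, (0 < o j)%N.
Implicit Types (v : 'rV[R]_p) (phi : 'rV[R]_p -> R) (V : set 'rV[R]_p).

Definition wdil (r : R) v : 'rV[R]_p := \row_j (r ^+ o j * v 0 j).

Definition wsum (s : seq 'I_p) : nat := (\sum_(j <- s) o j)%N.

(* The degree l part, and the sum, of the weighted homogeneous Taylor polynomial
   of weight m; the bound N is immaterial as soon as m <= N. *)
Definition taylor_part l m phi v : R :=
  \sum_(s : l.-tuple 'I_p | wsum s == m) iter_partial s phi 0 * \prod_(j <- s) v 0 j.

Definition taylor_poly N m phi v : R :=
  \sum_(0 <= l < N.+1) (l`!%:R)^-1 * taylor_part l m phi v.

Lemma wsum_size (s : seq 'I_p) : (size s <= wsum s)%N.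
Proof.
rewrite /wsum; elim: s => [|j s IH]; first by rewrite big_nil.
by rewrite big_cons/= -add1n leq_add.
Qed.

Lemma wsum_rcons s j : wsum (rcons s j) = (wsum s + o j)%N.
Proof. by rewrite /wsum -cats1 big_cat big_seq1. Qed.

Lemma taylor_part_gt l m phi v : (m < l)%N -> taylor_part l m phi v = 0.
Proof.
move=> ml; rewrite /taylor_part big_pred0// => s; apply/negbTE.
by rewrite neq_ltn (leq_trans ml) ?orbT// -{1}(size_tuple s) wsum_size.
Qed.

Lemma taylor_poly_widen N m phi v : (m <= N)%N ->
  taylor_poly N m phi v = taylor_poly m m phi v.
Proof.
move=> mN; rewrite /taylor_poly (@big_cat_nat _ _ _ m.+1 0 N.+1)//=.
rewrite [X in _ + X]big_nat_cond [X in _ + X]big1 ?addr0// => l.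
by rewrite andbT => /andP[ml _]; rewrite taylor_part_gt ?mulr0.
Qed.

Lemma iter_partial_rcons s j phi :
  iter_partial (rcons s j) phi = iter_partial s (partial j phi).
Proof. by rewrite /iter_partial foldr_rcons. Qed.

Lemma sum_tuple_rcons l (F : l.+1.-tuple 'I_p -> R) :
  \sum_s F s = \sum_j \sum_(t : l.-tuple 'I_p) F [tuple of rcons t j].
Proof.
rewrite pair_big/= (reindex (fun q : 'I_p * l.-tuple 'I_p => [tuple of rcons q.2 q.1]))//=.
apply/onW_bij/inj_card_bij; last by rewrite card_prod !card_tuple expnS.
move=> [a s] [b t] /= /(congr1 val)/= /rcons_inj[st ->].
by congr pair; exact: val_inj.
Qed.

(** [iter_partial] is a [foldr], so the last letter of a word is the derivative taken first.
    Splitting that letter off turns words of weight [m] for [phi] into words of weight [m - o j] for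
    [partial j phi]; a last letter with [o j > m] cannot occur. *)
Lemma taylor_part_rec l m phi v :
  taylor_part l.+1 m phi v = \sum_j v 0 j *
    (if (o j <= m)%N then taylor_part l (m - o j)%N (partial j phi) v else 0).
Proof.
rewrite /taylor_part big_mkcond/= sum_tuple_rcons; apply: eq_bigr => j _.
case: ifPn => [jm|mj].
  rewrite big_distrr/= [RHS]big_mkcond/=; apply: eq_bigr => s _.
  rewrite wsum_rcons iter_partial_rcons -{1}(subnK jm) eqn_add2r.
  case: ifPn => // _; rewrite -cats1 big_cat/= big_seq1; ring.
rewrite mulr0 big1// => s _; rewrite wsum_rcons ifF//.
by apply/negbTE; apply: contra mj => /eqP <-; exact: leq_addl.
Qed.

Lemma taylor_part_scale l m phi v (t : R) :
  taylor_part l m phi (t *: v) = t ^+ l * taylor_part l m phi v.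
Proof.
rewrite /taylor_part big_distrr/=; apply: eq_bigr => s _.
rewrite mulrCA; congr (_ * _); under eq_bigr do rewrite mxE.
by rewrite big_split/= big_const_seq count_predT size_tuple iter_mulr_1.
Qed.

(** The expected partial derivative of [taylor_poly m m phi]. At first it is known to be the
    derivative only along rays ([taylor_poly_ray]); for flat [phi] of class C^m,
    [taylor_poly_derive] makes it the genuine one. *)
Definition taylor_grad m phi j v : R :=
  if (o j <= m)%N then taylor_poly (m - o j)%N (m - o j)%N (partial j phi) v else 0.

Lemma taylor_gradE1 m phi j : (o j <= m)%N ->
  taylor_grad m phi j = taylor_poly (m - o j)%N (m - o j)%N (partial j phi).
Proof. by move=> jm; apply/funext => v; rewrite /taylor_grad jm. Qed.

Lemma taylor_gradE0 m phi j : (m < o j)%N -> taylor_grad m phi j = cst 0.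
Proof. by move=> jm; apply/funext => v; rewrite /taylor_grad leqNgt jm. Qed.

Lemma taylor_grad_widen N m phi j v : (m <= N + o j)%N ->
  taylor_grad m phi j v =
  if (o j <= m)%N then taylor_poly N (m - o j)%N (partial j phi) v else 0.
Proof.
move=> mN; rewrite /taylor_grad; case: ifP => // jm.
by rewrite [RHS]taylor_poly_widen// leq_subLR addnC.
Qed.

(** Along a ray the degree l part is a multiple of s^l, so differentiation replaces 1/l! by
    1/(l-1)!, and [taylor_part_rec] distributes what remains over the last letter. The whole is a
    computation with a polynomial in one variable. *)
Lemma taylor_poly_ray m phi v (s : R) :
  is_derive s (1 : R) (fun s => taylor_poly m m phi (s *: v))
   (\sum_j v 0 j * taylor_grad m phi j (s *: v)).
Proof.
have E1 : (fun s => taylor_poly m m phi (s *: v)) =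
  horner (\poly_(l < m.+1) (l`!%:R^-1 * taylor_part l m phi v)).
  apply/funext => t; rewrite /taylor_poly horner_poly big_mkord.
  by apply: eq_bigr => l _; rewrite taylor_part_scale; ring.
rewrite E1; apply: is_derive_eq.
have -> : (\poly_(l < m.+1) (l`!%:R^-1 * taylor_part l m phi v))^`() =
    \poly_(l < m.-1.+1) (l`!%:R^-1 * taylor_part l.+1 m phi v).
  apply/polyP => i; rewrite coef_deriv !coef_poly ltnS.
  case: (ltnP i m) => im.
    rewrite ifT; last by case: (m) im.
    have fi : i`!%:R != 0 :> R by rewrite pnatr_eq0 -lt0n fact_gt0.
    have i1 : i.+1%:R != 0 :> R by rewrite pnatr_eq0.
    rewrite -[LHS]mulr_natr factS natrM; move: (i.+1%:R) i1 => c c0.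
    by field; rewrite fi c0.
  by rewrite mul0rn taylor_part_gt ?ltnS// mulr0 if_same.
rewrite horner_poly.
(* Since every weight [o j] is positive, m - 1 is a degree bound common to all the polynomials of
   weight m - o j. *)
have W j : (m <= m.-1 + o j)%N by move: (o_gt0 j); lia.
under [RHS]eq_bigr => j _ do rewrite (taylor_grad_widen _ _ (W j)).
under [LHS]eq_bigr => l _ do rewrite taylor_part_rec.
rewrite /taylor_poly.
under [RHS]eq_bigr => j _.
  rewrite big_mkord (_ : (if _ then _ else _) = \sum_(l < m.-1.+1) l`!%:R^-1 *
     (s ^+ l * (if (o j <= m)%N then taylor_part l (m - o j)%N (partial j phi) v else 0))).
    rewrite big_distrr/=; over.
  case: ifP => _.
    by apply: eq_bigr => l _; rewrite taylor_part_scale.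
  by rewrite big1// => l _; rewrite !mulr0.
rewrite exchange_big/=; apply: eq_bigr => l _.
rewrite big_distrr/= big_distrl/=; apply: eq_bigr => j _; ring.
Qed.

Lemma wdil_line r v w (t : R) : wdil r (v + t *: w) = wdil r v + t *: wdil r w.
Proof. by apply/rowP => j; rewrite !mxE; ring. Qed.

Lemma wdil_norm r v : 0 <= r <= 1 -> `|wdil r v| <= r * `|v|.
Proof.
move=> /andP[r0 r1]; apply: norm_rV_le; first by rewrite mulr_ge0.
move=> j; rewrite mxE normrM normrX ger0_norm//.
apply: ler_pM; rewrite ?exprn_ge0 ?norm_coord_le//.
by rewrite -[leRHS]expr1 ler_wiXn2l.
Qed.

Lemma wdil_small V (K : R) : nbhs (0 : 'rV[R]_p) V ->
  exists2 r0 : R, 0 < r0 & forall r v, 0 < r < r0 -> `|v| <= K -> V (wdil r v).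
Proof.
move=> /near_normP[d d0 dV].
exists (Num.min 1 (d / (`|K| + 1))).
  by rewrite lt_min ltr01 divr_gt0// ltr_wpDl.
move=> r v /andP[r0]; rewrite lt_min => /andP[r1 rd] vK; apply: dV; rewrite subr0.
apply: (le_lt_trans (@wdil_norm r v _)); first by rewrite !ltW.
apply: (@le_lt_trans _ _ (r * (`|K| + 1))).
  apply: ler_wpM2l; first exact: ltW.
  by rewrite (le_trans vK)// (le_trans (ler_norm _))// lerDl.
by rewrite -ltr_pdivlMr// ltr_wpDl.
Qed.

Lemma wdil_derive phi V r v w : open V -> class_C 1 V phi -> V (wdil r v) ->
  is_derive v w (fun u => phi (wdil r u))
    (\sum_j r ^+ o j * w 0 j * partial j phi (wdil r v)).
Proof.
move=> oV cV Vv; apply: is_derive_line0.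
have H : is_derive (0 : R) (1 : R) (fun s : R => wdil r v + s *: wdil r w) (wdil r w).
  apply: is_derive_rV => j; rewrite mxE.
  under eq_fun do rewrite !mxE.
  apply: is_derive_eq.
  by rewrite scaler0 !add0r mul1r [_%:A]mulr1.
have Vv0 : V (wdil r v + (0:R) *: wdil r w) by rewrite scale0r addr0.
have := is_derive_curve oV cV Vv0 H; rewrite scale0r addr0.
under eq_fun do rewrite -wdil_line.
by move=> L; apply: is_derive_eq L _; apply: eq_bigr => j _; rewrite mxE.
Qed.

(* The mean value theorem along the rays s |-> s v reduces the estimate to the
   first derivatives, so that no symmetry of the higher ones is needed. *)
Lemma taylor_ray_estimate m phi V (K e : R) : (0 < m)%N -> open V -> V 0 ->
  class_C 1 V phi -> phi 0 = 0 -> 0 <= K -> 0 < e ->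
  (forall j, exists2 r0 : R, 0 < r0 & forall r v, 0 < r < r0 -> `|v| <= K ->
     `|r ^+ o j * partial j phi (wdil r v) / r ^+ m - taylor_grad m phi j v| <= e) ->
  exists2 r0 : R, 0 < r0 & forall r v, 0 < r < r0 -> `|v| <= K ->
     `|phi (wdil r v) / r ^+ m - taylor_poly m m phi v| <= p%:R * (K * e).
Proof.
move=> m0 oV V0 cV phi0 K0 e0 H.
have /choice[R0 R0P] : forall j, exists r0 : R, 0 < r0 /\ forall r v, 0 < r < r0 -> `|v| <= K ->
     `|r ^+ o j * partial j phi (wdil r v) / r ^+ m - taylor_grad m phi j v| <= e.
  by move=> j; have [r0 ? ?] := H j; exists r0.
have [r1 r10 r1V] := @wdil_small V K (open_nbhs_nbhs (conj oV V0)).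
exists (\big[Num.min/r1]_j R0 j).
  by apply: lt_bigmin => // j _; have [] := R0P j.
move=> r v /andP[r_gt0 rlt] vK.
have rr1 : r < r1 by apply: (lt_le_trans rlt); exact: bigmin_le_id.
have rR0 j : r < R0 j by apply: (lt_le_trans rlt); exact: bigmin_le.
pose g (s : R) := phi (wdil r (s *: v)) / r ^+ m - taylor_poly m m phi (s *: v).
pose dg (s : R) := \sum_j v 0 j * (r ^+ o j * partial j phi (wdil r (s *: v)) / r ^+ m - taylor_grad m phi j (s *: v)).
have sv (s : R) : `|s| <= `|1 : R| -> `|s *: v| <= K.
  rewrite normr1 normrZ => s1; apply: le_trans vK; exact: ler_piMl.
have := @mean_value_le _ g dg 1 (p%:R * (K * e)).
rewrite normr1 mulr1 /g scale1r scale0r.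
have -> : wdil r 0 = 0 by apply/rowP => j; rewrite !mxE mulr0.
have -> : taylor_poly m m phi 0 = 0.
  rewrite /taylor_poly big1// => -[_|l _]; last first.
    have := taylor_part_scale l.+1 m phi 0 0.
    by rewrite scaler0 expr0n mul0r => ->; rewrite mulr0.
  by rewrite /taylor_part big_pred0 ?mulr0// => s; rewrite tuple0/= /wsum big_nil eq_sym gtn_eqF.
rewrite phi0 mul0r !subr0; apply.
- move=> s s1; rewrite /dg; under eq_bigr do rewrite mulrBr; rewrite sumrB.
  apply: is_deriveB; last exact: taylor_poly_ray.
  have Vs : V (wdil r (s *: v)) by apply: r1V; [rewrite r_gt0|apply: sv; rewrite normr1].
  have Vs' : V (wdil r (0 + s *: v)) by rewrite add0r.
  have := wdil_derive v oV cV Vs'; rewrite add0r.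
  move=> [D E]; have D' : derivable (fun u => phi (wdil r u)) (0 + s *: v) v by rewrite add0r.
  have := derive_line D'; rewrite add0r E.
  under eq_fun do rewrite add0r.
  move=> L.
  have : is_derive s (1:R) ((fun s : R => phi (wdil r (s *: v))) * cst ((r ^+ m)^-1))
     (phi (wdil r (s *: v)) *: 0 + (r ^+ m)^-1 *: \sum_j r ^+ o j * v 0 j * partial j phi (wdil r (s *: v))).
    exact: is_deriveM.
  move=> L2; apply: is_derive_eq L2 _; rewrite scaler0 add0r scaler_sumr; apply: eq_bigr => j _.
  rewrite /GRing.scale/=; ring.
- move=> s s1; rewrite /dg.
  apply: (le_trans (ler_norm_sum _ _ _)).
  apply: (@le_trans _ _ (\sum_(j < p) K * e)); last first.
    by rewrite sumr_const card_ord mulr_natl.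
  apply: ler_sum => j _; rewrite normrM; apply: ler_pM => //.
    exact: le_trans (norm_coord_le _ _) vK.
  have [_] := R0P j; apply; first by rewrite r_gt0 rR0.
  by apply: sv; rewrite normr1.
Qed.

Definition flat_to m phi := forall s : seq 'I_p, (wsum s < m)%N -> iter_partial s phi 0 = 0.

Lemma flat_partial m phi j : flat_to m phi -> flat_to (m - o j) (partial j phi).
Proof.
move=> H s sm; rewrite -iter_partial_rcons; apply: H.
by rewrite wsum_rcons addnC -ltn_subRL.
Qed.

Lemma class_C_partial m V phi j : class_C m.+1 V phi -> class_C m V (partial j phi).
Proof. by move=> [_ /(_ j)[]]. Qed.

(** A derivative of weight [o j <= m] is rescaled by r^(m - o j), which is the estimate at a smaller
    weight; if [o j > m], a positive power of r remains and the limit is 0. The estimate at smaller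
    weights is a hypothesis because the lemma is used inside the induction that proves it. *)
Lemma taylor_grad_estimate_of m phi V j : (0 < m)%N -> open V -> V 0 -> class_C m V phi ->
  flat_to m phi ->
  (forall m' phi', (m' < m)%N -> class_C m' V phi' -> flat_to m' phi' ->
    forall K e : R, 0 <= K -> 0 < e ->
    exists2 r0 : R, 0 < r0 & forall r v, 0 < r < r0 -> `|v| <= K ->
     `|phi' (wdil r v) / r ^+ m' - taylor_poly m' m' phi' v| <= e) ->
  forall K e : R, 0 <= K -> 0 < e ->
  exists2 r0 : R, 0 < r0 & forall r v, 0 < r < r0 -> `|v| <= K ->
     `|r ^+ o j * partial j phi (wdil r v) / r ^+ m - taylor_grad m phi j v| <= e.
Proof.
case: m => // m _ oV V0 cV fl IH K e K0 e0.
have cp := class_C_partial j cV.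
have [jm|mj] := leqP (o j) m.+1.
  rewrite (taylor_gradE1 _ jm).
  have [|||r0 r00 rP] := IH (m.+1 - o j)%N (partial j phi) _ _ _ K e K0 e0.
  - by rewrite ltn_subrL o_gt0.
  - by apply: class_C_le cp; rewrite leq_subLR -add1n leq_add2r.
  - exact: flat_partial.
  exists r0 => // r v /andP[r_gt0 rr0] vK.
  have -> : r ^+ o j * partial j phi (wdil r v) / r ^+ m.+1 =
            partial j phi (wdil r v) / r ^+ (m.+1 - o j).
    rewrite -[in LHS](subnK jm) exprD.
    by field; rewrite !expf_neq0// gt_eqF.
  by apply: rP; rewrite ?r_gt0.
rewrite (taylor_gradE0 _ mj).
(* At weight 0 flatness is vacuous; the estimate serves here to bound [partial j phi] near 0. *)
have [||r1 r10 rP] := IH 0%N (partial j phi) _ (class_C_le (leq0n _) cp) _ K 1 K0 ltr01.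
- by [].
- by [].
set c := taylor_poly 0 0 (partial j phi) in rP.
have [M M0 cM] : exists2 M : R, 0 < M & forall v, `|c v| <= M.
  exists (`|c 0| + 1); first by rewrite ltr_wpDl.
  move=> v; rewrite (_ : c v = c 0) ?lerDl//.
  rewrite /c /taylor_poly !big_nat1 /taylor_part; congr (_ * _).
  apply: eq_bigr => s _; congr (_ * _).
  by rewrite tuple0 !big_nil.
exists (Num.min r1 (Num.min 1 (e / (M + 1)))).
  by rewrite !lt_min r10 ltr01 divr_gt0// addr_gt0.
move=> r v /andP[r_gt0]; rewrite !lt_min => /and3P[rr1 rl1 re] vK.
have := rP r v; rewrite r_gt0 rr1 expr0 invr1 mulr1 => /(_ isT vK) H1.
have H2 : `|partial j phi (wdil r v)| <= M + 1.
  rewrite -(subrK (c v) (partial j phi (wdil r v))).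
  by rewrite (le_trans (ler_normD _ _))// addrC lerD.
rewrite subr0 -[in leLHS](subnK (ltnW mj)) exprD.
have -> : r ^+ (o j - m.+1) * r ^+ m.+1 * partial j phi (wdil r v) / r ^+ m.+1 =
   r ^+ (o j - m.+1) * partial j phi (wdil r v).
  by field; rewrite expf_neq0// gt_eqF.
rewrite normrM normrX gtr0_norm//.
apply: (@le_trans _ _ (r * (M + 1))).
  apply: ler_pM; rewrite ?exprn_ge0 ?(ltW r_gt0)//.
  by rewrite -[leRHS]expr1 ler_wiXn2l ?subn_gt0// ltW.
by rewrite -ler_pdivlMr ?addr_gt0// ltW.
Qed.

(** Strong induction on the weight: the base case is continuity at 0, and the step is
    [taylor_ray_estimate] fed with the estimates of the derivatives, which have smaller weight. *)
Lemma taylor_estimate m phi V : open V -> V 0 -> class_C m V phi -> flat_to m phi ->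
  forall K e : R, 0 <= K -> 0 < e ->
  exists2 r0 : R, 0 < r0 & forall r v, 0 < r < r0 -> `|v| <= K ->
     `|phi (wdil r v) / r ^+ m - taylor_poly m m phi v| <= e.
Proof.
move=> oV V0; elim/ltn_ind: m phi => -[_|m IH] phi cV fl K e K0 e0.
  have := class_C_cont cV V0 => /cvgrPdist_le/(_ _ e0) near0.
  have [r0 r00 rP] := @wdil_small _ K near0.
  exists r0 => // r v rr vK; have := rP _ _ rr vK.
  rewrite expr0 divr1 distrC; congr (`| _ - _ | <= _).
  rewrite /taylor_poly big_nat1 fact0 invr1 mul1r /taylor_part (bigD1 [tuple])/=; last first.
    by rewrite /wsum big_nil.
  rewrite big_nil mulr1 big1 ?addr0// => s /andP[_ /eqP sn].
  by case: sn; exact: tuple0.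
have e1 : 0 < e / (p%:R * K + 1) by rewrite divr_gt0// ltr_wpDl// mulr_ge0.
have phi0 : phi 0 = 0 by apply: (fl [::]); rewrite /wsum big_nil.
have cV1 : class_C 1 V phi by exact: class_C_le cV.
have [|r0 r00 rP] := taylor_ray_estimate (ltn0Sn m) oV V0 cV1 phi0 K0 e1.
  move=> j; apply: (taylor_grad_estimate_of _ _ oV V0 cV fl) => // m' phi' m'm c' f' K' e' K'0 e'0.
  exact: IH.
exists r0 => // r v rr vK; apply: (le_trans (rP _ _ rr vK)).
rewrite mulrA mulrCA ler_piMr ?ltW// ltr_pdivrMr ?mul1r ?ltrDl//.
by rewrite ltr_wpDl// mulr_ge0.
Qed.

Lemma taylor_grad_estimate m phi V j : (0 < m)%N -> open V -> V 0 -> class_C m V phi ->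
  flat_to m phi ->
  forall K e : R, 0 <= K -> 0 < e ->
  exists2 r0 : R, 0 < r0 & forall r v, 0 < r < r0 -> `|v| <= K ->
     `|r ^+ o j * partial j phi (wdil r v) / r ^+ m - taylor_grad m phi j v| <= e.
Proof.
move=> m0 oV V0 cV fl; apply: (taylor_grad_estimate_of _ _ oV V0 cV fl) => // m' phi' _.
exact: taylor_estimate.
Qed.

Lemma taylor_poly_continuous N m phi : continuous (taylor_poly N m phi).
Proof.
move=> v; apply: (@cvg_sumr _ _ (nbhs v)) => l _; apply: cvgM; first exact: cvg_cst.
apply: (@cvg_sumr _ _ (nbhs v)) => s _; apply: cvgM; first exact: cvg_cst.
elim: (val s) => [|j t IH].
  by under eq_fun do rewrite big_nil; rewrite big_nil; exact: cvg_cst.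
under eq_fun do rewrite big_cons; rewrite big_cons; apply: cvgM => //.
exact: coord_continuous.
Qed.

Lemma taylor_grad_continuous m phi j : continuous (taylor_grad m phi j).
Proof.
have [jm|mj] := leqP (o j) m.
  by rewrite taylor_gradE1//; exact: taylor_poly_continuous.
by rewrite (taylor_gradE0 _ mj); exact: cst_continuous.
Qed.

(** The rescalings phi(wdil r v) / r^m converge to the Taylor polynomial uniformly on bounded sets,
    and their j-th derivatives converge likewise to [taylor_grad m phi j]. The increment of the
    limit is compared with that of a single rescaling for small r. *)
Lemma taylor_poly_derive m phi V j v : open V -> V 0 -> class_C m V phi -> flat_to m phi ->
  is_derive v (basis_vec j) (taylor_poly m m phi) (taylor_grad m phi j v).
Proof.
move=> oV V0 cV fl; have [m0|m0] := posnP m.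
  subst m; rewrite /taylor_grad leqNgt o_gt0/=.
  rewrite (_ : taylor_poly 0 0 phi = cst (taylor_poly 0 0 phi 0)); first exact: is_derive_cst.
  apply/funext => w; rewrite /taylor_poly !big_nat1 /taylor_part; congr (_ * _).
  by apply: eq_bigr => s _; rewrite tuple0 !big_nil.
have cV1 : class_C 1 V phi by exact: class_C_le cV.
pose P := taylor_poly m m phi; pose G := taylor_grad m phi j.
have key (t w : R) : 0 <= w ->
    (forall s : R, `|s| <= `|t| -> `|G (v + s *: basis_vec j) - G v| <= w) ->
    `|P (v + t *: basis_vec j) - P v - t * G v| <= w * `|t|.
  move=> w0 Gw; apply/ler_addgt0Pr => e e0.
  pose K := `|v| + `|t|.
  have K0 : 0 <= K by rewrite addr_ge0.
  (* Two errors in the values and one error in the slope, multiplied by |t|, add up to [e]. *)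
  have e1 : 0 < e / (2 + `|t|) by rewrite divr_gt0// ltr_wpDr.
  have [r1 r10 r1P] := taylor_estimate oV V0 cV fl K0 e1.
  have [r2 r20 r2P] := taylor_grad_estimate j m0 oV V0 cV fl K0 e1.
  have [r3 r30 r3P] := @wdil_small V K (open_nbhs_nbhs (conj oV V0)).
  pose r := Num.min r1 (Num.min r2 r3) / 2.
  have rr : 0 < r < Num.min r1 (Num.min r2 r3).
    have r_gt0 : 0 < Num.min r1 (Num.min r2 r3) by rewrite !lt_min r10 r20 r30.
    by rewrite divr_gt0// ltr_pdivrMr// mulr_natr mulr2n ltrDl.
  have [r_gt0 rr1 rr2 rr3] : [/\ 0 < r, r < r1, r < r2 & r < r3].
    by move: rr; rewrite !lt_min => /and4P[].
  have vs (s : R) : `|s| <= `|t| -> `|v + s *: basis_vec j| <= K.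
    move=> st; rewrite (le_trans (ler_normD _ _))// lerD2l normrZ.
    by rewrite (le_trans _ st)// ler_piMr// norm_basis_vec.
  pose q u := phi (wdil r u) / r ^+ m.
  pose D u := r ^+ o j * partial j phi (wdil r u) / r ^+ m.
  have Hq : `|q (v + t *: basis_vec j) - q v - t * G v| <= (e / (2 + `|t|) + w) * `|t|.
    have := @mean_value_le _ (fun s : R => q (v + s *: basis_vec j) - s * G v)
       (fun s => D (v + s *: basis_vec j) - G v) t (e / (2 + `|t|) + w).
    rewrite scale0r addr0 mul0r subr0 => H; rewrite addrAC; apply: H.
    - move=> s st.
      have Vs : V (wdil r (v + s *: basis_vec j)) by apply: r3P; [rewrite r_gt0|exact: vs].
      have [D1 D2] := wdil_derive (basis_vec j) oV cV1 Vs.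
      have := derive_line D1; rewrite D2 => L.
      have L2 : is_derive s (1:R) ((fun s : R => phi (wdil r (v + s *: basis_vec j))) * cst ((r ^+ m)^-1))
       (phi (wdil r (v + s *: basis_vec j)) *: 0 + (r ^+ m)^-1 *: \sum_i r ^+ o i * (basis_vec j : 'rV[R]_p) 0 i * partial i phi (wdil r (v + s *: basis_vec j))).
        exact: is_deriveM.
      apply: is_deriveB.
        apply: is_derive_eq L2 _; rewrite scaler0 add0r (bigD1 j)//= big1 ?addr0.
          by rewrite mxE !eqxx mulr1 [LHS]mulrC.
        by move=> i ij; rewrite mxE (negbTE ij) andbF mulr0 mul0r.
      have : is_derive s (1:R) (id * cst (G v) : R -> R) (s *: (0:R) + G v *: (1:R)).
        exact: is_deriveM.
      by rewrite scaler0 add0r [_%:A]mulr1.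
    - move=> s st; rewrite -(subrKA (G (v + s *: basis_vec j))).
      rewrite (le_trans (ler_normD _ _))// lerD//; last exact: Gw.
      by apply: r2P; rewrite ?r_gt0//; exact: vs.
  have q1 : `|P (v + t *: basis_vec j) - q (v + t *: basis_vec j)| <= e / (2 + `|t|).
    by rewrite distrC; apply: r1P; rewrite ?r_gt0//; exact: vs.
  have q2 : `|q v - P v| <= e / (2 + `|t|).
    by apply: r1P; rewrite ?r_gt0// lerDl.
  have -> : P (v + t *: basis_vec j) - P v - t * G v =
    (P (v + t *: basis_vec j) - q (v + t *: basis_vec j)) + (q v - P v) +
    (q (v + t *: basis_vec j) - q v - t * G v) by ring.
  apply: (le_trans (ler_normD _ _)); apply: (le_trans (lerD (ler_normD _ _) Hq)).
  apply: (le_trans (lerD (lerD q1 q2) (lexx _))).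
  have t2 : 2 + `|t| != 0 by rewrite gt_eqF// ltr_wpDr.
  rewrite le_eqVlt; apply/orP; left; apply/eqP; field.
  exact: t2.
have dP : (fun h : R => h^-1 *: ((P \o shift v) (h *: basis_vec j) - P v)) @ 0^' --> G v.
  apply/cvgrPdist_le => e e0.
  have /cvgrPdist_le/(_ _ e0)/near_normP[d d0 dG] := @taylor_grad_continuous m phi j v.
  near=> h; have h0 : h != 0 by near: h; exact: nbhs_dnbhs_neq.
  have hd : `|h| < d by near: h; exact: dnbhs0_lt.
  have H := @key h e (ltW e0).
  rewrite distrC -(ler_pM2r (_ : 0 < `|h|)) ?normr_gt0// -normrM mulrBl/=.
  rewrite [_^-1 *: _]mulrC mulfVK// [G v * h]mulrC [h *: _ + v]addrC; apply: H => s sh.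
  rewrite distrC; apply: dG; rewrite addrAC subrr add0r normrZ (le_lt_trans _ hd)//.
  by rewrite (le_trans _ sh)// ler_piMr// norm_basis_vec.
split; first by apply/cvg_ex; exists (G v).
exact/cvg_lim.
Unshelve. all: by end_near. Qed.

Lemma taylor_poly_C1 m phi V : open V -> V 0 -> class_C m V phi -> flat_to m phi ->
  class_C 1 setT (taylor_poly m m phi) /\
  forall j, partial j (taylor_poly m m phi) = taylor_grad m phi j.
Proof.
move=> oV V0 cV fl.
have E j : partial j (taylor_poly m m phi) = taylor_grad m phi j.
  by apply/funext => v; have [_] := taylor_poly_derive j v oV V0 cV fl.
split => //; split; first by move=> v _; exact: taylor_poly_continuous.
move=> j; split; first by move=> v _; have [] := taylor_poly_derive j v oV V0 cV fl.
by split => // v _; rewrite E; exact: taylor_grad_continuous.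
Qed.

(** Induction on the last letter: differentiating the zero polynomial makes [taylor_grad], the
    Taylor polynomial of [partial j phi], vanish identically. Contrapositively, a nonzero derivative
    of weight m makes the polynomial nonzero, which is what the negative case of the blow-up
    uses. *)
Lemma taylor_poly_nonzero m phi V : open V -> V 0 -> class_C m V phi -> flat_to m phi ->
  (forall v, taylor_poly m m phi v = 0) -> forall s, wsum s = m -> iter_partial s phi 0 = 0.
Proof.
move=> oV V0 + + + s; elim/last_ind: s m phi => [|s j IH] m phi cV fl P0.
  rewrite /wsum big_nil => m0; subst m; have := P0 0.
  rewrite /taylor_poly big_nat1 fact0 invr1 mul1r /taylor_part (bigD1 [tuple])/=; last first.
    by rewrite /wsum big_nil.
  rewrite big_nil mulr1 big1 ?addr0// => t /andP[_ /eqP tn].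
  by case: tn; exact: tuple0.
rewrite wsum_rcons => E; rewrite iter_partial_rcons.
have jm : (o j <= m)%N by rewrite -E leq_addl.
have m0 : (0 < m)%N by rewrite (leq_trans (o_gt0 j)).
apply: (IH (m - o j)%N).
- case: (m) m0 cV jm => // m' _ /(class_C_partial j) cV _; apply: class_C_le cV.
  by rewrite leq_subLR -add1n leq_add2r.
- exact: flat_partial.
- move=> v; have [_] := taylor_poly_derive j v oV V0 cV fl.
  rewrite /taylor_grad jm => <-.
  by rewrite (_ : taylor_poly m m phi = cst 0) ?derive_cst//; exact/funext.
- by rewrite -E addnK.
Qed.

End Taylor.

(** * Bilinearity of the bracket *)

Section LinearForms.
Context {R : realType} {n : nat}.
Notation V := 'rV[R]_n.
Implicit Types (q : V -> R) (u v w : V).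

Definition lform q := forall (a : R) u v, q (a *: u + v) = a * q u + q v.

Lemma lformD q u v : lform q -> q (u + v) = q u + q v.
Proof. by move=> l; rewrite -[u in LHS]scale1r l mul1r. Qed.

Lemma lform0 q : lform q -> q 0 = 0.
Proof. by move=> l; apply: (addrI (q 0)); rewrite -(lformD _ _ l) !addr0. Qed.

Lemma lformZ q a u : lform q -> q (a *: u) = a * q u.
Proof. by move=> l; rewrite -[_ *: _]addr0 l (lform0 l) addr0. Qed.

Lemma lformN q u : lform q -> q (- u) = - q u.
Proof. by move=> l; rewrite -scaleN1r (lformZ _ _ l) mulN1r. Qed.

Lemma lformB q u v : lform q -> q (u - v) = q u - q v.
Proof. by move=> l; rewrite (lformD _ _ l) (lformN _ l). Qed.

Lemma lform_sum q (I : Type) (r : seq I) (P : pred I) (F : I -> V) : lform q ->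
  q (\sum_(i <- r | P i) F i) = \sum_(i <- r | P i) q (F i).
Proof.
move=> l; elim: r => [|i r IH]; first by rewrite !big_nil lform0.
by rewrite !big_cons; case: ifP => // _; rewrite (lformD _ _ l) IH.
Qed.

Lemma lform_coord (f : V -> V) j : linear f -> lform (fun v => f v 0 j).
Proof. by move=> l a u v; rewrite l !mxE. Qed.

Lemma lform_comp q (f : V -> V) : lform q -> linear f -> lform (fun v => q (f v)).
Proof. by move=> l lf a u v; rewrite lf l. Qed.

Lemma row_basis v : v = \sum_i v 0 i *: basis_vec i.
Proof. exact: row_sum_delta. Qed.

End LinearForms.

Section Bracket.
Context {R : realType} {n k : nat} (G : carnot_group R n k).
Notation V := 'rV[R]_n.
Notation br := (bracket G).
Implicit Types (q : V -> R) (u v w x y z : V).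

Lemma brDr u v w : br u (v + w) = br u v + br u w.
Proof. by have := bracket_linear G u 1 v w; rewrite !scale1r. Qed.

Lemma br0r u : br u 0 = 0.
Proof. by apply: (addrI (br u 0)); rewrite -brDr !addr0. Qed.

Lemma brZr u a v : br u (a *: v) = a *: br u v.
Proof. by rewrite -[_ *: v]addr0 bracket_linear br0r addr0. Qed.

Lemma brNr u v : br u (- v) = - br u v.
Proof. by rewrite -scaleN1r brZr scaleN1r. Qed.

Lemma br_sumr u (I : Type) (r : seq I) (P : pred I) (F : I -> V) :
  br u (\sum_(i <- r | P i) F i) = \sum_(i <- r | P i) br u (F i).
Proof.
elim: r => [|i r IH]; first by rewrite !big_nil br0r.
by rewrite !big_cons; case: ifP => // _; rewrite brDr IH.
Qed.

(* The record only requires the bracket to be linear in its second argument;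
   [lbr] is its bilinear part, [dev] the deviation from it. *)
Definition lbr x y : V := \sum_i x 0 i *: br (basis_vec i) y.
Definition dev x y : V := br x y - lbr x y.

Lemma brE x y : br x y = lbr x y + dev x y.
Proof. by rewrite /dev addrC subrK. Qed.

Lemma lbr_linearr u : linear (lbr u).
Proof.
move=> a v w; rewrite /lbr scaler_sumr -big_split/=; apply: eq_bigr => i _.
by rewrite bracket_linear scalerDr scalerA [_ * a]mulrC -scalerA.
Qed.

Lemma lbr_linearl v : linear (lbr^~ v).
Proof.
move=> a u w; rewrite /lbr scaler_sumr -big_split/=; apply: eq_bigr => i _.
by rewrite !mxE scalerDl scalerA.
Qed.

Lemma dev_linear u : linear (dev u).
Proof. by move=> a v w; rewrite /dev bracket_linear lbr_linearr scalerBr addrACA opprD. Qed.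

Section lin.
Variables (f : V -> V) (lf : linear f).
Lemma linD u v : f (u + v) = f u + f v.
Proof. by rewrite -[u in LHS]scale1r lf scale1r. Qed.
Lemma lin0 : f 0 = 0.
Proof. by apply: (addrI (f 0)); rewrite -linD !addr0. Qed.
Lemma linZ a u : f (a *: u) = a *: f u.
Proof. by rewrite -[_ *: u]addr0 lf lin0 addr0. Qed.
Lemma linN u : f (- u) = - f u.
Proof. by rewrite -scaleN1r linZ scaleN1r. Qed.
Lemma linB u v : f (u - v) = f u - f v.
Proof. by rewrite linD linN. Qed.
Lemma lin_sum (I : Type) (r : seq I) (P : pred I) (F : I -> V) :
  f (\sum_(i <- r | P i) F i) = \sum_(i <- r | P i) f (F i).
Proof.
elim: r => [|i r IH]; first by rewrite !big_nil lin0.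
by rewrite !big_cons; case: ifP => // _; rewrite linD IH.
Qed.
End lin.

Lemma lbr_basis i v : lbr (basis_vec i) v = br (basis_vec i) v.
Proof.
rewrite /lbr (bigD1 i)//= mxE !eqxx scale1r big1 ?addr0// => j ji.
by rewrite mxE (negbTE ji) andbF scale0r.
Qed.

(** Summing the Jacobi identity over the basis vectors with the coefficients w_i: [br] is linear in
    [w] where [w] is the second argument, and becomes [lbr] where it is the first. *)
Lemma jac1 u v w : br u (br v w) + br v (lbr w u) + lbr w (br u v) = 0.
Proof.
have E : \sum_i w 0 i *: (br u (br v (basis_vec i)) + br v (br (basis_vec i) u) +
    br (basis_vec i) (br u v)) = 0.
  by rewrite big1// => i _; rewrite bracket_jacobi scaler0.
rewrite -[RHS]E {1}(row_basis w) !br_sumr.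
under [RHS]eq_bigr do rewrite !scalerDr.
rewrite !big_split/=; congr (_ + _ + _).
  by apply: eq_bigr => i _; rewrite !brZr.
by apply: eq_bigr => i _; rewrite !brZr.
Qed.

Lemma dev_br w u v : dev w (br u v) = - br v (dev w u).
Proof.
rewrite /dev brDr brNr; have /rowP J := bracket_jacobi G u v w; have /rowP J1 := jac1 u v w.
by apply/rowP => j; have := J j; have := J1 j; rewrite !mxE; lra.
Qed.

(** [dev_br] at u = z and its linear extension from the basis to [z] have the same right-hand side,
    so [dev w] takes the same value on [br z v] and on [lbr z v]. *)
Lemma dev_dev w z v : dev w (dev z v) = 0.
Proof.
have E : \sum_i z 0 i *: (dev w (br (basis_vec i) v) + br v (dev w (basis_vec i))) = 0.
  by rewrite big1// => i _; rewrite dev_br addNr scaler0.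
have {}E : dev w (lbr z v) + br v (dev w z) = 0.
  rewrite -[RHS]E; under [RHS]eq_bigr do rewrite scalerDr.
  rewrite big_split/=; congr (_ + _).
    rewrite /lbr (lin_sum (dev_linear w)); apply: eq_bigr => i _.
    by rewrite (linZ (dev_linear w)).
  rewrite [in LHS](row_basis z) (lin_sum (dev_linear w)) br_sumr.
  by apply: eq_bigr => i _; rewrite (linZ (dev_linear w)) brZr.
rewrite [in LHS]/dev -/(dev z v) -/(dev w _).
have := dev_br w z v; rewrite brE (linD (dev_linear w)) => /eqP.
rewrite -subr_eq0 opprK => /eqP F; apply/rowP => j; move/rowP: E => /(_ j).
by move/rowP: F => /(_ j); rewrite !mxE; lra.
Qed.

Lemma dev_lbr w u v : dev w (lbr u v) = - lbr v (dev w u).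
Proof.
have := dev_br w u v; rewrite !brE (linD (dev_linear w)) !dev_dev addr0.
by rewrite addr0.
Qed.

(** [dev_br] at u = v = x has br x x = 0 on its left, hence lbr x (dev w x) = 0; the statement is
    the polarised form. *)
Lemma lbr_dev_antisym w u v : lbr u (dev w v) = - lbr v (dev w u).
Proof.
have D x : lbr x (dev w x) = 0.
  have := dev_br w x x; rewrite bracket_alternating (lin0 (dev_linear w)).
  by rewrite brE dev_dev addr0 => /eqP; rewrite eq_sym oppr_eq0 => /eqP.
move: (dev w) (dev_linear w) D => d ld D.
have := D (u + v); rewrite (linD ld) (linD (lbr_linearl _)) !(linD (lbr_linearr _)).
by rewrite !D add0r addr0 => /eqP; rewrite addr_eq0 => /eqP.
Qed.

(** Two signs cancel: [dev w] lies in the centroid of [lbr]. *)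
Lemma dev_lbrC w u v : dev w (lbr u v) = lbr u (dev w v).
Proof. by rewrite dev_lbr [RHS]lbr_dev_antisym. Qed.

(** [jac1] treats one variable; the same summation over a basis is repeated in the other two. *)
Lemma jac_lbr u v w : lbr u (lbr v w) + lbr v (lbr w u) + lbr w (lbr u v) = 0.
Proof.
have J2 x y z : lbr x (br y z) + br y (lbr z x) + lbr z (lbr x y) = 0.
  have E : \sum_i x 0 i *: (br (basis_vec i) (br y z) + br y (lbr z (basis_vec i)) +
      lbr z (br (basis_vec i) y)) = 0.
    by rewrite big1// => i _; rewrite jac1 scaler0.
  rewrite -[RHS]E; under [RHS]eq_bigr do rewrite !scalerDr.
  rewrite !big_split/=; congr (_ + _ + _).
    rewrite [in LHS](row_basis x) (lin_sum (lbr_linearr _)) br_sumr.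
    by apply: eq_bigr => i _; rewrite (linZ (lbr_linearr _)) brZr.
  rewrite [lbr x y]/lbr (lin_sum (lbr_linearr _)).
  by apply: eq_bigr => i _; rewrite (linZ (lbr_linearr _)).
have E : \sum_i v 0 i *: (lbr u (br (basis_vec i) w) + br (basis_vec i) (lbr w u) +
    lbr w (lbr u (basis_vec i))) = 0.
  by rewrite big1// => i _; rewrite J2 scaler0.
rewrite -[RHS]E; under [RHS]eq_bigr do rewrite !scalerDr.
rewrite !big_split/=; congr (_ + _ + _).
  rewrite [in LHS]/(lbr v w) (lin_sum (lbr_linearr _)).
  by apply: eq_bigr => i _; rewrite (linZ (lbr_linearr _)).
transitivity (lbr w (\sum_i v 0 i *: lbr u (basis_vec i))).
  congr (lbr w _); rewrite [in LHS](row_basis v) (lin_sum (lbr_linearr _)).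
  by apply: eq_bigr => i _; rewrite (linZ (lbr_linearr _)).
rewrite (lin_sum (lbr_linearr _)); apply: eq_bigr => i _.
by rewrite (linZ (lbr_linearr _)).
Qed.

(* Spans are handled through the linear forms vanishing on them: [inW] is the
   span of the values of [dev], and [killW1] says that a form vanishes on the
   brackets with that span. *)
Definition inW v := forall q, lform q -> (forall w u, q (dev w u) = 0) -> q v = 0.
Definition killW1 q := lform q /\ forall u w v, q (lbr u (dev w v)) = 0.

Lemma inW_dev w u : inW (dev w u).
Proof. by move=> q _. Qed.

Lemma inWD u v : inW u -> inW v -> inW (u + v).
Proof. by move=> iu iv q l H; rewrite (lformD _ _ l) iu// iv// addr0. Qed.

Lemma inWZ a u : inW u -> inW (a *: u).
Proof. by move=> iu q l H; rewrite (lformZ _ _ l) iu// mulr0. Qed.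

Lemma inWN u : inW u -> inW (- u).
Proof. by move=> iu; rewrite -scaleN1r; exact: inWZ. Qed.

Lemma inWB u v : inW u -> inW v -> inW (u - v).
Proof. by move=> iu iv; apply: inWD => //; exact: inWN. Qed.

Lemma inW0 : inW 0.
Proof. by move=> q l _; exact: lform0. Qed.

Lemma inW_sum (I : Type) (r : seq I) (P : pred I) (F : I -> V) :
  (forall i, P i -> inW (F i)) -> inW (\sum_(i <- r | P i) F i).
Proof. by move=> H; elim/big_ind : _ => //; [exact: inW0|exact: inWD]. Qed.

Lemma inW_lbr u v : inW v -> inW (lbr u v).
Proof.
move=> iv q l H; apply: (iv (fun v => q (lbr u v))).
  exact: lform_comp l (lbr_linearr u).
by move=> w x; rewrite -dev_lbrC.
Qed.

Lemma dev_inW w v : inW v -> dev w v = 0.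
Proof.
move=> iv; apply/rowP => j; rewrite [RHS]mxE.
apply: (iv (fun v => dev w v 0 j)); first exact: lform_coord (dev_linear w).
by move=> z x; rewrite dev_dev mxE.
Qed.

(** Since br x x = 0, the square lbr x x equals - dev x x and lies in the span; polarisation gives
    the mixed terms. Thus [lbr] is antisymmetric modulo [inW]. *)
Lemma inW_sym u v : inW (lbr u v + lbr v u).
Proof.
have D x : inW (lbr x x).
  have : br x x = 0 by exact: bracket_alternating.
  rewrite brE => /eqP; rewrite addr_eq0 => /eqP ->; exact/inWN/inW_dev.
have -> : lbr u v + lbr v u = lbr (u + v) (u + v) - lbr u u - lbr v v.
  rewrite (linD (lbr_linearl _)) !(linD (lbr_linearr _)).
  by apply/rowP => j; rewrite !mxE; lra.
by apply: inWB => //; exact: inWB.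
Qed.

Lemma inW_lbrl w v : inW w -> inW (lbr w v).
Proof.
move=> iw; rewrite -[lbr w v](addrK (lbr v w)).
by apply: inWB; [exact: inW_sym|exact: inW_lbr].
Qed.

Lemma killW1_lbr q u w : killW1 q -> inW w -> q (lbr u w) = 0.
Proof.
move=> [l H] iw; apply: (iw (fun v => q (lbr u v))).
  exact: lform_comp l (lbr_linearr u).
by move=> z v; exact: H.
Qed.

(** [killW1] controls an element of the span only as the second argument; the Jacobi identity for
    [lbr] moves it there from the first one. *)
Lemma killW1_lbrl q w u v : killW1 q -> inW w -> q (lbr w (lbr u v)) = 0.
Proof.
move=> kq iw; have [l _] := kq.
have := jac_lbr u v w; rewrite addrC => /eqP; rewrite addr_eq0 => /eqP ->.
rewrite (lformN _ l) (lformD _ _ l) !killW1_lbr// ?addr0 ?oppr0//.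
  exact: inW_lbrl.
exact: inW_lbr.
Qed.

Lemma killW1_dev q m u v : killW1 q -> q (dev m (lbr u v)) = 0.
Proof. by move=> kq; rewrite dev_lbrC killW1_lbr//; exact: inW_dev. Qed.

Lemma killW1_devW q m w : killW1 q -> inW w -> q (dev m w) = 0.
Proof. by move=> [l _] iw; rewrite dev_inW// lform0. Qed.

Lemma layerP v j : v \in layer G j <-> forall i, ord G i != j -> v 0 i = 0.
Proof.
split; last first.
  move=> H; rewrite (row_basis v); apply: memv_suml => i _.
  have [ij|ij] := eqVneq (ord G i) j; last by rewrite H// scale0r mem0v.
  apply/memvZ/memv_span; apply/mapP; exists i => //.
  by rewrite mem_filter ij eqxx mem_enum.
move=> vj i ij.
have S : (layer G j <= lker (linfun (mulmxr (delta_mx i i) : V -> V)))%VS.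
  apply/span_subvP => _ /mapP[l + ->]; rewrite mem_filter => /andP[/eqP lj _].
  rewrite memv_ker lfunE/= mul_delta_mx_0//.
  by apply: contraNneq ij => <-; rewrite lj.
have := subvP S _ vj; rewrite memv_ker lfunE/= => /eqP/rowP/(_ i).
rewrite !mxE (bigD1 i)//= mxE !eqxx mulr1 big1 ?addr0// => l li.
by rewrite mxE (negbTE li) mulr0.
Qed.

Lemma ord_gt0 i : (0 < ord G i)%N.
Proof. by have /andP[] := ord_bounds G i. Qed.

Lemma ord_le i : (ord G i <= k)%N.
Proof. by have /andP[] := ord_bounds G i. Qed.

Lemma k_gt0 : (0 < k)%N.
Proof. by have [j <-] := ord_step G; exact: ord_gt0. Qed.

Lemma br_basis_coord i l j : ord G i = 1%N -> ord G j != (ord G l).+1 ->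
  br (basis_vec i) (basis_vec l) 0 j = 0.
Proof.
move=> i1 jl.
have M a : ord G l = a -> br (basis_vec i) (basis_vec l) \in bracket_layer G 1 a.
  move=> la; apply/memv_span/allpairsP; exists (i, l) => /=.
  by split=> //; rewrite mem_filter ?i1 ?la eqxx mem_enum inE.
have [lk|lk] := ltnP (ord G l) k.
  have := M _ erefl; rewrite -[ord G l]/((ord G l).+1.-1) bracket_stratified.
    by move/layerP; exact.
  by rewrite lk ltnS ord_gt0.
have lk' : ord G l = k by apply/eqP; rewrite eqn_leq lk ord_le.
by have := M _ lk'; rewrite bracket_top memv0 => /eqP ->; rewrite mxE.
Qed.

Lemma span_ind (P : V -> Prop) (s : seq V) : P 0 ->
  (forall a u v, P u -> P v -> P (a *: u + v)) -> {in s, forall v, P v} ->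
  forall v, v \in span s -> P v.
Proof.
move=> P0 Plin Ps v vs; rewrite (@coord_span _ _ _ (in_tuple s) v vs).
elim/big_ind : _ => //.
  by move=> x y Px Py; rewrite -[x]scale1r; exact: Plin.
by move=> i _; rewrite -[_ *: _]addr0; apply: Plin => //; apply/Ps/mem_nth.
Qed.

(** H_1 generates the algebra: a basis vector of order j > 1 is a combination of brackets of
    horizontal basis vectors with basis vectors of order j - 1, so induction on the order
    applies. *)
Lemma layer_ind (P : V -> Prop) : P 0 ->
  (forall a u v, P u -> P v -> P (a *: u + v)) ->
  (forall i, ord G i = 1%N -> P (basis_vec i)) ->
  (forall i l, ord G i = 1%N -> P (basis_vec l) -> P (br (basis_vec i) (basis_vec l))) ->
  forall v, P v.
Proof.
move=> P0 Plin P1 PS v; suff Pb j : P (basis_vec j).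
  rewrite (row_basis v); elim/big_ind : _ => //.
    by move=> x y Px Py; rewrite -[x]scale1r; exact: Plin.
  by move=> i _; rewrite -[_ *: _]addr0; exact: Plin.
have [a] := ubnP (ord G j); elim: a j => // a IH j ja.
have [j1|j1] := eqVneq (ord G j) 1%N; first exact: P1.
have j2 : (2 <= ord G j <= k)%N by rewrite ord_le andbT ltn_neqAle eq_sym j1 ord_gt0.
have : basis_vec j \in layer G (ord G j).
  by apply/layerP => i ij; rewrite mxE eqxx/=; case: eqP => // E; rewrite E eqxx in ij.
rewrite -(bracket_stratified G j2); apply: span_ind => // _ /allpairsP[[i l]/= [i1 l1 ->]].
move: i1 l1; rewrite !mem_filter => /andP[/eqP i1 _] /andP[/eqP l1 _].
apply: PS => //; apply: IH; rewrite l1.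
by move: ja j2; lia.
Qed.

(** Membership in the sum of the layers of order at least [j] and the span [inW]. The span is added
    because the antisymmetry of [lbr], on which the grading argument relies, holds only modulo
    it. *)
Definition inVW j v := exists2 v', inW (v - v') & forall i, (ord G i < j)%N -> v' 0 i = 0.

Lemma inVW_lin j a u v : inVW j u -> inVW j v -> inVW j (a *: u + v).
Proof.
move=> [u' iu u0] [v' iv v0]; exists (a *: u' + v').
  have -> : a *: u + v - (a *: u' + v') = a *: (u - u') + (v - v').
    by apply/rowP => i; rewrite !mxE; ring.
  by apply: inWD => //; exact: inWZ.
by move=> i ij; rewrite !mxE u0// v0// mulr0 addr0.
Qed.

Lemma inVW0 j : inVW j 0.
Proof. by exists 0 => [|i _]; rewrite ?subr0 ?mxE//; exact: inW0. Qed.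

Lemma inVWN j u : inVW j u -> inVW j (- u).
Proof. by move=> iu; rewrite -[- u]addr0 -scaleN1r; apply: inVW_lin => //; exact: inVW0. Qed.

Lemma inVWD j u v : inVW j u -> inVW j v -> inVW j (u + v).
Proof. by move=> iu iv; rewrite -[u]scale1r; exact: inVW_lin. Qed.

Lemma inVW_W j w : inW w -> inVW j w.
Proof. by move=> iw; exists 0 => [|i _]; rewrite ?subr0 ?mxE. Qed.

Lemma inVW_le i j v : (i <= j)%N -> inVW j v -> inVW i v.
Proof. by move=> ij [v' iv v0]; exists v' => // l li; apply: v0; exact: leq_trans ij. Qed.

(** For horizontal [u] this is the stratification. For a bracket [u] the Jacobi identity expresses
    [lbr u v] through iterated brackets with the two factors, up to symmetric terms that lie in
    [inW]. *)
Lemma inVW_lbr u j v : inVW j v -> inVW j.+1 (lbr u v).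
Proof.
move: u j v; apply: (@layer_ind (fun u => forall j v, inVW j v -> inVW j.+1 (lbr u v))).
- by move=> j v _; rewrite (lin0 (lbr_linearl v)); exact: inVW0.
- by move=> a u w Hu Hw j v iv; rewrite (lbr_linearl v); apply: inVW_lin; [exact: Hu|exact: Hw].
- move=> i i1 j v [v' iv v0]; exists (lbr (basis_vec i) v').
    by rewrite -(linB (lbr_linearr _)); exact: inW_lbr.
  move=> l lj; rewrite (row_basis v') (lin_sum (lbr_linearr _)) summxE big1// => h _.
  rewrite (linZ (lbr_linearr _)) mxE lbr_basis.
  have [hj|hj] := ltnP (ord G h) j; first by rewrite v0// mul0r.
  rewrite br_basis_coord ?mulr0//; apply: contraTneq lj => ->.
  by rewrite -leqNgt ltnS.
- move=> i h i1 Hh j v iv.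
  have H1 j' v' : inVW j' v' -> inVW j'.+1 (lbr (basis_vec i) v').
    move=> [w iw w0]; exists (lbr (basis_vec i) w).
      by rewrite -(linB (lbr_linearr _)); exact: inW_lbr.
    move=> l lj; rewrite (row_basis w) (lin_sum (lbr_linearr _)) summxE big1// => h' _.
    rewrite (linZ (lbr_linearr _)) mxE lbr_basis.
    have [hj|hj] := ltnP (ord G h') j'; first by rewrite w0// mul0r.
    rewrite br_basis_coord ?mulr0//; apply: contraTneq lj => ->.
    by rewrite -leqNgt ltnS.
  rewrite -lbr_basis; set p := basis_vec i; set u' := basis_vec h in Hh *.
  have -> : lbr (lbr p u') v = (lbr (lbr p u') v + lbr v (lbr p u')) +
      (lbr p (lbr u' v) + (lbr u' (lbr v p + lbr p v) - lbr u' (lbr p v))).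
    rewrite (linD (lbr_linearr _)) addrK.
    have /rowP J := jac_lbr p u' v; apply/rowP => l; have := J l; rewrite !mxE; lra.
  apply: inVWD; first exact/inVW_W/inW_sym.
  apply: inVWD; first by apply: (@inVW_le _ j.+2) => //; apply: H1; exact: Hh.
  apply: inVWD; first exact/inVW_W/inW_lbr/inW_sym.
  by apply/inVWN/(@inVW_le _ j.+2) => //; apply: Hh; exact: H1.
Qed.

Lemma inVW_iter x z i : inVW i.+1 (iter i (lbr x) z).
Proof.
elim: i => [|i IH] /=; last exact: inVW_lbr.
exists z => [|l]; first by rewrite subrr; exact: inW0.
by rewrite ltnS leqn0 => /eqP l0; have := ord_gt0 l; rewrite l0.
Qed.

(** By [inVW_iter], [k] applications leave only an element of the span [inW], since no layer has
    order above [k]; the next application is killed by [q]. *)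
Lemma killW1_iter q x z i : killW1 q -> (k < i)%N -> q (iter i (lbr x) z) = 0.
Proof.
move=> kq; case: i => // i; rewrite ltnS => ki; rewrite iterS; apply: killW1_lbr => //.
have [v' iv v0] := inVW_iter x z i; suff v'0 : v' = 0 by move: iv; rewrite v'0 subr0.
by apply/rowP => l; rewrite mxE v0// ltnS (leq_trans (ord_le l)).
Qed.

(** Words in two letters: [false] stands for the first factor of a product, [true] for the
    second. *)
Definition letters x y (w : seq bool) : seq V := [seq if b then y else x | b <- w].

Lemma nested_cons op a b (s : seq V) :
  nested_bracket op (a :: b :: s) = op a (nested_bracket op (b :: s)).
Proof. by []. Qed.

Lemma nested_inW x y (w : seq bool) : (1 < size w)%N ->
  inW (nested_bracket br (letters x y w) - nested_bracket lbr (letters x y w)).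
Proof.
case: w => // a [//|b w] _; elim: w a b => [|c w IH] a b.
  by rewrite /letters/= brE addrC addKr; exact: inW_dev.
have := IH b c; rewrite /letters ![map _ _]/= !nested_cons.
set N := br _ (nested_bracket br _); set M := lbr _ (nested_bracket lbr _) => H.
set f := if a then y else x.
have -> : br f N - lbr f M = dev f N + lbr f (N - M).
  by rewrite (linB (lbr_linearr _)) brE; apply/rowP => j; rewrite !mxE; lra.
by apply: inWD; [exact: inW_dev|exact: inW_lbr].
Qed.

(** In a word of length 2 the two brackets differ by a value of [dev], which [q] need not kill. One
    more letter places that difference inside another bracket, where [dev_dev], [dev_lbrC] and
    [killW1] make it vanish. *)
Lemma nested_kill q x y (w : seq bool) : killW1 q -> (2 < size w)%N ->
  q (nested_bracket br (letters x y w)) = q (nested_bracket lbr (letters x y w)).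
Proof.
move=> kq; have [l _] := kq; case: w => // a [//|b [//|c w]] _.
have := @nested_inW x y (b :: c :: w) isT.
rewrite /letters ![map _ _]/= !nested_cons.
set N := nested_bracket br _; set M := lbr _ (nested_bracket lbr _) => H.
set f := if a then y else x; set g := if b then y else x in H *.
apply/eqP; rewrite -subr_eq0 -(lformB _ _ l); apply/eqP.
have -> : br f (br g N) - lbr f M = dev f (lbr g N) + dev f (dev g N) + lbr f (br g N - M).
  rewrite (linB (lbr_linearr _)) -(linD (dev_linear _)) -brE [in LHS](brE f).
  by apply/rowP => j; rewrite !mxE; lra.
by rewrite dev_dev addr0 (lformD _ _ l) killW1_dev// add0r killW1_lbr.
Qed.

Lemma nested_lbr_inW x x' y y' (w : seq bool) : inW (x - x') -> inW (y - y') ->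
  inW (nested_bracket lbr (letters x y w) - nested_bracket lbr (letters x' y' w)).
Proof.
move=> ix iy; case: w => [|a w]; first by rewrite subrr; exact: inW0.
have il (b : bool) : inW ((if b then y else x) - (if b then y' else x')) by case: b.
elim: w a => [|b w IH] a; first exact: il.
have := IH b; rewrite /letters ![map _ _]/= !nested_cons.
set N := nested_bracket _ _; set M := nested_bracket _ _ => H.
set f := if a then y else x; set g := if a then y' else x'.
have -> : lbr f N - lbr g M = lbr (f - g) N + lbr g (N - M).
  by rewrite (linB (lbr_linearr _)) (linB (lbr_linearl _)) addrA subrK.
by apply: inWD; [exact/inW_lbrl/il|exact: inW_lbr].
Qed.

(** From length 3 on, changing the letters by elements of the span is invisible to [q]; this lets
    [op] be replaced by the polynomial [lop] inside such words. *)
Lemma nested_lbr_kill q x x' y y' (w : seq bool) : killW1 q -> (2 < size w)%N ->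
  inW (x - x') -> inW (y - y') ->
  q (nested_bracket lbr (letters x y w)) = q (nested_bracket lbr (letters x' y' w)).
Proof.
move=> kq + ix iy; have [l _] := kq; case: w => // a [//|b [//|c w]] _.
have il (d : bool) : inW ((if d then y else x) - (if d then y' else x')) by case: d.
have := @nested_lbr_inW _ _ _ _ (b :: c :: w) ix iy.
rewrite /letters ![map _ _]/= !nested_cons.
set N := nested_bracket _ _; set M := lbr _ (nested_bracket _ _) => H.
have := il a; set f := if a then y else x; set g := if a then y' else x' => ia.
apply/eqP; rewrite -subr_eq0 -(lformB _ _ l); apply/eqP.
set e := if b then y else x in H *.
have -> : lbr f (lbr e N) - lbr g M = lbr (f - g) (lbr e N) + lbr g (lbr e N - M).
  by rewrite (linB (lbr_linearr _)) (linB (lbr_linearl _)) addrA subrK.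
by rewrite (lformD _ _ l) killW1_lbrl// add0r killW1_lbr.
Qed.

Lemma nested_lbr_scale x z (t : R) (w : seq bool) :
  nested_bracket lbr (letters x (t *: z) w) =
  t ^+ count id w *: nested_bracket lbr (letters x z w).
Proof.
case: w => [|a w]; first by rewrite scaler0.
elim: w a => [|b w IH] a; first by case: a; rewrite /= ?expr1 ?expr0 ?scale1r.
have := IH b; rewrite /letters ![map _ _]/= !nested_cons => ->.
case: a; rewrite /= (linZ (lbr_linearr _)) ?add0n//.
by rewrite (linZ (lbr_linearl _)) scalerA mulrC -exprS.
Qed.

Lemma nested_diag q y (w : seq bool) : killW1 q -> (2 < size w)%N ->
  q (nested_bracket lbr (letters y y w)) = 0.
Proof.
move=> kq s2; rewrite -nested_kill//; have [l _] := kq.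
suff -> : nested_bracket br (letters y y w) = 0 by exact: lform0.
case: w s2 => // a [//|b w] _; elim: w a b => [|c w IH] a b.
  by rewrite /letters/= !if_same bracket_alternating.
by have := IH b c; rewrite /letters ![map _ _]/= !nested_cons => ->; exact: br0r.
Qed.

End Bracket.

(** * Coefficients of words in the Dynkin series *)

Section Dynkin.
Context {R : realType} (k : nat).
Notation idx := ('I_k.+1 * 'I_k.+1)%type.

Definition blocks m (rs : {ffun 'I_m -> idx}) : seq bool :=
  flatten [seq nseq (rs a).1 false ++ nseq (rs a).2 true | a <- enum 'I_m].

Definition dynkin_coef (m : nat) : R := (-1) ^+ m.-1 / m%:R.

(** [bch] with its words evaluated by an arbitrary functional [L], to which the factor 1 / length is
    left. The ring [P] and the embedding [iota] of the scalars allow the same combination of words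
    to be evaluated in vectors, in matrices of polynomials and in their coefficients. *)
Definition dynkin_sum (P : comNzRingType) (iota : R -> P) (U : lmodType P) (L : seq bool -> U) : U :=
  \sum_(1 <= m < k.+1) iota (dynkin_coef m) *:
    \sum_(rs : {ffun 'I_m -> idx} | [forall a, 0 < (rs a).1 + (rs a).2]%N)
       iota ((\prod_a (((rs a).1)`! * ((rs a).2)`!)%N%:R)^-1) *: L (blocks rs).

Lemma size_blocks m (rs : {ffun 'I_m -> idx}) :
  size (blocks rs) = (\sum_a ((rs a).1 + (rs a).2))%N.
Proof.
rewrite /blocks size_flatten sumnE /shape -map_comp big_map big_enum/=.
by apply: eq_bigr => a _; rewrite size_cat !size_nseq.
Qed.

Lemma blocks_neq0 m (rs : {ffun 'I_m -> idx}) : (0 < m)%N ->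
  [forall a, 0 < (rs a).1 + (rs a).2]%N -> blocks rs != [::].
Proof.
case: m rs => // m rs _ /forallP H; rewrite -size_eq0 size_blocks -lt0n.
by rewrite (bigD1 ord0)//= ltn_addr.
Qed.

Lemma eq_dynkin_sum (P : comNzRingType) (iota : R -> P) (U : lmodType P) (L L' : seq bool -> U) :
  (forall w, w != [::] -> L w = L' w) -> dynkin_sum iota L = dynkin_sum iota L'.
Proof.
move=> LL'; rewrite /dynkin_sum big_nat [RHS]big_nat; apply: eq_bigr => m /andP[m1 _].
by congr (_ *: _); apply: eq_bigr => rs Hrs; rewrite LL'// blocks_neq0.
Qed.

Lemma dynkin_sumD (P : comNzRingType) (iota : R -> P) (U : lmodType P) (L L' : seq bool -> U) :
  dynkin_sum iota (fun w => L w + L' w) = dynkin_sum iota L + dynkin_sum iota L'.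
Proof.
rewrite /dynkin_sum -big_split/=; apply: eq_bigr => m _; rewrite -scalerDr -big_split/=.
by congr (_ *: _); apply: eq_bigr => rs _; rewrite scalerDr.
Qed.

Lemma dynkin_sumZ (P : comNzRingType) (iota : R -> P) (U : lmodType P) c (L : seq bool -> U) :
  dynkin_sum iota (fun w => c *: L w) = c *: dynkin_sum iota L.
Proof.
rewrite /dynkin_sum scaler_sumr; apply: eq_bigr => m _; rewrite scalerA mulrC -scalerA.
by congr (_ *: _); rewrite scaler_sumr; apply: eq_bigr => rs _; rewrite !scalerA mulrC.
Qed.

Lemma dynkin_sum_map (P P' : comNzRingType) (iota : R -> P) (iota' : R -> P')
   (U : lmodType P) (U' : lmodType P') (f : U -> U') (L : seq bool -> U) :
  {morph f : u v / u + v} -> f 0 = 0 -> (forall c u, f (iota c *: u) = iota' c *: f u) ->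
  f (dynkin_sum iota L) = dynkin_sum iota' (fun w => f (L w)).
Proof.
move=> fD f0 fZ; rewrite /dynkin_sum (big_morph f fD f0); apply: eq_bigr => m _.
by rewrite fZ (big_morph f fD f0); congr (_ *: _); apply: eq_bigr => rs _; rewrite fZ.
Qed.

Definition texp (P : comNzRingType) (iota : R -> P) (A : algType P) (a : A) : A :=
  \sum_(r < k.+1) iota (r`!%:R^-1) *: a ^+ r.

(** For a multiplicative functional the word sum is the truncated series of log(exp a exp b): the
    words [blocks rs] come from expanding (exp a exp b - 1)^m by distributivity. *)
Lemma dynkin_word_prod (P : comNzRingType) (iota : {rmorphism R -> P}) (A : algType P) (a b : A) :
  dynkin_sum iota (fun w => \prod_(c <- w) if c then b else a) =
  \sum_(1 <= m < k.+1) iota (dynkin_coef m) *: (texp iota a * texp iota b - 1) ^+ m.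
Proof.
(* The value 0 at the exponents (0, 0) accounts for the - 1, and matches the side condition on
   [rs]. *)
pose F (j : idx) : A := if (0 < j.1 + j.2)%N then
  iota ((j.1`! * j.2`!)%N%:R^-1) *: (a ^+ j.1 * b ^+ j.2) else 0.
have BE : texp iota a * texp iota b - 1 = \sum_j F j.
  apply/eqP; rewrite subr_eq; apply/eqP.
  transitivity (\sum_(j : idx) iota ((j.1`! * j.2`!)%N%:R^-1) *: (a ^+ j.1 * b ^+ j.2)).
    rewrite /texp big_distrl/= -(pair_bigA _ (fun i j : 'I_k.+1 => iota ((i`! * j`!)%N%:R^-1) *: (a ^+ i * b ^+ j)))/=.
    apply: eq_bigr => i _; rewrite big_distrr/=; apply: eq_bigr => j _.
    by rewrite -scalerAl -scalerAr scalerA natrM invfM rmorphM.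
  rewrite (bigD1 (ord0, ord0))//= !fact0 mul1n invr1 rmorph1 scale1r !expr0 mulr1 addrC.
  congr (_ + _); rewrite [RHS](bigD1 (ord0, ord0))//= {1}/F/= add0r.
  apply: eq_bigr => -[i j] ij; rewrite /F/= ifT//.
  rewrite lt0n addn_eq0; apply: contra ij => /andP[/eqP i0 /eqP j0].
  by apply/eqP; congr pair; exact: val_inj.
apply: eq_bigr => m _; congr (_ *: _); rewrite BE.
transitivity (\prod_(i < m) \sum_j F j); last by rewrite prodr_const card_ord.
rewrite bigA_distr_bigA/= big_mkcond/=; apply: eq_bigr => rs _.
have P0 (r : seq 'I_m) i (f : 'I_m -> A) : i \in r -> f i = 0 -> \prod_(j <- r) f j = 0.
  elim: r => // j r IH; rewrite inE big_cons => /predU1P[<- ->|ir f0].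
    by rewrite mul0r.
  by rewrite IH// mulr0.
case: ifPn => [/forallP H|/forallPn[i Hi]]; last first.
  by rewrite (P0 _ i) ?mem_index_enum// /F (negbTE Hi).
have FE i : F (rs i) = iota (((rs i).1`! * (rs i).2`!)%N%:R^-1) *: (a ^+ (rs i).1 * b ^+ (rs i).2).
  by rewrite /F H.
under [RHS]eq_bigr do rewrite FE.
rewrite [RHS]scaler_prod; congr (_ *: _).
  by rewrite -prodfV rmorph_prod.
have pn (c : bool) r : \prod_(d <- nseq r c) (if d then b else a) = (if c then b else a) ^+ r.
  by rewrite big_nseq iter_mulr_1.
rewrite /blocks big_flatten big_map -deprecated_filter_index_enum big_filter; apply: eq_bigr => i _.
by rewrite big_cat !pn.
Qed.

End Dynkin.

Lemma bch_dynkin (R : realType) (n k : nat) (op : 'rV[R]_n -> 'rV[R]_n -> 'rV[R]_n) x y :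
  bch k op x y =
  dynkin_sum k id (fun w => (size w)%:R^-1 *: nested_bracket op (letters x y w)).
Proof.
rewrite /bch /dynkin_sum; apply: eq_bigr => m _; congr (_ *: _); apply: eq_bigr => rs _.
rewrite scalerA invfM mulrC size_blocks; congr (_ *: nested_bracket op _).
rewrite /blocks /letters map_flatten -map_comp; congr flatten; apply: eq_map => a /=.
by rewrite map_cat !map_nseq.
Qed.

Lemma split_first_true (w : seq bool) : w = nseq (size w) false \/
  exists a w', w = nseq a false ++ true :: w'.
Proof.
elim: w => [|[] w IH]; first by left.
  by right; exists 0%N, w.
case: IH => [E|[a [w' E]]]; [left|right; exists a.+1, w'].
  by rewrite /= -E.
by rewrite E.
Qed.

(* Sums over the occurrences of a given word are read off the entries of
   products of small matrices that act as an automaton. *)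
Section DynkinMatrix.
Context {R : realType} (k : nat).
Notation P := {poly R}.
Notation M3 := 'M[P]_3.
Let e (i j : 'I_3) : M3 := delta_mx i j.

(** An entry of a product of transition matrices tells whether the automaton accepts the word, so
    sums over selected words are entries of a truncated logarithm that can be computed directly. *)
Lemma dynkin_entry (a b : M3) (i j : 'I_3) :
  (\sum_(1 <= m < k.+1) (dynkin_coef m : R)%:P *: (texp k polyC a * texp k polyC b - 1) ^+ m) i j =
  dynkin_sum k polyC (fun w => ((\prod_(c <- w) if c then b else a) i j : P^o)).
Proof.
rewrite -dynkin_word_prod.
apply: (@dynkin_sum_map _ _ _ _ _ _ _ _ (fun M : M3 => M i j : P^o)).
- by move=> u v; rewrite mxE.
- by rewrite mxE.
- by move=> c u; rewrite mxE.
Qed.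

Lemma dynkin_coefp (l : nat) (L : seq bool -> P^o) :
  (dynkin_sum k polyC L)`_l = dynkin_sum k id (fun w => ((L w)`_l : R^o)).
Proof.
apply: (@dynkin_sum_map _ _ _ _ _ _ _ _ (fun p : P^o => (p : P)`_l : R^o)).
- by move=> u v; rewrite coefD.
- by rewrite coef0.
- by move=> c u; rewrite coefCM.
Qed.

Lemma texp_sqr0 (a : M3) : (0 < k)%N -> a * a = 0 -> texp k polyC a = 1 + a.
Proof.
move=> k0 a2; rewrite /texp.
case: k k0 => // k' _; rewrite big_ord_recl big_ord_recl big1/= ?addr0.
  by rewrite expr0 expr1 fact0 invr1 !scale1r.
by move=> r _; rewrite /bump/= !add1n !exprS mulrA a2 mul0r scaler0.
Qed.

Let o0 : 'I_3 := ord0.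
Let o1 : 'I_3 := lift ord0 ord0.
Let o2 : 'I_3 := ord_max.

Lemma eM i j i' j' : e i j * e i' j' = (j == i')%:R *: e i j'.
Proof.
rewrite /e; have [->|ji] := eqVneq j i'; first by rewrite scale1r; exact: mul_delta_mx.
by rewrite scale0r; exact: mul_delta_mx_0.
Qed.

Lemma eE i j i' j' : e i j i' j' = ((i' == i) && (j' == j))%:R.
Proof. by rewrite mxE. Qed.

(** The letter [c] leads from state [o0] to state [o1], and in [detect2] the second letter leads
    from [o1] to [o2]; all other transitions are 0. An entry of a word product then tests equality
    with one word. *)
Definition detect1 (c d : bool) : M3 := if c == d then e o0 o1 else 0.
Definition detect2 (c1 c2 d : bool) : M3 :=
  if d == c1 then e o0 o1 else if d == c2 then e o1 o2 else 0.

Lemma prod_detect1 c (w : seq bool) :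
  (\prod_(d <- w) (if d then detect1 c true else detect1 c false)) o0 o1 = (w == [:: c])%:R.
Proof.
have E d : (if d then detect1 c true else detect1 c false) = detect1 c d by case: d.
under eq_bigr do rewrite E.
case: w => [|d [|d' w]]; first by rewrite big_nil mxE.
  by rewrite big_seq1 /detect1 eqseq_cons eqxx andbT eq_sym; case: eqP => _; rewrite mxE.
rewrite !big_cons mulrA /detect1.
have -> : (if c == d then e o0 o1 else 0) * (if c == d' then e o0 o1 else 0) = 0.
  by case: eqP => _; case: eqP => _; rewrite ?mulr0 ?mul0r// eM scale0r.
by rewrite mul0r mxE !eqseq_cons andbF.
Qed.

Lemma prod_detect2 c (w : seq bool) :
  (\prod_(d <- w) (if d then detect2 c (~~ c) true else detect2 c (~~ c) false)) o0 o2 =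
  (w == [:: c; ~~ c])%:R.
Proof.
have E d : (if d then detect2 c (~~ c) true else detect2 c (~~ c) false) =
    if d == c then e o0 o1 else e o1 o2.
  by rewrite /detect2; case: d; case: c.
under eq_bigr do rewrite E.
case: w => [|d [|d' [|d'' w]]]; first by rewrite big_nil mxE.
- by rewrite big_seq1; case: eqP => _; rewrite mxE eqseq_cons/= andbF.
- rewrite !big_cons big_nil mulr1 !eqseq_cons eqxx andbT.
  by clear E; case: d; case: d'; case: c => /=; rewrite eM/= ?scale1r ?scale0r mxE.
- rewrite !big_cons !mulrA.
  have -> : (if d == c then e o0 o1 else e o1 o2) * (if d' == c then e o0 o1 else e o1 o2) *
    (if d'' == c then e o0 o1 else e o1 o2) = 0.
    by clear E; case: d; case: d'; case: d''; case: c => /=; rewrite eM/= ?scale1r ?scale0r ?mul0r// eM/= scale0r.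
  by rewrite mul0r mxE !eqseq_cons !andbF.
Qed.

Lemma entry_sum (I : Type) (r : seq I) (Q : pred I) (F : I -> M3) i j :
  (\sum_(m <- r | Q m) F m) i j = \sum_(m <- r | Q m) F m i j.
Proof. by apply: (big_morph (fun M : M3 => M i j)) => [u v|]; rewrite mxE. Qed.

Lemma nilp_sum1 (B : M3) : (0 < k)%N -> B * B = 0 ->
  \sum_(1 <= m < k.+1) (dynkin_coef m : R)%:P *: B ^+ m = B.
Proof.
move=> k0 B2; rewrite big_ltn// big_nat big1 ?addr0.
  by rewrite /dynkin_coef expr0 div1r invr1 scale1r expr1.
by case=> // -[//|m] _; rewrite !exprS mulrA B2 mul0r scaler0.
Qed.

Lemma nilp_sum2 (B : M3) : (1 < k)%N -> B * B * B = 0 ->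
  \sum_(1 <= m < k.+1) (dynkin_coef m : R)%:P *: B ^+ m = B - (2^-1)%:P *: (B * B).
Proof.
move=> k1 B3; rewrite (big_ltn (_ : 1 < k.+1)%N) ?ltnS ?(ltnW k1)// (big_ltn (_ : 2 < k.+1)%N) ?ltnS//.
rewrite big_nat big1 ?addr0.
  rewrite /dynkin_coef expr0 div1r invr1 scale1r expr1 expr2.
  by rewrite expr1 mulN1r polyCN scaleNr.
by case=> // -[//|[//|m]] _; rewrite !exprS !mulrA B3 mul0r scaler0.
Qed.

Lemma dynkin_word1 c : (0 < k)%N -> dynkin_sum k id (fun w => ((w == [:: c])%:R : R^o)) = 1.
Proof.
move=> k0.
transitivity ((dynkin_sum k polyC (fun w => (((w == [:: c])%:R : P) : P^o)))`_0).
  by rewrite dynkin_coefp; apply: eq_dynkin_sum => w _; case: eqP => _; rewrite ?coef1 ?coef0.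
have -> : dynkin_sum k polyC (fun w => (((w == [:: c])%:R : P) : P^o)) =
  dynkin_sum k polyC (fun w => ((\prod_(d <- w) if d then detect1 c true else detect1 c false) o0 o1 : P^o)).
  by apply: eq_dynkin_sum => w _; rewrite prod_detect1.
rewrite -dynkin_entry.
have sq d : detect1 c d * detect1 c d = 0.
  by rewrite /detect1; case: eqP => _; rewrite ?mul0r// eM scale0r.
rewrite !texp_sqr0//.
have -> : (1 + detect1 c false) * (1 + detect1 c true) - 1 = e o0 o1.
  by rewrite /detect1; case: (c) => /=; rewrite addr0 ?mul1r ?mulr1 addrC addKr.
by rewrite nilp_sum1 ?eM ?scale0r// eE !eqxx coef1.
Qed.

Lemma shuffle_add (U : zmodType) (t a b c : U) : t + a + (b + c) - t = a + b + c.
Proof. by apply/eqP; rewrite subr_eq -!addrA [X in X == _]addrC -!addrA. Qed.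

(** The coefficients of xy and yx in log(exp x exp y). On these matrices B^3 = 0, and the logarithm
    is B - B^2 / 2. *)
Lemma dynkin_word2 c : (1 < k)%N ->
  dynkin_sum k id (fun w => ((w == [:: c; ~~ c])%:R : R^o)) = (if c then - 2^-1 else 2^-1).
Proof.
move=> k1.
transitivity ((dynkin_sum k polyC (fun w => (((w == [:: c; ~~ c])%:R : P) : P^o)))`_0).
  by rewrite dynkin_coefp; apply: eq_dynkin_sum => w _; case: eqP => _; rewrite ?coef1 ?coef0.
have -> : dynkin_sum k polyC (fun w => (((w == [:: c; ~~ c])%:R : P) : P^o)) =
  dynkin_sum k polyC (fun w => ((\prod_(d <- w) if d then detect2 c (~~ c) true else detect2 c (~~ c) false) o0 o2 : P^o)).
  by apply: eq_dynkin_sum => w _; rewrite prod_detect2.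
rewrite -dynkin_entry.
have sq d : detect2 c (~~ c) d * detect2 c (~~ c) d = 0.
  by rewrite /detect2; case: d; case: c => /=; rewrite eM scale0r.
rewrite !texp_sqr0// ?(ltnW k1)//.
pose B := (1 + detect2 c (~~ c) false) * (1 + detect2 c (~~ c) true) - 1.
have BE : B = e o0 o1 + e o1 o2 + (if c then 0 else e o0 o2).
  rewrite /B mulrDl mul1r mulrDr mulr1 /detect2; case: (c) => /=; rewrite eM ?scale0r ?scale1r.
    exact: shuffle_add.
  by rewrite [e o0 o1 + e o1 o2]addrC; exact: shuffle_add.
have B2 : B * B = e o0 o2.
  rewrite BE !mulrDl !mulrDr !eM/= !scale0r scale1r ?add0r ?addr0.
  by case: (c); rewrite ?mulr0 ?mul0r ?eM/= ?scale0r ?addr0.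
rewrite -/B nilp_sum2//; last first.
  rewrite B2 BE !mulrDr !eM/= !scale0r !add0r.
  by case: (c); rewrite ?mulr0// eM scale0r.
rewrite B2 BE; case: (c); rewrite !mxE/= ?add0r ?addr0 mulr1 ?coefB ?coefN !coefC eqxx/=//.
by field.
Qed.

(* The automaton of the words x ... x z and x ... x z x. *)
Definition lin_x : M3 := 'X *: e o0 o0 + 'X *: e o1 o2.
Definition lin_z : M3 := e o0 o1.

Lemma mul_row (A B : M3) i j : (A * B) i j = \sum_l A i l * B l j.
Proof. by rewrite mxE. Qed.

Lemma lin_x_mul (B : M3) j : (lin_x * B) o0 j = 'X * B o0 j /\
  (lin_x * B) o1 j = 'X * B o2 j /\ (lin_x * B) o2 j = 0.
Proof.
rewrite /lin_x !mul_row !big_ord_recr !big_ord0/= !mxE/= !mulr1 !mulr0 !addr0 !add0r !mul0r ?addr0 ?add0r.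
split; [|split] => //.
by congr (_ * B _ _); exact: val_inj.
Qed.

Lemma lin_z_mul (B : M3) j : (lin_z * B) o0 j = B o1 j /\
  (lin_z * B) o1 j = 0 /\ (lin_z * B) o2 j = 0.
Proof.
rewrite /lin_z !mul_row !big_ord_recr !big_ord0/= !mxE/= !mul0r !mul1r ?addr0 ?add0r.
by split; [congr (B _ _); exact: val_inj|].
Qed.

Let W (w : seq bool) : M3 := \prod_(d <- w) (if d then lin_z else lin_x).

Lemma W_row2 w j : w != [::] -> W w o2 j = 0.
Proof.
case: w => // -[] w _; rewrite /W big_cons.
  by have [_ []] := lin_z_mul (W w) j.
by have [_ []] := lin_x_mul (W w) j.
Qed.

Lemma W_row1 w j : W w o1 j = if w is [::] then (o1 == j)%:R else
  if w is [:: false] then 'X * (o2 == j)%:R else 0.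
Proof.
case: w => [|[] w]; first by rewrite /W big_nil mxE.
  by rewrite /W big_cons; have [_ []] := lin_z_mul (W w) j.
rewrite /W big_cons; have [_ [-> _]] := lin_x_mul (W w) j.
case: w => [|b w]; first by rewrite /W big_nil mxE.
by rewrite W_row2// mulr0.
Qed.

Lemma W_row0 a w j : W (nseq a false ++ true :: w) o0 j = 'X^a * W w o1 j.
Proof.
elim: a => [|a IH]; rewrite /W big_cons.
  by have [-> _] := lin_z_mul (W w) j; rewrite expr0 mul1r.
have [-> _] := lin_x_mul (W (nseq a false ++ true :: w)) j.
by rewrite IH exprS mulrA.
Qed.

Lemma W_row0_nseq a : W (nseq a false) o0 o1 = 0 /\ W (nseq a false) o0 o2 = 0.
Proof.
elim: a => [|a [IH1 IH2]]; rewrite /W/= ?big_nil ?big_cons; first by rewrite !mxE.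
have [-> _] := lin_x_mul (W (nseq a false)) o1.
have [-> _] := lin_x_mul (W (nseq a false)) o2.
by rewrite IH1 IH2 !mulr0.
Qed.

(** The truncation of exp X - 1 after degree k; the variable X counts the letters x of a word. *)
Definition uexp : P := \sum_(1 <= r < k.+1) (r`!%:R^-1)%:P * 'X^r.

Lemma lin_xX r : lin_x ^+ r.+2 = 'X^(r.+2) *: e o0 o0.
Proof.
elim: r => [|r IH].
  rewrite expr2 /lin_x mulrDl !mulrDr -!scalerAl -!scalerAr !eM/= !scale0r !scale1r.
  by rewrite !scaler0 !addr0 scalerA expr2.
rewrite exprS IH /lin_x mulrDl -!scalerAl -!scalerAr !eM/= scale0r scale1r !scaler0 addr0.
by rewrite scalerA exprS.
Qed.

Lemma texp_lin_x : (0 < k)%N -> texp k polyC lin_x = 1 + uexp *: e o0 o0 + 'X *: e o1 o2.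
Proof.
move=> k0; rewrite /texp -(big_mkord xpredT (fun r => (r`!%:R^-1)%:P *: lin_x ^+ r)).
rewrite (big_ltn (ltn0Sn k)) (big_ltn (_ : 1 < k.+1)%N) ?ltnS//.
rewrite /uexp (big_ltn (_ : 1 < k.+1)%N) ?ltnS//.
rewrite !fact0 !invr1 !polyC1 !scale1r mul1r expr0 !expr1.
rewrite -!addrA; congr (1 + _); rewrite {1}/lin_x scalerDl -!addrA; congr (_ + _).
rewrite addrC; congr (_ + _); rewrite scaler_suml big_nat [RHS]big_nat.
by apply: eq_bigr => -[|[|r]]// _; rewrite lin_xX scalerA.
Qed.

Lemma texp_lin_z : (0 < k)%N -> texp k polyC lin_z = 1 + lin_z.
Proof. by move=> k0; rewrite texp_sqr0// /lin_z eM scale0r. Qed.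

Let Bxz : M3 := texp k polyC lin_x * texp k polyC lin_z - 1.
Let Bzx : M3 := texp k polyC lin_z * texp k polyC lin_x - 1.

Lemma BxzE : (0 < k)%N -> Bxz = uexp *: e o0 o0 + 'X *: e o1 o2 + (1 + uexp) *: e o0 o1.
Proof.
move=> k0; rewrite /Bxz texp_lin_x// texp_lin_z//.
rewrite mulrDr mulr1 /lin_z !mulrDl mul1r -!scalerAl !eM/= scale0r scale1r scaler0 addr0.
by rewrite scalerDl scale1r; apply/eqP; rewrite subr_eq -!addrA [X in X == _]addrC -!addrA.
Qed.

Lemma BzxE : (0 < k)%N -> Bzx = uexp *: e o0 o0 + 'X *: e o1 o2 + (e o0 o1 + 'X *: e o0 o2).
Proof.
move=> k0; rewrite /Bzx texp_lin_x// texp_lin_z//.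
rewrite mulrDl mul1r /lin_z !mulrDr mulr1 -!scalerAr !eM/= scale0r scale1r scaler0 addr0.
by apply/eqP; rewrite subr_eq -!addrA [X in X == _]addrC -!addrA.
Qed.

(** Both [Bxz] and [Bzx] have this shape, with different [c] and [d]; the first row of their powers
    is then explicit ([pow_gen]). *)
Lemma mul_gen (M : M3) (c d : P) :
  let B := uexp *: e o0 o0 + 'X *: e o1 o2 + (c *: e o0 o1 + d *: e o0 o2) in
  [/\ (M * B) o0 o0 = M o0 o0 * uexp, (M * B) o0 o1 = M o0 o0 * c &
      (M * B) o0 o2 = M o0 o1 * 'X + M o0 o0 * d].
Proof.
have E0 : o0 = ord0 by []. have E1 : o1 = widen_ord (leqnSn 2) ord_max by exact: val_inj.
have E2 : widen_ord (leqnSn 2) (widen_ord (leqnSn 1) ord_max) = o0 by exact: val_inj.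
move=> B; rewrite !mul_row !big_ord_recr !big_ord0/= !add0r -!E1 !E2 -/o2.
have BE a b : B a b = uexp * ((a == o0) && (b == o0))%:R + 'X * ((a == o1) && (b == o2))%:R +
    (c * ((a == o0) && (b == o1))%:R + d * ((a == o0) && (b == o2))%:R) by rewrite /B !mxE.
clearbody B; rewrite !BE /= !mulr0 !mulr1 !addr0 ?add0r ?mulr0 ?addr0.
by split=> //; rewrite addrC.
Qed.

Lemma pow_gen (c d : P) m :
  let B := uexp *: e o0 o0 + 'X *: e o1 o2 + (c *: e o0 o1 + d *: e o0 o2) in
  [/\ (B ^+ m.+1) o0 o0 = uexp ^+ m.+1, (B ^+ m.+1) o0 o1 = uexp ^+ m * c &
      (B ^+ m.+1) o0 o2 = (if m is m'.+1 then uexp ^+ m' * c * 'X else 0) + uexp ^+ m * d].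
Proof.
move=> B; elim: m => [|m [IH0 IH1 IH2]].
  have [] := @mul_gen 1 c d; rewrite -/B mul1r expr1 expr0 !mxE/= => -> -> ->.
  by rewrite !mul1r mul0r add0r.
have [] := @mul_gen (B ^+ m.+1) c d; rewrite -/B -exprSr IH0 IH1 => -> -> ->.
by rewrite -exprSr.
Qed.

Definition log_series : P := \sum_(1 <= m < k.+1) (dynkin_coef m : R)%:P * uexp ^+ m.

Lemma uexp_fact : uexp = 'X * \sum_(1 <= r < k.+1) (r`!%:R^-1)%:P * 'X^(r.-1).
Proof.
rewrite /uexp big_distrr/= big_nat [RHS]big_nat; apply: eq_bigr => -[//|r] _.
by rewrite exprS/= mulrCA.
Qed.

Lemma uexp_deriv : uexp^`() = 1 + uexp - (k`!%:R^-1)%:P * 'X^k.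
Proof.
have -> : 1 + uexp = \sum_(0 <= r < k.+1) (r`!%:R^-1)%:P * 'X^r.
  by rewrite big_ltn// fact0 invr1 mul1r expr0.
rewrite big_nat_recr//= addrK /uexp raddf_sum big_add1/= big_nat [RHS]big_nat.
apply: eq_bigr => r _; rewrite derivM derivC mul0r add0r derivXn/=.
rewrite mulrnAr -mulrnAl -polyCMn; congr (_%:P * _); rewrite -[LHS]mulr_natr.
have fi : r`!%:R != 0 :> R by rewrite pnatr_eq0 -lt0n fact_gt0.
have i1 : r.+1%:R != 0 :> R by rewrite pnatr_eq0.
rewrite factS natrM; move: (r.+1%:R) i1 => c c0.
by field; rewrite fi c0.
Qed.

(** This is log(exp X) = X up to degree k. The derivative of [uexp] is 1 + uexp up to a multiple of
    X^k, and the finite geometric series times 1 + uexp is 1 - (- uexp)^k. Every error is divisible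
    by X^k, so the derivative of the series is 1 in degrees below k. *)
Lemma log_series_coef i : (i <= k)%N -> log_series`_i = (i == 1%N)%:R.
Proof.
have kfact0 (Q : P) l : (l < k)%N -> ('X^k * Q)`_l = 0 by move=> lk; rewrite coefXnM lk.
have D : log_series^`() = 1 - (- uexp) ^+ k -
   'X^k * ((k`!%:R^-1)%:P * \sum_(0 <= m < k) (- uexp) ^+ m).
  have E : log_series^`() = (\sum_(0 <= m < k) (- uexp) ^+ m) * uexp^`().
    rewrite /log_series raddf_sum big_add1/= big_distrl/= big_nat [RHS]big_nat.
    apply: eq_bigr => m _; rewrite derivM derivC mul0r add0r deriv_exp/=.
    rewrite mulrnAr -mulrnAl -polyCMn /dynkin_coef/= -[_ / _ *+ _]mulr_natr divfK ?pnatr_eq0//.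
    rewrite -[- uexp]mulN1r exprMn rmorphXn/= polyCN polyC1; ring.
  rewrite E uexp_deriv mulrBr; congr (_ - _); last first.
    by rewrite mulrA mulrC [_ * (_)%:P]mulrC.
  have -> : 1 + uexp = 1 - (- uexp) by rewrite opprK.
  have := subrX1 (- uexp) k; rewrite big_mkord => H.
  by rewrite mulrC -opprB mulNr -H opprB.
case: i => [|i] ik.
  rewrite /log_series coef_sum big_nat big1// => -[//|m] _; rewrite coefCM.
  have -> : (uexp ^+ m.+1)`_0 = 0 by rewrite exprS uexp_fact -mulrA coefXM.
  by rewrite mulr0.
have := congr1 (fun p : P => p`_i) D; rewrite coef_deriv !coefB kfact0// subr0.
have -> : (- uexp) ^+ k = 'X^k * (- \sum_(1 <= r < k.+1) (r`!%:R^-1)%:P * 'X^(r.-1)) ^+ k.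
  by rewrite uexp_fact -mulrN exprMn.
rewrite kfact0// subr0 coef1 => H.
have i1 : i.+1%:R != 0 :> R by rewrite pnatr_eq0.
apply: (mulfI i1); rewrite mulr_natl H eqSS.
by case: i {ik H i1} => [|i]; rewrite ?mulr1 ?mulr0.
Qed.

(** The entry at [o0], [o1] collects the words x...xz: there (1 + uexp) uexp^m - uexp^m = uexp^(m+1)
    turns the difference into [log_series]. In the entry at [o0], [o2], for the words x...xzx, the
    powers beyond the first cancel and the first one leaves - X. *)
Lemma dynkin_lin_diff (i : nat) : (0 < k)%N -> (i <= k)%N ->
  ((\sum_(1 <= m < k.+1) (dynkin_coef m : R)%:P *: Bxz ^+ m) o0 o1 -
   (\sum_(1 <= m < k.+1) (dynkin_coef m : R)%:P *: Bzx ^+ m) o0 o1)`_i = (i == 1%N)%:R /\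
  ((\sum_(1 <= m < k.+1) (dynkin_coef m : R)%:P *: Bxz ^+ m) o0 o2 -
   (\sum_(1 <= m < k.+1) (dynkin_coef m : R)%:P *: Bzx ^+ m) o0 o2)`_i = - (i == 1%N)%:R.
Proof.
move=> k0 ik.
have -> : Bxz = uexp *: e o0 o0 + 'X *: e o1 o2 + ((1 + uexp) *: e o0 o1 + 0 *: e o0 o2).
  by rewrite BxzE// scale0r addr0.
have -> : Bzx = uexp *: e o0 o0 + 'X *: e o1 o2 + (1 *: e o0 o1 + 'X *: e o0 o2).
  by rewrite BzxE// scale1r.
have E1 (B : M3) j : (\sum_(1 <= m < k.+1) (dynkin_coef m : R)%:P *: B ^+ m) o0 j =
    \sum_(1 <= m < k.+1) (dynkin_coef m : R)%:P * (B ^+ m) o0 j.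
  by rewrite entry_sum; apply: eq_bigr => m _; rewrite mxE.
rewrite !E1 -!sumrB; split.
  rewrite -(log_series_coef ik); congr (nth 0 (polyseq _) i); apply: eq_big_nat => -[|m]// _.
  by have [_ -> _] := pow_gen (1 + uexp) 0 m; have [_ -> _] := pow_gen 1 'X m; rewrite exprS; ring.
transitivity ((- 'X : P)`_i); last by rewrite coefN coefX.
congr (nth 0 (polyseq _) i); rewrite big_ltn// big_nat big1 ?addr0.
  have [_ _ ->] := pow_gen (1 + uexp) 0 0; have [_ _ ->] := pow_gen 1 'X 0.
  by rewrite /dynkin_coef expr0 invr1 mulr1 polyC1 /=; ring.
move=> -[|[|m]]// _.
have [_ _ ->] := pow_gen (1 + uexp) 0 m.+1; have [_ _ ->] := pow_gen 1 'X m.+1.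
by rewrite exprS; ring.
Qed.

Lemma W_classify w : count id w = 1%N ->
  (exists a, w = nseq a false ++ [:: true]) \/
  (exists a, w = nseq a false ++ [:: true; false]) \/
  (exists a b, w = nseq a false ++ true :: nseq b.+2 false).
Proof.
case: (split_first_true w) => [->|[a [w' ->]]]; first by rewrite count_nseq.
rewrite count_cat count_nseq/= add0n add1n => -[cw].
case: (split_first_true w') cw => [->|[b [w'' ->]]]; last by rewrite count_cat/= addnCA.
case: (size w') => [|[|b]] _; [left|right; left|right; right].
- by exists a.
- by exists a.
- by exists a, b.
Qed.

(** Negating the letters exchanges the two factors. Among the words with a single z and at most one
    x after it, the coefficients in log(exp x exp z) and log(exp z exp x) thus differ only for xz
    and zx. *)
Lemma dynkin_lin (i : nat) : (0 < k)%N -> (i <= k)%N ->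
  dynkin_sum k id (fun w => (((\prod_(d <- w) if d then lin_z else lin_x) o0 o1 : P)`_i : R^o)) -
  dynkin_sum k id (fun w => (((\prod_(d <- w) if ~~ d then lin_z else lin_x) o0 o1 : P)`_i : R^o)) = (i == 1%N)%:R /\
  dynkin_sum k id (fun w => (((\prod_(d <- w) if d then lin_z else lin_x) o0 o2 : P)`_i : R^o)) -
  dynkin_sum k id (fun w => (((\prod_(d <- w) if ~~ d then lin_z else lin_x) o0 o2 : P)`_i : R^o)) = - (i == 1%N)%:R.
Proof.
move=> k0 ik; have [E1 E2] := dynkin_lin_diff k0 ik.
rewrite -!(@dynkin_coefp i (fun w => (\prod_(d <- w) if d then lin_z else lin_x) _ _)).
rewrite -!(@dynkin_coefp i (fun w => (\prod_(d <- w) if ~~ d then lin_z else lin_x) _ _)).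
have S j : dynkin_sum k polyC (fun w => ((\prod_(d <- w) if ~~ d then lin_z else lin_x) o0 j : P^o)) =
    dynkin_sum k polyC (fun w => ((\prod_(d <- w) if d then lin_x else lin_z) o0 j : P^o)).
  by apply: eq_dynkin_sum => w _; congr (fun_of_matrix _ _ _); apply: eq_bigr => -[].
by rewrite !S -!dynkin_entry -!coefB.
Qed.

(* The part of a word functional that is linear in the letter z only sees the
   words x ... x z and x ... x z x. *)
Lemma dynkin_lin_part (F : seq bool -> R) (nu : nat -> R) : (1 < k)%N ->
  (forall i, (k < i)%N -> nu i = 0) ->
  (forall a, (1 < a)%N -> F (nseq a false ++ [:: true]) = nu a) ->
  (forall a, (0 < a)%N -> F (nseq a false ++ [:: true; false]) = - nu a.+1) ->
  (forall a b, F (nseq a false ++ true :: nseq b.+2 false) = 0) ->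
  dynkin_sum k id (fun w => if (count id w == 1%N) && (2 < size w)%N
                            then (size w)%:R^-1 * F w else 0 : R^o) =
  dynkin_sum k id (fun w => if (count negb w == 1%N) && (2 < size w)%N
                            then (size w)%:R^-1 * F (map negb w) else 0 : R^o).
Proof.
move=> k1 nu0 F1 F2 F3.
(* [Th] weighs the coefficient of X^i by nu i / (i + 1), where i + 1 is the length of the word; the
   sum starts at i = 2 because only words longer than 2 count. *)
pose Th (p q : P) : R := \sum_(2 <= i < k.+1) (i.+1%:R^-1 * nu i) * (p`_i - q`_i).
have Wn w : count id w != 1%N -> W w o0 o1 = 0 /\ W w o0 o2 = 0.
  case: (split_first_true w) => [->|[a [w' ->]]]; first by move=> _; exact: W_row0_nseq.
  rewrite count_cat count_nseq/= add0n add1n eqSS !W_row0 !W_row1 => cw.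
  by case: w' cw => [//|[|] [|c w']]//=; rewrite ?mulr0.
have ThX a : Th 'X^a 0 = if (1 < a)%N then a.+1%:R^-1 * nu a else 0.
  rewrite /Th; have [a1|a1] := ltnP 1 a; last first.
    rewrite big_nat big1// => i /andP[i2 _]; rewrite coefXn coef0 subr0.
    by rewrite gtn_eqF ?mulr0// (leq_trans _ i2).
  have [ka|ak] := ltnP k a.
    rewrite nu0// mulr0 big_nat big1// => i /andP[_ ik]; rewrite coefXn coef0 subr0.
    by rewrite ltn_eqF ?mulr0// (leq_ltn_trans _ ka).
  rewrite (bigD1_seq a) ?mem_index_iota ?a1 ?iota_uniq//= coefXn coef0 eqxx subr0 mulr1.
  by rewrite big1 ?addr0// => i ia; rewrite coefXn coef0 (negbTE ia) subr0 mulr0.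
have ThN p q : Th p q = - Th q p.
  by rewrite /Th -sumrN; apply: eq_bigr => i _; rewrite -mulrN opprB.
have H w : (if (count id w == 1%N) && (2 < size w)%N then (size w)%:R^-1 * F w else 0) =
   Th (W w o0 o1) (W w o0 o2).
  have [cw|cw] /= := eqVneq (count id w) 1%N; last first.
    by have [-> ->] := Wn _ cw; rewrite /Th big1// => i _; rewrite subrr mulr0.
  have [[a ->]|[[a ->]|[a [b ->]]]] := W_classify cw.
  - rewrite !W_row0 !W_row1/= mulr1 mulr0 ThX size_cat size_nseq addn1 ltnS.
    by case: ifP => // a1; rewrite F1.
  - rewrite !W_row0 !W_row1/= mulr1 !mulr0 -exprSr ThN ThX size_cat size_nseq addn2 !ltnS.
    by case: ifP => [a1|]; rewrite ?oppr0// F2// mulrN.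
  - by rewrite F3 mulr0 if_same !W_row0 !W_row1/= !mulr0 /Th big1// => i _; rewrite subrr mulr0.
have HL : dynkin_sum k id (fun w => if (count id w == 1%N) && (2 < size w)%N
                            then (size w)%:R^-1 * F w else 0 : R^o) =
   dynkin_sum k id (fun w => Th (W w o0 o1) (W w o0 o2) : R^o).
  by apply: eq_dynkin_sum => w _; exact: H.
have HR : dynkin_sum k id (fun w => if (count negb w == 1%N) && (2 < size w)%N
                            then (size w)%:R^-1 * F (map negb w) else 0 : R^o) =
   dynkin_sum k id (fun w => Th (W (map negb w) o0 o1) (W (map negb w) o0 o2) : R^o).
  apply: eq_dynkin_sum => w _; rewrite -H size_map count_map.
  by rewrite (eq_count (a2 := negb)).
have dsum (f g : nat -> seq bool -> R) (c : nat -> R) :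
  dynkin_sum k id (fun w => \sum_(2 <= i < k.+1) c i * (f i w - g i w) : R^o) =
  \sum_(2 <= i < k.+1) c i * (dynkin_sum k id (f i : seq bool -> R^o) - dynkin_sum k id (g i : seq bool -> R^o)).
  elim: (index_iota 2 k.+1) => [|i r IH].
    have E : (fun w => \sum_(i <- [::]) c i * (f i w - g i w) : R^o) =
             (fun w => 0 *: (0 : R^o)).
      by apply/funext => w; rewrite big_nil scale0r.
    by rewrite big_nil E dynkin_sumZ scale0r.
  have E : (fun w => \sum_(j <- i :: r) c j * (f j w - g j w) : R^o) =
      (fun w => c i *: (f i w + (-1) *: g i w : R^o) +
     (\sum_(j <- r) c j * (f j w - g j w) : R^o)).
    by apply/funext => w; rewrite big_cons scaleN1r.
  by rewrite big_cons -IH E dynkin_sumD dynkin_sumZ dynkin_sumD dynkin_sumZ scaleN1r.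
rewrite HL HR /Th !dsum; apply/eqP; rewrite -subr_eq0 -sumrB big_nat big1// => i /andP[i2].
rewrite ltnS => ik; rewrite -mulrBr.
have [] := dynkin_lin (ltnW k1) ik; rewrite gtn_eqF// oppr0.
have SW j : dynkin_sum k id (fun w => (W (map negb w) o0 j)`_i : R^o) =
    dynkin_sum k id (fun w => (((\prod_(d <- w) if ~~ d then lin_z else lin_x) o0 j : P)`_i : R^o)).
  by apply: eq_dynkin_sum => w _; rewrite /W big_map.
rewrite !SW => /eqP; rewrite subr_eq0 => /eqP -> /eqP; rewrite subr_eq0 => /eqP ->.
by rewrite subrr mulr0.
Qed.

End DynkinMatrix.

(** * Polynomial functions divisible by a power of t *)

Section PolyOrder.
Context {R : realType} {n : nat}.
Implicit Types (m : nat).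

Definition polyO m (f : R -> R) := exists p : {poly R}, forall t, f t = t ^+ m * p.[t].

Lemma polyO_D m f g : polyO m f -> polyO m g -> polyO m (fun t => f t + g t).
Proof.
by move=> [p fp] [r gr]; exists (p + r) => t; rewrite fp gr hornerD mulrDr.
Qed.

Lemma polyO_M a b f g : polyO a f -> polyO b g -> polyO (a + b) (fun t => f t * g t).
Proof.
move=> [p fp] [r gr]; exists (p * r) => t; rewrite fp gr hornerM exprD.
by rewrite mulrACA.
Qed.

Lemma polyO_cst c : polyO 0 (fun=> c).
Proof. by exists c%:P => t; rewrite hornerC mul1r. Qed.

Lemma polyO_Z m c f : polyO m f -> polyO m (fun t => c * f t).
Proof. exact: (polyO_M (polyO_cst c)). Qed.

Lemma polyO_B m f g : polyO m f -> polyO m g -> polyO m (fun t => f t - g t).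
Proof.
move=> pf pg; have -> : (fun t => f t - g t) = (fun t => f t + (-1) * g t).
  by apply/funext => t; rewrite mulN1r.
by apply: polyO_D => //; exact: polyO_Z.
Qed.

Lemma polyO_le a b f : (a <= b)%N -> polyO b f -> polyO a f.
Proof.
move=> ab [p fp]; exists ('X^(b - a) * p) => t.
by rewrite hornerM hornerXn mulrA -exprD subnKC.
Qed.

Lemma polyO_0 m : polyO m (fun=> 0).
Proof. by exists 0 => t; rewrite horner0 mulr0. Qed.

Lemma polyO_X m : polyO m (fun t => t ^+ m).
Proof. by exists 1 => t; rewrite hornerC mulr1. Qed.

Lemma polyO_XZ m c : polyO m (fun t => t ^+ m * c).
Proof. by exists c%:P => t; rewrite hornerC. Qed.

Lemma polyO_sum m (I : Type) (r : seq I) (P : pred I) (F : I -> R -> R) :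
  (forall i, P i -> polyO m (F i)) -> polyO m (fun t => \sum_(i <- r | P i) F i t).
Proof.
move=> PF; elim: r => [|i r IH].
  by rewrite (_ : (fun _ => _) = fun=> 0); [exact: polyO_0|apply/funext => t; rewrite big_nil].
rewrite (_ : (fun _ => _) = (fun t => (if P i then F i t else 0) + \sum_(i <- r | P i) F i t)).
  by apply: polyO_D => //; case: (boolP (P i)) => [/PF//|_]; exact: polyO_0.
by apply/funext => t; rewrite big_cons; case: ifP; rewrite ?add0r.
Qed.

(** The polynomial c - t p(t) vanishes at all points 2^-i, hence identically, and its value at 0 is
    c. These points are chosen because [q_antisym] can scale the first argument of [br] only by
    powers of 2. *)
Lemma polyO_eq0 c m f : polyO m.+1 f -> (forall i, (2^-1 ^+ i) ^+ m * c = f (2^-1 ^+ i)) -> c = 0.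
Proof.
move=> [p fp] H.
have N i : 2^-1 ^+ i != 0 :> R by rewrite expf_neq0// invr_eq0 pnatr_eq0.
have H' i : root (c%:P - 'X * p) (2^-1 ^+ i).
  rewrite /root !hornerE subr_eq0; apply/eqP.
  have := H i; rewrite fp exprS (mulrC (2^-1 ^+ i)) -mulrA => /(mulfI _); apply.
  exact: expf_neq0.
have p0 : c%:P - 'X * p = 0.
  apply/eqP/negP => /negP p0.
  have := @max_poly_roots _ _ [seq 2^-1 ^+ i | i <- iota 0 (size (c%:P - 'X * p))] p0.
  rewrite size_map size_iota ltnn => F.
  suff : false by []. apply: F.
    by apply/allP => _ /mapP[i _ ->]; exact: H'.
  rewrite map_inj_uniq ?iota_uniq// => i j; wlog ij : i j / (i <= j)%N.
    by move=> W E; case: (leqP i j) => [ij|/ltnW ij]; [exact: W|apply/esym/W].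
  move=> E; have := congr1 (fun r : R => r * 2 ^+ j) E.
  rewrite -exprMn mulVf ?pnatr_eq0// expr1n -{1}(subnKC ij) exprD mulrA -exprMn.
  rewrite mulVf ?pnatr_eq0// expr1n mul1r => /eqP; rewrite -natrX -[1]/(1%:R) eqr_nat.
  rewrite -[X in _ == X](expn0 2) eqn_exp2l// subn_eq0 => ji.
  by apply/eqP; rewrite eqn_leq ij.
have := congr1 (fun r : {poly R} => r.[0]) p0.
by rewrite hornerD hornerN hornerM hornerX hornerC horner0 mul0r subr0.
Qed.

Definition polyV m (f : R -> 'rV[R]_n) := forall j, polyO m (fun t => f t 0 j).

Lemma polyV_D m f g : polyV m f -> polyV m g -> polyV m (fun t => f t + g t).
Proof.
move=> pf pg j; under eq_fun do rewrite mxE; exact: polyO_D.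
Qed.

Lemma polyV_Z m c f : polyV m f -> polyV m (fun t => c *: f t).
Proof.
move=> pf j; under eq_fun do rewrite !mxE; exact: polyO_Z.
Qed.

Lemma polyV_le a b f : (a <= b)%N -> polyV b f -> polyV a f.
Proof. by move=> ab pf j; exact: polyO_le (pf j). Qed.

Lemma polyV_cst v : polyV 0 (fun=> v).
Proof. by move=> j; exact: polyO_cst. Qed.

Lemma polyV_0 m : polyV m (fun=> 0).
Proof. by move=> j; under eq_fun do rewrite mxE; exact: polyO_0. Qed.

Lemma polyV_X m v : polyV m (fun t => t ^+ m *: v).
Proof.
move=> j; under eq_fun do rewrite mxE mulrC; apply: polyO_Z; exact: polyO_X.
Qed.

Lemma polyV_X1 v : polyV 1 (fun t => t *: v).
Proof. exact: (polyV_X 1). Qed.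

Lemma polyV_sum m (I : Type) (r : seq I) (P : pred I) (F : I -> R -> 'rV[R]_n) :
  (forall i, P i -> polyV m (F i)) -> polyV m (fun t => \sum_(i <- r | P i) F i t).
Proof.
move=> PF j; under eq_fun do rewrite summxE.
by apply: polyO_sum => i Pi; exact: PF.
Qed.

Lemma polyO_lform m q f : lform q -> polyV m f -> polyO m (fun t => q (f t)).
Proof.
move=> lq pf; rewrite (_ : (fun _ => _) = (fun t => \sum_i q (basis_vec i) * f t 0 i)).
  by apply: polyO_sum => i _; apply: polyO_Z; exact: pf.
apply/funext => t; rewrite [in LHS](row_basis (f t)) (lform_sum _ _ _ lq).
by apply: eq_bigr => i _; rewrite (lformZ _ _ lq) mulrC.
Qed.

End PolyOrder.

(** * Associativity forces the deviation from bilinearity to vanish *)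

Section Bilinear.
Context {R : realType} {n k : nat} (G : carnot_group R n k).
Notation V := 'rV[R]_n.
Notation br := (bracket G).
Notation lbr := (lbr G).
Notation dev := (dev G).
Notation killW1 := (killW1 G).
Notation inW := (inW G).
Notation dsum f := (dynkin_sum k id (f : seq bool -> R^o)).
Notation op := (mulG G).
Implicit Types (q : V -> R) (u v x y z : V).

(** Orders add because [lbr] is bilinear. The dependence of [br] on its first argument is not yet
    known to be polynomial, which is why the estimates are made for [lbr]. *)
Lemma polyV_lbr a b f g : polyV a f -> polyV b g -> polyV (a + b) (fun t => lbr (f t) (g t)).
Proof.
move=> pf pg.
have -> : (fun t => lbr (f t) (g t)) = (fun t => \sum_i f t 0 i *: br (basis_vec i) (g t)) by [].
apply: polyV_sum => i _.
rewrite (_ : (fun _ => _) = (fun t => \sum_j (f t 0 i * g t 0 j) *: br (basis_vec i) (basis_vec j))).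
  apply: polyV_sum => j _ l; under eq_fun do rewrite mxE mulrC; apply: polyO_Z.
  exact: polyO_M.
apply/funext => t; rewrite [in LHS](row_basis (g t)) br_sumr scaler_sumr.
by apply: eq_bigr => j _; rewrite brZr scalerA.
Qed.

Lemma polyV_nested f g (w : seq bool) : polyV 1 f -> polyV 1 g -> w != [::] ->
  polyV (size w) (fun t => nested_bracket lbr (letters (f t) (g t) w)).
Proof.
move=> pf pg; case: w => // a w _; elim: w a => [|b w IH] a; first by case: a.
have H := IH b.
by apply: (polyV_lbr (a := 1) _ H); case: a.
Qed.

Lemma polyV_dynkin m (F : seq bool -> R -> V) :
  (forall w, w != [::] -> polyV m (F w)) -> polyV m (fun t => dynkin_sum k id (F ^~ t)).
Proof.
move=> PF; rewrite /dynkin_sum.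
rewrite (_ : (fun _ => _) = (fun t => \sum_(i <- index_iota 1 k.+1 | (0 < i)%N)
  id (dynkin_coef i) *:
     (\sum_(rs : {ffun 'I_i -> 'I_k.+1 * 'I_k.+1} | [forall a, (0 < (rs a).1 + (rs a).2)%N])
         id (\prod_a (((rs a).1)`! * ((rs a).2)`!)%:R)^-1 *: F (blocks rs) t))).
  apply: polyV_sum => i i0; apply: polyV_Z; apply: polyV_sum => rs rs0.
  by apply: polyV_Z; apply: PF; exact: blocks_neq0.
by apply/funext => t; rewrite [LHS]big_nat_cond [RHS]big_nat_cond; apply: eq_bigl; case.
Qed.

Lemma polyO_dynkin m (F : seq bool -> R -> R) :
  (forall w, w != [::] -> polyO m (F w)) -> polyO m (fun t => dsum (F ^~ t)).
Proof.
move=> PF; rewrite /dynkin_sum.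
rewrite (_ : (fun _ => _) = (fun t => \sum_(i <- index_iota 1 k.+1 | (0 < i)%N)
  id (dynkin_coef i) *
     (\sum_(rs : {ffun 'I_i -> 'I_k.+1 * 'I_k.+1} | [forall a, (0 < (rs a).1 + (rs a).2)%N])
         id (\prod_a (((rs a).1)`! * ((rs a).2)`!)%:R)^-1 * F (blocks rs) t))).
  apply: polyO_sum => i i0; apply: polyO_Z; apply: polyO_sum => rs rs0.
  by apply: polyO_Z; apply: PF; exact: blocks_neq0.
by apply/funext => t; rewrite [LHS]big_nat_cond [RHS]big_nat_cond; apply: eq_bigl; case.
Qed.

Lemma lform_dynkin q (F : seq bool -> V) : lform q ->
  q (dynkin_sum k id F) = dsum (fun w => q (F w)).
Proof.
move=> lq; apply: (@dynkin_sum_map R k R R id id _ R^o q).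
- by move=> u v; exact: lformD.
- exact: lform0.
- by move=> c u; exact: lformZ.
Qed.

Lemma opE x y : op x y =
  dynkin_sum k id (fun w => (size w)%:R^-1 *: nested_bracket br (letters x y w)).
Proof. exact: bch_dynkin. Qed.

(** The product built from the bilinear part: it agrees with [op] modulo the span [inW] ([op_lop])
    and is polynomial in its arguments. *)
Definition lop x y := bch k lbr x y.

Lemma lopE x y : lop x y =
  dynkin_sum k id (fun w => (size w)%:R^-1 *: nested_bracket lbr (letters x y w)).
Proof. exact: bch_dynkin. Qed.

Lemma op_lop x y : inW (op x y - lop x y).
Proof.
rewrite opE lopE -scaleN1r -dynkin_sumZ -dynkin_sumD /dynkin_sum.
rewrite big_nat big_nat_cond; apply: inW_sum => i /andP[/andP[i0 _] _].
apply: inWZ; apply: inW_sum => rs rs0; apply: inWZ; rewrite scaleN1r -scalerBr; apply: inWZ.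
case: (blocks rs) => [|a [|b w]]; [|by case: a; rewrite subrr; exact: inW0|].
  by rewrite subrr; exact: inW0.
exact: nested_inW.
Qed.

Lemma polyV_lop f g : polyV 1 f -> polyV 1 g -> polyV 1 (fun t => lop (f t) (g t)).
Proof.
move=> pf pg; under eq_fun do rewrite lopE.
apply: (polyV_dynkin (F := fun w t => (size w)%:R^-1 *: nested_bracket lbr (letters (f t) (g t) w))) => w w0.
apply: polyV_Z; apply: (polyV_le (b := size w)); first by case: (w) w0.
exact: polyV_nested.
Qed.

Definition lgap x y := lop x y - x - y.

Lemma lopE2 x y : lop x y = x + y + lgap x y.
Proof. by rewrite /lgap; apply/rowP => j; rewrite !mxE; lra. Qed.

Lemma single_letters x y (U : lmodType R) (L : V -> U) :
  dynkin_sum k id (fun w : seq bool => (w == [:: false])%:R *: L x + (w == [:: true])%:R *: L y) =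
  L x + L y.
Proof.
rewrite dynkin_sumD; congr (_ + _).
- pose f (c : R^o) := c *: L x.
  transitivity (f (dynkin_sum k id (fun w => ((w == [:: false])%:R : R^o)))); last first.
    by rewrite (dynkin_word1 false (k_gt0 G)) /f scale1r.
  by rewrite (@dynkin_sum_map R k R R id id R^o U f) => [//|a b||c a];
    rewrite /f ?scalerDl ?scale0r ?scalerA.
- pose f (c : R^o) := c *: L y.
  transitivity (f (dynkin_sum k id (fun w => ((w == [:: true])%:R : R^o)))); last first.
    by rewrite (dynkin_word1 true (k_gt0 G)) /f scale1r.
  by rewrite (@dynkin_sum_map R k R R id id R^o U f) => [//|a b||c a];
    rewrite /f ?scalerDl ?scale0r ?scalerA.
Qed.

Lemma lgapE x y : lgap x y =
  dynkin_sum k id (fun w => if (1 < size w)%N then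
     (size w)%:R^-1 *: nested_bracket lbr (letters x y w) else 0).
Proof.
rewrite /lgap -addrA -opprD; apply/eqP; rewrite subr_eq addrC; apply/eqP.
rewrite -[X in X + _](single_letters x y idfun) -dynkin_sumD lopE; apply: eq_dynkin_sum.
by move=> [//|[|] [|b w]] _; rewrite /= ?invr1 ?scale1r ?scale0r ?add0r ?addr0.
Qed.

Lemma polyV_lgap f g : polyV 1 f -> polyV 1 g -> polyV 2 (fun t => lgap (f t) (g t)).
Proof.
move=> pf pg; under eq_fun do rewrite lgapE.
apply: (polyV_dynkin (F := fun w t => if (1 < size w)%N then
   (size w)%:R^-1 *: nested_bracket lbr (letters (f t) (g t) w) else 0)) => w w0.
case: (ltnP 1 (size w)) => w1; last exact: polyV_0.
by apply: polyV_Z; apply: (polyV_le (b := size w)) => //; exact: polyV_nested.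
Qed.

Section Functional.
Hypothesis k1 : (1 < k)%N.
Variable q : V -> R.
Hypothesis kq : killW1 q.
Let lq : lform q := kq.1.

Definition hq x y : R := dsum (fun w => if (2 < size w)%N then
   (size w)%:R^-1 * q (nested_bracket lbr (letters x y w)) else 0).

(* [hq] collects the words of length at least 3, in which the bracket may be
   replaced by [lbr]. *)
Lemma law x y : q (op x y) = q x + q y + 4^-1 * (q (br x y) - q (br y x)) + hq x y.
Proof.
rewrite opE lform_dynkin// /hq.
have E2 (a b : V) c : dsum (fun w => (w == [:: c; ~~ c])%:R * (2^-1 * q (br a b))) =
   (if c then - 4^-1 else 4^-1) * q (br a b).
  transitivity ((2^-1 * q (br a b)) *: dsum (fun w => (w == [:: c; ~~ c])%:R)).
    rewrite -dynkin_sumZ; apply: eq_dynkin_sum => w _; exact: mulrC.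
  by rewrite (dynkin_word2 c k1) /GRing.scale/=; case: c; field.
have -> : 4^-1 * (q (br x y) - q (br y x)) =
   dsum (fun w => (w == [:: false; true])%:R * (2^-1 * q (br x y))) +
   dsum (fun w => (w == [:: true; false])%:R * (2^-1 * q (br y x))).
  by rewrite (E2 x y false) (E2 y x true); ring.
rewrite -(single_letters x y (q : V -> R^o)) -!dynkin_sumD; apply: eq_dynkin_sum.
move=> w w0; rewrite (lformZ _ _ lq); case: (ltnP 2 (size w)) => s2.
  rewrite nested_kill//; case: w s2 {w0} => [|a [|b [|c w]]]// _.
  by case: a; case: b; rewrite /= !scale0r !mul0r !add0r.
case: w w0 s2 => [|[|] [|[|] [|c w]]]//= _ _;
by rewrite ?scale0r ?scale1r ?mul0r ?mul1r ?add0r ?addr0 ?invr1 ?mul1r ?bracket_alternating ?(lform0 lq) ?mulr0 ?scaler0.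
Qed.

Lemma hq_congr x x' y y' : inW (x - x') -> inW (y - y') -> hq x y = hq x' y'.
Proof.
move=> ix iy; apply: eq_dynkin_sum => w _; case: ifP => // s2.
by rewrite (nested_lbr_kill kq s2 ix iy).
Qed.

Lemma polyO_hq f g : polyV 1 f -> polyV 1 g -> polyO 3 (fun t => hq (f t) (g t)).
Proof.
move=> pf pg; apply: (polyO_dynkin (F := fun w t => if (2 < size w)%N then
   (size w)%:R^-1 * q (nested_bracket lbr (letters (f t) (g t) w)) else 0)) => w w0.
case: (ltnP 2 (size w)) => s2; last exact: polyO_0.
apply: polyO_Z; apply: polyO_lform => //; apply: (polyV_le (b := size w)) => //.
exact: polyV_nested.
Qed.

Lemma q_inW x m m' : inW (m - m') -> q (br x m) = q (br x m').
Proof.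
move=> im; apply/eqP; rewrite -subr_eq0 -(lformB _ _ lq) -brNr -brDr brE (lformD _ _ lq).
by rewrite killW1_lbr// killW1_devW// addr0.
Qed.

(** [lgap] is a combination of brackets [lbr]; [dev_lbrC] moves [dev] inside them, where [q] kills
    it. *)
Lemma q_lgap x y z : q (br x (lgap y z)) = q (lbr x (lgap y z)).
Proof.
rewrite brE (lformD _ _ lq) lgapE.
have ld : lform (fun v => q (dev x v)) by apply: lform_comp => //; exact: dev_linear.
rewrite (lform_dynkin _ ld).
rewrite [X in _ + X](_ : _ = dsum (fun w => 0 *: (0 : R^o))).
  by rewrite dynkin_sumZ scale0r addr0.
apply: eq_dynkin_sum => w _; rewrite scale0r.
case: ifP => s1; last by rewrite (lform0 ld).
rewrite (lformZ _ _ ld); case: w s1 => [//|a [|b w]//] _.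
by rewrite /letters ![map _ _]/= nested_cons killW1_dev// mulr0.
Qed.

Lemma op_diag x : op x x = 2 *: x.
Proof.
rewrite opE -[2]/(1 + 1) scalerDl scale1r -(single_letters x x idfun).
apply: eq_dynkin_sum => -[//|a [|b w]] _.
  by case: a; rewrite /= invr1 !scale1r scale0r ?add0r ?addr0.
have -> : nested_bracket br (letters x x [:: a, b & w]) = 0.
  elim: w a b => [|c w IH] a b; first by rewrite /letters/= !if_same bracket_alternating.
  by have := IH b c; rewrite /letters ![map _ _]/= !nested_cons => ->; exact: br0r.
by rewrite scaler0; case: a; rewrite /= !scale0r addr0.
Qed.

(* Associativity for the triples (x, z, x), (x, x, z) and (z, x, x). *)
Lemma homog_identity x z : let u := op x z in let v := op z x in
  2^-1 * (q (br (2 *: x) z) - 2 * q (br x z)) =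
  2 * (hq x z - hq z x) - (hq (2 *: x) z - hq z (2 *: x))
  + (hq x u + hq u x) - (hq x v + hq v x).
Proof.
move=> u v.
have E1 : q (op u x) = q (op x v) by rewrite /u /v /mulG bch_assoc.
have E2 : q (op (2 *: x) z) = q (op x u).
  by rewrite -op_diag /u /mulG bch_assoc.
have E3 : q (op v x) = q (op z (2 *: x)).
  by rewrite -op_diag /v /mulG bch_assoc.
have E4 := law x z; have E5 := law z x.
rewrite -/u in E4; rewrite -/v in E5.
clearbody u v; move: E1 E2 E3; rewrite !law E4 E5 !brZr !(lformZ _ _ lq).
move: (q (br u x)) (q (br x u)) (q (br v x)) (q (br x v)) => a b c d.
lra.
Qed.

Lemma hq_diag x : hq x x = 0.
Proof.
rewrite /hq (_ : (fun w => _) = (fun w : seq bool => 0 *: (0 : R^o))).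
  by rewrite dynkin_sumZ scale0r.
apply/funext => w; rewrite scale0r; case: (ltnP 2 (size w)) => // s2.
by rewrite nested_diag// mulr0.
Qed.

Lemma polyV0_nested f g (w : seq bool) : polyV 0 f -> polyV 0 g ->
  polyV 0 (fun t => nested_bracket lbr (letters (f t) (g t) w)).
Proof.
move=> pf pg; case: w => [|a w]; first exact: polyV_cst.
elim: w a => [|b w IH] a; first by case: a.
by apply: (polyV_lbr (a := 0) (b := 0) _ (IH b)); case: a.
Qed.

Section Sigma.
Variables (x : V) (d : R -> V).
Hypothesis pd : polyV 1 d.
Let N (f g : R -> V) w t := nested_bracket lbr (letters (f t) (g t) w).
Let c : R -> V := fun t => x + d t.
Let e : R -> V := fun=> x.

Let pc : polyV 0 c.
Proof. by apply: polyV_D; [exact: polyV_cst|exact: polyV_le pd]. Qed.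

Let pe : polyV 0 e. Proof. exact: polyV_cst. Qed.

Lemma polyV_nested_diff w : w != [::] ->
  polyV 1 (fun t => N e c w t - N c c w t) /\ polyV 1 (fun t => N c e w t - N c c w t).
Proof.
have pdN : polyV 1 (fun t => e t - c t).
  rewrite (_ : (fun _ => _) = (fun t => (-1) *: d t)); first exact: polyV_Z.
  by apply/funext => t; rewrite /c opprD addrA subrr add0r scaleN1r.
have H f g f' g' a w' : polyV 0 f -> polyV 0 f' -> polyV 0 g -> polyV 0 g' ->
    polyV 1 (fun t => f t - f' t) -> polyV 1 (fun t => g t - g' t) ->
   polyV 1 (fun t => N f g (a :: w') t - N f' g' (a :: w') t).
  move=> pf pf' pg pg' pff pgg; elim: w' a => [|b w' IH] a; first by case: a.
  have -> : (fun t => N f g [:: a, b & w'] t - N f' g' [:: a, b & w'] t) =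
     (fun t => lbr ((if a then g t else f t) - (if a then g' t else f' t)) (N f g (b :: w') t) +
        lbr (if a then g' t else f' t) (N f g (b :: w') t - N f' g' (b :: w') t)).
    apply/funext => t; rewrite (linB (lbr_linearr _ _)) (linB (lbr_linearl _ _)) addrA subrK.
    by [].
  apply: polyV_D.
    apply: (polyV_lbr (a := 1) (b := 0) (f := fun t => (if a then g t else f t) -
       (if a then g' t else f' t)) _ (polyV0_nested (b :: w') pf pg)).
    by case: a.
  by apply: (polyV_lbr (a := 0) _ (IH b)); case: a.
have p0 f : polyV 1 (fun t => f t - f t :> V).
  have -> : (fun t => f t - f t) = fun=> 0 by apply/funext => t; rewrite subrr.
  exact: polyV_0.
by case: w => // a w _; split; apply: H.
Qed.

(** With c = x + d this is a second difference of a multilinear expression in the two kinds of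
    letters: the terms of order 0 and 1 in d cancel, as the recursion on the first letter shows. *)
Lemma polyV_nested_sigma w : w != [::] ->
  polyV 2 (fun t => N e c w t + N c e w t - N c c w t - N e e w t).
Proof.
case: w => // a w _; elim: w a => [|b w IH] a.
  rewrite (_ : (fun _ => _) = fun=> 0); first exact: polyV_0.
  by apply/funext => t; case: a => //=; apply/rowP => j; rewrite !mxE; lra.
have [P1 P2] := @polyV_nested_diff (b :: w) isT.
have -> : (fun t => N e c [:: a, b & w] t + N c e [:: a, b & w] t - N c c [:: a, b & w] t
     - N e e [:: a, b & w] t) =
  (fun t => lbr (e t) (N e c (b :: w) t + N c e (b :: w) t - N c c (b :: w) t - N e e (b :: w) t)
    + (if a then lbr (d t) (N e c (b :: w) t - N c c (b :: w) t)
       else lbr (d t) (N c e (b :: w) t - N c c (b :: w) t))).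
  apply/funext => t; rewrite /N /letters ![map _ _]/= !nested_cons.
  case: a; rewrite -/(N e c (b :: w) t) -/(N c e (b :: w) t) -/(N c c (b :: w) t) -/(N e e (b :: w) t);
  rewrite {1 2 3}/c !(linD (lbr_linearl _ _)) !(linB (lbr_linearr _ _)) (linD (lbr_linearr _ _));
  by apply/rowP => j; rewrite !mxE; ring.
apply: polyV_D; first exact: (polyV_lbr (a := 0)).
by case: a; exact: (polyV_lbr (a := 1) (b := 1)).
Qed.

(** As [hq] vanishes on the diagonal, the symmetric sum equals the second difference of
    [polyV_nested_sigma], which is quadratic in the displacement [d]. *)
Lemma polyO_sigma : polyO 2 (fun t => hq x (c t) + hq (c t) x).
Proof.
rewrite (_ : (fun _ => _) = (fun t => hq x (c t) + hq (c t) x - hq (c t) (c t) - hq x x)).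
  pose F w t := if (2 < size w)%N then (size w)%:R^-1 *
    q (N e c w t + N c e w t - N c c w t - N e e w t) else 0.
  rewrite (_ : (fun _ => _) = (fun t => dsum (F ^~ t))).
    apply: polyO_dynkin => w w0; rewrite /F.
    case: (ltnP 2 (size w)) => s2; last exact: polyO_0.
    by apply: polyO_Z; apply: polyO_lform => //; exact: polyV_nested_sigma.
  apply/funext => t; rewrite /hq -scaleN1r -[X in _ + X]scaleN1r -!dynkin_sumZ -!dynkin_sumD.
  apply: eq_dynkin_sum => w _; rewrite /F; case: ifP => _.
    by rewrite !(lformB _ _ lq) (lformD _ _ lq) /GRing.scale/= /N; ring.
  by rewrite !scaler0 !addr0.
by apply/funext => t; rewrite !hq_diag !subr0.
Qed.

End Sigma.

Lemma letters_swap x y w : letters y x w = letters x y (map negb w).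
Proof. by rewrite /letters -map_comp; apply: eq_map => -[]. Qed.

Lemma inW_nested_diag x w : (1 < size w)%N -> inW (nested_bracket lbr (letters x x w)).
Proof.
move=> s1; rewrite -[X in inW X]opprK; apply: inWN.
rewrite -[X in inW X]add0r.
suff {1}<- : nested_bracket br (letters x x w) = 0 by exact: nested_inW.
case: w s1 => // a [//|b w] _; elim: w a b => [|c w IH] a b.
  by rewrite /letters/= !if_same bracket_alternating.
by have := IH b c; rewrite /letters ![map _ _]/= !nested_cons => ->; exact: br0r.
Qed.

Lemma lop_0 x y : (x == 0) || (y == 0) -> inW (lop x y - (x + y)).
Proof.
move=> xy; rewrite lopE2 [X in inW X]addrC addKr lgapE /dynkin_sum big_nat big_nat_cond; apply: inW_sum => i /andP[/andP[i0 _] _].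
apply: inWZ; apply: inW_sum => rs rs0; apply: inWZ; case: ifP => [s1|_]; last exact: inW0.
apply: inWZ; move: (blocks rs) s1 => w s1.
case/orP: xy => /eqP->.
  rewrite letters_swap -[X in letters _ X](scale0r y) nested_lbr_scale; apply: inWZ.
  by apply: inW_nested_diag; rewrite size_map.
by rewrite -[X in letters _ X](scale0r x) nested_lbr_scale; apply: inWZ; exact: inW_nested_diag.
Qed.

Lemma polyV_lop_diff x z : polyV 1 (fun t => lop x (t *: z) - lop x 0) /\
  polyV 1 (fun t => lop (t *: z) x - lop 0 x).
Proof.
have P w : polyV 1 (fun t => nested_bracket lbr (letters x (t *: z) w) -
   nested_bracket lbr (letters x 0 w)).
  pose M := nested_bracket lbr (letters x z w).
  have <- : (fun t => (t ^+ count id w - 0 ^+ count id w) *: M) =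
     (fun t => nested_bracket lbr (letters x (t *: z) w) - nested_bracket lbr (letters x 0 w)).
    apply/funext => t; rewrite -[X in _ - nested_bracket _ (letters _ X _)](scale0r z).
    by rewrite !nested_lbr_scale scalerBl.
  case: (count id w) => [|m].
    have -> : (fun t : R => (t ^+ 0 - 0 ^+ 0) *: M) = fun=> 0.
      by apply/funext => t; rewrite !expr0 subrr scale0r.
    exact: polyV_0.
  have -> : (fun t : R => (t ^+ m.+1 - 0 ^+ m.+1) *: M) = (fun t => t ^+ m.+1 *: M).
    by apply/funext => t; rewrite expr0n subr0.
  by apply: (polyV_le (b := m.+1)) => //; exact: polyV_X.
split.
  pose F w t := (size w)%:R^-1 *: (nested_bracket lbr (letters x (t *: z) w) -
   nested_bracket lbr (letters x 0 w)).
  rewrite (_ : (fun _ => _) = (fun t => dynkin_sum k id (F ^~ t))).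
    by apply: polyV_dynkin => w _; apply: polyV_Z; exact: P.
  apply/funext => t; rewrite !lopE -scaleN1r -dynkin_sumZ -dynkin_sumD.
  by apply: eq_dynkin_sum => w _; rewrite /F scalerBr scaleN1r.
pose F w t := (size w)%:R^-1 *: (nested_bracket lbr (letters x (t *: z) (map negb w)) -
   nested_bracket lbr (letters x 0 (map negb w))).
rewrite (_ : (fun _ => _) = (fun t => dynkin_sum k id (F ^~ t))).
  by apply: polyV_dynkin => w _; apply: polyV_Z; exact: P.
apply/funext => t; rewrite !lopE -scaleN1r -dynkin_sumZ -dynkin_sumD.
by apply: eq_dynkin_sum => w _; rewrite /F scalerBr scaleN1r -!letters_swap.
Qed.

Lemma nested_iter x z a : nested_bracket lbr (letters x z (nseq a false ++ [:: true])) =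
  iter a (lbr x) z.
Proof. by elim: a => [|[|a] IH]//; rewrite iterS -IH. Qed.

Lemma nested_iter2 x z a : nested_bracket lbr (letters x z (nseq a false ++ [:: true; false])) =
  iter a (lbr x) (lbr z x).
Proof. by elim: a => [|[|a] IH]//; rewrite iterS -IH. Qed.

Lemma nested_xx x z (w v : seq bool) : (1 < size v)%N ->
  inW (nested_bracket lbr (letters x z v)) -> inW (nested_bracket lbr (letters x z (w ++ v))).
Proof.
move=> sv iv; elim: w => // a w IH; move: IH; rewrite cat_cons.
case E: (w ++ v) => [|b s]; first by move: sv; case: (w) E => //= ->.
by move=> IH; exact: inW_lbr.
Qed.

(* The part of log (exp x exp z) - log (exp z exp x) that is linear in z is the
   single bracket [x, z], which has length 2. *)
Lemma polyO_kappa x z : polyO 2 (fun t => hq x (t *: z) - hq (t *: z) x).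
Proof.
pose F w := q (nested_bracket lbr (letters x z w)).
have F0 w : (2 < size w)%N -> count id w = 0 -> F w = 0.
  move=> s2 cw; rewrite /F; rewrite (_ : w = nseq (size w) false); last first.
    by elim: w {s2} cw => //= -[]//= w IH /IH {1}->.
  have -> : letters x z (nseq (size w) false) = letters x x (nseq (size w) false).
    by rewrite /letters !map_nseq.
  by rewrite nested_diag// size_nseq.
pose L1 w := if (count id w == 1%N) && (2 < size w)%N then (size w)%:R^-1 * F w else 0.
pose L2 w := if (count negb w == 1%N) && (2 < size w)%N then (size w)%:R^-1 * F (map negb w) else 0.
have L12 : dsum L1 = dsum L2.
  (* Here nu i is [q] of the i-fold left bracket of [z] by [x]. Nilpotency makes it vanish beyond k,
     antisymmetry modulo the span gives the sign for the words ending in zx, and a tail of at least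
     two letters x already lies in the span. *)
  apply: (@dynkin_lin_part R k F (fun i => q (iter i (lbr x) z))) => //.
  - by move=> i ki; exact: killW1_iter.
  - by move=> a _; rewrite /F nested_iter.
  - move=> [//|a] _; rewrite /F nested_iter2 iterSr [in RHS]iterSr.
    apply/eqP; rewrite -addr_eq0 -(lformD _ _ lq); apply/eqP.
    have -> : iter a (lbr x) (lbr x (lbr z x)) + iter a.+1 (lbr x) (lbr x z) =
              lbr x (iter a (lbr x) (lbr z x + lbr x z)).
      rewrite -iterSr !iterS -(linD (lbr_linearr _ _)); congr (lbr x _).
      by elim: a => //= a <-; rewrite (linD (lbr_linearr _ _)).
    apply: killW1_lbr => //; elim: a => [|a IH]; first exact: inW_sym.
    by rewrite iterS; exact: inW_lbr.
  - move=> a b; rewrite /F.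
    have Ezz : letters x z (nseq b.+2 false) = letters x x (nseq b.+2 false).
      by rewrite /letters !map_nseq.
    have iW := @inW_nested_diag x (nseq b.+2 false); rewrite size_nseq in iW.
    case: a => [|a].
      rewrite cat0s; have -> : letters x z (true :: nseq b.+2 false) =
         z :: letters x z (nseq b.+2 false) by [].
      rewrite Ezz -[nested_bracket _ _]/(lbr z (nested_bracket lbr (letters x x (nseq b.+2 false)))).
      by apply: killW1_lbr => //; exact: iW.
    have -> : nseq a.+1 false ++ true :: nseq b.+2 false =
       false :: ((nseq a false ++ [:: true]) ++ nseq b.+2 false) by rewrite -catA.
    have -> : nested_bracket lbr (letters x z (false :: ((nseq a false ++ [:: true]) ++ nseq b.+2 false))) =
       lbr x (nested_bracket lbr (letters x z ((nseq a false ++ [:: true]) ++ nseq b.+2 false))).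
      by case: a.
    apply: killW1_lbr => //; apply: nested_xx; first by rewrite size_nseq.
    by rewrite Ezz; exact: iW.
pose c w (t : R) := if (2 < size w)%N && (1 < count id w)%N then
   (size w)%:R^-1 * (t ^+ count id w * F w) else 0.
pose c' w (t : R) := if (2 < size w)%N && (1 < count negb w)%N then
   (size w)%:R^-1 * (t ^+ count negb w * F (map negb w)) else 0.
(* The number of letters z is the power of t: none gives 0 by alternation, one gives the linear
   part, and the rest is of order t^2. *)
have hc w t : (2 < size w)%N -> t ^+ count id w * F w = t * (if count id w == 1%N then F w else 0) +
   (if (1 < count id w)%N then t ^+ count id w * F w else 0).
  move=> s2; case E: (count id w) => [|[|m]]/=.
  - by rewrite F0// !mulr0 addr0.
  - by rewrite addr0 expr1.
  - by rewrite mulr0 add0r.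
have h1 t : hq x (t *: z) = t * dsum L1 + dsum (c ^~ t).
  rewrite -[t * _]/(t *: (dsum L1)) -dynkin_sumZ -dynkin_sumD /hq; apply: eq_dynkin_sum => w _.
  rewrite /L1 /c andbC; case: (ltnP 2 (size w)) => s2 /=; last by rewrite scaler0 addr0.
  rewrite nested_lbr_scale (lformZ _ _ lq) -/(F w) [in LHS]hc// /GRing.scale/=.
  by case: ifP => _; case: ifP => _; ring.
have h2 t : hq (t *: z) x = t * dsum L2 + dsum (c' ^~ t).
  rewrite -[t * _]/(t *: (dsum L2)) -dynkin_sumZ -dynkin_sumD /hq; apply: eq_dynkin_sum => w _.
  rewrite /L2 /c' andbC; case: (ltnP 2 (size w)) => s2 /=; last by rewrite scaler0 addr0.
  have E : count negb w = count id (map negb w) by rewrite count_map; apply: eq_count.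
  rewrite letters_swap nested_lbr_scale (lformZ _ _ lq) -/(F _) [in LHS]hc ?size_map// -E /GRing.scale/=.
  by case: ifP => _; case: ifP => _; ring.
rewrite (_ : (fun _ => _) = (fun t => dsum (c ^~ t) - dsum (c' ^~ t))); last first.
  by apply/funext => t; rewrite h1 h2 L12; ring.
apply: polyO_B; apply: polyO_dynkin => w _.
- rewrite /c; case: (boolP (_ && _)) => [/andP[_ c1]|_]; last exact: polyO_0.
  apply: polyO_Z; apply: (polyO_le c1).
  exact: polyO_XZ.
- rewrite /c'; case: (boolP (_ && _)) => [/andP[_ c1]|_]; last exact: polyO_0.
  apply: polyO_Z; apply: (polyO_le c1).
  exact: polyO_XZ.
Qed.

(* For z replaced by t z, the right-hand side of [homog_identity] is O(t^2) while
   the left-hand side is linear in t. *)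
Lemma br_homog x z : q (br (2 *: x) z) = 2 * q (br x z).
Proof.
apply/eqP; rewrite -subr_eq0 -(mulrI_eq0 _ (_ : GRing.lreg 2^-1)); last first.
  by apply/lregP; rewrite invr_eq0 pnatr_eq0.
apply/eqP; pose u t := op x (t *: z); pose v t := op (t *: z) x.
pose f t := 2 * (hq x (t *: z) - hq (t *: z) x) - (hq (2 *: x) (t *: z) - hq (t *: z) (2 *: x))
  + (hq x (u t) + hq (u t) x) - (hq x (v t) + hq (v t) x).
have [P1 P2] := polyV_lop_diff x z.
apply: (@polyO_eq0 _ _ 1 f).
  apply: polyO_B; last first.
    (* Inside [hq] the product [op] may be replaced by [lop] up to the span, and the increment of
       [lop] from t = 0 is divisible by t. *)
    rewrite (_ : (fun _ => _) = (fun t => hq x (x + (lop (t *: z) x - lop 0 x)) +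
       hq (x + (lop (t *: z) x - lop 0 x)) x)); first exact: polyO_sigma.
    apply/funext => t; have I : inW (v t - (x + (lop (t *: z) x - lop 0 x))).
      have -> : v t - (x + (lop (t *: z) x - lop 0 x)) =
         (v t - lop (t *: z) x) + (lop 0 x - (0 + x)).
        by apply/rowP => j; rewrite !mxE; ring.
      by apply: inWD; [exact: op_lop|apply: lop_0; rewrite eqxx].
    have I0 : inW (x - x) by rewrite subrr; exact: inW0.
    by rewrite (hq_congr I0 I) (hq_congr I I0).
  apply: polyO_D; last first.
    rewrite (_ : (fun _ => _) = (fun t => hq x (x + (lop x (t *: z) - lop x 0)) +
       hq (x + (lop x (t *: z) - lop x 0)) x)); first exact: polyO_sigma.
    apply/funext => t; have I : inW (u t - (x + (lop x (t *: z) - lop x 0))).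
      have -> : u t - (x + (lop x (t *: z) - lop x 0)) =
         (u t - lop x (t *: z)) + (lop x 0 - (x + 0)).
        by apply/rowP => j; rewrite !mxE; ring.
      by apply: inWD; [exact: op_lop|apply: lop_0; rewrite eqxx orbT].
    have I0 : inW (x - x) by rewrite subrr; exact: inW0.
    by rewrite (hq_congr I0 I) (hq_congr I I0).
  by apply: polyO_B; [apply: polyO_Z|]; exact: polyO_kappa.
move=> i; rewrite expr1 /f -homog_identity !brZr !(lformZ _ _ lq).
ring.
Qed.

Lemma br_homogV x z i : q (br (2^-1 ^+ i *: x) z) = 2^-1 ^+ i * q (br x z).
Proof.
elim: i x => [|i IH] x; first by rewrite !expr0 scale1r mul1r.
have := br_homog (2^-1 ^+ i.+1 *: x) z; rewrite scalerA exprS mulrA divff ?pnatr_eq0// mul1r IH.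
by move=> E; rewrite -mulrA E mulrA mulVf ?pnatr_eq0// mul1r.
Qed.

(** What associativity leaves beside the terms of [q] composed with [br]: differences of [hq] and
    brackets with [lgap], all of third order under simultaneous scaling ([polyO_cubic]). *)
Definition cubic x y z : R := hq y z - hq x y + hq x (op y z) - hq (op x y) z
  + 4^-1 * q (lbr z (lgap x y)) + 4^-1 * q (lbr x (lgap y z)).

Lemma q_op z x y : q (br z (op x y)) = q (br z x) + q (br z y) + q (lbr z (lgap x y)).
Proof.
rewrite (q_inW z (op_lop x y)) lopE2 -q_lgap; move: (lgap x y) => g.
by rewrite !brDr !(lformD _ _ lq).
Qed.

Lemma q_lbr_lgap m m' x y : inW (m - m') -> q (lbr m (lgap x y)) = q (lbr m' (lgap x y)).
Proof.
move=> im; apply/eqP; rewrite -subr_eq0 -(lformB _ _ lq) -(linB (lbr_linearl _ _)).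
have ld : lform (fun v => q (lbr (m - m') v)) by apply: lform_comp => //; exact: lbr_linearr.
rewrite lgapE (lform_dynkin _ ld) (_ : (fun w => _) = (fun w : seq bool => 0 *: (0 : R^o))).
  by rewrite dynkin_sumZ scale0r.
apply/funext => w; rewrite scale0r; case: (ltnP 1 (size w)) => s1; last exact: (lform0 ld).
rewrite (lformZ _ _ ld); case: w s1 => [//|a [|b w]//] _.
by rewrite /letters ![map _ _]/= nested_cons killW1_lbrl// mulr0.
Qed.

Lemma additive_identity x y z :
  4^-1 * ((q (br (op x y) z) - q (br x z) - q (br y z)) +
          (q (br (op y z) x) - q (br y x) - q (br z x))) = cubic x y z.
Proof.
have : q (op (op x y) z) = q (op x (op y z)) by rewrite /mulG bch_assoc.
rewrite (law (op x y) z) (law x (op y z)) (law x y) (law y z) (q_op z) (q_op x) /cubic.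
lra.
Qed.

(** [additive_identity] couples the additivity defects of two products. The alternating sum over the
    three cyclic shifts contains the defect of xy against z twice and cancels the others. *)
Lemma br_op x y z : q (br (op x y) z) = q (br x z) + q (br y z) +
  2 * (cubic x y z - cubic y z x + cubic z x y).
Proof. by rewrite -!additive_identity; field. Qed.

Lemma polyO_cubic x y z : polyO 3 (fun t => cubic (t *: x) (t *: y) (t *: z)).
Proof.
have pl u v : polyV 1 (fun t => lop (t *: u) (t *: v)) by apply: polyV_lop; exact: polyV_X1.
have I0 u : inW (u - u) by rewrite subrr; exact: inW0.
rewrite (_ : (fun _ => _) = (fun t => hq (t *: y) (t *: z) - hq (t *: x) (t *: y)
  + hq (t *: x) (lop (t *: y) (t *: z)) - hq (lop (t *: x) (t *: y)) (t *: z)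
  + 4^-1 * q (lbr (t *: z) (lgap (t *: x) (t *: y)))
  + 4^-1 * q (lbr (t *: x) (lgap (t *: y) (t *: z))))); last first.
  apply/funext => t; rewrite /cubic (hq_congr (I0 (t *: x)) (op_lop (t *: y) (t *: z))).
  by rewrite (hq_congr (op_lop (t *: x) (t *: y)) (I0 (t *: z))).
have ph u v w : polyO 3 (fun t => 4^-1 * q (lbr (t *: u) (lgap (t *: v) (t *: w)))).
  apply: polyO_Z; apply: polyO_lform => //; apply: (polyV_lbr (a := 1) (b := 2)).
    exact: polyV_X1.
  by apply: polyV_lgap; exact: polyV_X1.
apply: polyO_D => //; apply: polyO_D => //; apply: polyO_B; last first.
  by apply: polyO_hq => //; exact: polyV_X1.
apply: polyO_D; last by apply: polyO_hq => //; exact: polyV_X1.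
by apply: polyO_B; apply: polyO_hq; exact: polyV_X1.
Qed.

(* The expansion of [q (br m m) = 0] at m = (t x)(t y), up to O(t^3), along
   t = 2^-i. *)
Lemma q_antisym x y : q (br x y) + q (br y x) = 0.
Proof.
pose C x y z := cubic x y z - cubic y z x + cubic z x y.
pose f (t : R) := - (2 * C (t *: x) (t *: y) (t *: x) + 2 * C (t *: x) (t *: y) (t *: y) +
   q (lbr (lop (t *: x) (t *: y)) (lgap (t *: x) (t *: y)))).
have PC u v w : polyO 3 (fun t => 2 * C (t *: u) (t *: v) (t *: w)).
  apply: polyO_Z; apply: polyO_D; last exact: polyO_cubic.
  by apply: polyO_B; exact: polyO_cubic.
apply: (@polyO_eq0 _ _ 2 f).
  rewrite /f; under eq_fun do rewrite -mulN1r; apply: polyO_Z; apply: polyO_D.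
    by apply: polyO_D; exact: PC.
  apply: polyO_lform => //; apply: (polyV_lbr (a := 1) (b := 2)).
    by apply: polyV_lop; exact: polyV_X1.
  by apply: polyV_lgap; exact: polyV_X1.
move=> i; set t := 2^-1 ^+ i; set m := op (t *: x) (t *: y).
have : q (br m m) = 0 by rewrite bracket_alternating (lform0 lq).
rewrite {2}/m q_op /m !br_op -/(C _ _ _) -/(C _ _ _).
rewrite (q_lbr_lgap _ _ (op_lop _ _)) /f.
rewrite !brZr !(lformZ _ _ lq) /t !br_homogV -/t !bracket_alternating !(lform0 lq).
lra.
Qed.

(** Antisymmetry transfers linearity from the second argument of [br] to the first, as seen by
    [q]. *)
Lemma q_dev x y : q (dev x y) = 0.
Proof.
have qA u v : q (br u v) = - q (br v u) by apply/eqP; rewrite -addr_eq0 q_antisym.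
have -> : dev x y = br x y - \sum_i x 0 i *: br (basis_vec i) y by [].
rewrite (lformB _ _ lq) qA [x in br y x]row_basis br_sumr !(lform_sum _ _ _ lq) -sumrN -sumrB big1//.
by move=> i _; rewrite brZr !(lformZ _ _ lq) (qA (basis_vec i)) mulrN opprK addNr.
Qed.

End Functional.

(** Induction on [v] along the stratification. For a bracket, [dev w] is applied to the Jacobi
    identity: one term starts with a horizontal vector and is killed by hypothesis, another is
    covered by the induction hypothesis, and the third is the one wanted. *)
Lemma killH1_killW1 q : lform q ->
  (forall i w v, ord G i = 1%N -> q (lbr (basis_vec i) (dev w v)) = 0) -> killW1 q.
Proof.
move=> lq qH; split=> // u w v; move: v u w.
apply: (layer_ind (G := G)).
- by move=> u w; rewrite (lin0 (dev_linear _ _)) (lin0 (lbr_linearr _ _)) (lform0 lq).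
- move=> a v1 v2 IH1 IH2 u w.
  by rewrite (dev_linear _ _) (lbr_linearr _ _) lq IH1 IH2 mulr0 addr0.
- by move=> i oi u w; rewrite lbr_dev_antisym (lformN _ lq) qH// oppr0.
- move=> i l oi IH u w; rewrite -lbr_basis; move: (basis_vec l) IH => v IH.
  have J : dev w (lbr u (lbr (basis_vec i) v)) + dev w (lbr (basis_vec i) (lbr v u)) +
     dev w (lbr v (lbr u (basis_vec i))) = 0.
    by rewrite -!(linD (dev_linear _ _)) jac_lbr (lin0 (dev_linear _ _)).
  move: J; rewrite (dev_lbrC _ w u (lbr (basis_vec i) v)) (dev_lbrC _ w (basis_vec i) (lbr v u)) (dev_lbr _ w v (lbr u _)) => J.
  have := congr1 q J; rewrite !(lformD _ _ lq) (lformN _ lq) (lform0 lq) qH// addr0.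
  by rewrite IH subr0.
Qed.

Definition in_from j v := forall i, (ord G i < j)%N -> v 0 i = 0.

Lemma in_from_lbr i j v : ord G i = 1%N -> in_from j v -> in_from j.+1 (lbr (basis_vec i) v).
Proof.
move=> oi vj l lj; rewrite lbr_basis [v]row_basis br_sumr summxE big1// => m _.
rewrite brZr mxE; have [mj|jm] := ltnP (ord G m) j; first by rewrite vj// mul0r.
by rewrite br_basis_coord ?mulr0// neq_ltn [X in X || _](leq_trans lj)// ltnS.
Qed.

Lemma in_from_top v : in_from k.+1 v -> v = 0.
Proof. by move=> vk; apply/rowP => i; rewrite mxE vk// ltnS ord_le. Qed.

(* Forms vanishing on the j-fold brackets of H_1 with [dev w v]: for j = k this is
   no condition, by nilpotency, and one goes down to j = 0 with [q_dev]. *)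
Lemma dev0_gt1 w v : (1 < k)%N -> dev w v = 0.
Proof.
move=> k1; apply/rowP => l; rewrite [RHS]mxE; move: w v.
suff H : forall j q, lform q ->
   (forall (s : seq 'I_n) w v, all (fun i => ord G i == 1%N) s -> size s = j ->
      q (foldr (fun i => lbr (basis_vec i)) (dev w v) s) = 0) -> forall w v, q (dev w v) = 0.
  move=> w v; apply: (H k (fun v => v 0 l)).
    by move=> a u u'; rewrite !mxE.
  move=> s w' v' sH ss; suff -> : foldr (fun i => lbr (basis_vec i)) (dev w' v') s = 0 by rewrite mxE.
  have : in_from (size s).+1 (foldr (fun i => lbr (basis_vec i)) (dev w' v') s); last by rewrite ss; exact: in_from_top.
  elim: s sH {ss} => [_|i s IH /= /andP[/eqP oi sH]].
    by move=> i; rewrite /= ltnS leqn0 => /eqP o0; have := ord_gt0 G i; rewrite o0.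
  by apply: in_from_lbr => //; exact: IH.
elim=> [|j IH] q lq qs; first by move=> w v; exact: (qs [::]).
apply: IH => // s w v sH ss.
have ls : linear (fun d => foldr (fun i => lbr (basis_vec i)) d s).
  elim: (s) => [|i r IH] a u u' //=; by rewrite IH (lbr_linearr _ _).
have lqs := lform_comp lq ls.
(* A horizontal bracket inserted next to [dev] gives j + 1 brackets, the level at which [q] is
   assumed to vanish; so the form with [j] brackets satisfies [killW1]. *)
apply: (q_dev k1 (q := fun d => q (foldr (fun i => lbr (basis_vec i)) d s))).
apply: killH1_killW1 => // i w' v' oi.
have := qs (rcons s i) w' v'; rewrite -cats1 foldr_cat all_cat sH /= oi size_cat ss addn1.
exact.
Qed.

End Bilinear.

(** * The case of step one *)

Section Step1.
Context {R : realType}.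

(** With the exponents and m bounded by 1, the word xy survives with coefficient 1, while yx, which
    comes from m = 2, is cut off. The product in step one thus reads x + y + [x, y] / 2, and the
    coefficients of [dynkin_word2] are not those of this case. *)
Lemma dynkin_sum1 (U : lmodType R) (L : seq bool -> U) :
  dynkin_sum 1 id L = L [:: false] + L [:: true] + L [:: false; true].
Proof.
rewrite /dynkin_sum big_nat1 /dynkin_coef /= expr0 divr1 scale1r.
rewrite (reindex (fun p : 'I_2 * 'I_2 => [ffun=> p])) /=; last first.
  exists (fun f : {ffun 'I_1 -> 'I_2 * 'I_2} => f ord0) => [p _|f _]; first by rewrite ffunE.
  by apply/ffunP => i; rewrite ffunE (ord1 i).
have E1 (p : 'I_2 * 'I_2) : [forall a : 'I_1, (0 < ([ffun=> p] a).1 + ([ffun=> p] a).2)%N] =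
   (0 < p.1 + p.2)%N.
  by apply/forallP/idP => [/(_ ord0)|H i]; rewrite ffunE.
have E2 (p : 'I_2 * 'I_2) : blocks ([ffun=> p] : {ffun 'I_1 -> _}) = nseq p.1 false ++ nseq p.2 true.
  by rewrite /blocks enum_ordSl enum_ord0 /= ffunE cats0.
rewrite (eq_bigl _ _ E1) (eq_bigr (fun p : 'I_2 * 'I_2 => L (nseq p.1 false ++ nseq p.2 true))); last first.
  move=> -[a b] _; rewrite E2 big_ord1 ffunE /=.
  case: a => [[|[|a]] ia]//; case: b => [[|[|b]] ib]//; by rewrite (_ : (_ * _)%N = 1%N)// invr1 scale1r.
rewrite (eq_bigl (fun p : 'I_2 * 'I_2 => xpredT p.1 && (0 < p.1 + p.2)%N)) //.
rewrite -(pair_big_dep xpredT (fun a b : 'I_2 => (0 < a + b)%N)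
   (fun a b : 'I_2 => L (nseq a false ++ nseq b true))) /=.
rewrite !big_ord_recl big_ord0 /= addr0.
rewrite !big_mkcond !big_ord_recl !big_ord0 /= !addr0 add0r.
by rewrite addrCA addrA.
Qed.

(** All basis vectors are horizontal and of top order, so brackets with a basis vector in first
    place vanish and [dev] is the whole bracket; [dev_dev] then gives br x (br y z) = 0.
    Associativity makes the first argument of the bracket additive along products, whence
    antisymmetry and, by expansion in the basis, br = 0. *)
Lemma dev0_step1 n (G : carnot_group R n 1) w v : dev G w v = 0.
Proof.
have br0 i y : bracket G (basis_vec i) y = 0.
  apply/rowP => l; rewrite mxE [y]row_basis br_sumr summxE big1// => m _.
  have o1 j : ord G j = 1%N by apply/eqP; rewrite eqn_leq ord_gt0 ord_le.
  by rewrite brZr mxE br_basis_coord ?mulr0// !o1.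
have devE x y : dev G x y = bracket G x y.
  by rewrite /dev /lbr big1 ?subr0// => i _; rewrite br0 scaler0.
have opE1 x y : mulG G x y = x + y + 2^-1 *: bracket G x y.
  by rewrite opE dynkin_sum1 /= !invr1 !scale1r.
have AA x y z : bracket G x (bracket G y z) = 0 by rewrite -!devE dev_dev.
have Aop x y z : bracket G (mulG G x y) z = bracket G x z + bracket G y z.
  have : mulG G (mulG G x y) z = mulG G x (mulG G y z) by rewrite /mulG bch_assoc.
  rewrite (opE1 (mulG G x y) z) (opE1 x (mulG G y z)) (opE1 y z).
  move: (bracket G (mulG G x y) z) => B; rewrite (opE1 x y).
  rewrite !brDr brZr AA scaler0 addr0 => /rowP E; apply/rowP => j; have := E j; rewrite !mxE.
  lra.
have A0 a b y : bracket G (bracket G a b) y = 0.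
  have := bracket_alternating G (mulG G y (bracket G a b)).
  rewrite Aop opE1 !brDr !brZr !AA ?br0r !bracket_alternating ?scaler0 ?addr0 ?add0r.
  by [].
have Aanti x y : bracket G x y = - bracket G y x.
  have := bracket_alternating G (mulG G x y).
  rewrite Aop opE1 !brDr !brZr !AA ?br0r !bracket_alternating ?scaler0 ?addr0 ?add0r.
  by move=> /eqP; rewrite addr_eq0 => /eqP.
rewrite devE Aanti [w]row_basis br_sumr big1 ?oppr0// => i _.
by rewrite brZr Aanti br0 oppr0 scaler0.
Qed.

End Step1.

Section BracketBilinear.
Context {R : realType} {n k : nat} (G : carnot_group R n k).
Notation br := (bracket G).

Lemma dev0 w v : dev G w v = 0.
Proof.
have [k1|k1] := ltnP 1 k; first exact: dev0_gt1.
have E : k = 1%N by apply/eqP; rewrite eqn_leq k1 (k_gt0 G).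
by move: (G); rewrite E => G'; exact: dev0_step1.
Qed.

Lemma br_lbr w v : br w v = lbr G w v.
Proof. by rewrite brE dev0 addr0. Qed.

Lemma br_linearl v : linear (br^~ v).
Proof. by move=> a x y; rewrite !br_lbr; exact: lbr_linearl. Qed.

Lemma br_anti x y : br x y = - br y x.
Proof.
have := bracket_alternating G (x + y).
rewrite (linD (br_linearl _)) !brDr !bracket_alternating add0r addr0 => /eqP.
by rewrite addr_eq0 => /eqP.
Qed.

End BracketBilinear.

(** * The group law, the frame and homogeneous distances *)

Section C1Closure.
Context {R : realType} {p : nat}.
Notation V := 'rV[R]_p.
Implicit Types (U : set V) (f g : V -> R).

Lemma class_C1P U f : open U -> (forall u, U u -> {for u, continuous f}) ->
  (forall j u, U u -> derivable f u (basis_vec j)) ->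
  (forall j u, U u -> {for u, continuous (partial j f)}) -> class_C 1 U f.
Proof.
move=> oU cf df cdf; split; first by move=> u /[!inE]; exact: cf.
move=> j; split; first by move=> u; exact: df.
by split=> // u /[!inE]; exact: cdf.
Qed.

Lemma class_C1_derivable U f j u : class_C 1 U f -> U u -> derivable f u (basis_vec j).
Proof. by move=> [_ /(_ j)[d _]]; exact: d. Qed.

Lemma class_C1_contp U f j u : class_C 1 U f -> U u -> {for u, continuous (partial j f)}.
Proof. by move=> [_ /(_ j)[_ [c _]]] Uu; apply: c; rewrite inE. Qed.

Lemma class_C1_cst U (c : R) : open U -> class_C 1 U (fun=> c).
Proof.
move=> oU; apply: class_C1P => //.
- by move=> u _; exact: cst_continuous.
- move=> j u _; rewrite (_ : partial j (fun=> c) = fun=> 0); first exact: cst_continuous.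
  by apply/funext => v; rewrite /partial derive_cst.
Qed.

Lemma class_C1_D U f g : open U -> class_C 1 U f -> class_C 1 U g ->
  class_C 1 U (fun u => f u + g u).
Proof.
move=> oU fU gU; apply: class_C1P => //.
- by move=> u Uu; apply: continuousD; [exact: (class_C_cont fU Uu)|exact: (class_C_cont gU Uu)].
- by move=> j u Uu; apply: derivableD; [exact: class_C1_derivable fU _|exact: class_C1_derivable gU _].
- move=> j u Uu.
  have E z : U z -> partial j (fun u => f u + g u) z = partial j f z + partial j g z.
    by move=> Uz; rewrite /partial deriveD//; [exact: class_C1_derivable fU _|exact: class_C1_derivable gU _].
  apply: (eq_on_continuous oU Uu E).
  have H1 := class_C1_contp (j := j) fU Uu; have H2 := class_C1_contp (j := j) gU Uu.
  exact: (cvgD H1 H2).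
Qed.

Lemma class_C1_M U f g : open U -> class_C 1 U f -> class_C 1 U g ->
  class_C 1 U (fun u => f u * g u).
Proof.
move=> oU fU gU; apply: class_C1P => //.
- by move=> u Uu; apply: continuousM; [exact: (class_C_cont fU Uu)|exact: (class_C_cont gU Uu)].
- by move=> j u Uu; apply: derivableM; [exact: class_C1_derivable fU _|exact: class_C1_derivable gU _].
- move=> j u Uu.
  have E z : U z -> partial j (fun u => f u * g u) z = f z * partial j g z + g z * partial j f z.
    by move=> Uz; rewrite /partial deriveM//; [exact: class_C1_derivable fU _|exact: class_C1_derivable gU _].
  apply: (eq_on_continuous oU Uu E).
  have H1 := class_C1_contp (j := j) fU Uu; have H2 := class_C1_contp (j := j) gU Uu.
  exact: (cvgD (cvgM (class_C_cont fU Uu) H2) (cvgM (class_C_cont gU Uu) H1)).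
Qed.

Lemma class_C1_sum U (I : Type) (r : seq I) (P : pred I) (F : I -> V -> R) : open U ->
  (forall i, P i -> class_C 1 U (F i)) -> class_C 1 U (fun u => \sum_(i <- r | P i) F i u).
Proof.
move=> oU PF; elim: r => [|i r IH].
  have -> : (fun u => \sum_(i <- [::] | P i) F i u) = fun=> 0 by apply/funext => u; rewrite big_nil.
  exact: class_C1_cst.
have -> : (fun u => \sum_(i <- i :: r | P i) F i u) =
   (fun u => (if P i then F i u else 0) + \sum_(i <- r | P i) F i u).
  by apply/funext => u; rewrite big_cons; case: ifP; rewrite ?add0r.
by apply: class_C1_D => //; case: (boolP (P i)) => [/PF//|_]; exact: class_C1_cst.
Qed.

Lemma class_C1_coord U l : open U -> class_C 1 U (fun u => u 0 l).
Proof.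
have D j u : is_derive u (basis_vec j) (fun u : V => u 0 l) (j == l)%:R.
  apply: is_derive_line0; have -> : (fun s : R => (u + s *: basis_vec j) 0 l) =
     (fun s => u 0 l + s * (j == l)%:R).
    by apply/funext => s; rewrite !mxE eqxx [l == j]eq_sym.
  rewrite (_ : (fun s => _) = cst (u 0 l) + (j == l)%:R \*: (@id R^o)).
    by apply: is_derive_eq; rewrite add0r /GRing.scale/= mulr1.
  by apply/funext => s; rewrite /GRing.scale/= mulrC.
move=> oU; apply: class_C1P => //.
- by move=> u _; exact: coord_continuous.
- move=> j u _; rewrite (_ : partial j _ = fun=> (j == l)%:R); first exact: cst_continuous.
  by apply/funext => v; have [_] := D j v.
Qed.

End C1Closure.

Section C1Map.
Context {R : realType}.

Lemma class_C1_map_cst p q (U : set 'rV[R]_p) (v : 'rV[R]_q) : open U -> class_C1_map U (fun=> v).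
Proof. by move=> oU j; exact: class_C1_cst. Qed.

Lemma class_C1_map_id p (U : set 'rV[R]_p) : open U -> class_C1_map U id.
Proof. by move=> oU j; exact: class_C1_coord. Qed.

Lemma class_C1_map_Z p q (U : set 'rV[R]_p) c (f : 'rV[R]_p -> 'rV[R]_q) : open U ->
  class_C1_map U f -> class_C1_map U (fun u => c *: f u).
Proof.
move=> oU fU j; under eq_fun do rewrite mxE; apply: class_C1_M => //.
exact: class_C1_cst.
Qed.

Lemma class_C1_map_sum p q (U : set 'rV[R]_p) (I : Type) (r : seq I) (P : pred I)
    (F : I -> 'rV[R]_p -> 'rV[R]_q) : open U ->
  (forall i, P i -> class_C1_map U (F i)) ->
  class_C1_map U (fun u => \sum_(i <- r | P i) F i u).
Proof.
move=> oU PF j; under eq_fun do rewrite summxE.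
by apply: class_C1_sum => // i Pi; exact: PF.
Qed.

Lemma class_C1_map_comp p q s (U : set 'rV[R]_p) (W : set 'rV[R]_q) (F : 'rV[R]_p -> 'rV[R]_q)
    (H : 'rV[R]_q -> 'rV[R]_s) : open U -> open W -> (forall u, U u -> W (F u)) ->
  class_C1_map U F -> class_C1_map W H -> class_C1_map U (fun u => H (F u)).
Proof. by move=> oU oW UW FU HW j; exact: (class_C1_comp oW oU (HW j) UW FU). Qed.

Lemma class_C1_map_continuous p q (U : set 'rV[R]_p) (F : 'rV[R]_p -> 'rV[R]_q) u :
  class_C1_map U F -> U u -> {for u, continuous F}.
Proof. by move=> FU Uu; apply: (@cvg_rV _ _ (nbhs u)) => j; exact: (class_C_cont (FU j) Uu). Qed.

End C1Map.

Section Group.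
Context {R : realType} {n k : nat} (G : carnot_group R n k).
Notation V := 'rV[R]_n.
Notation br := (bracket G).
Notation op := (mulG G).
Notation C1 F := (class_C1_map setT F).
Implicit Types (x y z : V).

Lemma class_C1_br p (f g : 'rV[R]_p -> V) : C1 f -> C1 g -> C1 (fun u => br (f u) (g u)).
Proof.
move=> fU gU; have -> : (fun u => br (f u) (g u)) = (fun u => \sum_i \sum_j (f u 0 i * g u 0 j) *: br (basis_vec i) (basis_vec j)).
  apply/funext => u; rewrite [in LHS](row_basis (f u)) (lin_sum (br_linearl G _)).
  apply: eq_bigr => i _; rewrite (linZ (br_linearl G _)) [in LHS](row_basis (g u)) br_sumr scaler_sumr.
  by apply: eq_bigr => j _; rewrite brZr scalerA.
have oT : open (setT : set 'rV[R]_p) := openT.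
apply: class_C1_map_sum; first exact: oT.
move=> i _; apply: class_C1_map_sum; first exact: oT.
move=> j _ l.
have -> : (fun u => ((f u 0 i * g u 0 j) *: br (basis_vec i) (basis_vec j)) 0 l) =
   (fun u => f u 0 i * g u 0 j * br (basis_vec i) (basis_vec j) 0 l).
  by apply/funext => u; rewrite mxE.
apply: (class_C1_M oT _ (class_C1_cst _ oT)).
exact: (class_C1_M oT (fU i) (gU j)).
Qed.

Lemma class_C1_nested p (f g : 'rV[R]_p -> V) w : C1 f -> C1 g ->
  C1 (fun u => nested_bracket br (letters (f u) (g u) w)).
Proof.
move=> fU gU; case: w => [|a w]; first exact/class_C1_map_cst/openT.
elim: w a => [|b w IH] a; first by case: a.
by apply: (class_C1_br _ (IH b)); case: a.
Qed.

Lemma class_C1_dynkin p (F : seq bool -> 'rV[R]_p -> V) : (forall w, C1 (F w)) ->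
  C1 (fun u => dynkin_sum k id (F ^~ u)).
Proof.
move=> PF; apply: class_C1_map_sum => [|i _]; first exact: openT.
apply: class_C1_map_Z; first exact: openT; apply: class_C1_map_sum => [|rs _]; first exact: openT.
by apply: class_C1_map_Z; first exact: openT.
Qed.

Lemma class_C1_op p (f g : 'rV[R]_p -> V) : C1 f -> C1 g -> C1 (fun u => op (f u) (g u)).
Proof.
move=> fU gU; under eq_fun do rewrite opE.
apply: (class_C1_dynkin (F := fun w u => (size w)%:R^-1 *: nested_bracket br (letters (f u) (g u) w))).
by move=> w; apply: class_C1_map_Z; [exact: openT|exact: class_C1_nested].
Qed.

Lemma class_C1_opl x : C1 (op x).
Proof.
apply: (class_C1_op (f := fun=> x) (g := id)); first exact/class_C1_map_cst/openT.
exact/class_C1_map_id/openT.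
Qed.

Lemma op_comm x y : br x y = 0 -> op x y = x + y.
Proof.
move=> xy; rewrite opE -(single_letters G x y idfun).
apply: eq_dynkin_sum => -[//|a [|b w]] _.
  by case: a; rewrite /= invr1 !scale1r scale0r ?add0r ?addr0.
have -> : nested_bracket br (letters x y [:: a, b & w]) = 0.
  have yx : br y x = 0 by rewrite br_anti xy oppr0.
  elim: w a b => [|c w IH] a b.
    by rewrite /letters/=; case: a; case: b; rewrite ?bracket_alternating.
  by have := IH b c; rewrite /letters ![map _ _]/= !nested_cons => ->; exact: br0r.
by rewrite scaler0; case: a; rewrite /= !scale0r addr0.
Qed.

Lemma br0l x : br 0 x = 0.
Proof. by rewrite br_anti br0r oppr0. Qed.

Lemma op0r x : op x 0 = x.
Proof. by rewrite op_comm ?br0r// addr0. Qed.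

Lemma op0l x : op 0 x = x.
Proof. by rewrite op_comm ?br0l// add0r. Qed.

Lemma opNr x : op x (- x) = 0.
Proof. by rewrite op_comm ?subrr// brNr bracket_alternating oppr0. Qed.

Lemma opNl x : op (- x) x = 0.
Proof. by rewrite -[X in op _ X]opprK opNr. Qed.

Lemma opA x y z : op x (op y z) = op (op x y) z.
Proof. exact: bch_assoc. Qed.

Lemma opK x : cancel (op x) (op (- x)).
Proof. by move=> y; rewrite opA opNl op0l. Qed.

Lemma opVK x : cancel (op (- x)) (op x).
Proof. by move=> y; rewrite opA opNr op0l. Qed.

Lemma dil_linear t : linear (dil G t).
Proof. by move=> a u v; apply/rowP => j; rewrite !mxE; ring. Qed.

Lemma dil_basis t i : dil G t (basis_vec i) = t ^+ ord G i *: basis_vec i.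
Proof. by apply/rowP => j; rewrite !mxE; have [->//|] := eqVneq j i; rewrite andbF !mulr0. Qed.

(** On a horizontal basis vector this is the stratification; the Jacobi identity, read as a
    derivation rule, carries it to brackets, hence to all first arguments. *)
Lemma dil_br t u v : dil G t (br u v) = br (dil G t u) (dil G t v).
Proof.
move: u v; apply: (layer_ind (G := G)) => [v|a u u' IH IH' v|i oi v|i l oi IH v].
- by rewrite br0l (lin0 (dil_linear t)) br0l.
- by rewrite (br_linearl G) !(dil_linear t) (br_linearl G) IH IH'.
- rewrite [v]row_basis br_sumr !(lin_sum (dil_linear t)) br_sumr; apply: eq_bigr => l _.
  rewrite brZr !(linZ (dil_linear t)) brZr; congr (_ *: _).
  rewrite !dil_basis oi expr1 brZr (linZ (br_linearl G _)) scalerA -exprSr.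
  apply/rowP => j; rewrite !mxE; have [->//|jl] := eqVneq (ord G j) (ord G l).+1.
  by rewrite br_basis_coord// !mulr0.
- have J a b c : br (br a b) c = br a (br b c) - br b (br a c).
    have := bracket_jacobi G a b c; rewrite (br_anti G c (br a b)) (br_anti G c a) brNr.
    by move=> H; apply/eqP; rewrite eq_sym -subr_eq0 -H.
  have H w : dil G t (br (basis_vec i) w) = br (dil G t (basis_vec i)) (dil G t w).
    rewrite [w]row_basis br_sumr !(lin_sum (dil_linear t)) br_sumr; apply: eq_bigr => m _.
    rewrite brZr !(linZ (dil_linear t)) brZr; congr (_ *: _).
    rewrite !dil_basis oi expr1 brZr (linZ (br_linearl G _)) scalerA -exprSr.
    apply/rowP => j; rewrite !mxE; have [->//|jl] := eqVneq (ord G j) (ord G m).+1.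
    by rewrite br_basis_coord// !mulr0.
  by rewrite !H !J (linB (dil_linear t)) H !IH H.
Qed.

Lemma dil_op t u v : dil G t (op u v) = op (dil G t u) (dil G t v).
Proof.
rewrite !opE (@dynkin_sum_map R k R R id id V V (dil G t)) => [|a b||c a].
- apply: eq_dynkin_sum => w _; rewrite (linZ (dil_linear t)); congr (_ *: _).
  case: w => [|a w]; first by rewrite (lin0 (dil_linear t)).
  elim: w a => [|b w IH] a; first by case: a.
  by have := IH b; rewrite /letters ![map _ _]/= !nested_cons dil_br => ->; case: a.
- by rewrite (linD (dil_linear t)).
- by rewrite (lin0 (dil_linear t)).
- by rewrite (linZ (dil_linear t)).
Qed.

Lemma dilM s t x : dil G s (dil G t x) = dil G (s * t) x.
Proof. by apply/rowP => j; rewrite !mxE exprMn mulrA. Qed.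

Lemma dil1 x : dil G 1 x = x.
Proof. by apply/rowP => j; rewrite !mxE expr1n mul1r. Qed.

Lemma dilK t : t != 0 -> cancel (dil G t) (dil G t^-1).
Proof. by move=> t0 x; rewrite dilM mulVf// dil1. Qed.

Lemma dilVK t : t != 0 -> cancel (dil G t^-1) (dil G t).
Proof. by move=> t0 x; rewrite dilM divff// dil1. Qed.

(** The automorphism property at t = 2 forces 2^(ord j) = 2^(ord i + ord l) at every nonzero
    coordinate. *)
Lemma br_basis_ord i l j : br (basis_vec i) (basis_vec l) 0 j != 0 ->
  ord G j = (ord G i + ord G l)%N.
Proof.
move=> c0; have := dil_br 2 (basis_vec i) (basis_vec l).
rewrite !dil_basis brZr (linZ (br_linearl G _)) scalerA => /rowP/(_ j); rewrite !mxE.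
move=> /(mulIf c0); rewrite -exprD -!natrX => /eqP; rewrite eqr_nat eqn_exp2l// => /eqP ->.
by rewrite addnC.
Qed.

Lemma br_ord1 x y j : ord G j = 1%N -> br x y 0 j = 0.
Proof.
move=> oj; rewrite [x]row_basis (lin_sum (br_linearl G _)) summxE big1// => i _.
rewrite (linZ (br_linearl G _)) mxE [y]row_basis br_sumr summxE big1 ?mulr0// => l _.
rewrite brZr mxE; have [->|] := eqVneq (br (basis_vec i) (basis_vec l) 0 j) 0; first by rewrite mulr0.
move=> /br_basis_ord; rewrite oj; have := ord_gt0 G i; have := ord_gt0 G l; lia.
Qed.

Lemma op_ord1 x y j : ord G j = 1%N -> op x y 0 j = x 0 j + y 0 j.
Proof.
move=> oj; have lj : lform (fun v : V => v 0 j) by move=> a u v; rewrite !mxE.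
rewrite opE (lform_dynkin _ lj) -(single_letters G x y (fun v : V => v 0 j : R^o)).
apply: eq_dynkin_sum => -[//|a [|b w]] _.
  by case: a; rewrite mxE /= invr1 mul1r ?scale1r scale0r ?add0r ?addr0.
by rewrite mxE br_ord1// mulr0; case: a; rewrite /= !scale0r addr0.
Qed.

Lemma hproj_op x y : hproj G (op x y) = hproj G x + hproj G y.
Proof.
apply/rowP => j; rewrite !mxE; case: eqP => [oj|]; last by rewrite addr0.
exact: op_ord1.
Qed.

(* The terms of [op x (t z)] that are linear in [t]. *)
Definition op_lin x z : V := dynkin_sum k id (fun w =>
  if count id w == 1%N then (size w)%:R^-1 *: nested_bracket br (letters x z w) else 0).

Lemma op_line x z : is_derive (0 : R) (1 : R) (fun t => op x (t *: z)) (op_lin x z).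
Proof.
have H w : is_derive (0 : R) (1 : R)
   (fun t => (size w)%:R^-1 *: nested_bracket br (letters x (t *: z) w))
   (if count id w == 1%N then (size w)%:R^-1 *: nested_bracket br (letters x z w) else 0).
  have -> : (fun t => (size w)%:R^-1 *: nested_bracket br (letters x (t *: z) w)) =
     (fun t => t ^+ count id w *: ((size w)%:R^-1 *: nested_bracket br (letters x z w))).
    apply/funext => t; rewrite scalerA [_ * _]mulrC -scalerA; congr (_ *: _).
    have -> : br = lbr G by apply/funext => a; apply/funext => b; rewrite br_lbr.
    exact: nested_lbr_scale.
  move: (_ *: _) => M; case: (count id w) => [|[|m]] /=.
  - have -> : (fun t : R => t ^+ 0 *: M) = cst M by apply/funext => t; rewrite expr0 scale1r.
    exact: is_derive_cst.
  - have -> : (fun t : R => t ^+ 1 *: M) = (fun t => 0 + t *: M).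
      by apply/funext => t; rewrite expr1 add0r.
    apply: is_derive_rV => j.
    rewrite (_ : (fun s => _) = M 0 j \*: (@id R^o)).
      by apply: is_derive_eq; rewrite /GRing.scale/= mulr1.
    by apply/funext => s; rewrite !mxE add0r /GRing.scale/= mulrC.
  - apply: is_derive_rV => j; rewrite mxE.
    rewrite (_ : (fun s => _) = M 0 j \*: ((@id R^o) ^+ m.+2)).
      by apply: is_derive_eq; rewrite exprS mul0r mulr0 scale0r scaler0.
    apply/funext => s; rewrite mxE mulrC [RHS]/GRing.scale/=; congr (_ * _).
    by rewrite -[RHS]/(((@id R^o) ^+ m.+2) s) exprfctE.
have HS (I : Type) (r : seq I) (P : pred I) (F : I -> R -> V) (D : I -> V) :
    (forall i, is_derive (0 : R) (1 : R) (F i) (D i)) ->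
    is_derive (0 : R) (1 : R) (fun t => \sum_(i <- r | P i) F i t) (\sum_(i <- r | P i) D i).
  move=> FD; elim: r => [|i r IH].
    rewrite big_nil; have -> : (fun t => \sum_(i <- [::] | P i) F i t) = cst 0.
      by apply/funext => t; rewrite big_nil.
    exact: is_derive_cst.
  have E : (fun t => \sum_(i <- i :: r | P i) F i t) =
     (if P i then F i else cst 0) + (fun t => \sum_(i <- r | P i) F i t).
    by apply/funext => t; rewrite big_cons fctE; case: ifP; rewrite ?add0r.
  rewrite big_cons E; case: ifP => _; first exact: is_deriveD.
  by rewrite -[X in is_derive _ _ _ X]add0r; apply: is_deriveD; exact: is_derive_cst.
have HZ c F (D : V) : is_derive (0 : R) (1 : R) F D -> is_derive (0 : R) (1 : R) (fun t => c *: F t) (c *: D).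
  by move=> FD; exact: is_deriveZ.
under eq_fun do rewrite opE.
apply: HS => m; apply: HZ; apply: HS => rs; apply: HZ; exact: H.
Qed.

Lemma class_C1_op_lin z : C1 (op_lin^~ z).
Proof.
apply: (class_C1_dynkin (F := fun w x =>
  if count id w == 1%N then (size w)%:R^-1 *: nested_bracket br (letters x z w) else 0)) => w.
case: (count id w == 1%N); last exact/class_C1_map_cst/openT.
apply: class_C1_map_Z; first exact: openT.
apply: class_C1_nested; first exact/class_C1_map_id/openT.
exact/class_C1_map_cst/openT.
Qed.

Lemma frameE x : frame G x = \matrix_j op_lin x (basis_vec j).
Proof.
apply/matrixP => j l; rewrite !mxE.
by have [_ ->] := is_derive_coord l (op_line x (basis_vec j)).
Qed.

Lemma frame_continuous j l : continuous (fun x => frame G x j l).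
Proof.
move=> x; rewrite (_ : (fun x => _) = (fun x => op_lin x (basis_vec j) 0 l)).
  exact: (class_C_cont (class_C1_op_lin (basis_vec j) l) (I : setT x)).
by apply/funext => y; rewrite frameE mxE.
Qed.

Lemma frame_jacobian x : frame G x = Defs.jacobian (op x) 0.
Proof.
apply/matrixP => j l; rewrite [RHS]mxE /partial frameE mxE.
apply/esym; apply: (@derive_val _ _ _ _ _ _ _ _); apply: is_derive_line0; apply: is_derive_coord.
by under eq_fun do rewrite add0r; exact: op_line.
Qed.

Lemma frame0 : frame G 0 = 1%:M.
Proof.
apply/matrixP => j l; rewrite !mxE; apply: derive_val.
have -> : (fun t : R => op 0 (t *: basis_vec j) 0 l) = (j == l)%:R \*: (@id R^o).
  by apply/funext => t; rewrite op0l !mxE eqxx /GRing.scale/= mulrC eq_sym.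
by apply: is_derive_eq; rewrite /GRing.scale/= mulr1.
Qed.

Lemma op_curve x (g : R -> V) t v : is_derive t (1 : R) g v ->
  is_derive t (1 : R) (fun s => op x (g s)) (v *m Defs.jacobian (op x) (g t)).
Proof.
move=> dg; apply: is_derive_rV => l.
have := is_derive_curve openT (class_C1_opl x l) (I : setT (g t)) dg.
rewrite (_ : lin_form _ v = (v *m Defs.jacobian (op x) (g t)) 0 l)//.
by rewrite mxE; apply: eq_bigr => j _; rewrite mxE.
Qed.

Lemma op_linE x z : op_lin x z = z *m frame G x.
Proof.
have [_ <-] := op_line x z; apply: derive_val.
have D1 : is_derive (0 : R) (1 : R) (fun t : R => 0 + t *: z) z.
  exact: is_derive_line0V (is_derive_id _ _).
have := op_curve x D1; rewrite scale0r addr0 -frame_jacobian.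
by under eq_fun do rewrite add0r.
Qed.

(** Left invariance of the frame: both sides differentiate (x y)(t e_j) = x (y (t e_j)) at t = 0. *)
Lemma frame_op x y : frame G (op x y) = frame G y *m Defs.jacobian (op x) y.
Proof.
apply/matrixP => j l; rewrite frameE mxE.
have [_ <-] := is_derive_coord l (op_line (op x y) (basis_vec j)).
apply: derive_val; under eq_fun do rewrite -opA.
have := is_derive_coord l (op_curve x (op_line y (basis_vec j))).
rewrite scale0r op0r (_ : op_lin y (basis_vec j) = row j (frame G y)); last by rewrite frameE rowK.
by rewrite -row_mul mxE.
Qed.

Lemma jacobian_opK x y : Defs.jacobian (op x) y *m Defs.jacobian (op (- x)) (op x y) = 1%:M.
Proof.
apply/matrixP => j l.
have D1 : is_derive (0 : R) (1 : R) (fun t : R => y + t *: basis_vec j) (basis_vec j).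
  exact: is_derive_line0V (is_derive_id _ _).
have := is_derive_coord l (op_curve (- x) (op_curve x D1)).
under eq_fun do rewrite opK.
move=> [_]; have [_ ->] := is_derive_coord l D1.
rewrite scale0r addr0 -mulmxA /basis_vec -rowE => E; move: E; rewrite [RHS]mxE => <-.
by rewrite !mxE eqxx eq_sym.
Qed.

Lemma jacobian_op0 x y : Defs.jacobian (op x) y \in unitmx.
Proof. exact: (mulmx1_unit (jacobian_opK x y)).1. Qed.

Lemma frame_dil t x j l : frame G (dil G t x) j l * t ^+ ord G j = t ^+ ord G l * frame G x j l.
Proof.
have H1 : is_derive (0 : R) (1 : R) (fun s : R => op (dil G t x) (dil G t (s *: basis_vec j)) 0 l)
   (frame G (dil G t x) j l * t ^+ ord G j).
  have -> : (fun s : R => op (dil G t x) (dil G t (s *: basis_vec j)) 0 l) =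
     (fun s : R => op (dil G t x) (s *: (t ^+ ord G j *: basis_vec j)) 0 l).
    by apply/funext => s; rewrite (linZ (dil_linear t)) dil_basis.
  have := is_derive_coord l (op_line (dil G t x) (t ^+ ord G j *: basis_vec j)).
  have -> : op_lin (dil G t x) (t ^+ ord G j *: basis_vec j) = t ^+ ord G j *: op_lin (dil G t x) (basis_vec j).
    by rewrite !op_linE scalemxAl.
  by rewrite frameE !mxE mulrC.
have H2 : is_derive (0 : R) (1 : R) (fun s : R => op (dil G t x) (dil G t (s *: basis_vec j)) 0 l)
   (t ^+ ord G l * frame G x j l).
  have -> : (fun s : R => op (dil G t x) (dil G t (s *: basis_vec j)) 0 l) =
     (t ^+ ord G l) \*: (fun s : R => op x (s *: basis_vec j) 0 l : R^o).
    by apply/funext => s; rewrite -dil_op mxE.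
  have := is_derive_coord l (op_line x (basis_vec j)).
  by rewrite frameE mxE => H; exact: is_deriveZ.
by have [_ <-] := H1; have [_ <-] := H2.
Qed.

Lemma det_frame_dil t x : t != 0 -> \det (frame G (dil G t x)) = \det (frame G x).
Proof.
move=> t0; pose D := diag_mx (\row_j t ^+ ord G j) : 'M[R]_n.
have E : D *m frame G (dil G t x) = frame G x *m D.
  apply/matrixP => j l; rewrite mul_diag_mx mul_mx_diag !mxE mulrC.
  have := frame_dil t x j l; rewrite !mxE => ->; exact: mulrC.
have := congr1 determinant E; rewrite !det_mulmx mulrC; apply: mulIf.
by rewrite det_diag; apply/prodf_neq0 => j _; rewrite mxE expf_neq0.
Qed.

End Group.

Lemma cvg_prodr (R : realType) (T : Type) (F : set_system T) (FF : Filter F) (I : Type) (r : seq I)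
    (P : pred I) (f : I -> T -> R) (l : I -> R) : (forall i, f i @ F --> l i) ->
  (fun t => \prod_(i <- r | P i) f i t) @ F --> \prod_(i <- r | P i) l i.
Proof.
move=> fl; elim: r => [|i r IH].
  have -> : (fun t => \prod_(i <- [::] | P i) f i t) = fun=> 1.
    by apply/funext => t; rewrite big_nil.
  by rewrite big_nil; exact: cvg_cst.
have -> : (fun t => \prod_(i <- i :: r | P i) f i t) =
    (fun t => (if P i then f i t else 1) * \prod_(i <- r | P i) f i t).
  by apply/funext => t; rewrite big_cons; case: ifP; rewrite ?mul1r.
have -> : \prod_(i <- i :: r | P i) l i = (if P i then l i else 1) * \prod_(i <- r | P i) l i.
  by rewrite big_cons; case: ifP; rewrite ?mul1r.
by apply: cvgM => //; case: (P i) => //; exact: cvg_cst.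
Qed.

Lemma cvg_det (R : realType) (T : Type) (F : set_system T) (FF : Filter F) n (M : T -> 'M[R]_n)
    (L : 'M[R]_n) : (forall i j, (fun t => M t i j) @ F --> L i j) ->
  (fun t => \det (M t)) @ F --> \det L.
Proof.
move=> ML; rewrite /determinant; apply: (@cvg_sumr _ _ F) => s _.
by apply: cvgM; [exact: cvg_cst|apply: (cvg_prodr FF) => i; exact: ML].
Qed.

Section Frame.
Context {R : realType} {n k : nat} (G : carnot_group R n k).
Notation V := 'rV[R]_n.

Lemma dil0 x : dil G 0 x = 0.
Proof. by apply/rowP => j; rewrite !mxE expr0n gtn_eqF ?mul0r// ord_gt0. Qed.

Lemma dil_origin t : dil G t 0 = 0.
Proof. exact: (lin0 (dil_linear G t)). Qed.

Lemma dil_cvg0 x : dil G t x @[t --> (0 : R)] --> (0 : V).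
Proof.
apply: cvg_rV => j; rewrite mxE.
have -> : (fun t => dil G t x 0 j) = (fun t : R => t ^+ ord G j * x 0 j).
  by apply/funext => t; rewrite mxE.
have H : t ^+ ord G j * x 0 j @[t --> (0 : R)] --> 0 ^+ ord G j * x 0 j.
  by apply: cvgM; [exact: exprn_continuous|exact: cvg_cst].
by move: H; rewrite expr0n gtn_eqF ?mul0r// ord_gt0.
Qed.

(** Dilations conjugate the frame by a diagonal matrix and so preserve its determinant. Letting t
    tend to 0 in [dil G t x] identifies it with the determinant at the origin. *)
Lemma det_frame x : \det (frame G x) = 1.
Proof.
have C : (fun t => \det (frame G (dil G t x))) @ (0 : R)^' --> (1 : R).
  rewrite -(det1 R n) -(frame0 G); apply: cvg_det => i j.
  have H : dil G t x @[t --> (0 : R)^'] --> (0 : V).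
    by apply: cvg_trans (dil_cvg0 x); apply: cvg_app; exact: nbhs_dnbhs.
  exact: (cvg_comp _ _ H (@frame_continuous _ _ _ G i j 0)).
have C' : (fun t => \det (frame G (dil G t x))) @ (0 : R)^' --> \det (frame G x).
  apply: cvg_near_cst; near=> t; apply: det_frame_dil; near: t; exact: nbhs_dnbhs_neq.
by apply: (cvg_unique _ C' C).
Unshelve. all: by end_near. Qed.

Lemma frame_unit x : frame G x \in unitmx.
Proof. by rewrite unitmxE det_frame unitr1. Qed.

End Frame.

(** * Size of the balls of a homogeneous distance *)

Section HomogeneousDistance.
Context {R : realType} {n k : nat} (G : carnot_group R n k).
Variable rho : 'rV[R]_n -> 'rV[R]_n -> R.
Hypothesis hrho : homogeneous_distance G rho.
Notation V := 'rV[R]_n.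
Notation N := (rho 0).
Implicit Types (x y z : V).

Lemma rhoE x y : rho x y = N (mulG G (- x) y).
Proof. by rewrite -(rho_left_invariant hrho (- x) x y) opNl. Qed.

Lemma N_op x y : rho x (mulG G x y) = N y.
Proof. by rewrite rhoE opK. Qed.

Lemma N0 : N 0 = 0.
Proof. exact/(rho_eq0 hrho). Qed.

Lemma N_eq0 y : N y = 0 -> y = 0.
Proof. by move/(rho_eq0 hrho). Qed.

Lemma N_ge0 y : 0 <= N y.
Proof.
have := rho_triangle hrho 0 y 0; rewrite N0 (rho_sym hrho y 0) -mulr2n pmulrn_lge0//.
Qed.

Lemma N_dil t y : 0 < t -> N (dil G t y) = t * N y.
Proof. by move=> t0; rewrite -(rho_dil hrho)// dil_origin. Qed.

Lemma N_continuous : continuous N.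
Proof.
move=> y; apply: (@continuous_comp _ _ _ (fun y : V => (0 : V, y)) (fun p => rho p.1 p.2)).
  exact: (cvg_pair (cvg_cst (0 : V)) (@cvg_id _ (nbhs y))).
exact: (rho_continuous hrho).
Qed.

(** On the unit sphere of the norm, which is compact, [N] has a positive minimum. A point outside is
    brought to the sphere by a dilation of ratio t <= 1, found by intermediate values; N y < 1
    bounds t from below, and 1/t enters at most to the power [k]. *)
Lemma ball_bounded : exists2 C : R, 0 < C & forall y, N y < 1 -> `|y| <= C.
Proof.
(* Without a vector of norm 1 the space is reduced to 0. *)
have [[y1 ny1]|no] := pselect (exists y : V, `|y| = 1); last first.
  exists 1 => // y _; rewrite leNgt; apply/negP => y1; apply: no.
  exists (`|y|^-1 *: y); rewrite normrZ normfV normr_id mulVf//.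
  by rewrite gt_eqF// (lt_trans _ y1).
pose K := [set y : V | `|y| = 1].
have cK : compact K.
  apply: bounded_closed_compact.
    by exists 1; split => // M M1 y /= ->; exact: ltW.
  have -> : K = (fun y : V => `|y|) @^-1` [set 1] by [].
  by apply: preimage_closed; [move=> y _; exact: norm_continuous|exact: closed_eq].
have [c cK' cmin] := @EVT_min_rV _ _ N K (ex_intro _ y1 ny1) cK
   (continuous_subspaceT (@N_continuous)).
have c0 : 0 < N c.
  rewrite lt_neqAle N_ge0 andbT eq_sym; apply/eqP => /N_eq0 E.
  by have := set_mem cK'; rewrite /K/= E normr0 => /eqP; rewrite eq_sym oner_eq0.
exists (Num.max 1 ((N c)^-1 ^+ k)) => [|y Ny]; first by rewrite lt_max ltr01.
rewrite le_max; have [//|y_1] /= := leP `|y| 1.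
have cg : {within `[(0 : R), 1], continuous (fun t => `|dil G t y|)}.
  apply: continuous_subspaceT => t; apply: (@continuous_comp _ _ _ (fun t => dil G t y) Num.norm).
    apply: cvg_rV => j; rewrite mxE.
    have -> : (fun t => dil G t y 0 j) = (fun t : R => t ^+ ord G j * y 0 j).
      by apply/funext => s; rewrite mxE.
    by apply: cvgM; [exact: exprn_continuous|exact: cvg_cst].
  exact: norm_continuous.
have [||t /[!in_itv]/= /andP[t0 t1] gt] := IVT (v := 1) _ cg; first exact: ler01.
  by rewrite dil0 dil1 normr0 ge_min ler01/= le_max (ltW y_1) orbT.
have {}t0 : 0 < t.
  by rewrite lt_neqAle t0 andbT; apply/eqP => t0'; move: gt; rewrite -t0' dil0 normr0 => /eqP; rewrite eq_sym oner_eq0.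
have ct : N c < t.
  have /(cmin (dil G t y)) : dil G t y \in K by rewrite inE.
  rewrite N_dil// => /le_lt_trans; apply; by rewrite gtr_pMr.
rewrite -(dilK G (lt0r_neq0 t0) y); apply: norm_rV_le => [|j].
  by rewrite exprn_ge0// invr_ge0 ltW.
rewrite mxE normrM; apply: (@le_trans _ _ (`|t^-1 ^+ ord G j| * 1)).
  by rewrite ler_wpM2l// -gt; exact: norm_coord_le.
rewrite mulr1 ger0_norm ?exprn_ge0 ?invr_ge0 ?(ltW t0)//.
apply: (@le_trans _ _ (t^-1 ^+ k)).
  by apply: ler_weXn2l; [rewrite invf_ge1|exact: ord_le].
by apply: lerXn2r; rewrite ?nnegrE ?invr_ge0 ?(ltW t0) ?(ltW c0)// lef_pV2 ?posrE// ltW.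
Qed.

Lemma ball_small W : nbhs (0 : V) W -> exists2 r0 : R, 0 < r0 &
  forall r y, 0 < r < r0 -> N y < r -> W y.
Proof.
move=> W0; have [C C0 CP] := ball_bounded.
have [r0 r00 rP] := wdil_small (ord_gt0 G) C W0.
exists r0 => // r y rr Nr; have r_gt0 : 0 < r by case/andP: rr.
rewrite -(dilVK G (lt0r_neq0 r_gt0) y); apply: rP => //; apply: CP.
by rewrite N_dil ?invr_gt0// mulrC ltr_pdivrMr// mul1r.
Qed.

End HomogeneousDistance.

(** * Lebesgue measure on R^p *)

Section OpenMeasurable.
Context {R : realType} (p : nat).
Notation V := 'rV[R]_p.

Lemma measurable_rV_ball (c : V) (r : R) : measurable [set v : V | forall j, `|v 0 j - c 0 j| < r].
Proof.
have -> : [set v : V | forall j, `|v 0 j - c 0 j| < r] =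
   \bigcap_(j in [set: 'I_p]) [set v : V | `|v 0 j - c 0 j| < r].
  by apply/seteqP; split => v /= H j; [move=> _; exact: H|exact: H].
apply: fin_bigcap_measurable; first exact: finite_finset.
move=> j _; have m := @measurable_rV_coord R p j.
have -> : [set v : V | `|v 0 j - c 0 j| < r] =
   (fun v : V => v 0 j : measurableTypeR R) @^-1` [set a : R | `|a - c 0 j| < r] by [].
rewrite -[X in measurable X]setTI; apply: m => //.
apply: open_measurable; rewrite (_ : [set a : R | _] = ball (c 0 j) r); first exact: ball_open.
by apply/seteqP; split => a /=; rewrite /ball/= distrC.
Qed.

(** The sigma-algebra is the one generated by the coordinates, so an open set is written as the
    countable union of the boxes with rational centre and radius that it contains. *)
Lemma measurable_open (U : set V) : open U -> measurable U.
Proof.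
move=> oU.
pose B (i : 'rV[rat]_p * rat) : set V := [set v | forall j, `|v 0 j - ratr (i.1 0 j)| < ratr i.2].
have mB i : measurable (B i).
  have -> : B i = [set v : V | forall j, `|v 0 j - (\row_j ratr (i.1 0 j)) 0 j| < ratr i.2].
    by apply/seteqP; split => v H j; have := H j; rewrite !mxE.
  exact: measurable_rV_ball.
have -> : U = \bigcup_i (if `[< B i `<=` U >] then B i else set0).
  apply/seteqP; split; last first.
    by move=> v [i _]; case: ifP => // /asboolP; exact.
  move=> v Uv; have /near_normP[e e0 eU] : nbhs v U by exact: open_nbhs_nbhs.
  have [r r0 re] : exists2 r : rat, (0 : R) < ratr r & (ratr r : R) < e / 2.
    have [r] := @rat_in_itvoo R 0 (e / 2) (divr_gt0 e0 (ltr0n _ 2)).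
    by rewrite in_itv/= => /andP[r1 r2]; exists r.
  have q_ex j : exists q : rat, `|v 0 j - ratr q| < ratr r.
    have lt : v 0 j - ratr r < v 0 j + ratr r by lra.
    have [q] := rat_in_itvoo lt.
    by rewrite in_itv/= => /andP[q1 q2]; exists q; rewrite ltr_norml; apply/andP; split; lra.
  pose q := \row_j projT1 (cid (q_ex j)).
  have qP j : `|v 0 j - ratr (q 0 j)| < ratr r by rewrite mxE; exact: projT2 (cid (q_ex j)).
  exists (q, r) => //=; case: asboolP; first by move=> _ j; exact: qP.
  move=> nBU; exfalso; apply: nBU => w Bw; apply: eU; apply: norm_rV_lt => // j.
  have := Bw j; have := qP j; rewrite /= !mxE !ltr_norml => /andP[a1 a2] /andP[b1 b2].
  by apply/andP; split; lra.
apply: countable_bigcupT_measurable; first exact: countableP.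
by move=> i; case: ifP.
Qed.

Lemma measurable_continuous (W : set V) (f : V -> R) : open W ->
  (forall v, W v -> {for v, continuous f}) -> measurable_fun W (f : V -> measurableTypeR R).
Proof.
move=> oW cf; apply: (measurability _ (RGenOInfty.measurableE R)) => //=.
move=> _ [_ [x ->] <-]; apply: measurable_open.
rewrite openE => v [Wv fv].
have : nbhs v W by exact: open_nbhs_nbhs.
have : nbhs (f v) `]x, +oo[%classic.
  apply: open_nbhs_nbhs; split => //; exact: interval_open.
move=> /(cf _ Wv) H1 H2; exact: filterI.
Qed.

End OpenMeasurable.

(** * Integration against a measure given by a density in a parametrisation *)

Section Density.
Context d1 d2 (X : measurableType d1) (Y : measurableType d2) (R : realType).
Variables (mu : {measure set X -> \bar R}) (sigma : {measure set Y -> \bar R}).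
Variables (U : set X) (Phi : X -> Y) (w : X -> \bar R) (D : set Y).
Hypotheses (mU : measurable U) (mPhi : measurable_fun U Phi) (mw : measurable_fun U w).
Hypotheses (w0 : forall x, (0 <= w x)%E) (wfin : forall x, w x \is a fin_num) (mD : measurable D).
Hypothesis sigmaE : forall E, measurable E -> E `<=` D ->
  sigma E = (\int[mu]_(x in U `&` Phi @^-1` E) w x)%E.
Import HBNNSimple.
Local Open Scope ereal_scope.

Let UD := U `&` Phi @^-1` D.
Let mUD : measurable UD. Proof. exact: mPhi. Qed.
Let mwUD : measurable_fun UD w. Proof. by apply: measurable_funS mw => //; exact: subIsetl. Qed.
Let mPhiUD : measurable_fun UD Phi. Proof. by apply: measurable_funS mPhi => //; exact: subIsetl. Qed.

(** Indicators, finite sums and monotone convergence. As the density formula is given only for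
    measurable parts of [D], the simple functions are restricted to [D] throughout. *)
Lemma ge0_integral_density (h : Y -> \bar R) : measurable_fun D h -> (forall y, 0 <= h y) ->
  \int[sigma]_(y in D) h y = \int[mu]_(x in UD) (h (Phi x) * w x).
Proof.
move=> mh h0; pose g := nnsfun_approx mD mh.
have mg n : measurable_fun UD (fun x => (g n (Phi x))%:E).
  apply/measurable_EFinP; apply: (measurable_comp measurableT) => //.
have -> : \int[sigma]_(y in D) h y = lim (\int[sigma]_(y in D) (EFin \o g n) y @[n --> \oo]).
  have hE y : D y -> h y = lim ((EFin \o g n) y @[n --> \oo]).
    by move=> Dy; apply/esym/cvg_lim => //; exact: cvg_nnsfun_approx.
  under eq_integral => y /[!inE] /hE -> //.
  apply: monotone_convergence => //.
  - move=> n; apply/measurable_EFinP.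
    by apply: (measurable_funS measurableT) => //; exact/measurable_funP.
  - by move=> n x Ex //=; rewrite lee_fin.
  - by move=> x Ex a b ab; rewrite lee_fin; exact/lefP/nd_nnsfun_approx.
have -> : \int[mu]_(x in UD) (h (Phi x) * w x) =
    lim (\int[mu]_(x in UD) ((g n (Phi x))%:E * w x) @[n --> \oo]).
  have hE x : UD x -> h (Phi x) * w x = lim (((g n (Phi x))%:E * w x) @[n --> \oo]).
    move=> [Ux Dx]; apply/esym/cvg_lim => //; apply: cvgeZr => //.
    exact: cvg_nnsfun_approx.
  under eq_integral => x /[!inE] /hE -> //.
  apply: monotone_convergence => //.
  - by move=> n; apply: emeasurable_funM.
  - by move=> n x Ex /=; rewrite mule_ge0 ?lee_fin.
  - by move=> x Ex a b ab/=; rewrite lee_wpmul2r ?lee_fin//; exact/lefP/nd_nnsfun_approx.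
suff suf n : \int[mu]_(x in UD) ((g n (Phi x))%:E * w x) = \int[sigma]_(y in D) (EFin \o g n) y.
  by congr (limn _); apply/funext => n; rewrite suf.
transitivity (\int[sigma]_(x in D)
   (\sum_(y \in range (g n)) (y * \1_(g n @^-1` [set y]) x)%:E)); last first.
  by apply: eq_integral => t tE; rewrite /= fimfunE -fsumEFin.
have indich m r : measurable_fun D (fun x => (r * \1_(g m @^-1` [set r]) x)%:E).
  by apply: (measurable_comp measurableT) => //; exact: measurable_funM.
have indichP m r : measurable_fun UD (fun x => (r * \1_(g m @^-1` [set r]) (Phi x))%:E).
  apply/measurable_EFinP; apply: measurable_funM => //.
  by apply: (measurable_comp measurableT) => //.
rewrite ge0_integral_fsum//; last by move=> m y Ey; exact: nnfun_muleindic_ge0.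
transitivity (\int[mu]_(x in UD) (\sum_(y \in range (g n))
    (y * \1_(g n @^-1` [set y]) (Phi x))%:E * w x)).
  under [RHS]eq_integral => x xE.
    rewrite -ge0_mule_fsuml => [|y]; last exact: nnfun_muleindic_ge0.
    rewrite fsumEFin // -(fimfunE _ (Phi x)); over.
  by [].
rewrite ge0_integral_fsum//; last 2 first.
  - by move=> y; apply: emeasurable_funM.
  - by move=> m y Ey; rewrite mule_ge0 ?nnfun_muleindic_ge0.
apply: eq_fsbigr => r rhn.
under [RHS]eq_integral do rewrite EFinM.
rewrite integralZl_indic_nnsfun => //.
under eq_integral do rewrite EFinM -muleA.
have mi : measurable_fun UD (fun x => (\1_(g n @^-1` [set r]) (Phi x))%:E : \bar R).
  by apply/measurable_EFinP; apply: (measurable_comp measurableT) => //.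
have r0 : (0 <= r)%R by move: rhn; rewrite inE => -[y _ <-].
rewrite ge0_integralZl//.
- under eq_integral do rewrite muleC.
  rewrite integral_indic// sigmaE; last 2 first.
  + by apply: measurableI.
  + exact: subIsetr.
  congr (_ * _); rewrite integral_mkcond [RHS]integral_mkcond; apply: eq_integral => x _.
  rewrite !patchE; case: ifPn => [/set_mem[Ux Dx]|n1]; case: ifPn => [/set_mem[Ux' [gx Dx']]|n2] //.
  + by rewrite indicE (mem_set gx) mule1.
  + rewrite indicE memNset ?mule0// => gx; case/negP: n2; apply: mem_set; split => //.
  + by case/negP: n1; apply: mem_set.
- by apply: emeasurable_funM.
- by move=> x _; rewrite mule_ge0// lee_fin.
Qed.

End Density.

(** * Lebesgue measure under anisotropic dilations *)

Section Scaling.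
Context {R : realType}.
Local Open Scope ereal_scope.

Lemma measurable_mulr (c : R) : measurable_fun setT (fun a : measurableTypeR R => (c * a)%R : measurableTypeR R).
Proof. by apply: measurable_funM => //; exact: measurable_cst. Qed.

Notation RR := (measurableTypeR R).

Lemma lebesgue_scale (c : R) (A : set RR) : (0 < c)%R -> measurable A ->
  lebesgue_measure A = c%:E * lebesgue_measure ((fun a : RR => (c * a)%R : RR) @^-1` A).
Proof.
move=> c0 mA.
rewrite -[RHS]/(pushforward (mscale (NngNum (ltW c0)) (@lebesgue_measure R)) (fun a : RR => (c * a)%R : RR) A).
apply: lebesgue_measure_unique; [exact: measurable_mulr|move=> mf _ [[a b] _ <-]|exact: mA].
rewrite [RHS]/(c%:E * lebesgue_measure ((fun a : RR => (c * a)%R : RR) @^-1` `]a, b])).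
have -> : (fun a : RR => (c * a)%R : RR) @^-1` `]a, b] = [set` `](a / c)%R, (b / c)%R]].
  by apply/seteqP; split => x /=; rewrite !in_itv/= ltr_pdivrMr// ler_pdivlMr// mulrC.
rewrite !lebesgue_measure_itv/= !lte_fin ltr_pM2r ?invr_gt0//.
by case: ifP => _ /=; congr EFin; [field; rewrite gt_eqF|rewrite mulr0].
Qed.

Lemma measurable_wdil p (o : 'I_p -> nat) (r : R) : measurable_fun setT (wdil o r : 'rV[R]_p -> 'rV[R]_p).
Proof.
apply: measurable_rVP => i; under eq_fun do rewrite mxE.
by apply: measurable_funM => //; exact: measurable_rV_coord.
Qed.

(** By uniqueness of the product measure it suffices to look at rectangles: the first coordinate
    contributes its power of r by one-dimensional scaling, the others by induction. *)
Lemma lebesgue_rV_scale p (o : 'I_p -> nat) (r : R) (E : set 'rV[R]_p) : (0 < r)%R -> measurable E ->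
  lebesgue_rV p E = (r ^+ (\sum_j o j)%N)%:E * lebesgue_rV p (wdil o r @^-1` E).
Proof.
move=> r0; elim: p o E => [|p IH] o E mE.
  rewrite big_ord0 expr0 mul1e /=.
  have -> : wdil o r = id by apply/funext => v; apply/rowP => -[].
  by rewrite preimage_id.
have mcE : measurable (@rV_cons R p @^-1` E).
  by rewrite -[X in measurable X]setTI; exact: measurable_rV_cons.
pose o' j := o (lift ord0 j).
have wE (u : RR * 'rV[R]_p) : wdil o r (rV_cons u) = rV_cons ((r ^+ o ord0 * u.1)%R : RR, wdil o' r u.2).
  apply/rowP => j; rewrite mxE; case: (@split_ordP 1 p j) => i ->.
    rewrite /rV_cons !(@row_mxEl R 1 1 p) !mxE; congr (_ ^+ o _ * _)%R.
    by apply: val_inj; rewrite /= (ord1 i).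
  by rewrite /rV_cons !(@row_mxEr R 1 1 p) mxE; congr (_ ^+ o _ * _)%R; exact: val_inj.
pose f (u : RR * 'rV[R]_p) := ((r ^+ o ord0 * u.1)%R : RR, wdil o' r u.2).
have mf : measurable_fun setT f.
  apply: measurable_fun_pair; first exact: (measurableT_comp (measurable_mulr _) measurable_fst).
  exact: (measurableT_comp (measurable_wdil _ _) measurable_snd).
pose c := (r ^+ (\sum_j o j)%N)%R.
have c0 : (0 < c)%R by exact: exprn_gt0.
pose c' := NngNum (ltW c0).
rewrite -[LHS]/((lebesgue_measure \x lebesgue_rV p) (@rV_cons R p @^-1` E)).
transitivity (pushforward (mscale c' (lebesgue_measure \x lebesgue_rV p)) f (@rV_cons R p @^-1` E)); last first.
  rewrite /pushforward /mscale/= /rV_step /pushforward; congr (_ * _).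
  congr product_measure1; apply/funext => u; rewrite /preimage/= wE. by [].
apply: product_measure_unique => // A B mA mB.
rewrite -[LHS]/(c%:E * (lebesgue_measure \x lebesgue_rV p)
  (((fun a : RR => (r ^+ o ord0 * a)%R : RR) @^-1` A) `*` (wdil o' r @^-1` B))).
rewrite product_measure1E//; last 2 first.
- by rewrite -[X in measurable X]setTI; exact: measurable_mulr.
- by rewrite -[X in measurable X]setTI; exact: measurable_wdil.
rewrite -[RHS]/((@lebesgue_measure R) A * lebesgue_rV p B).
rewrite (lebesgue_scale (exprn_gt0 (o ord0) r0) mA) (IH o' _ mB).
rewrite /c big_ord_recl exprD EFinM muleACA; congr (_ * _).
Qed.

Lemma lebesgue_rV_bounded p (C : R) : lebesgue_rV p [set v | forall j, `|v 0%R j| < C]%R < +oo.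
Proof.
elim: p => [|p IH]; first by rewrite /= diracE; case: (_ \in _); rewrite ltry.
have mB : measurable [set v : 'rV[R]_p | forall j, `|v 0%R j| < C]%R.
  have -> : [set v : 'rV[R]_p | forall j, `|v 0%R j| < C]%R = [set v : 'rV[R]_p | forall j, `|v 0 j - (0 : 'rV[R]_p) 0 j| < C]%R.
    by apply/seteqP; split => v H j; have := H j; rewrite mxE subr0.
  exact: measurable_rV_ball.
rewrite /= /rV_step /pushforward.
have -> : @rV_cons R p @^-1` [set v | forall j, `|v 0%R j| < C]%R =
    [set` `](- C)%R, C[] `*` [set v : 'rV[R]_p | forall j, `|v 0%R j| < C]%R.
  apply/seteqP; split => -[a u] /=; rewrite /rV_cons.
    move=> H; split; last first.
      by move=> j; have := H (rshift 1 j); rewrite (@row_mxEr R 1 1 p).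
    by have := H (@lshift 1 p ord0); rewrite (@row_mxEl R 1 1 p) mxE in_itv/= ltr_norml.
  move=> [/=]; rewrite in_itv/= -ltr_norml => Ha Hu j.
  case: (@split_ordP 1 p j) => i ->; first by rewrite (@row_mxEl R 1 1 p) mxE.
  by rewrite (@row_mxEr R 1 1 p).
rewrite product_measure1E//.
have L : lebesgue_measure ([set` `](- C)%R, C[] : set R) \is a fin_num.
  by rewrite lebesgue_measure_itv; case: ifP.
by apply: lte_mul_pinfty => //; exact: measure_ge0.
Qed.

Lemma ge0_integral_wdil p (o : 'I_p -> nat) (r : R) (D : set 'rV[R]_p) (h : 'rV[R]_p -> \bar R) :
  (0 < r)%R -> measurable D -> measurable_fun D h -> (forall v, D v -> 0 <= h v) ->
  \int[lebesgue_rV p]_(u in D) h u =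
  (r ^+ (\sum_j o j)%N)%:E * \int[lebesgue_rV p]_(v in wdil o r @^-1` D) h (wdil o r v).
Proof.
move=> r0 mD mh h0; have mw := measurable_wdil o r.
have mD' : measurable (wdil o r @^-1` D) by rewrite -[X in measurable X]setTI; exact: mw.
have c0 : (0 <= r ^+ (\sum_j o j)%N)%R by rewrite exprn_ge0// ltW.
rewrite -[X in X%:E * _]/((NngNum c0)%:num) -ge0_integral_mscale//; last 2 first.
- by apply: (measurable_comp mD) => //; [move=> _ [v Dv <-]|exact: measurable_funS mw].
- by move=> v; exact: h0.
transitivity (\int[pushforward (mscale (NngNum c0) (lebesgue_rV p)) (wdil o r)]_(u in D) h u).
  apply: eq_measure_integral => A mA AD.
  exact: (lebesgue_rV_scale o r0 mA).
by rewrite ge0_integral_pushforward// => v /set_mem Dv; exact: h0.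
Qed.

End Scaling.

(** * The horizontal measure of a graph *)

Section EuclideanNorm.
Context {R : realType} {p : nat}.
Implicit Types u v : 'rV[R]_p.

Lemma inner_mulmx u v : inner u v = (u *m v^T) 0 0.
Proof. by rewrite /inner mxE; apply: eq_bigr => j _; rewrite mxE. Qed.

Lemma enorm_ge0 u : 0 <= enorm u.
Proof. exact: sqrtr_ge0. Qed.

Lemma enorm_sqr u : enorm u ^+ 2 = \sum_j u 0 j ^+ 2.
Proof. by rewrite sqr_sqrtr// sumr_ge0// => j _; exact: sqr_ge0. Qed.

Lemma enorm_inner u : enorm u ^+ 2 = (u *m u^T) 0 0.
Proof. by rewrite enorm_sqr -inner_mulmx; apply: eq_bigr => j _; rewrite expr2. Qed.

Lemma enormZ c u : enorm (c *: u) = `|c| * enorm u.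
Proof.
rewrite /enorm -sqrtr_sqr -sqrtrM ?sqr_ge0// mulr_sumr; congr Num.sqrt.
by apply: eq_bigr => j _; rewrite mxE exprMn.
Qed.

Lemma enorm_eq0 u : (enorm u == 0) = (u == 0).
Proof.
apply/eqP/eqP => [u0|->]; last by rewrite /enorm big1 ?sqrtr0// => j _; rewrite mxE expr0n.
have := enorm_sqr u; rewrite u0 expr0n => /esym/eqP.
rewrite psumr_eq0 => [/allP H|j _]; last exact: sqr_ge0.
by apply/rowP => j; have /implyP/(_ isT) := H j (mem_index_enum _); rewrite sqrf_eq0 mxE => /eqP.
Qed.

Lemma enorm_gt0 u : u != 0 -> 0 < enorm u.
Proof. by move=> u0; rewrite lt_neqAle enorm_ge0 andbT eq_sym enorm_eq0. Qed.

Lemma cvg_enorm (T : Type) (F : set_system T) (FF : Filter F) (f : T -> 'rV[R]_p) (l : 'rV[R]_p) :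
  (forall j, (fun t => f t 0 j) @ F --> l 0 j) -> (fun t => enorm (f t)) @ F --> enorm l.
Proof.
move=> fl; have H : (fun t => \sum_j f t 0 j ^+ 2) @ F --> \sum_j l 0 j ^+ 2.
  apply: (@cvg_sumr _ _ F) => j _; rewrite expr2; under eq_fun do rewrite expr2.
  exact: (cvgM (fl j) (fl j)).
exact: (cvg_comp _ _ H (@sqrt_continuous R (\sum_j l 0 j ^+ 2))).
Qed.

End EuclideanNorm.

Lemma measurable_fun_rV d (T : measurableType d) (R : realType) p (D : set T) (f : T -> 'rV[R]_p) :
  (forall i, measurable_fun D (fun t => f t 0 i : measurableTypeR R)) ->
  measurable_fun D f.
Proof.
move=> mf mD Y mY.
pose coord (i : 'I_p) (x : 'rV[R]_p) : measurableTypeR R := x 0 i.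
suff : g_sigma_preimage coord `<=` [set A | measurable (D `&` f @^-1` A)] by exact.
apply: smallest_sub.
  split => /=.
  - by rewrite preimage_set0 setI0.
  - move=> A mA; rewrite setTD preimage_setC.
    have -> : D `&` ~` (f @^-1` A) = D `\` (D `&` f @^-1` A).
      by apply/seteqP; split => t /= [Dt nA]; split => //; [case|move=> fA; apply: nA].
    exact: measurableD.
  - by move=> F mF; rewrite preimage_bigcup setI_bigcupr; exact: bigcupT_measurable.
rewrite -bigcup_seq; apply: bigcup_sub => i _ A [B mB <-] /=.
by rewrite setTI; exact: mf.
Qed.

Section Insert.
Context {R : realType} {m : nat} (a : 'I_m.+1).

Definition ins (c : R) (u : 'rV[R]_m) : 'rV[R]_m.+1 :=
  \row_j if unlift a j is Some l then u 0 l else c.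

Lemma ins_lift c u l : ins c u 0 (lift a l) = u 0 l.
Proof. by rewrite mxE liftK. Qed.

Lemma ins_at c u : ins c u 0 a = c.
Proof. by rewrite mxE unlift_none. Qed.

Lemma col'_ins c u : col' a (ins c u) = u.
Proof. by apply/rowP => l; rewrite mxE ins_lift. Qed.

Lemma ins_col' (y : 'rV[R]_m.+1) : ins (y 0 a) (col' a y) = y.
Proof. by apply/rowP => j; case: (unliftP a j) => [l|] ->; rewrite ?ins_lift ?ins_at ?mxE. Qed.

Lemma sum_ins (F : 'I_m.+1 -> R) : \sum_j F j = F a + \sum_(l < m) F (lift a l).
Proof. by rewrite (bigD1_ord a). Qed.

(* The gradient of [y_a - psi], as a row; [wvec] below lists its derivatives
   along the frame. *)
Definition gvec (psi : 'rV[R]_m -> R) u : 'rV[R]_m.+1 := ins 1 (- grad psi u).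

Definition graph_jac (psi : 'rV[R]_m -> R) u : 'M[R]_(m, m.+1) :=
  \matrix_(l, j) ins (partial l psi u) (basis_vec l) 0 j.

Definition gsel : 'M[R]_(m, m.+1) := \matrix_(l, j) (j == lift a l)%:R.

Lemma graph_jac_gvec psi u : graph_jac psi u *m (gvec psi u)^T = 0.
Proof.
apply/matrixP => l i; rewrite !mxE sum_ins !mxE unlift_none mulr1.
rewrite (bigD1 l)//= !mxE liftK !mxE !eqxx mul1r big1 ?addr0 ?subrr// => l' ll'.
by rewrite !mxE liftK !mxE (negbTE ll') mul0r.
Qed.

Lemma graph_jac_sel psi u : graph_jac psi u *m gsel^T = 1%:M.
Proof.
apply/matrixP => l i; rewrite !mxE sum_ins !mxE unlift_none.
rewrite (negbTE (neq_lift a i)) mulr0 add0r (bigD1 i)//= !mxE liftK !mxE !eqxx /= mulr1.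
rewrite big1 ?addr0 1?eq_sym// => l' ll'; rewrite !mxE (inj_eq lift_inj) (negbTE ll') mulr0 //.
Qed.

Lemma gsel_sel : gsel *m gsel^T = 1%:M.
Proof.
apply/matrixP => l i; rewrite !mxE (bigD1 (lift a i))//= !mxE eqxx mulr1.
rewrite (inj_eq lift_inj) eq_sym big1 ?addr0// => j ji; by rewrite !mxE (negbTE ji) mulr0.
Qed.

Lemma graph_jac_row_free psi u (M : 'M[R]_m.+1) : M \in unitmx -> row_free (graph_jac psi u *m M).
Proof.
move=> Mu; apply/row_freeP; exists (invmx M *m gsel^T).
by rewrite mulmxA mulmxK// graph_jac_sel.
Qed.

Lemma gvec_neq0 psi u : gvec psi u != 0.
Proof. by apply/eqP => /rowP/(_ a)/eqP; rewrite ins_at mxE oner_eq0. Qed.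

(** Stack [w] on [J] into a square matrix [K]. As [w] is orthogonal to the rows of [J], (det K)^2 =
    |w|^2 det(J J^T). Pairing [K] with the matrix of [g] and the coordinate rows [gsel], whose
    determinant c has square 1, gives c det K = |w|^2; squaring and dividing leaves the claim. *)
Lemma det_gram_graph psi u (F : 'M[R]_m.+1) : \det F = 1 ->
  let J := graph_jac psi u *m invmx F in
  \det (J *m J^T) = enorm (gvec psi u *m F^T) ^+ 2.
Proof.
move=> F1 J; have Fu : F \in unitmx by rewrite unitmxE F1 unitr1.
set g := gvec psi u; set w := g *m F^T.
pose Jg := graph_jac psi u.
have Jw : J *m w^T = 0.
  by rewrite /J /w trmx_mul trmxK mulmxA mulmxKV// graph_jac_gvec.
have wJ : w *m J^T = 0 by rewrite -[LHS]trmxK trmx_mul trmxK Jw trmx0.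
have sc (A : 'M[R]_1) : \det A = A 0 0 by rewrite {1}[A]mx11_scalar det_scalar1.
pose K : 'M[R]_(1 + m) := col_mx w J.
have K2 : \det K ^+ 2 = enorm w ^+ 2 * \det (J *m J^T).
  rewrite expr2 -{2}det_tr -det_mulmx /K tr_col_mx mul_col_row wJ Jw det_ublock.
  by rewrite sc enorm_inner.
pose c := \det (col_mx g gsel : 'M[R]_(1 + m)).
have c2 : c ^+ 2 = 1.
  (* [P] lists basis vectors, so P P^T = 1, while the product of the other matrix with P^T is
     triangular with determinant 1. *)
  pose e : 'rV[R]_m.+1 := basis_vec a.
  pose P : 'M[R]_(1 + m) := col_mx e gsel.
  have ge : g *m e^T = 1%:M.
    apply/matrixP => i j; rewrite !ord1 -inner_mulmx /inner (bigD1 a)//= ins_at !mxE !eqxx mul1r.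
    by rewrite big1 ?addr0// => l la; rewrite [e 0 l]mxE (negbTE la) andbF mulr0.
  have se : gsel *m e^T = 0.
    apply/matrixP => l i; rewrite !mxE big1// => j _; rewrite !mxE.
    case: (eqVneq j a) => [->|_]; last by rewrite andbF mulr0.
    by rewrite (negbTE (neq_lift a l)) mul0r.
  have ee : e *m e^T = 1%:M.
    apply/matrixP => i j; rewrite !ord1 -inner_mulmx /inner (bigD1 a)//= !mxE !eqxx mul1r.
    by rewrite big1 ?addr0// => l la; rewrite !mxE (negbTE la) andbF mulr0.
  have P2 : \det P ^+ 2 = 1.
    rewrite expr2 -{2}det_tr -det_mulmx /P tr_col_mx mul_col_row ee se gsel_sel.
    by rewrite -[e *m _]trmxK trmx_mul trmxK se trmx0 det_ublock !det1 mulr1.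
  have cP : c * \det P = 1.
    by rewrite -(det_tr P) -det_mulmx /P tr_col_mx mul_col_row ge se gsel_sel det_ublock !det1 mulr1.
  by rewrite -[LHS]mulr1 -P2 -exprMn cP expr1n.
have KF : \det K = \det (col_mx (w *m F) Jg : 'M[R]_(1 + m)).
  rewrite -[LHS]mulr1 -F1 -det_mulmx; congr (\det _).
  by rewrite /K mul_col_mx /J mulmxKV.
have Kc : \det K * c = enorm w ^+ 2.
  rewrite KF -det_tr mulrC /c -det_mulmx tr_col_mx mul_col_row.
  have -> : gsel *m Jg^T = 1%:M by rewrite -[LHS]trmxK trmx_mul trmxK graph_jac_sel trmx1.
  have -> : g *m Jg^T = 0 by rewrite -[LHS]trmxK trmx_mul trmxK graph_jac_gvec trmx0.
  rewrite det_lblock det1 mulr1 sc.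
  by rewrite enorm_inner /w !trmx_mul !trmxK !mulmxA.
have w0 : enorm w != 0.
  rewrite enorm_eq0; apply/eqP => w0; have : g = 0.
    by rewrite -(mulmxK (_ : F^T \in unitmx) g) ?unitmx_tr// -/w w0 mul0mx.
  by move/eqP; rewrite (negbTE (gvec_neq0 _ _)).
have : enorm w ^+ 2 * \det (J *m J^T) = enorm w ^+ 2 * enorm w ^+ 2.
  by rewrite -K2 -[LHS]mulr1 -c2 -exprMn Kc expr2.
by apply: mulfI; rewrite expf_neq0.
Qed.

End Insert.

Lemma deriv0_right (R : realType) (h : R -> R) c : is_derive (0 : R) (1 : R) h c ->
  (\forall t \near 0^'+, h t = h 0) -> c = 0.
Proof.
move=> [d <-] h0.
have C := cvg_dnbhs_at_right (d : _ @ 0^' --> 'D_1 h 0).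
have C0 : (fun t : R => t^-1 *: ((h \o shift 0) (t *: 1) - h 0)) @ 0^'+ --> (0 : R).
  apply: cvg_near_cst; near=> t; rewrite /= addr0 /GRing.scale/= mulr1.
  by rewrite (_ : h t = h 0) ?subrr ?mulr0//; near: t.
exact: (cvg_unique _ C C0).
Unshelve. all: by end_near. Qed.

#[local] Opaque mulG frame bch.

Section GraphFormula.
Context {R : realType} {m k : nat} (G : carnot_group R m.+1 k).
Notation V := 'rV[R]_m.+1.
Variable rho : V -> V -> R.
Hypothesis hrho : homogeneous_distance G rho.
Variable sigma : {measure set V -> \bar R}.
Hypothesis hsigma : riemannian_surface_measure G sigma.
Variables (a : 'I_m.+1) (psi : 'rV[R]_m -> R) (U : set 'rV[R]_m).
Hypotheses (oU : open U) (psiU : class_C 1 U psi).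
Notation N := (rho 0).
Notation op := (mulG G).

Definition gr (u : 'rV[R]_m) : V := ins a (psi u) u.

Definition wvec (u : 'rV[R]_m) : V := gvec a psi u *m (frame G (gr u))^T.

Lemma gr_C1 : class_C1_map U gr.
Proof.
move=> j; case: (unliftP a j) => [l|] ->.
  by under eq_fun do rewrite ins_lift; exact: class_C1_coord.
by have -> : (fun u => gr u 0 a) = psi by apply/funext => u; rewrite ins_at.
Qed.

Lemma gr_jacobian u : U u -> Defs.jacobian gr u = graph_jac a psi u.
Proof.
move=> Uu; apply/matrixP => l j; rewrite [LHS]mxE [RHS]mxE /partial.
case: (unliftP a j) => [i|] ->; last first.
  rewrite ins_at; congr ('D_ _ _ _); apply/funext => v; exact: ins_at.
rewrite ins_lift (_ : (fun v => gr v 0 (lift a i)) = (fun v => v 0 i)); last first.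
  by apply/funext => v; exact: ins_lift.
apply: derive_val; apply: is_derive_line0.
have D := is_derive_line0V (is_derive_id u (basis_vec l)).
exact: (is_derive_coord i D).
Qed.

Lemma gr_continuous u : U u -> {for u, continuous gr}.
Proof. exact: class_C1_map_continuous gr_C1. Qed.

Lemma wvec_neq0 u : wvec u != 0.
Proof.
apply/eqP => w0; have : gvec a psi u = 0.
  by rewrite -(mulmxK (_ : (frame G (gr u))^T \in unitmx) (gvec a psi u)) ?unitmx_tr ?frame_unit// -/(wvec u) w0 mul0mx.
by move/eqP; rewrite (negbTE (gvec_neq0 _ _ _)).
Qed.

Lemma wvec_def u : wvec u = gvec a psi u *m (frame G (gr u))^T.
Proof. by []. Qed.

Lemma wvecE v j : wvec v 0 j = \sum_l gvec a psi v 0 l * frame G (gr v) j l.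
Proof. by rewrite mxE; apply: eq_bigr => l _; rewrite [_^T _ _]mxE. Qed.

Lemma gr_at u : gr u 0 a = psi u.
Proof. exact: ins_at. Qed.

Lemma gr_lift u l : gr u 0 (lift a l) = u 0 l.
Proof. exact: ins_lift. Qed.

Lemma col'_gr u : col' a (gr u) = u.
Proof. exact: col'_ins. Qed.

Lemma gr_col' (y : V) : y 0 a = psi (col' a y) -> gr (col' a y) = y.
Proof. by move=> E; rewrite /gr -E ins_col'. Qed.

#[local] Opaque wvec gr.

Lemma wvec_cvg u j : U u -> (fun v => wvec v 0 j) @ nbhs u --> wvec u 0 j.
Proof.
move=> Uu.
have EF : (fun v => wvec v 0 j) = (fun v => \sum_l gvec a psi v 0 l * frame G (gr v) j l).
  by apply/funext => v; exact: wvecE.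
rewrite EF wvecE.
apply: (@cvg_sumr _ _ (nbhs u)) => l _.
have H2 : (fun v => frame G (gr v) j l) @ nbhs u --> frame G (gr u) j l.
  exact: (cvg_comp _ _ (gr_continuous Uu) (@frame_continuous _ _ _ G j l (gr u))).
suff H1 : (fun v => gvec a psi v 0 l) @ nbhs u --> gvec a psi u 0 l by exact: (cvgM H1 H2).
case: (unliftP a l) => [i|] ->; last first.
  rewrite ins_at (_ : (fun v => gvec a psi v 0 a) = fun=> 1); first exact: cvg_cst.
  by apply/funext => v; rewrite ins_at.
rewrite ins_lift (_ : (fun v => gvec a psi v 0 (lift a i)) = (fun v => - partial i psi v)); last first.
  by apply/funext => v; rewrite ins_lift !mxE.
by rewrite !mxE; apply: cvgN; exact: (class_C1_contp psiU Uu).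
Qed.

Lemma enorm_wvec_cvg u : U u -> (fun v => enorm (wvec v)) @ nbhs u --> enorm (wvec u).
Proof. by move=> Uu; apply: (@cvg_enorm _ _ _ _ (nbhs_filter u) wvec (wvec u)) => j; exact: wvec_cvg. Qed.

Lemma hproj_wvec_cvg u : U u ->
  (fun v => enorm (hproj G (wvec v))) @ nbhs u --> enorm (hproj G (wvec u)).
Proof.
move=> Uu; apply: (@cvg_enorm _ _ _ _ (nbhs_filter u) (fun v => hproj G (wvec v)) (hproj G (wvec u))) => j.
have E v : hproj G (wvec v) 0 j = if ord G j == 1%N then wvec v 0 j else 0 by rewrite mxE.
have EF : (fun v => hproj G (wvec v) 0 j) = (fun v => if ord G j == 1%N then wvec v 0 j else 0).
  by apply/funext => v; exact: E.
rewrite EF E.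
by case: eqP => _; [exact: wvec_cvg|exact: cvg_cst].
Qed.

Variables (S : set V) (x : V) (r : R).
Hypothesis SP : forall y, N y < r -> S (op x y) <-> (U (col' a y) /\ y 0 a = psi (col' a y)).

Let Phi u := op x (gr u).

Let Phi_C1 : class_C1_map U Phi.
Proof. by apply: class_C1_map_comp oU openT _ gr_C1 (class_C1_opl G x) => u _. Qed.

Let Phi_jacobian u : U u -> Defs.jacobian Phi u = graph_jac a psi u *m Defs.jacobian (op x) (gr u).
Proof.
move=> Uu; apply/matrixP => l j; rewrite [LHS]mxE /partial -gr_jacobian//.
apply: derive_val; apply: is_derive_line0.
have D1 : is_derive (0 : R) (1 : R) (fun s : R => gr (u + s *: basis_vec l)) (row l (Defs.jacobian gr u)).
  apply: is_derive_rV => i; rewrite !mxE.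
  exact: (is_derive_line0V (is_derive_partial (class_C1_derivable (gr_C1 i) Uu))).
have := is_derive_coord j (op_curve G x D1).
by rewrite scale0r addr0 -row_mul mxE.
Qed.

Let J u := graph_jac a psi u *m invmx (frame G (gr u)).

Let gramE u : U u -> gram G Phi u = J u *m (J u)^T.
Proof.
move=> Uu; suff E : graph_jac a psi u *m Defs.jacobian (op x) (gr u) *m invmx (frame G (Phi u)) = J u.
  by rewrite /gram (Phi_jacobian Uu) E.
rewrite /J /Phi frame_op -mulmxA; congr (_ *m _).
have := frame_unit G (gr u); have := jacobian_op0 G x (gr u).
move: (frame G (gr u)) (Defs.jacobian (op x) (gr u)) => F D Du Fu.
have FJu : F *m D \in unitmx by rewrite unitmx_mul Fu Du.
by rewrite -[RHS]mulmx1 -(mulmxV FJu) !mulmxA mulVmx// mul1mx.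
Qed.

Let sqrt_gram u : U u -> Num.sqrt (\det (gram G Phi u)) = enorm (wvec u).
Proof.
move=> Uu; rewrite gramE// /J (det_gram_graph _ _ _ (det_frame G (gr u))).
by rewrite sqrtr_sqr ger0_norm// enorm_ge0.
Qed.

Let Phi_inj : {in U &, injective Phi}.
Proof.
move=> u v _ _ /(can_inj (opK G x)) E.
by rewrite -(col'_gr u) -(col'_gr v) E.
Qed.

Let nP u : U u -> N (gr u) < r -> S (Phi u).
Proof. by move=> Uu Nu; apply/SP => //; rewrite col'_gr gr_at. Qed.

(** Along a curve in [S], translated back to 0, the function y_a - psi vanishes. The curves of
    [tangent] lie in [S] only for small t > 0, so the derivative at 0 is read off from the right. *)
Let tangent_gvec u v : U u -> N (gr u) < r -> tangent S (Phi u) v ->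
  (gvec a psi u *m (v *m Defs.jacobian (op (- x)) (Phi u))^T) 0 0 = 0.
Proof.
move=> Uu Nu [gam [g0 dg Sg]].
have := op_curve G (- x) dg; rewrite g0; set v' := _ *m _ => dd.
pose d s := op (- x) (gam s).
have d0 : d 0 = gr u by rewrite /d g0 opK.
have cd : {for 0, continuous d}.
  by apply: differentiable_continuous; apply/derivable1_diffP; have [] := dd.
have ND : \forall t \near 0^'+, N (d t) < r.
  have C := cvg_comp _ _ cd (@N_continuous _ _ _ G rho hrho (d 0)).
  have C' := cvg_at_right_filter C; apply: (cvgr_lt _ C'); by rewrite d0.
have D1 : is_derive (0 : R) (1 : R) (fun t => col' a (d t)) (col' a v').
  apply: is_derive_rV => l; rewrite mxE.
  have -> : (fun s => col' a (d s) 0 l) = (fun s => d s 0 (lift a l)).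
    by apply/funext => s; rewrite mxE.
  exact: (is_derive_coord (lift a l) dd).
have Ud : U (col' a (d 0)) by rewrite d0 col'_gr.
have D2 := is_derive_curve oU psiU Ud D1.
have D3 := is_deriveB (is_derive_coord a dd) D2.
have H0 : \forall t \near 0^'+, ((fun s => d s 0 a) - (fun s => psi (col' a (d s)))) t =
   ((fun s => d s 0 a) - (fun s => psi (col' a (d s)))) 0.
  near=> t; rewrite !fctE d0 gr_at col'_gr subrr.
  have Nt : N (d t) < r by near: t.
  have St : S (op x (d t)) by rewrite /d opVK; near: t.
  by have [_ ->] := (SP Nt).1 St; rewrite subrr.
rewrite -(deriv0_right D3 H0) -inner_mulmx /inner (sum_ins a) ins_at mul1r /lin_form.
rewrite (_ : \sum_(l < m) _ = - \sum_(l < m) col' a v' 0 l * partial l psi (col' a (d 0))) //.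
rewrite -sumrN; apply: eq_bigr => l _.
by rewrite ins_lift !mxE d0 col'_gr mulNr mulrC.
Unshelve. all: by end_near. Qed.

Let jac_inv u : Defs.jacobian (op x) (gr u) *m Defs.jacobian (op (- x)) (Phi u) = 1%:M.
Proof. exact: jacobian_opK. Qed.

Let frame_compE u v : frame_comp G (Phi u) v =
  (v *m Defs.jacobian (op (- x)) (Phi u)) *m invmx (frame G (gr u)).
Proof.
rewrite /frame_comp /Phi frame_op -mulmxA; congr (_ *m _).
have := frame_unit G (gr u); have := jac_inv u.
move: (frame G (gr u)) (Defs.jacobian (op x) (gr u)) (Defs.jacobian (op (- x)) (Phi u)) => F D D' DD Fu.
have FJu : F *m D \in unitmx by rewrite unitmx_mul Fu (mulmx1_unit DD).1.
rewrite -[RHS]mulmx1 -(mulmxV FJu) !mulmxA mulmxKV//.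
by rewrite (mulmx1C DD) mul1mx.
Qed.

Let tangent_graph u l : U u -> N (gr u) < r ->
  tangent S (Phi u) (row l (graph_jac a psi u) *m Defs.jacobian (op x) (gr u)).
Proof.
move=> Uu Nu; exists (fun s => Phi (u + s *: basis_vec l)); split.
- by rewrite scale0r addr0.
- rewrite -gr_jacobian//.
  have D1 : is_derive (0 : R) (1 : R) (fun s : R => gr (u + s *: basis_vec l)) (row l (Defs.jacobian gr u)).
    apply: is_derive_rV => i; rewrite !mxE.
    exact: (is_derive_line0V (is_derive_partial (class_C1_derivable (gr_C1 i) Uu))).
  by have := op_curve G x D1; rewrite scale0r addr0.
- have c0 : (fun s : R => u + s *: basis_vec l) @ nbhs (0 : R) --> u.
    rewrite -[X in _ --> X]addr0 -(scale0r (basis_vec l)); apply: cvgD; first exact: cvg_cst.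
    by apply: cvgZl; exact: cvg_id.
  have H1 : \forall s \near 0^'+, U (u + s *: basis_vec l).
    by apply: (cvg_at_right_filter c0); exact: open_nbhs_nbhs.
  have H2 : \forall s \near 0^'+, N (gr (u + s *: basis_vec l)) < r.
    have C := cvg_comp _ _ c0 (cvg_comp _ _ (gr_continuous Uu) (@N_continuous _ _ _ G rho hrho (gr u))).
    have C' := cvg_at_right_filter C; exact: (cvgr_lt _ C').
  near=> s; apply: nP; by near: s.
Unshelve. all: by end_near. Qed.

(** The translated coordinate curves of the graph are tangent, and orthogonality to them leaves only
    the multiples of [gvec]; a unit normal is thus determined up to sign. *)
Lemma unit_normal_graph u nu : U u -> N (gr u) < r -> is_unit_normal G S (Phi u) nu ->
  exists2 c : R, nu = c *: wvec u & `|c| * enorm (wvec u) = 1.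
Proof.
move=> Uu Nu [nu1 nuT].
set F := frame G (gr u); have Fu : F \in unitmx := frame_unit G (gr u).
pose b := nu *m (invmx F)^T.
have bE : nu = b *m F^T by rewrite /b -mulmxA -trmx_mul mulmxV// trmx1 mulmx1.
have bJ l : (b *m (row l (graph_jac a psi u))^T) 0 0 = 0.
  have := nuT _ (tangent_graph l Uu Nu).
  rewrite frame_compE -!mulmxA (mulmxA (Defs.jacobian _ _)) jac_inv mul1mx.
  by rewrite inner_mulmx trmx_mul mulmxA -/b.
clearbody b; have b0 l : b 0 (lift a l) = b 0 a * gvec a psi u 0 (lift a l).
  have := bJ l; rewrite -inner_mulmx /inner (sum_ins a).
  rewrite !mxE unlift_none (bigD1 l)//= !mxE !liftK !mxE !eqxx mulr1 big1 ?addr0.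
    by move=> /eqP; rewrite addrC addr_eq0 => /eqP ->; rewrite mulrN.
  by move=> i il; rewrite !mxE liftK !mxE (negbTE il) mulr0.
have bg : b = b 0 a *: gvec a psi u.
  apply/rowP => j; rewrite [RHS]mxE; case: (unliftP a j) => [l|] ->; first exact: b0.
  by rewrite ins_at mulr1.
have nuE : nu = b 0 a *: wvec u by rewrite wvec_def bE {1}bg -scalemxAl.
by exists (b 0 a) => //; rewrite -enormZ -nuE.
Qed.

Lemma unit_normal_exists u : U u -> N (gr u) < r ->
  is_unit_normal G S (Phi u) ((enorm (wvec u))^-1 *: wvec u).
Proof.
move=> Uu Nu; split.
  rewrite enormZ ger0_norm ?invr_ge0 ?enorm_ge0// mulVf// gt_eqF// enorm_gt0//.
  exact: wvec_neq0.
move=> v /(tangent_gvec Uu Nu) H.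
rewrite inner_mulmx frame_compE -scalemxAl mxE trmx_mul mulmxA.
have Fu : frame G (gr u) \in unitmx := frame_unit G (gr u).
rewrite wvec_def -(mulmxA (gvec a psi u)) -trmx_mul mulVmx//.
by rewrite trmx1 mulmx1 H mulr0.
Qed.

(** [unit_normal] is a choice between two opposite vectors, by the two lemmas above; the norm of its
    horizontal part does not see the sign. *)
Lemma hnormal_graph u : U u -> N (gr u) < r ->
  enorm (hnormal G S (Phi u)) = enorm (hproj G (wvec u)) / enorm (wvec u).
Proof.
move=> Uu Nu; have [c nuE c1] : exists2 c : R, unit_normal G S (Phi u) = c *: wvec u & `|c| * enorm (wvec u) = 1.
  apply: (unit_normal_graph Uu Nu); rewrite /unit_normal.
  exact: (xgetPex 0 (ex_intro _ _ (unit_normal_exists Uu Nu))).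
rewrite /hnormal nuE.
have -> : hproj G (c *: wvec u) = c *: hproj G (wvec u).
  by apply/rowP => j; rewrite !mxE; case: ifP; rewrite ?mulr0.
rewrite enormZ mulrC; congr (_ * _); apply: (mulIf (_ : enorm (wvec u) != 0)).
  by rewrite gt_eqF// enorm_gt0// wvec_neq0.
by rewrite c1 mulVf// gt_eqF// enorm_gt0// wvec_neq0.
Qed.

Let back_continuous : continuous (op (- x)).
Proof. by move=> y; exact: (class_C1_map_continuous (class_C1_opl G (- x)) (I : setT y)). Qed.

Let col'_continuous : continuous (fun y : V => col' a y : 'rV[R]_m).
Proof.
move=> y; apply: (@cvg_rV _ _ (nbhs y)) => l; rewrite mxE.
have -> : (fun z : V => col' a z 0 l) = (fun z => z 0 (lift a l)).
  by apply/funext => z; rewrite mxE.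
exact: coord_continuous.
Qed.

Let base y := col' a (op (- x) y) : 'rV[R]_m.

Let base_continuous : continuous base.
Proof. by move=> y; exact: (cvg_comp _ _ (@back_continuous y) (@col'_continuous _)). Qed.

Let O := [set y | U (base y)].

Let oO : open O.
Proof. by apply: open_comp oU => y _; exact: base_continuous. Qed.

Variable s : R.
Hypothesis sr : s <= r.

Let D := S `&` rball rho x s.

Let DE : D = [set y | (O y /\ op (- x) y 0 a - psi (base y) = 0) /\ rho x y < s].
Proof.
apply/seteqP; split => y /=.
  move=> [Sy ys]; split => //.
  have Ny : N (op (- x) y) < r by rewrite -(rhoE hrho) (lt_le_trans _ sr).
  have [Uy E] : U (base y) /\ op (- x) y 0 a = psi (base y) by apply/(SP Ny); rewrite opVK.
  by split => //; rewrite E subrr.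
move=> [[Oy /eqP]]; rewrite subr_eq0 => /eqP E ys; split => //.
have Ny : N (op (- x) y) < r by rewrite -(rhoE hrho) (lt_le_trans _ sr).
by rewrite -(opVK G x y); apply/(SP Ny).
Qed.

Let mD : measurable D.
Proof.
rewrite DE.
have -> : [set y | (O y /\ op (- x) y 0 a - psi (base y) = 0) /\ rho x y < s] =
  (O `&` (fun y => op (- x) y 0 a - psi (base y)) @^-1` [set 0]) `&` [set y | rho x y < s] by [].
apply: measurableI.
  apply: (measurable_continuous oO) => //; last first.
    exact: measurable_open.
  move=> y Oy; have c1 := class_C_cont (class_C1_opl G (- x) a) (I : setT y).
  have c2 := cvg_comp _ _ (@base_continuous y) (class_C_cont psiU Oy).
  exact: (cvgB c1 c2).
apply: measurable_open.
have -> : [set y | rho x y < s] = (fun y => N (op (- x) y)) @^-1` [set t | t < s].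
  by apply/seteqP; split => y /=; rewrite -(rhoE hrho).
apply: open_comp; last exact: open_lt.
by move=> y _; exact: (cvg_comp _ _ (@back_continuous y) (@N_continuous _ _ _ G rho hrho _)).
Qed.

Let Phi_preim : U `&` Phi @^-1` D = U `&` [set u | N (gr u) < s].
Proof.
apply/seteqP; split => u [Uu] /=.
  by move=> [_]; rewrite /rball/= /Phi (N_op hrho) => ?; split.
move=> Nu; split => //; split; last by rewrite /rball/= /Phi (N_op hrho).
by apply: nP => //; exact: (lt_le_trans Nu).
Qed.

Lemma graph_formula : sigma_H G sigma S (rball rho x s) =
  (\int[lebesgue_rV m]_(u in U `&` [set u | (N (gr u) < s)%R]) (enorm (hproj G (wvec u)))%:E)%E.
Proof.
have mU : measurable U := measurable_open oU.
have mPhi : measurable_fun U Phi.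
  apply: measurable_fun_rV => i; apply: measurable_continuous => // u Uu.
  exact: (class_C_cont (Phi_C1 i) Uu).
have mw : measurable_fun U (fun u => (Num.sqrt (\det (gram G Phi u)))%:E).
  apply/measurable_EFinP; apply: (eq_measurable_fun (fun u => enorm (wvec u))).
    by move=> u /set_mem Uu; rewrite sqrt_gram.
  by apply: measurable_continuous => // u Uu; exact: enorm_wvec_cvg.
(* [D] lies in the image of the parametrisation, so the area formula holds for each of its
   measurable parts. *)
have sE E : measurable E -> E `<=` D -> sigma E =
    (\int[lebesgue_rV m]_(u in U `&` Phi @^-1` E) (Num.sqrt (\det (gram G Phi u)))%:E)%E.
  move=> mE ED; apply: (hsigma oU Phi_C1 Phi_inj _ mE).
    by move=> u Uu; rewrite Phi_jacobian//; apply: graph_jac_row_free; exact: jacobian_op0.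
  move=> y /ED; rewrite DE => -[[Oy /eqP]]; rewrite subr_eq0 => /eqP E' _.
  by exists (base y) => //; rewrite /Phi /base gr_col'// opVK.
have mh : measurable_fun D (fun y => (enorm (hnormal G S y))%:E).
  apply/measurable_EFinP.
  apply: (eq_measurable_fun (fun y => enorm (hproj G (wvec (base y))) / enorm (wvec (base y)))).
    move=> y /set_mem Dy; move: (Dy); rewrite DE => -[[Oy /eqP]]; rewrite subr_eq0 => /eqP E ys.
    have yE : y = Phi (base y) by rewrite /Phi /base gr_col'// opVK.
    rewrite {3}yE hnormal_graph// -(N_op hrho x) -/(Phi (base y)) -yE.
    exact: (lt_le_trans ys).
  apply: (@measurable_funS _ _ _ _ O) => //; first exact: measurable_open.
    by rewrite DE => y [[]].
  apply: measurable_continuous => // y Oy.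
  have c1 : (fun z => enorm (hproj G (wvec (base z)))) @ nbhs y --> enorm (hproj G (wvec (base y))).
    exact: (cvg_comp _ _ (@base_continuous y) (hproj_wvec_cvg Oy)).
  have c2 : (fun z => enorm (wvec (base z))) @ nbhs y --> enorm (wvec (base y)).
    exact: (cvg_comp _ _ (@base_continuous y) (enorm_wvec_cvg Oy)).
  have nz : enorm (wvec (base y)) != 0 by rewrite gt_eqF// enorm_gt0// wvec_neq0.
  exact: (cvgM c1 (cvgV nz c2)).
rewrite /sigma_H -/D (ge0_integral_density mU mPhi mw _ _ mD sE mh) ?Phi_preim//; last first.
  by move=> y; rewrite lee_fin enorm_ge0.
apply: eq_integral => u /set_mem[Uu Nu].
rewrite -EFinM sqrt_gram// hnormal_graph//; last exact: (lt_le_trans Nu).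
by rewrite divfK// gt_eqF// enorm_gt0// wvec_neq0.
Qed.

End GraphFormula.

(** * Rescaled graphs *)

Lemma continuous_bounded (R : realType) p (f : 'rV[R]_p -> R) (C : R) : continuous f ->
  exists2 M : R, 0 < M & forall v, `|v| <= C -> `|f v| <= M.
Proof.
move=> cf; have [C0|C0] := leP 0 C; last first.
  by exists 1 => // v vC; have := le_trans (normr_ge0 v) vC; rewrite leNgt C0.
pose K := [set v : 'rV[R]_p | `|v| <= C].
have cK : compact K.
  apply: bounded_closed_compact.
    by exists C; split => [|M CM v /= vC]; [exact: num_real|exact: (le_trans vC (ltW CM))].
  have -> : K = (fun v : 'rV[R]_p => `|v|) @^-1` [set t | t <= C] by [].
  by apply: preimage_closed; [move=> v _; exact: norm_continuous|exact: closed_le].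
have K0 : K !=set0 by exists 0; rewrite /K/= normr0.
have cnf : continuous (fun v => `|f v|).
  by move=> v; exact: (cvg_comp _ _ (cf v) (@norm_continuous _ _ (f v))).
have [c cK' cmax] := @EVT_max_rV _ _ (fun v => `|f v|) K K0 cK (continuous_subspaceT cnf).
exists (`|f c| + 1) => [|v vC]; first by rewrite ltr_wpDl.
by apply: (le_trans (cmax v _)); [rewrite inE|rewrite lerDl].
Qed.

Lemma integral_rescale (R : realType) p (o : 'I_p -> nat) (r : R) (D : set 'rV[R]_p)
    (h g : 'rV[R]_p -> R) (c q : nat) : 0 < r -> q = (\sum_j o j + c)%N ->
  measurable D -> measurable_fun D (EFin \o h) -> measurable_fun (wdil o r @^-1` D) (EFin \o g) ->
  (forall v, 0 <= h v) -> (forall v, 0 <= g v) -> (forall v, h (wdil o r v) = r ^+ c * g v) ->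
  (\int[lebesgue_rV p]_(u in D) (h u)%:E * ((r ^+ q)^-1)%:E =
   \int[lebesgue_rV p]_(v in wdil o r @^-1` D) (g v)%:E)%E.
Proof.
move=> r0 -> mD mh mg h0 g0 hg.
have mD' : measurable (wdil o r @^-1` D).
  by rewrite -[X in measurable X]setTI; apply: measurable_wdil.
rewrite (ge0_integral_wdil o r0)//; last by move=> v _; rewrite lee_fin.
rewrite (eq_integral (fun v => (r ^+ c)%:E * (g v)%:E)%E); last first.
  by move=> v _; rewrite hg EFinM.
rewrite ge0_integralZl//; last 2 first.
- by move=> v _; rewrite lee_fin.
- by rewrite lee_fin exprn_ge0// ltW.
rewrite muleA [LHS]muleAC -!EFinM -exprD.
by rewrite mulfV ?mul1e// expf_neq0// gt_eqF.
Qed.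

(** Dominated convergence is applied along sequences. All functions are extended by 0 to a fixed box
    of finite measure, where a constant dominates; on the null set [E] membership in the domains may
    oscillate. *)
Lemma integral_cvg_dominated (R : realType) p (D : R -> set 'rV[R]_p) (D0 E : set 'rV[R]_p)
    (g : R -> 'rV[R]_p -> R) (g0 : 'rV[R]_p -> R) (C M : R) :
  (forall r, 0 < r -> measurable (D r)) ->
  (forall r, 0 < r -> measurable_fun (D r) (EFin \o g r)) ->
  measurable D0 -> measurable_fun D0 (EFin \o g0) ->
  measurable E -> lebesgue_rV p E = 0%E ->
  (forall v, D0 v -> forall j, `|v 0 j| < C) ->
  (\forall r \near 0^'+, forall v, D r v -> (forall j, `|v 0 j| < C) /\ `|g r v| <= M) ->
  (forall v, ~ E v -> D0 v -> (\forall r \near 0^'+, D r v) /\ g r v @[r --> 0^'+] --> g0 v) ->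
  (forall v, ~ E v -> ~ D0 v -> \forall r \near 0^'+, ~ D r v) ->
  (\int[lebesgue_rV p]_(v in D0) (g0 v)%:E)%E \is a fin_num /\
  (fun r => \int[lebesgue_rV p]_(v in D r) (g r v)%:E)%E @ 0^'+ -->
    (\int[lebesgue_rV p]_(v in D0) (g0 v)%:E)%E.
Proof.
move=> mD mg mD0 mg0 mE E0 D0C nD nD0 nD1.
have [d /= d0 dP] := nD.
pose B := [set v : 'rV[R]_p | forall j, `|v 0 j| < C].
have mB : measurable B.
  have -> : B = [set v : 'rV[R]_p | forall j, `|v 0 j - (0 : 'rV[R]_p) 0 j| < C].
    by apply/seteqP; split => v H j; move: (H j); rewrite mxE subr0.
  exact: measurable_rV_ball.
have DB r : 0 < r < d -> D r `<=` B.
  move=> /andP[r0 rd] v Dv; have [] := dP r _ r0 v Dv => //=.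
  by rewrite sub0r normrN gtr0_norm.
have D0B : D0 `<=` B by [].
have key (u : R^nat) : (forall n, 0 < u n < d) -> u n @[n --> \oo] --> 0 ->
    (\int[lebesgue_rV p]_(v in D0) (g0 v)%:E)%E \is a fin_num /\
    (fun n => \int[lebesgue_rV p]_(v in D (u n)) (g (u n) v)%:E)%E @ \oo -->
      (\int[lebesgue_rV p]_(v in D0) (g0 v)%:E)%E.
  move=> ud u0.
  have u_gt0 n : 0 < u n by case/andP: (ud n).
  have ucv : u n @[n --> \oo] --> 0^'+.
    by move=> A nA; have : \forall n \near \oo, 0 < u n -> A (u n) := u0 _ nA; apply: filterS => n; apply.
  pose f_ n := (EFin \o g (u n)) \_ (D (u n)).
  pose f := (EFin \o g0) \_ D0.
  have iE (D' : set 'rV[R]_p) h : D' `<=` B ->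
      (\int[lebesgue_rV p]_(v in D') h v = \int[lebesgue_rV p]_(v in B) (h \_ D') v)%E.
    by move=> DB'; rewrite -integral_mkcondr (setIidr DB').
  have M0 : 0 <= `|M| by [].
  have [] := @dominated_convergence _ _ R (lebesgue_rV p) B mB f_ f (cst `|M|%:E).
  - move=> n; apply/(measurable_restrict _ (mD _ (u_gt0 n)) mB).
    by rewrite (setIidr (DB _ (ud n))); exact: mg.
  - apply/(measurable_restrict _ mD0 mB).
    by rewrite (setIidr D0B).
  - exists E; split => // v /= nv; apply: contrapT => Ev; apply: nv => _.
    have [D0v|D0v] := pselect (D0 v).
      have [n1 n2] := nD0 v Ev D0v.
      rewrite /f patchE mem_set//.
      have H1 : (EFin \o (fun r => g r v)) @ 0^'+ --> (g0 v)%:E by apply: cvg_EFin n2; apply: nearW.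
      have H2 := cvg_comp _ _ ucv H1.
      apply: cvg_trans H2; apply: near_eq_cvg.
      have n3 : \forall n \near \oo, D (u n) v := ucv _ n1; apply: filterS n3 => n Dn.
      by rewrite /f_ patchE mem_set.
    rewrite /f patchE memNset//.
    have n3 : \forall n \near \oo, ~ D (u n) v := ucv _ (nD1 v Ev D0v).
    apply: cvg_near_cst; apply: filterS n3 => n Dn.
    by rewrite /f_ patchE memNset.
  - apply/integrableP; split; first exact: measurable_cst.
    under eq_integral do rewrite gee0_abs ?lee_fin//.
    by rewrite integral_cst// lte_mul_pinfty//; exact: lebesgue_rV_bounded.
  - apply: aeW => v n Bv; rewrite /f_ patchE; case: ifPn => [/set_mem Dv|_]; last first.
      by rewrite abse0 lee_fin.
    have /andP[r0 rd] := ud n.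
    have [] := dP (u n) _ r0 v Dv; first by rewrite /= sub0r normrN gtr0_norm.
    by move=> _ gM; rewrite /= lee_fin (le_trans gM)// ler_norm.
  move=> If _ cf; rewrite iE//; split; first exact: integrable_fin_num.
  have -> : (fun n => \int[lebesgue_rV p]_(v in D (u n)) (g (u n) v)%:E)%E =
     [sequence \int[lebesgue_rV p]_(x in B) (f_ n x)]_n%E.
    by apply/funext => n; rewrite iE//; exact: DB.
  exact: cf.
have d2 : 0 < d / 2 < d by rewrite divr_gt0//= ltr_pdivrMr// mulr_natr mulr2n ltrDl.
(* The limit integral is the same for all sequences, so any one with values below [d] shows that it
   is finite. *)
have [fn _] : (\int[lebesgue_rV p]_(v in D0) (g0 v)%:E)%E \is a fin_num /\ True.
  split => //; have [||] := key (fun n => (d / 2) / n.+1%:R) => //.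
    move=> n; rewrite divr_gt0 ?ltr0n//=; last by case/andP: d2.
    rewrite ltr_pdivrMr ?ltr0n// (@lt_le_trans _ _ d)//; first by case/andP: d2.
    by rewrite ler_peMr ?ler1n// ltW.
  rewrite -(mulr0 (d / 2)); apply: cvgM; first exact: cvg_cst.
  exact: cvg_harmonic.
split => //; rewrite -(fineK fn); apply/cvge_at_rightP => u [ugt ucv].
(* The domination holds only for r < d, so the sequence is capped at d / 2; this changes finitely
   many terms. *)
pose w n := Num.min (u n) (d / 2).
have wd n : 0 < w n < d.
  rewrite /w lt_min gt_min ugt/=; case/andP: d2 => -> ->; by rewrite orbT.
have nw : \forall n \near \oo, u n = w n.
  have /andP[d20 _] := d2.
  have H : \forall n \near \oo, u n < d / 2 := cvgr_lt _ ucv _ d20.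
  have [n0 _ nP] := H; exists n0 => // n n0n; rewrite /w /= min_l// ltW//; exact: nP.
have wcv : w n @[n --> \oo] --> 0 by apply: cvg_trans ucv; apply: near_eq_cvg; apply: filterS nw => n ->.
have [_ H] := key w wd wcv; rewrite fineK//.
by apply: cvg_trans H; apply: near_eq_cvg; apply: filterS nw => n ->.
Qed.

Lemma taylor_poly_wdil (R : realType) p (o : 'I_p -> nat) N m (phi : 'rV[R]_p -> R) (r : R) v :
  taylor_poly o N m phi (wdil o r v) = r ^+ m * taylor_poly o N m phi v.
Proof.
rewrite /taylor_poly big_distrr/=; apply: eq_bigr => l _.
rewrite mulrCA; congr (_ * _); rewrite /taylor_part big_distrr/=; apply: eq_bigr => s /eqP <-.
rewrite mulrCA; congr (_ * _); rewrite /wsum.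
have -> : \prod_(j <- s) wdil o r v 0 j = \prod_(j <- s) (r ^+ o j * v 0 j).
  by apply: eq_bigr => j _; rewrite mxE.
by rewrite big_split/= -expr_sum.
Qed.

Section Limit.
Context {R : realType} {m k : nat} (G : carnot_group R m.+1 k).
Notation V := 'rV[R]_m.+1.
Variable rho : V -> V -> R.
Hypothesis hrho : homogeneous_distance G rho.
Variables (a : 'I_m.+1) (psi : 'rV[R]_m -> R) (U : set 'rV[R]_m).
Notation N := (rho 0).
Notation i := (ord G a).
Lemma hprojE (u : V) j : hproj G u 0 j = if ord G j == 1%N then u 0 j else 0.
Proof. by rewrite mxE. Qed.

#[local] Opaque hproj enorm.

Definition ord_lift (l : 'I_m) : nat := ord G (lift a l).
Hypotheses (oU : open U) (U0 : U 0) (psiU : class_C i U psi) (fl : flat_to ord_lift i psi).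

Lemma ord_lift_gt0 l : (0 < ord_lift l)%N.
Proof. exact: ord_gt0. Qed.

Let i_gt0 : (0 < i)%N := ord_gt0 G a.
Let psiU1 : class_C 1 U psi. Proof. exact: class_C_le psiU. Qed.

Definition taylor_limit := taylor_poly ord_lift i i psi.
Notation P := taylor_limit.

Let PC1 : class_C 1 setT P.
Proof. exact: (taylor_poly_C1 ord_lift_gt0 oU U0 psiU fl).1. Qed.

Let Ppartial l : partial l P = taylor_grad ord_lift i psi l.
Proof. exact: (taylor_poly_C1 ord_lift_gt0 oU U0 psiU fl).2. Qed.

Definition psi_r (r : R) (v : 'rV[R]_m) : R := psi (wdil ord_lift r v) / r ^+ i.
Definition grad_r (r : R) (v : 'rV[R]_m) : 'rV[R]_m := \row_l (r ^+ ord_lift l * partial l psi (wdil ord_lift r v) / r ^+ i).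
(** [wvec] with the gradient and the base point as independent arguments, so that it can be
    evaluated at the rescaled gradient [grad_r] and passed to the limit in both. *)
Definition Wt (c : 'rV[R]_m) (y : V) : V := ins a 1 (- c) *m (frame G y)^T.

Lemma WtE c y j : Wt c y 0 j = \sum_l ins a 1 (- c) 0 l * frame G y j l.
Proof. by rewrite mxE; apply: eq_bigr => l _; rewrite [_^T _ _]mxE. Qed.

Lemma wvec_Wt (phi : 'rV[R]_m -> R) v : wvec G a phi v = Wt (grad phi v) (gr a phi v).
Proof. exact: wvec_def. Qed.

#[local] Opaque Wt.

Definition density_r (r : R) (v : 'rV[R]_m) : R := enorm (hproj G (Wt (grad_r r v) (gr a (psi_r r) v))).
Definition density0 (v : 'rV[R]_m) : R := enorm (hproj G (wvec G a P v)).

Lemma gr_dil (r : R) v : 0 < r -> gr a psi (wdil ord_lift r v) = dil G r (gr a (psi_r r) v).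
Proof.
move=> r0; apply/rowP => j; rewrite [RHS]mxE; case: (unliftP a j) => [l|] ->.
  by rewrite !gr_lift mxE.
by rewrite !gr_at /psi_r mulrC divfK// expf_neq0// gt_eqF.
Qed.

Lemma enorm_hproj_scale (u v : V) c : 0 <= c -> (forall j, ord G j = 1%N -> u 0 j = c * v 0 j) ->
  enorm (hproj G u) = c * enorm (hproj G v).
Proof.
move=> c0 uv; rewrite -[c in RHS]ger0_norm// -enormZ; congr enorm.
apply/rowP => j; rewrite [RHS]mxE (hprojE u) (hprojE v).
by case: eqP => [/uv//|_]; rewrite mulr0.
Qed.

(** The function y_a - psi scales with weight i, and a horizontal derivative lowers the weight by
    one ([frame_dil] at order 1); hence the power i - 1. *)
Lemma hproj_wvec_dil (r : R) v : 0 < r ->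
  enorm (hproj G (wvec G a psi (wdil ord_lift r v))) = r ^+ i.-1 * density_r r v.
Proof.
move=> r0; rewrite /density_r; apply: enorm_hproj_scale => [|j oj].
  by rewrite exprn_ge0// ltW.
have rn : r != 0 by rewrite gt_eqF.
have ri : r ^+ i = r * r ^+ i.-1 by rewrite -exprS prednK.
have rin : r ^+ i.-1 != 0 by exact: expf_neq0.
apply: (etrans (wvecE G a psi (wdil ord_lift r v) j)).
rewrite (WtE (grad_r r v) (gr a (psi_r r) v) j).
rewrite mulr_sumr.
rewrite (gr_dil v r0); apply: eq_bigr => l _.
move: (frame_dil G r (gr a (psi_r r) v) j l); rewrite oj expr1 => /(canRL (mulfK rn)) ->.
move: (frame G (gr a (psi_r r) v) j l) => fr.
case: (unliftP a l) => [l'|] ->.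
  rewrite !ins_lift !mxE ri -/(ord_lift l'); field; exact/andP.
by rewrite !ins_at ri; field.
Qed.

Lemma N_gr_dil (r : R) v : 0 < r -> (N (gr a psi (wdil ord_lift r v)) < r) = (N (gr a (psi_r r) v) < 1).
Proof. by move=> r0; rewrite gr_dil// (N_dil hrho)// -[X in (_ < X) = _]mulr1 ltr_pM2l. Qed.

Definition dom_r (r : R) := [set v | U (wdil ord_lift r v) /\ N (gr a (psi_r r) v) < 1].

Let dom_rE (r : R) : 0 < r ->
  wdil ord_lift r @^-1` (U `&` [set u | N (gr a psi u) < r]) = dom_r r.
Proof. by move=> r0; apply/seteqP; split => v /= [Uv]; rewrite N_gr_dil. Qed.

Lemma measurable_domU s : measurable (U `&` [set u | N (gr a psi u) < s]).
Proof.
have -> : U `&` [set u | N (gr a psi u) < s] =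
   U `&` (fun u => N (gr a psi u)) @^-1` `]-oo, s[%classic.
  by apply/seteqP; split => u /= [Uu]; rewrite in_itv.
have mf : measurable_fun U (fun u => N (gr a psi u) : measurableTypeR R).
  apply: measurable_continuous => // u Uu.
  exact: (cvg_comp _ _ (gr_continuous oU psiU1 Uu) (@N_continuous _ _ _ G rho hrho _)).
by apply: mf; [exact: measurable_open|exact: measurable_itv].
Qed.

Lemma measurable_wvecU : measurable_fun U (fun u => enorm (hproj G (wvec G a psi u)) : measurableTypeR R).
Proof. by apply: measurable_continuous => // u Uu; exact: (hproj_wvec_cvg oU psiU1 Uu). Qed.

Let measurable_dom (r : R) : 0 < r -> measurable (dom_r r).
Proof.
move=> r0; rewrite -dom_rE// -[X in measurable X]setTI.
by apply: measurable_wdil => //; exact: measurable_domU.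
Qed.

Let measurable_density (r : R) : 0 < r -> measurable_fun (dom_r r) (fun v => (density_r r v)%:E).
Proof.
move=> r0; apply/measurable_EFinP.
apply: (eq_measurable_fun (fun v => (r ^+ i.-1)^-1 * enorm (hproj G (wvec G a psi (wdil ord_lift r v))))).
  by move=> v _; rewrite hproj_wvec_dil// mulrA mulVf ?mul1r// expf_neq0// gt_eqF.
apply: measurable_funM; first exact: measurable_cst.
pose h : 'rV[R]_m -> measurableTypeR R := fun u => enorm (hproj G (wvec G a psi u)).
change (measurable_fun (dom_r r) (h \o wdil ord_lift r)).
apply: (measurable_comp (measurable_open oU)).
- by move=> _ [v [Uv _] <-].
- exact: measurable_wvecU.
- by apply: measurable_funS (measurable_wdil _ _).
Qed.

Lemma rescaled_integral (r : R) : 0 < r ->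
  (\int[lebesgue_rV m]_(u in U `&` [set u | (N (gr a psi u) < r)%R])
     (enorm (hproj G (wvec G a psi u)))%:E * ((r ^+ (hom_dim G).-1)^-1)%:E =
   \int[lebesgue_rV m]_(v in dom_r r) (density_r r v)%:E)%E.
Proof.
move=> r0; rewrite -(dom_rE r0).
apply: (@integral_rescale _ _ ord_lift r _ (fun u => enorm (hproj G (wvec G a psi u))) (density_r r) i.-1) => //.
(* Q - 1 is the sum of the weights of the coordinates other than a, from the volume, plus i - 1,
   from the density. *)
- by rewrite /hom_dim (bigD1_ord a)//= addnC -subn1 -addnBA// subn1.
- exact: measurable_domU.
- apply: (@measurable_funS _ _ _ _ U) => //; first exact: measurable_open.
  by apply/measurable_EFinP; exact: measurable_wvecU.
- by rewrite (dom_rE r0); exact: measurable_density.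
- by move=> v; exact: enorm_ge0.
- by move=> v; exact: enorm_ge0.
- by move=> v; exact: hproj_wvec_dil.
Qed.

Lemma Wt_cvg T (F : set_system T) (FF : Filter F) (c : T -> 'rV[R]_m) (y : T -> V) (c0 : 'rV[R]_m) (y0 : V) :
  (forall l, (fun t => c t 0 l) @ F --> c0 0 l) -> y @ F --> y0 ->
  (fun t => enorm (hproj G (Wt (c t) (y t)))) @ F --> enorm (hproj G (Wt c0 y0)).
Proof.
move=> cc cy.
have wj j : (fun t => Wt (c t) (y t) 0 j) @ F --> Wt c0 y0 0 j.
  have EF : (fun t => Wt (c t) (y t) 0 j) =
      (fun t => \sum_l ins a 1 (- c t) 0 l * frame G (y t) j l).
    by apply/funext => t; exact: WtE.
  rewrite EF WtE; apply: (@cvg_sumr _ _ F) => l _.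
  have H2 : (fun t => frame G (y t) j l) @ F --> frame G y0 j l.
    exact: (cvg_comp _ _ cy (@frame_continuous _ _ _ G j l y0)).
  suff H1 : (fun t => ins a 1 (- c t) 0 l) @ F --> ins a 1 (- c0) 0 l by exact: (cvgM H1 H2).
  case: (unliftP a l) => [l'|] ->.
    have -> : (fun t => ins a 1 (- c t) 0 (lift a l')) = (fun t => - c t 0 l').
      by apply/funext => t; rewrite ins_lift mxE.
    by rewrite ins_lift [X in _ --> X]mxE; exact: cvgN.
  have -> : (fun t => ins a 1 (- c t) 0 a) = (fun=> 1) by apply/funext => t; rewrite ins_at.
  by rewrite ins_at; exact: cvg_cst.
apply: (@cvg_enorm _ _ _ _ FF (fun t => hproj G (Wt (c t) (y t))) (hproj G (Wt c0 y0))) => j.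
have EF : (fun t => hproj G (Wt (c t) (y t)) 0 j) =
    (fun t => if ord G j == 1%N then Wt (c t) (y t) 0 j else 0).
  by apply/funext => t; exact: hprojE.
rewrite EF (hprojE (Wt c0 y0)).
by case: eqP => _; [exact: wj|exact: cvg_cst].
Qed.

Lemma near_taylor K e : 0 <= K -> 0 < e -> \forall r \near 0^'+, forall v, `|v| <= K ->
  [/\ U (wdil ord_lift r v), `|psi_r r v - P v| <= e &
      forall l, `|grad_r r v 0 l - grad P v 0 l| <= e].
Proof.
move=> K0 e0.
have [r1 r10 H1] := taylor_estimate ord_lift_gt0 oU U0 psiU fl K0 e0.
have [r2 r20 H2] := wdil_small ord_lift_gt0 K (open_nbhs_nbhs (conj oU U0)).
have near0 (d : R) (Q : R -> Prop) : 0 < d -> (forall r, 0 < r < d -> Q r) -> \forall r \near 0^'+, Q r.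
  move=> d0 dQ; near=> r; apply: dQ; apply/andP; split; near: r.
    exact: nbhs_right_gt.
  exact: nbhs_right_lt.
have H3 : \forall r \near 0^'+, forall l, forall v, `|v| <= K -> `|grad_r r v 0 l - grad P v 0 l| <= e.
  apply: filter_forall => l.
  have [r3 r30 H3] := taylor_grad_estimate ord_lift_gt0 l i_gt0 oU U0 psiU fl K0 e0.
  apply: (near0 _ _ r30) => r rr v vK.
  by rewrite !mxE Ppartial; exact: H3.
have H1' : \forall r \near 0^'+, forall v, `|v| <= K -> `|psi_r r v - P v| <= e.
  by apply: (near0 _ _ r10) => r rr v vK; exact: H1.
have H2' : \forall r \near 0^'+, forall v, `|v| <= K -> U (wdil ord_lift r v).
  by apply: (near0 _ _ r20) => r rr v vK; exact: H2.
near=> r => v vK; split.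
- by move: v vK; near: r.
- by move: v vK; near: r.
- by move=> l; move: l v vK; near: r.
Unshelve. all: by end_near. Qed.

Lemma psi_r_cvg v : psi_r r v @[r --> 0^'+] --> P v.
Proof.
apply/cvgrPdist_le => e e0; have := near_taylor (normr_ge0 v) e0.
by apply: filterS => r /(_ v (lexx _))[_ H _]; rewrite distrC.
Qed.

Lemma grad_r_cvg v l : grad_r r v 0 l @[r --> 0^'+] --> grad P v 0 l.
Proof.
apply/cvgrPdist_le => e e0; have := near_taylor (normr_ge0 v) e0.
by apply: filterS => r /(_ v (lexx _))[_ _ H]; rewrite distrC.
Qed.

Lemma gr_r_cvg v : gr a (psi_r r) v @[r --> 0^'+] --> gr a P v.
Proof.
apply: cvg_rV => j; case: (unliftP a j) => [l|] ->.
  have -> : (fun r => gr a (psi_r r) v 0 (lift a l)) = (fun=> v 0 l).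
    by apply/funext => r; rewrite gr_lift.
  by rewrite gr_lift; exact: cvg_cst.
have -> : (fun r => gr a (psi_r r) v 0 a) = (fun r => psi_r r v).
  by apply/funext => r; rewrite gr_at.
by rewrite gr_at; exact: psi_r_cvg.
Qed.

Lemma N_gr_r_cvg v : N (gr a (psi_r r) v) @[r --> 0^'+] --> N (gr a P v).
Proof.
by apply: continuous_cvg; [exact: (@N_continuous _ _ _ G rho hrho _)|exact: gr_r_cvg].
Qed.

Lemma density_r_cvg v : density_r r v @[r --> 0^'+] --> density0 v.
Proof.
rewrite /density0 wvec_Wt; apply: Wt_cvg; last exact: gr_r_cvg.
exact: grad_r_cvg.
Qed.

Lemma gr_P_dil (r : R) v : gr a P (wdil ord_lift r v) = dil G r (gr a P v).
Proof.
apply/rowP => j; rewrite [RHS]mxE; case: (unliftP a j) => [l|] ->.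
  by rewrite !gr_lift mxE.
by rewrite !gr_at; exact: taylor_poly_wdil.
Qed.

Lemma gr_P_continuous : continuous (gr a P).
Proof. by move=> v; exact: (gr_continuous openT PC1 (I : setT v)). Qed.

Let NP_continuous : continuous (fun v => N (gr a P v)).
Proof.
by move=> v; exact: (cvg_comp _ _ (@gr_P_continuous v) (@N_continuous _ _ _ G rho hrho _)).
Qed.

Definition dom0 (t : R) := [set v | N (gr a P v) < t].

Let measurable_NP : measurable_fun setT (fun v => N (gr a P v) : measurableTypeR R).
Proof. by apply: measurable_continuous => [|v _]; [exact: openT|exact: NP_continuous]. Qed.

Lemma measurable_dom0 t : measurable (dom0 t).
Proof.
have -> : dom0 t = setT `&` (fun v => N (gr a P v)) @^-1` `]-oo, t[%classic.
  by apply/seteqP; split => v /=; rewrite in_itv/= => // -[].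
by apply: measurable_NP => //; exact: measurable_itv.
Qed.

Let levelset := [set v | N (gr a P v) = 1].

Let measurable_levelset : measurable levelset.
Proof.
have -> : levelset = setT `&` (fun v => N (gr a P v)) @^-1` [set 1].
  by apply/seteqP; split => v //= [].
by apply: measurable_NP => //; exact: measurable_set1.
Qed.

Lemma gr_coord_bounded : exists2 C : R, 0 < C &
  forall (phi : 'rV[R]_m -> R) v, N (gr a phi v) < 1 -> `|v| <= C.
Proof.
have [C C0 CP] := ball_bounded hrho; exists C => // phi v /CP H.
apply: norm_rV_le => [|l]; first exact: ltW.
by rewrite -(gr_lift a phi v l); exact: (le_trans (norm_coord_le _ _) H).
Qed.

Lemma dom0_finite : (lebesgue_rV m (dom0 1) < +oo)%E.
Proof.
have [C C0 CP] := gr_coord_bounded.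
have mB : measurable [set v : 'rV[R]_m | forall j, `|v 0 j| < C + 1].
  have -> : [set v : 'rV[R]_m | forall j, `|v 0 j| < C + 1] =
      [set v : 'rV[R]_m | forall j, `|v 0 j - (0 : 'rV[R]_m) 0 j| < C + 1].
    by apply/seteqP; split => v H j; move: (H j); rewrite mxE subr0.
  exact: measurable_rV_ball.
apply: le_lt_trans (lebesgue_rV_bounded m (C + 1)); apply: le_measure; rewrite ?inE//.
  exact: measurable_dom0.
move=> v /CP vC j; apply: (le_lt_trans (norm_coord_le v j)); apply: (le_lt_trans vC).
by rewrite ltrDl.
Qed.

Lemma dom0_scale t : 0 < t ->
  lebesgue_rV m (dom0 t) = ((t ^+ (\sum_j ord_lift j)%N)%:E * lebesgue_rV m (dom0 1))%E.
Proof.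
move=> t0; rewrite (lebesgue_rV_scale ord_lift t0 (measurable_dom0 t)); congr (_ * lebesgue_rV m _)%E.
apply/seteqP; split => v /=; rewrite /dom0/= gr_P_dil (N_dil hrho)//.
  by rewrite -[X in _ < X -> _]mulr1 ltr_pM2l.
by rewrite -[X in _ -> _ < X]mulr1 ltr_pM2l.
Qed.

(* The volume of [dom0 t] is a constant times a power of t, hence continuous at
   t = 1. *)
Let levelset_null : lebesgue_rV m levelset = 0%E.
Proof.
set mu := lebesgue_rV m.
have mfin : mu (dom0 1) \is a fin_num by rewrite ge0_fin_numE//; exact: dom0_finite.
have LE t : 1 < t -> (mu levelset + mu (dom0 1) <= (t ^+ (\sum_j ord_lift j)%N)%:E * mu (dom0 1))%E.
  move=> t1; rewrite -dom0_scale ?(lt_trans _ t1)// -measureU//.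
  - apply: le_measure; rewrite ?inE//; [|exact: measurable_dom0|].
      by apply: measurableU => //; exact: measurable_dom0.
    by move=> v [Hv|Hv]; rewrite /dom0/=; [rewrite Hv|exact: (lt_trans Hv)].
  - exact: measurable_dom0.
  - by apply/seteqP; split => v //= []; rewrite /levelset /dom0/= => ->; rewrite ltxx.
have lfin : mu levelset \is a fin_num.
  rewrite ge0_fin_numE//; have /LE : (1 : R) < 2 by rewrite ltr1n.
  rewrite -(fineK mfin) -EFinM => H; apply: (le_lt_trans _ (ltry _)); apply: le_trans H.
  by rewrite leeDl// fineK.
move: LE; rewrite -(fineK mfin) -(fineK lfin).
set e := fine _; set c := fine _ => LE.
have e0 : 0 <= e by rewrite fine_ge0.
have LE' t : 1 < t -> e + c <= t ^+ (\sum_j ord_lift j)%N * c.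
  by move=> /LE; rewrite -EFinM -EFinD lee_fin.
have cv : (fun t : R => t ^+ (\sum_j ord_lift j)%N * c) @ 1^'+ --> 1 ^+ (\sum_j ord_lift j)%N * c.
  apply: cvg_at_right_filter; apply: cvgM; last exact: cvg_cst.
  exact: exprn_continuous.
have : e + c <= c.
  rewrite -[leRHS]mul1r -(expr1n _ (\sum_j ord_lift j)%N).
  apply: (cvgr_to_ge cv); near=> t; apply: LE'; near: t; exact: nbhs_right_gt.
rewrite gerDr => e1; congr (_%:E); apply/eqP; by rewrite eq_le e1 e0.
Unshelve. all: by end_near. Qed.

(** The density is a fixed continuous function [q] of the pair (gradient, point). For small r these
    pairs stay in one ball, since function and gradient are within 1 of those of the limit
    polynomial. *)
Let density_bounded (C : R) : 0 <= C -> exists M : R, \forall r \near 0^'+,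
  forall v, `|v| <= C -> `|density_r r v| <= M.
Proof.
move=> C0.
pose q w := enorm (hproj G (Wt (lsubmx (w : 'rV[R]_(m + m.+1))) (rsubmx w))).
have qc : continuous q.
  move=> w; apply: (@Wt_cvg _ (nbhs w) _ (fun w => lsubmx w) (fun w => rsubmx w)).
    move=> l; have -> : (fun t => lsubmx t 0 l) = (fun t : 'rV[R]_(m + m.+1) => t 0 (lshift m.+1 l)).
      by apply/funext => t; rewrite mxE.
    by rewrite mxE; exact: coord_continuous.
  apply: (@cvg_rV _ _ (nbhs w)) => l.
  have -> : (fun t : 'rV[R]_(m + m.+1) => rsubmx t 0 l) = (fun t => t 0 (rshift m l)).
    by apply/funext => t; rewrite mxE.
  by rewrite mxE; exact: coord_continuous.
have [M1 M10 P1] := continuous_bounded C (@taylor_poly_continuous _ _ ord_lift i i psi).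
have gM l : exists M2 : R, 0 < M2 /\ forall v, `|v| <= C -> `|partial l P v| <= M2.
  rewrite Ppartial; have [M M0 MP] := continuous_bounded C (@taylor_grad_continuous _ _ ord_lift i psi l).
  by exists M.
have [M2 M2P] := choice gM.
have M2_ge0 : 0 <= \sum_l M2 l by apply: sumr_ge0 => l _; apply: ltW; exact: (M2P l).1.
pose K := C + M1 + \sum_l M2 l + 1.
have [M M0 MP] := continuous_bounded K qc.
exists M; have := near_taylor C0 (@ltr01 R); apply: filterS => r rP v vC.
have [_ Hp Hg] := rP v vC.
have -> : density_r r v = q (row_mx (grad_r r v) (gr a (psi_r r) v)).
  by rewrite /q row_mxKl row_mxKr.
apply: MP; have K0 : 0 <= K by rewrite /K !addr_ge0// ltW.
have gl l : `|grad_r r v 0 l| <= K.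
  have H1 : `|grad P v 0 l| <= \sum_l M2 l.
    rewrite mxE; apply: (le_trans ((M2P l).2 v vC)).
    by rewrite (bigD1 l)//= lerDl sumr_ge0// => l' _; exact: ltW (M2P l').1.
  have := ler_normD (grad_r r v 0 l - grad P v 0 l) (grad P v 0 l).
  rewrite subrK; move: (Hg l) H1 M10 C0; rewrite /K; lra.
have pl : `|psi_r r v| <= K.
  have := ler_normD (psi_r r v - P v) (P v); rewrite subrK.
  by move: (P1 v vC) Hp M2_ge0 C0; rewrite /K; lra.
apply: norm_rV_le => // j; case: (@split_ordP m m.+1 j) => l ->.
  by rewrite (row_mxEl (grad_r r v)).
rewrite (row_mxEr (grad_r r v)); case: (unliftP a l) => [l'|] ->; last by rewrite gr_at.
rewrite gr_lift; apply: (le_trans (norm_coord_le v l')); apply: (le_trans vC).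
by move: M10 M2_ge0; rewrite /K; lra.
Qed.

Lemma density0_measurable : measurable_fun setT (fun v => density0 v : measurableTypeR R).
Proof.
apply: measurable_continuous => [|v _]; first exact: openT.
exact: (hproj_wvec_cvg openT PC1 (I : setT v)).
Qed.

Lemma rescaled_limit :
  (\int[lebesgue_rV m]_(v in [set v | (N (gr a P v) < 1)%R]) (enorm (hproj G (wvec G a P v)))%:E)%E \is a fin_num /\
  (fun r : R => \int[lebesgue_rV m]_(u in U `&` [set u | (N (gr a psi u) < r)%R])
     (enorm (hproj G (wvec G a psi u)))%:E * ((r ^+ (hom_dim G).-1)^-1)%:E)%E @ 0^'+ -->
  (\int[lebesgue_rV m]_(v in [set v | (N (gr a P v) < 1)%R]) (enorm (hproj G (wvec G a P v)))%:E)%E.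
Proof.
have [C C0 CP] := gr_coord_bounded.
have C1 : 0 <= C by exact: ltW.
have [M MP] := density_bounded C1.
(* Off the level set N = 1, being inside or outside the unit ball is stable under the convergence of
   the graphs, so the domains converge pointwise. *)
have [] := @integral_cvg_dominated R m dom_r (dom0 1) levelset density_r density0 (C + 1) M.
- exact: measurable_dom.
- exact: measurable_density.
- exact: measurable_dom0.
- by apply/measurable_EFinP; apply: measurable_funTS; exact: density0_measurable.
- exact: measurable_levelset.
- exact: levelset_null.
- move=> v /CP vC j; apply: (le_lt_trans (norm_coord_le v j)); apply: (le_lt_trans vC).
  by rewrite ltrDl.
- apply: filterS MP => r rM v [_ /CP vC]; split; last exact: rM.
  move=> j; apply: (le_lt_trans (norm_coord_le v j)); apply: (le_lt_trans vC).
  by rewrite ltrDl.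
- move=> v _ v1; split; last exact: density_r_cvg.
  have NC := @N_gr_r_cvg v.
  have H1 : \forall r \near 0^'+, N (gr a (psi_r r) v) < 1 := cvgr_lt _ NC _ v1.
  have := near_taylor (normr_ge0 v) (@ltr01 R).
  move=> H2; near=> r; split; last by near: r; exact: H1.
  have H : forall w : 'rV[R]_m, `|w| <= `|v| -> [/\ U (wdil ord_lift r w), `|psi_r r w - P w| <= 1 &
      forall l, `|grad_r r w 0 l - grad P w 0 l| <= 1] by near: r; exact: H2.
  by have [] := H v (lexx _).
- move=> v v1 v0; have NC := @N_gr_r_cvg v.
  have v2 : 1 < N (gr a P v).
    rewrite lt_neqAle eq_sym; apply/andP; split; first exact/eqP.
    by rewrite leNgt; exact/negP.
  have H1 : \forall r \near 0^'+, 1 < N (gr a (psi_r r) v) := cvgr_gt _ NC _ v2.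
  near=> r; move=> [_]; apply/negP; rewrite -leNgt ltW//; near: r; exact: H1.
move=> fin cv; split; first exact: fin.
apply: cvg_trans cv; apply: near_eq_cvg; near=> r.
by rewrite rescaled_integral//; near: r; exact: nbhs_right_gt.
Unshelve. all: by end_near. Qed.

End Limit.

(** * The implicit function theorem *)

Section ImplicitFunction.
Context {R : realType} {m : nat}.
Notation V := 'rV[R]_m.+1.
Variables (a : 'I_m.+1) (W : set V) (f : V -> R).
Hypotheses (oW : open W) (W0 : W 0) (fW : class_C 1 W f) (f0 : f 0 = 0).
Hypothesis fa0 : partial a f 0 != 0.
Notation ins := (ins a).
Notation c := (partial a f 0).

Let ins_line t s (u : 'rV[R]_m) : ins (t + s) u = ins t u + s *: basis_vec a.
Proof.
apply/rowP => j; rewrite [RHS]mxE.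
have -> : (s *: basis_vec a) 0 j = s * (j == a)%:R by rewrite !mxE eqxx.
case: (unliftP a j) => [l|] ->.
  by rewrite !ins_lift eq_sym (negbTE (neq_lift _ _)) mulr0 addr0.
by rewrite !ins_at eqxx mulr1.
Qed.

Let ins_norm (t : R) (u : 'rV[R]_m) (e : R) : 0 <= e -> `|t| <= e -> `|u| <= e -> `|ins t u| <= e.
Proof.
move=> e0 te ue; apply: norm_rV_le => // j; case: (unliftP a j) => [l|] ->.
  by rewrite ins_lift; exact: (le_trans (norm_coord_le _ _)).
by rewrite ins_at.
Qed.

Let ins00 : ins (0 : R) (0 : 'rV[R]_m) = 0.
Proof. by apply/rowP => j; case: (unliftP a j) => [l|] ->; rewrite ?ins_lift ?ins_at !mxE. Qed.

Let ins_continuous (t : R) : continuous (ins t : 'rV[R]_m -> V).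
Proof.
move=> u; apply: (@cvg_rV _ _ (nbhs u)) => j; case: (unliftP a j) => [l|] ->.
  have -> : (fun v => ins t v 0 (lift a l)) = (fun v : 'rV[R]_m => v 0 l).
    by apply/funext => v; rewrite ins_lift.
  by rewrite ins_lift; exact: coord_continuous.
have -> : (fun v => ins t v 0 a) = (fun=> t) by apply/funext => v; rewrite ins_at.
by rewrite ins_at; exact: cvg_cst.
Qed.

Let increment (B e t1 t2 : R) (u : 'rV[R]_m) :
  (forall s, `|s| <= `|t2 - t1| -> W (ins (t1 + s) u) /\ `|partial a f (ins (t1 + s) u) - B| <= e) ->
  `|f (ins t2 u) - f (ins t1 u) - B * (t2 - t1)| <= e * `|t2 - t1|.
Proof.
move=> H; pose g s := f (ins t1 u + s *: basis_vec a) - B * s.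
have := @mean_value_le R g (fun s => partial a f (ins (t1 + s) u) - B) (t2 - t1) e.
rewrite /g -ins_line scale0r addr0 mulr0 subr0 addrCA subrr addr0.
have -> : f (ins t2 u) - B * (t2 - t1) - f (ins t1 u) = f (ins t2 u) - f (ins t1 u) - B * (t2 - t1) by ring.
apply => s sd; last exact: (H s sd).2.
apply: is_deriveB.
  rewrite ins_line; apply: derive_line; rewrite -ins_line.
  exact: (class_C1_derivable (j := a) fW (H s sd).1).
change (is_derive s (1 : R) (B \*: (@id R^o)) B).
by apply: is_derive_eq; rewrite [B *: _]mulr1.
Qed.

(* For u near 0, [f (ins t u) - c * t] varies by at most [|c| / 2] times the variation
   of t on a segment [-d, d], which therefore contains exactly one zero of [f (ins t u)]. *)
Lemma implicit_function : exists (d e : R) (psi : 'rV[R]_m -> R),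
  [/\ 0 < d, 0 < e, psi 0 = 0, class_C 1 [set u | `|u| < e] psi &
  (forall u, `|u| < e -> [/\ W (gr a psi u), partial a f (gr a psi u) != 0 &
     forall l, partial l psi u = - (partial (lift a l) f (gr a psi u) / partial a f (gr a psi u))]) /\
  (forall y : V, `|y 0 a| <= d -> `|col' a y| < e -> W y /\ (f y = 0 <-> y 0 a = psi (col' a y)))].
Proof.
have c0 : 0 < `|c| by rewrite normr_gt0.
(* For two parameters of size at most d1, the intermediate values t1 + s have size at most 3 d1. *)
have [d1 d10 dP] : exists2 d : R, 0 < d & forall y : V, `|y| <= 3 * d ->
    W y /\ `|partial a f y - c| <= `|c| / 2.
  have n1 : \forall y \near (0 : V), W y by exact: open_nbhs_nbhs.
  have n2 : \forall y \near (0 : V), `|partial a f y - c| <= `|c| / 2.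
    have /cvgrPdist_le := class_C1_contp (j := a) fW W0; move=> /(_ (`|c| / 2)) H.
    by have := H (divr_gt0 c0 (ltr0Sn _ _)); apply: filterS => y; rewrite distrC.
  have /near_normP[d d0 dP] : \forall y \near (0 : V), W y /\ `|partial a f y - c| <= `|c| / 2.
    by near=> y; split; near: y.
  exists (d / 4); first by rewrite divr_gt0.
  by move=> y yd; apply: dP; rewrite subr0 (le_lt_trans yd)//; lra.
have incr (t1 t2 : R) (u : 'rV[R]_m) : `|t1| <= d1 -> `|t2| <= d1 -> `|u| <= d1 ->
    `|f (ins t2 u) - f (ins t1 u) - c * (t2 - t1)| <= `|c| / 2 * `|t2 - t1|.
  move=> h1 h2 h3; apply: increment => s sd; apply: dP; apply: ins_norm.
  - by lra.
  - have := ler_normD t1 s; have := ler_normB t2 t1; lra.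
  - by lra.
(* The error takes up only half of the slope |c|, so an increment of [f] controls that of t.
   Uniqueness of the zero and continuity of [psi] follow from this. *)
have diff_le (t1 t2 : R) (u : 'rV[R]_m) : `|t1| <= d1 -> `|t2| <= d1 -> `|u| <= d1 ->
    `|t2 - t1| <= 2 * (`|f (ins t2 u) - f (ins t1 u)| / `|c|).
  move=> h1 h2 h3; have H := incr _ _ _ h1 h2 h3.
  rewrite mulrA ler_pdivlMr//; have := ler_normB (f (ins t2 u) - f (ins t1 u) - c * (t2 - t1)) (f (ins t2 u) - f (ins t1 u)).
  rewrite addrAC subrr add0r normrN normrM mulrC; lra.
have insW t (u : 'rV[R]_m) : `|t| <= d1 -> `|u| <= d1 -> W (ins t u).
  by move=> td ud; apply: (dP _ _).1; apply: ins_norm => //; lra.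
have fins t (u : 'rV[R]_m) : `|t| <= d1 -> `|u| <= d1 -> f (ins t v) @[v --> u] --> f (ins t u).
  move=> td ud; apply: (@continuous_comp _ _ _ (ins t) f); first exact: ins_continuous.
  exact: (class_C_cont fW (insW _ _ td ud)).
have n00 : `|0 : 'rV[R]_m| <= d1 by rewrite normr0 ltW.
have z00 : `|0 : R| <= d1 by rewrite normr0 ltW.
have dd1 : `|d1| <= d1 by rewrite gtr0_norm.
have dd2 : `|- d1| <= d1 by rewrite normrN gtr0_norm.
have c2 : 0 < c ^+ 2 by rewrite exprn_even_gt0.
have cc : `|c| * `|c| = c ^+ 2 by rewrite -normrM -expr2 ger0_norm// ltW.
(* Multiplying by [c] treats both signs of the slope at once: the product has slope close to c^2 >
   0. *)
have cf (x t : R) : `|x - c * t| <= `|c| / 2 * `|t| -> `|c * x - c ^+ 2 * t| <= c ^+ 2 / 2 * `|t|.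
  move=> H; have -> : c * x - c ^+ 2 * t = c * (x - c * t) by ring.
  rewrite normrM; apply: le_trans (ler_wpM2l (ltW c0) H) _.
  by rewrite !mulrA cc.
have pos : 0 < c * f (ins d1 0).
  have := cf _ _ (incr 0 d1 0 z00 dd1 n00); rewrite ins00 f0 !subr0 (gtr0_norm d10).
  by have := mulr_gt0 c2 d10; rewrite ler_norml => ? /andP[? ?]; lra.
have neg : c * f (ins (- d1) 0) < 0.
  have := cf _ _ (incr 0 (- d1) 0 z00 dd2 n00); rewrite ins00 f0 !subr0 normrN (gtr0_norm d10).
  by have := mulr_gt0 c2 d10; rewrite ler_norml => ? /andP[? ?]; lra.
have [e [e0 ed eP]] : exists e : R, [/\ 0 < e, e <= d1 & forall u, `|u| < e ->
    0 < c * f (ins d1 u) /\ c * f (ins (- d1) u) < 0].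
  have n1 : \forall u \near (0 : 'rV[R]_m), 0 < c * f (ins d1 u).
    have cv : c * f (ins d1 u) @[u --> (0 : 'rV[R]_m)] --> c * f (ins d1 0).
      exact: (cvgM (cvg_cst c) (fins _ _ dd1 n00)).
    exact: (cvgr_gt _ cv _ pos).
  have n2 : \forall u \near (0 : 'rV[R]_m), c * f (ins (- d1) u) < 0.
    have cv : c * f (ins (- d1) u) @[u --> (0 : 'rV[R]_m)] --> c * f (ins (- d1) 0).
      exact: (cvgM (cvg_cst c) (fins _ _ dd2 n00)).
    exact: (cvgr_lt _ cv _ neg).
  have /near_normP[d d0 H] : \forall u \near (0 : 'rV[R]_m), 0 < c * f (ins d1 u) /\ c * f (ins (- d1) u) < 0.
    by near=> u; split; near: u.
  exists (Num.min d d1); split; first by rewrite lt_min d0.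
    by rewrite ge_min lexx orbT.
  by move=> u; rewrite lt_min => /andP[ud _]; apply: H; rewrite subr0.
pose root u := [set t : R | `|t| <= d1 /\ f (ins t u) = 0].
have rootP (u : 'rV[R]_m) : `|u| < e -> exists t, root u t.
  move=> ue; have ud : `|u| <= d1 by exact: le_trans (ltW ue) ed.
  have [H1 H2] := eP u ue.
  have dle : - d1 <= d1 by lra.
  have cg : {within `[- d1, d1], continuous (fun t => c * f (ins t u))}.
    apply: continuous_in_subspaceT => t; rewrite inE/= in_itv/= => td.
    apply: cvgM; first exact: cvg_cst.
    apply: (@continuous_comp _ _ _ (ins ^~ u) f); last first.
      by apply: (class_C_cont fW); apply: insW; rewrite // ler_norml.
    apply: (@cvg_rV _ _ (nbhs t)) => j; case: (unliftP a j) => [l|] ->.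
      have -> : (fun v : R => ins v u 0 (lift a l)) = (fun=> u 0 l).
        by apply/funext => v; rewrite ins_lift.
      by rewrite ins_lift; exact: cvg_cst.
    have -> : (fun v : R => ins v u 0 a) = id by apply/funext => v; rewrite ins_at.
    by rewrite ins_at; exact: cvg_id.
  have [|t td ft] := IVT dle cg (_ : Num.min _ _ <= 0 <= Num.max _ _).
    by rewrite ge_min le_max (ltW H1) (ltW H2) orbT.
  exists t; split; first by rewrite ler_norml; move: td; rewrite in_itv.
  by move/eqP: ft; rewrite mulf_eq0 (negbTE fa0)/= => /eqP.
pose psi u := xget 0 (root u).
have psiP (u : 'rV[R]_m) : `|u| < e -> root u (psi u).
  by move=> /rootP[t tr]; exact: (xgetPex 0 (ex_intro _ t tr)).
have psi_le (u : 'rV[R]_m) t : `|u| < e -> `|t| <= d1 -> `|psi u - t| <= 2 * (`|f (ins t u)| / `|c|).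
  move=> ue td; have [pd p0] := psiP u ue.
  have := diff_le t (psi u) u td pd (le_trans (ltW ue) ed).
  by rewrite p0 sub0r normrN.
have oU : open [set u : 'rV[R]_m | `|u| < e].
  have -> : [set u : 'rV[R]_m | `|u| < e] = (fun u : 'rV[R]_m => `|u|) @^-1` [set t | t < e] by [].
  by apply: open_comp; [move=> v _; exact: norm_continuous|exact: open_lt].
have psi0 : psi 0 = 0.
  have := psi_le 0 0; rewrite normr0 ins00 f0 normr0 mul0r mulr0 subr0 => /(_ e0 (ltW d10)).
  by rewrite normr_le0 => /eqP.
have grE (u : 'rV[R]_m) : gr a psi u = ins (psi u) u by [].
have grd (u : 'rV[R]_m) : `|u| < e -> `|gr a psi u| <= d1.
  move=> ue; rewrite grE; apply: ins_norm; [exact: ltW|exact: (psiP u ue).1|].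
  by exact: le_trans (ltW ue) ed.
have grd3 (u : 'rV[R]_m) : `|u| < e -> `|gr a psi u| <= 3 * d1.
  by move=> /grd H; apply: (le_trans H); lra.
have Wgr (u : 'rV[R]_m) : `|u| < e -> W (gr a psi u) by move=> /grd3/dP[].
have fgr (u : 'rV[R]_m) : `|u| < e -> partial a f (gr a psi u) != 0.
  move=> /grd3/dP[_]; apply: contraPneq => ->; rewrite sub0r normrN => H.
  by lra.
have nU (u0 : 'rV[R]_m) : `|u0| < e -> \forall v \near u0, `|v| < e.
  by move=> ue; exact: (open_nbhs_nbhs (conj oU ue)).
have f_near (u0 : 'rV[R]_m) (t0 := psi u0) : `|u0| < e -> f (ins t0 v) @[v --> u0] --> (0 : R).
  move=> ue; have [td t0'] := psiP u0 ue; rewrite -[X in _ --> X]t0'; apply: fins => //.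
  exact: le_trans (ltW ue) ed.
have psic (u0 : 'rV[R]_m) : `|u0| < e -> {for u0, continuous psi}.
  move=> ue; suff : psi @ nbhs u0 --> psi u0 by []; apply/cvgrPdist_le => e1 e10.
  have e2 : 0 < e1 * `|c| / 2 by rewrite divr_gt0// mulr_gt0.
  have n1 := cvgr0_norm_le _ (@f_near u0 ue) _ e2; have n2 := nU u0 ue.
  near=> v.
  have ve : `|v| < e by near: v; exact: n2.
  have fv : `|f (ins (psi u0) v)| <= e1 * `|c| / 2 by near: v; exact: n1.
  rewrite distrC; apply: le_trans (psi_le _ _ ve (psiP u0 ue).1) _.
  by rewrite mulrA ler_pdivrMr//; lra.
have grc (u0 : 'rV[R]_m) : `|u0| < e -> {for u0, continuous (gr a psi)}.
  move=> ue; apply: (@cvg_rV _ _ (nbhs u0)) => j; case: (unliftP a j) => [l|] ->.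
    have -> : (fun v => gr a psi v 0 (lift a l)) = (fun v => v 0 l).
      by apply/funext => v; rewrite gr_lift.
    by rewrite gr_lift; exact: coord_continuous.
  have -> : (fun v => gr a psi v 0 a) = psi by apply/funext => v; rewrite gr_at.
  by rewrite gr_at; exact: psic.
have psiD (u0 : 'rV[R]_m) l : `|u0| < e -> is_derive u0 (basis_vec l) psi
    (- (partial (lift a l) f (gr a psi u0) / partial a f (gr a psi u0))).
  move=> ue; set B := partial a f (gr a psi u0); set D := partial (lift a l) f (gr a psi u0).
  have [td t0] := psiP u0 ue.
  have B0 : B != 0 by exact: fgr.
  have nB : 0 < `|B| by rewrite normr_gt0.
  apply: is_derive_line0; pose us s : 'rV[R]_m := u0 + s *: basis_vec l.
  have us0 : us 0 = u0 by rewrite /us scale0r addr0.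
  have usc : us s @[s --> (0 : R)] --> u0.
    rewrite -[X in _ --> X]us0; apply: (@cvg_rV _ _ (nbhs (0 : R))) => j.
    have -> : (fun s => us s 0 j) = (fun s => u0 0 j + s * (l == j)%:R).
      by apply/funext => s; rewrite !mxE eqxx eq_sym.
    rewrite us0 -[X in _ --> X]addr0 -[X in _ --> _ + X](mul0r (l == j)%:R).
    by apply: cvgD; [exact: cvg_cst|apply: cvgM; [exact: cvg_id|exact: cvg_cst]].
  have gD : is_derive (0 : R) (1 : R) (fun s => f (ins (psi u0) (us s))) D.
    have E s : ins (psi u0) (us s) = gr a psi u0 + s *: basis_vec (lift a l).
      apply/rowP => j; rewrite [RHS]mxE.
      have -> : (s *: basis_vec (lift a l)) 0 j = s * (j == lift a l)%:R by rewrite !mxE eqxx.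
      case: (unliftP a j) => [l'|] ->.
        by rewrite ins_lift gr_lift !mxE eqxx (inj_eq (@lift_inj _ a)).
      by rewrite ins_at gr_at (negbTE (neq_lift _ _)) mulr0 addr0.
    have -> : (fun s => f (ins (psi u0) (us s))) = (fun s => f (gr a psi u0 + s *: basis_vec (lift a l))).
      by apply/funext => s; rewrite E.
    apply: is_derive_line0V; apply: is_derive_partial.
    exact: (class_C1_derivable (j := lift a l) fW (Wgr u0 ue)).
  pose F s := f (ins (psi u0) (us s)); pose q s := psi (us s) - psi u0.
  have F0 : F 0 = 0 by rewrite /F us0.
  have pD : h^-1 * F h @[h --> (0 : R)^'] --> D.
    have [d1' dv] := gD; have := d1'; rewrite /derivable => /cvgP; rewrite -/(derive _ _ _) dv.
    suff -> : (fun h : R => h^-1 *: (((fun s => f (ins (psi u0) (us s))) \o shift 0) (h *: 1) -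
       f (ins (psi u0) (us 0)))) = (fun h => h^-1 * F h) by [].
    by apply/funext => h /=; rewrite us0 t0 subr0 addr0 [_%:A]mulr1.
  (* A bound for the difference quotients of [psi]: by [psi_le] they are at most 2 / |c| times those
     of [F], which converge to [D]. *)
  pose M := 2 / `|c| * (`|D| + 1).
  have M0 : 0 < M by rewrite mulr_gt0// ?divr_gt0// ltr_wpDl.
  have near' (Q : set R) : nbhs (0 : R) Q -> \forall h \near (0 : R)^', Q h.
    by move=> Q0; exact: (nbhs_dnbhs Q0).
  have ne : \forall h \near (0 : R)^', `|us h| < e.
    by apply: near'; exact: (usc _ (nU u0 ue)).
  have qle (h : R) : `|us h| < e -> `|q h| <= 2 * (`|F h| / `|c|).
    by move=> he; apply: psi_le.
  have qM : \forall h \near (0 : R)^', `|h^-1 * q h| <= M.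
    have n1 : \forall h \near (0 : R)^', `|h^-1 * F h| <= `|D| + 1.
      have /cvgrPdist_le/(_ _ ltr01) n2 := pD; near=> h.
      have H : `|D - h^-1 * F h| <= 1 by near: h; exact: n2.
      move: (h^-1 * F h) H => X H.
      by have := ler_normB D (D - X); rewrite opprB addrC subrK; lra.
    near=> h; have he : `|us h| < e by near: h; exact: ne.
    have hp : `|h^-1 * F h| <= `|D| + 1 by near: h; exact: n1.
    rewrite /M; apply: le_trans (ler_wpM2l _ hp); last by rewrite divr_ge0.
    rewrite !normrM; have := ler_wpM2l (normr_ge0 h^-1) (qle h he).
    by move=> H; apply: (le_trans H); rewrite le_eqVlt; apply/orP; left; apply/eqP; ring.
  (* [f] is linearised in the coordinate [a] over the base point [us h], between psi(u0) and psi(us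
     h). Its slope tends to [B], and the boundedness of the quotients of [psi] makes the error
     vanish in the limit. *)
  have L0 : B * (h^-1 * q h) + h^-1 * F h @[h --> (0 : R)^'] --> (0 : R).
    apply/cvgr0Pnorm_le => e1 e10; have e2 : 0 < e1 / M by rewrite divr_gt0.
    have [d2 d20 H2] : exists2 d : R, 0 < d & forall y : V, `|y - gr a psi u0| < d ->
        W y /\ `|partial a f y - B| <= e1 / M.
      have Wg : W (gr a psi u0) := Wgr u0 ue.
      have n1 : \forall y \near gr a psi u0, W y by exact: open_nbhs_nbhs.
      have /cvgrPdist_le/(_ _ e2) n2 := class_C1_contp (j := a) fW Wg.
      have /near_normP[d d0 H] : \forall y \near gr a psi u0, W y /\ `|partial a f y - B| <= e1 / M.
        by near=> y; split; [near: y; exact: n1|rewrite distrC; near: y; exact: n2].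
      by exists d.
    have n1 : \forall h \near (0 : R)^', `|us h - u0| < d2.
      have n0 : \forall v \near u0, `|v - u0| < d2 by apply/near_normP; exists d2.
      by apply: near'; exact: (usc _ n0).
    have n2 : \forall h \near (0 : R)^', `|q h| < d2.
      have n0 : \forall v \near u0, `|psi v - psi u0| < d2.
        have /cvgrPdist_lt/(_ _ d20) H := psic u0 ue.
        by near=> v; rewrite distrC; near: v; exact: H.
      by apply: near'; exact: (usc _ n0).
    near=> h.
    have he : `|us h| < e by near: h; exact: ne.
    have hq : `|h^-1 * q h| <= M by near: h; exact: qM.
    have h1 : `|us h - u0| < d2 by near: h; exact: n1.
    have h2 : `|q h| < d2 by near: h; exact: n2.
    have := @increment B (e1 / M) (psi u0) (psi (us h)) (us h).
    rewrite (psiP _ he).2 sub0r -/(F h) -/(q h) => H.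
    have {}H : `|- F h - B * q h| <= e1 / M * `|q h|.
      apply: H => s sq; apply: H2; apply: norm_rV_lt => // j; rewrite mxE.
      have -> : (- gr a psi u0) 0 j = - gr a psi u0 0 j by rewrite mxE.
      case: (unliftP a j) => [l'|] ->.
        rewrite ins_lift gr_lift; apply: le_lt_trans h1.
        by have := norm_coord_le (us h - u0) l'; rewrite !mxE.
      by rewrite ins_at gr_at addrAC subrr add0r (le_lt_trans sq).
    have -> : B * (h^-1 * q h) + h^-1 * F h = - (h^-1 * (- F h - B * q h)) by ring.
    rewrite normrN normrM; apply: le_trans (ler_wpM2l (normr_ge0 _) H) _.
    rewrite mulrCA -normrM; apply: le_trans (ler_wpM2l (ltW e2) hq) _.
    by rewrite divfK// gt_eqF.
  have L1 : h^-1 * q h @[h --> (0 : R)^'] --> - (D / B).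
    have H := cvgM (cvgB L0 pD) (cvg_cst B^-1).
    have E : (fun h => h^-1 * q h) = (fun h => (B * (h^-1 * q h) + h^-1 * F h - h^-1 * F h) * B^-1).
      by apply/funext => h; rewrite addrK [RHS]mulrC mulKf.
    have -> : - (D / B) = (0 - D) * B^-1 by rewrite sub0r mulNr.
    by rewrite E; exact: H.
  have E : (fun h : R => h^-1 *: (((fun s => psi (us s)) \o shift 0) (h *: 1) - psi (us 0))) =
      (fun h => h^-1 * q h).
    by apply/funext => h /=; rewrite us0 addr0 [_%:A]mulr1.
  by split; [rewrite /derivable E; apply/cvg_ex; eexists; exact: L1|rewrite /derive E; exact: cvg_lim].
exists d1, e, psi; split => //.
  apply: class_C1P => //.
  - by move=> j u ue; have [] := psiD u j ue.
  - move=> j u ue; apply: (@eq_on_continuous _ _ [set u : 'rV[R]_m | `|u| < e] _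
      (fun u => - (partial (lift a j) f (gr a psi u) / partial a f (gr a psi u)))) => //.
      by move=> v ve; have [] := psiD v j ve.
    have H1 : partial (lift a j) f (gr a psi v) @[v --> u] --> partial (lift a j) f (gr a psi u).
      exact: (cvg_comp _ _ (grc u ue) (class_C1_contp (j := lift a j) fW (Wgr u ue))).
    have H2 : partial a f (gr a psi v) @[v --> u] --> partial a f (gr a psi u).
      exact: (cvg_comp _ _ (grc u ue) (class_C1_contp (j := a) fW (Wgr u ue))).
    exact: (cvgN (cvgM H1 (cvgV (fgr u ue) H2))).
split=> [u ue|y yd ye].
  split; [exact: Wgr|exact: fgr|] => l; by have [] := psiD u l ue.
have yE : ins (y 0 a) (col' a y) = y := ins_col' a y.
split; first by rewrite -yE; apply: insW => //; exact: le_trans (ltW ye) ed.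
split=> [fy|yp]; last by rewrite -yE yp; exact: (psiP _ ye).2.
have := psi_le _ _ ye yd; rewrite yE fy normr0 mul0r mulr0 normr_le0 subr_eq0.
by move/eqP.
Unshelve. all: by end_near. Qed.

End ImplicitFunction.

(** * Hypersurfaces and their blow-ups *)

#[local] Opaque hproj enorm.

Section Surface.
Context {R : realType} {m k : nat} (G : carnot_group R m.+1 k).
Notation V := 'rV[R]_m.+1.
Notation op := (mulG G).
Variable rho : V -> V -> R.
Hypothesis hrho : homogeneous_distance G rho.
Notation N := (rho 0).

Lemma gr_origin (a : 'I_m.+1) (psi : 'rV[R]_m -> R) : psi 0 = 0 -> gr a psi 0 = 0.
Proof.
by move=> p0; apply/rowP => j; case: (unliftP a j) => [l|] ->; rewrite ?gr_lift ?gr_at ?p0 !mxE.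
Qed.

Lemma wvec_origin (a : 'I_m.+1) (psi : 'rV[R]_m -> R) : psi 0 = 0 ->
  wvec G a psi 0 = ins a 1 (- grad psi 0).
Proof. by move=> p0; rewrite wvec_def gr_origin// frame0 trmx1 mulmx1. Qed.

(** Left translation moves the base point to 0; the gradient stays nonzero because the differential
    of the translation is invertible. *)
Lemma surface_interior_op (S : set V) x : surface_interior S x -> exists (W : set V) (f : V -> R),
  [/\ open W, W 0, class_C 1 W f, f 0 = 0 & grad f 0 != 0 /\
    forall y, W y -> S (op x y) <-> f y = 0].
Proof.
move=> [Sx [U [f [oU Ux fU gf SU]]]].
pose W := [set y | U (op x y)].
have opc : continuous (op x).
  by move=> y; exact: (class_C1_map_continuous (class_C1_opl G x) (I : setT y)).
have oW : open W.
  have -> : W = op x @^-1` U by [].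
  by apply: open_comp => // y _; exact: opc.
have opU : class_C1_map W (op x).
  by move=> j; apply: (class_C_sub (U := setT)) => //; exact: class_C1_opl.
have SE y : W y -> S (op x y) <-> f (op x y) = 0.
  move=> Wy; split=> [Sy|fy].
    by have [] : ([set y | f y = 0] `&` U) (op x y) by rewrite -SU.
  by have [] : (S `&` U) (op x y) by rewrite SU.
have W0 : W 0 by rewrite /W/= op0r.
exists W, (fun y => f (op x y)); split => //.
- exact: (class_C1_comp oU oW fU).
- by apply/(SE 0 W0); rewrite op0r.
split => //; apply: contra gf => /eqP g0.
have J0 : grad f x *m (Defs.jacobian (op x) 0)^T = 0.
  apply/rowP => j; rewrite [RHS]mxE.
  have [_] := is_derive_comp_partial (f := f) (L := op x) (w := 0) (j := j) oU fU W0
    (fun l => class_C1_derivable (j := j) (class_C1_opl G x l) (I : setT 0)).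
  have -> : 'D_(basis_vec j) (fun z => f (op x z)) 0 = grad (fun y => f (op x y)) 0 0 j by rewrite mxE.
  rewrite g0 mxE => /esym E; rewrite -[RHS]E mxE /lin_form; apply: eq_bigr => l _.
  by rewrite !mxE op0r mulrC.
have Ju : (Defs.jacobian (op x) 0)^T \in unitmx by rewrite unitmx_tr jacobian_op0.
by rewrite -(mulmxK Ju (grad f x)) J0 mul0mx.
Qed.

Lemma surface_graph (S : set V) x (W : set V) (f : V -> R) (a : 'I_m.+1) : open W -> W 0 ->
  class_C 1 W f -> f 0 = 0 -> partial a f 0 != 0 ->
  (forall y, W y -> S (op x y) <-> f y = 0) ->
  exists (e r : R) (psi : 'rV[R]_m -> R),
  [/\ 0 < e, 0 < r, class_C 1 [set u | `|u| < e] psi, psi 0 = 0 &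
    (forall l, partial l psi 0 = - (partial (lift a l) f 0 / partial a f 0)) /\
    (forall y, N y < r -> S (op x y) <-> (`|col' a y| < e /\ y 0 a = psi (col' a y)))].
Proof.
move=> oW W0 fW f0 fa SW.
have [d [e [psi [d0 e0 psi0 psiC [H1 H2]]]]] := implicit_function oW W0 fW f0 fa.
have [r r0 rP] : exists2 r : R, 0 < r & forall y, N y < r -> `|y| < Num.min d e.
  have n0 : \forall y \near (0 : V), `|y| < Num.min d e.
    by apply/near_normP; exists (Num.min d e); [rewrite lt_min d0|move=> y; rewrite subr0].
  have [r r0 rP] := ball_small hrho n0.
  exists (r / 2); first by rewrite divr_gt0.
  move=> y Ny; apply: (rP (r / 2) y) => //; apply/andP; split; lra.
exists e, r, psi; split => //; split=> [l|y /rP].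
  have n0 : `|0 : 'rV[R]_m| < e by rewrite normr0.
  by have [_ _ /(_ l)] := H1 0 n0; rewrite gr_origin.
rewrite lt_min => /andP[yd ye].
have ye' : `|col' a y| < e.
  apply: norm_rV_lt => // l; rewrite mxE; exact: le_lt_trans (norm_coord_le _ _) ye.
have [Wy fy] := H2 y (ltW (le_lt_trans (norm_coord_le y a) yd)) ye'.
by rewrite (SW y Wy) fy; split=> [|[]].
Qed.

(** Both the measure of the balls and the constant are evaluated by [graph_formula], the constant on
    the global limit graph. The base point [x'] is free because the constant is taken at [x] for the
    vertical hyperplane and at 0 for [S_infty]. *)
Lemma sigma_H_asymp sigma (hsigma : riemannian_surface_measure G sigma) (S : set V) x (a : 'I_m.+1)
    (psi : 'rV[R]_m -> R) (U : set 'rV[R]_m) (r : R) : open U -> U 0 ->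
  class_C (ord G a) U psi -> flat_to (ord_lift G a) (ord G a) psi -> 0 < r ->
  (forall y, N y < r -> S (op x y) <-> (U (col' a y) /\ y 0 a = psi (col' a y))) ->
  forall (S' : set V) x', (forall y, S' (op x' y) <-> y 0 a = taylor_limit G a psi (col' a y)) ->
  asymp_at0 (fun s => sigma_H G sigma S (rball rho x s)) (sigma_H G sigma S' (rball rho x' 1))
    (hom_dim G).-1.
Proof.
move=> oU U0 psiU fl r0 SP S' x' SP'.
have psiU1 : class_C 1 U psi := class_C_le (ord_gt0 G a) psiU.
have PC1 : class_C 1 setT (taylor_limit G a psi).
  exact: (taylor_poly_C1 (fun l => ord_gt0 G (lift a l)) oU U0 psiU fl).1.
have SP1 y : N y < 1 -> S' (op x' y) <-> (setT (col' a y) /\ y 0 a = taylor_limit G a psi (col' a y)).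
  by move=> _; rewrite SP'; split=> [|[]].
have [fin cv] := rescaled_limit hrho oU U0 psiU fl.
have E1 := graph_formula hrho hsigma openT PC1 SP1 (lexx 1).
rewrite setTI in E1; split; first by rewrite E1.
rewrite E1; apply: cvg_trans cv; apply: near_eq_cvg; near=> s.
by rewrite (graph_formula hrho hsigma oU psiU1 SP)//; near: s; exact: nbhs_right_le.
Unshelve. all: by end_near. Qed.

(** The two conditions differ only at the empty word, whose derivative is [psi 0]. *)
Lemma low_order_vanishing_flat (a : 'I_m.+1) (psi : 'rV[R]_m -> R) : psi 0 = 0 ->
  low_order_vanishing G a psi <-> flat_to (ord_lift G a) (ord G a) psi.
Proof.
move=> p0; split=> [L [//|j s] H|L s _ H]; last exact: L.
exact: L.
Qed.

Lemma psi_tilde_taylor (a : 'I_m.+1) (psi : 'rV[R]_m -> R) : psi_tilde G a psi = taylor_limit G a psi.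
Proof.
apply/funext => v; rewrite /taylor_limit /taylor_poly big_ltn// {1}/taylor_part big1 ?mulr0 ?add0r//.
move=> s; rewrite tuple0 /wsum big_nil => /eqP i0.
by have := ord_gt0 G a; rewrite -i0.
Qed.

(** The normal is computed from a graph in some direction b with nonzero derivative. At the origin
    the frame is the identity, so the horizontal part of the normal is proportional to the
    horizontal derivatives of [f]; if these all vanished, the point would be characteristic. *)
Lemma horizontal_partial (S : set V) x (W : set V) (f : V -> R) : open W -> W 0 ->
  class_C 1 W f -> f 0 = 0 -> grad f 0 != 0 ->
  (forall y, W y -> S (op x y) <-> f y = 0) -> enorm (hnormal G S x) != 0 ->
  exists j, ord G j = 1%N /\ partial j f 0 != 0.
Proof.
move=> oW W0 fW f0 gf SW hn.
have [b fb] : exists b, partial b f 0 != 0.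
  apply: contrapT => no; move/eqP: gf; apply; apply/rowP => j; rewrite !mxE.
  by apply/eqP; apply/negPn/negP => H; apply: no; exists j.
have [e [r [psi [e0 r0 psiC psi0 [Dpsi SP]]]]] := surface_graph oW W0 fW f0 fb SW.
have oU : open [set u : 'rV[R]_m | `|u| < e].
  have -> : [set u : 'rV[R]_m | `|u| < e] = (fun u : 'rV[R]_m => `|u|) @^-1` [set t | t < e] by [].
  by apply: open_comp; [move=> v _; exact: norm_continuous|exact: open_lt].
have U0 : `|0 : 'rV[R]_m| < e by rewrite normr0.
have N0r : N (gr b psi 0) < r by rewrite gr_origin// (N0 hrho).
have hE := hnormal_graph hrho oU psiC SP U0 N0r.
rewrite /= gr_origin// op0r in hE.
apply: contrapT => no; move/eqP: hn; apply; rewrite hE.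
suff -> : hproj G (wvec G b psi 0) = 0.
  by have /eqP -> : enorm (0 : V) == 0; rewrite ?mul0r// enorm_eq0.
apply/rowP => j; rewrite hprojE [RHS]mxE; case: eqP => // oj.
rewrite wvec_origin//; apply: contrapT => wj; apply: no; exists j; split => //.
apply/eqP => fj; apply: wj.
move: oj fj; case: (unliftP b j) => [l|] -> oj fj; last by rewrite fj eqxx in fb.
by rewrite ins_lift !mxE Dpsi fj mul0r oppr0 oppr0.
Qed.

Lemma taylor_limit1 (a : 'I_m.+1) (psi : 'rV[R]_m -> R) v : ord G a = 1%N ->
  taylor_limit G a psi v = \sum_l (if ord G (lift a l) == 1%N then partial l psi 0 * v 0 l else 0).
Proof.
have part0 (o : 'I_m -> nat) n phi (w : 'rV[R]_m) : taylor_part o 0 n phi w = if n == 0%N then phi 0 else 0.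
  rewrite /taylor_part; case: eqP => [->|/eqP n0].
    rewrite (big_pred1 [tuple]) => [|s]; first by rewrite big_nil mulr1.
    have -> : wsum o s = 0%N by rewrite (tuple0 s) /wsum big_nil.
    by change (true = (s == [tuple])); apply/esym/eqP; exact: tuple0.
  by rewrite big_pred0// => s; rewrite tuple0 /wsum big_nil eq_sym (negbTE n0).
move=> oa1; rewrite /taylor_limit oa1 /taylor_poly !big_nat_recl//= big_nil addr0.
rewrite part0 mulr0 add0r invr1 mul1r taylor_part_rec; apply: eq_bigr => l _.
rewrite part0 /ord_lift; have := ord_gt0 G (lift a l); case: (ord G (lift a l)) => [|[|n]]//= _.
  by rewrite mulrC.
by rewrite mulr0.
Qed.

(** At the origin [wvec] is the gradient of y_a - psi, and [nu_H] is a nonzero multiple of its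
    horizontal part. In weight one the Taylor polynomial is the horizontal linear part of [psi]
    ([taylor_limit1]), and horizontal coordinates add under the product, so the two equations
    agree. *)
Lemma vertical_hyperplane_graph (S : set V) x (a : 'I_m.+1) (psi : 'rV[R]_m -> R)
    (U : set 'rV[R]_m) (r : R) : open U -> U 0 -> class_C 1 U psi -> psi 0 = 0 ->
  ord G a = 1%N -> 0 < r ->
  (forall y, N y < r -> S (op x y) <-> (U (col' a y) /\ y 0 a = psi (col' a y))) ->
  enorm (hnormal G S x) != 0 ->
  forall y, vertical_hyperplane G x (nu_H G S x) (op x y) <-> y 0 a = taylor_limit G a psi (col' a y).
Proof.
move=> oU U0 psiU psi0 oa1 r0 SP hn y.
have N0r : N (gr a psi 0) < r by rewrite gr_origin// (N0 hrho).
have xE : op x (gr a psi 0) = x by rewrite gr_origin// op0r.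
have un : is_unit_normal G S x (unit_normal G S x).
  have := unit_normal_exists hrho oU psiU SP U0 N0r; rewrite /= xE => un.
  exact: (xgetPex 0 (ex_intro _ _ un)).
have := @unit_normal_graph _ _ _ _ _ hrho _ _ _ oU psiU _ _ _ SP 0 (unit_normal G S x) U0 N0r.
rewrite /= xE => /(_ un)[c cE _].
have hE j : nu_H G S x 0 j = (enorm (hnormal G S x))^-1 * c *
    (if ord G j == 1%N then ins a 1 (- grad psi 0) 0 j else 0).
  rewrite /nu_H [LHS]mxE /hnormal hprojE {2}cE wvec_origin// -mulrA; congr (_ * _).
  by case: eqP => _; [rewrite [LHS]mxE|rewrite mulr0].
set t := _ * c in hE.
have t0 : t != 0.
  apply: contraNneq hn => t0; have nu0 : nu_H G S x = 0.
    by apply/rowP => j; rewrite hE t0 mul0r mxE.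
  by move/eqP: nu0; rewrite /nu_H scaler_eq0 invr_eq0 -enorm_eq0 orbb.
have hy : hproj G (op x y - x) = hproj G y.
  apply/rowP => j; have := congr1 (fun u : V => u 0 j) (hproj_op G x y).
  rewrite [(hproj G x + _) 0 j]mxE !hprojE [(op x y - x) 0 j]mxE [(- x) 0 j]mxE.
  by case: eqP => // _ ->; rewrite addrAC subrr add0r.
have iE : inner (hproj G (op x y - x)) (nu_H G S x) = t * (y 0 a - taylor_limit G a psi (col' a y)).
  rewrite hy /inner (sum_ins a) taylor_limit1// mulrBr; congr (_ + _).
    by rewrite hE hprojE oa1 eqxx ins_at mulr1 mulrC.
  rewrite mulr_sumr -sumrN; apply: eq_bigr => l _.
  rewrite hE hprojE; case: eqP => _; last by rewrite !mulr0 oppr0.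
  by rewrite ins_lift !mxE; ring.
rewrite /vertical_hyperplane/= iE; split=> [/eqP|->]; last by rewrite subrr mulr0.
by rewrite mulf_eq0 (negbTE t0)/= subr_eq0 => /eqP.
Qed.

Lemma norm_ball_open p (e : R) : open [set u : 'rV[R]_p | `|u| < e].
Proof.
have -> : [set u : 'rV[R]_p | `|u| < e] = (fun u : 'rV[R]_p => `|u|) @^-1` [set t | t < e] by [].
by apply: open_comp; [move=> v _; exact: norm_continuous|exact: open_lt].
Qed.

Lemma near_N_gr (a : 'I_m.+1) (psi : 'rV[R]_m -> R) (U : set 'rV[R]_m) (r : R) : open U -> U 0 ->
  class_C 1 U psi -> psi 0 = 0 -> 0 < r -> \forall u \near (0 : 'rV[R]_m), N (gr a psi u) < r.
Proof.
move=> oU U0 psiU psi0 r0.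
have H : N (gr a psi u) @[u --> (0 : 'rV[R]_m)] --> N (gr a psi 0).
  exact: (cvg_comp _ _ (gr_continuous oU psiU U0) (@N_continuous _ _ _ G rho hrho _)).
by apply: (cvgr_lt _ H); rewrite gr_origin// (N0 hrho).
Qed.

(* Otherwise S contains a curve through x with velocity X_a, along which
   psi (col' a y) has zero derivative. *)
Lemma graph_partial (S : set V) x (W : set V) (f : V -> R) (a : 'I_m.+1)
    (psi : 'rV[R]_m -> R) (U : set 'rV[R]_m) (r1 : R) : open W -> W 0 ->
  class_C 1 W f -> f 0 = 0 -> grad f 0 != 0 -> (forall y, W y -> S (op x y) <-> f y = 0) ->
  open U -> U 0 -> class_C 1 U psi -> 0 < r1 ->
  (forall y, N y < r1 -> S (op x y) -> y 0 a = psi (col' a y)) -> partial a f 0 != 0.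
Proof.
move=> oW W0 fW f0 gf SW oU U0 psiU r10 Spsi; apply/negP => /eqP fa.
have [b fb] : exists b, partial b f 0 != 0.
  apply: contrapT => no; move/eqP: gf; apply; apply/rowP => j; rewrite !mxE.
  by apply/eqP; apply/negPn/negP => H; apply: no; exists j.
have ab : b != a by apply: contraNneq fb => ->; rewrite fa.
case: (unliftP b a) => [a' aE|aE]; last by rewrite aE eqxx in ab.
have [e [r [phi [e0 r0 phiC phi0 [Dphi SP]]]]] := surface_graph oW W0 fW f0 fb SW.
have oUe := @norm_ball_open m e.
have Ue0 : `|0 : 'rV[R]_m| < e by rewrite normr0.
pose y t := gr b phi (t *: basis_vec a').
have ya t : y t 0 a = t by rewrite /y aE gr_lift !mxE !eqxx mulr1.
have Da : is_derive (0 : R) (1 : R) (fun t => phi (t *: basis_vec a')) 0.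
  have D1 : derivable phi 0 (basis_vec a') := class_C1_derivable (j := a') phiC Ue0.
  have := is_derive_line0V (is_derive_partial D1).
  rewrite Dphi -aE fa mul0r oppr0.
  have -> // : (fun s : R => phi (0 + s *: basis_vec a')) = (fun s => phi (s *: basis_vec a')).
  by apply/funext => s; rewrite add0r.
have cE t l : col' a (y t) 0 l = y t 0 (lift a l) by rewrite mxE.
have Dc : is_derive (0 : R) (1 : R) (fun t => col' a (y t)) 0.
  apply: is_derive_rV => l; rewrite mxE.
  have -> : (fun t => col' a (y t) 0 l) = (fun t => y t 0 (lift a l)) by apply/funext => t; rewrite cE.
  case: (unliftP b (lift a l)) => [l' lE|lE].
    have -> : (fun t => y t 0 (lift a l)) = (fun=> 0).
      apply/funext => t; rewrite /y lE gr_lift !mxE.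
      have /negbTE -> : l' != a'; last by rewrite andbF mulr0.
      by apply: contraNneq (neq_lift a l) => E; rewrite lE E -aE.
    exact: is_derive_cst.
  have -> : (fun t => y t 0 (lift a l)) = (fun t => phi (t *: basis_vec a')) => //.
  by apply/funext => t; rewrite /y lE gr_at.
have y0 : y 0 = 0 by rewrite /y scale0r gr_origin.
have c0 : col' a (y 0) = 0 by rewrite y0; apply/rowP => l; rewrite !mxE.
have U0' : U (col' a (y 0)) by rewrite c0.
have := is_derive_curve oU psiU U0' Dc.
rewrite linear0 => Dg.
have DI : is_derive (0 : R) (1 : R) (fun t => psi (col' a (y t)) - t) (0 - 1) by apply: is_deriveB.
have SP0 t : N (y t) < r -> N (y t) < r1 -> `|t| < e -> t = psi (col' a (y t)).
  move=> Nr Nr1 te; rewrite -[LHS]ya; apply: Spsi => //; apply/(SP _ Nr).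
  rewrite /y col'_gr gr_at; split => //; rewrite normrZ.
  by apply: le_lt_trans te; rewrite ler_piMr// norm_basis_vec.
have r2 : 0 < Num.min r r1 by rewrite lt_min r0.
have /near_normP[d d0 dP] := near_N_gr b oUe Ue0 phiC phi0 r2.
suff : 0 - 1 = 0 :> R by move/eqP; rewrite sub0r oppr_eq0 oner_eq0.
apply: (deriv0_right DI); near=> t.
have t0 : 0 < t by near: t; exact: nbhs_right_gt.
have te : t < e by near: t; exact: nbhs_right_lt.
have td : t < d by near: t; exact: nbhs_right_lt.
have /andP[] : (N (y t) < r) && (N (y t) < r1).
  rewrite -lt_min; apply: dP; rewrite subr0 normrZ gtr0_norm//; apply: le_lt_trans td.
  by rewrite ler_piMr ?norm_basis_vec// ltW.
move=> Nr Nr1; rewrite -(SP0 t)// ?gtr0_norm// subrr subr0.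
by rewrite -(SP0 0)// ?y0 ?(N0 hrho)// normr0.
Unshelve. all: by end_near. Qed.

(** The inclusion alone does not tell which points of the graph of [psi] belong to [S]. The graph of
    the implicit function consists of points of [S], hence lies on that of [psi], and the two
    functions coincide near 0. *)
Lemma graph_agree (S : set V) x (W : set V) (f : V -> R) (a : 'I_m.+1)
    (psi : 'rV[R]_m -> R) (U : set 'rV[R]_m) (r1 : R) : open W -> W 0 ->
  class_C 1 W f -> f 0 = 0 -> partial a f 0 != 0 -> (forall y, W y -> S (op x y) <-> f y = 0) ->
  open U -> U 0 -> 0 < r1 ->
  (forall y, N y < r1 -> S (op x y) -> y 0 a = psi (col' a y)) ->
  exists (U' : set 'rV[R]_m) (r : R), [/\ open U', U' 0, U' `<=` U, 0 < r &
    forall y, N y < r -> S (op x y) <-> (U' (col' a y) /\ y 0 a = psi (col' a y))].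
Proof.
move=> oW W0 fW f0 fa SW oU U0 r10 Spsi.
have [e [r [phi [e0 r0 phiC phi0 [Dphi SP]]]]] := surface_graph oW W0 fW f0 fa SW.
have oUe := @norm_ball_open m e.
have Ue0 : `|0 : 'rV[R]_m| < e by rewrite normr0.
have r2 : 0 < Num.min r r1 by rewrite lt_min r0.
have /near_normP[d1 d10 d1P] := near_N_gr a oUe Ue0 phiC phi0 r2.
have nU : \forall u \near (0 : 'rV[R]_m), U u by exact: open_nbhs_nbhs.
have [d2 d20 d2P] := (near_normP _ _).1 nU.
pose d := Num.min e (Num.min d1 d2).
have d0 : 0 < d by rewrite !lt_min e0 d10.
have phiE u : `|u| < d -> phi u = psi u.
  rewrite !lt_min => /and3P[ue ud1 ud2].
  have /andP[Nr Nr1] : (N (gr a phi u) < r) && (N (gr a phi u) < r1).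
    by rewrite -lt_min; apply: d1P; rewrite subr0.
  have Sg : S (op x (gr a phi u)) by apply/(SP _ Nr); rewrite col'_gr gr_at.
  by have := Spsi _ Nr1 Sg; rewrite col'_gr gr_at.
have n0 : \forall y \near (0 : V), `|y| < d.
  by apply/near_normP; exists d => // y; rewrite subr0.
have [r3 r30 r3P] := ball_small hrho n0.
exists [set u | `|u| < d], (Num.min r (Num.min r1 (r3 / 2))); split.
- exact: norm_ball_open.
- by rewrite /= normr0.
- by move=> u /=; rewrite !lt_min => /and3P[_ _ ud2]; apply: d2P; rewrite subr0.
- by rewrite !lt_min r0 r10 divr_gt0.
move=> y; rewrite !lt_min => /and3P[Nr Nr1 Nr3].
have yd : `|y| < d by apply: (r3P (r3 / 2)) => //; apply/andP; split; lra.
have cd : `|col' a y| < d.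
  by apply: norm_rV_lt => // l; rewrite mxE; exact: le_lt_trans (norm_coord_le _ _) yd.
rewrite (SP y Nr) -(phiE _ cd); split=> [[]//|[_ ->]]; split => //.
by move: cd; rewrite lt_min => /andP[].
Qed.

Lemma dil_invP S (r : R) z : 0 < r -> (dil G r^-1 @` S) z <-> S (dil G r z).
Proof.
move=> r0; have rn : r != 0 by rewrite gt_eqF.
split=> [[y Sy <-]|Sz]; first by rewrite (dilVK G rn).
by exists (dil G r z) => //; rewrite (dilK G rn).
Qed.

Lemma lower_sub_upper (S : set V) : lower_blowup G S `<=` upper_blowup G S.
Proof.
move=> y yl W Wy no; have lo := yl W Wy.
have : \forall r \near (0 : R)^'+, False.
  near=> r; have [z zW] : (W `&` dil G r^-1 @` S) !=set0 by near: r; exact: lo.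
  suff E : W `&` dil G r^-1 @` S = set0 by move: zW; rewrite E.
  by near: r; exact: no.
by move/filter_ex => -[].
Unshelve. all: by end_near. Qed.

(** * Set limits of the dilated graph *)

Section Blowup.
Variables (a : 'I_m.+1) (psi : 'rV[R]_m -> R) (U : set 'rV[R]_m) (S : set V) (r0 : R).
Hypotheses (oU : open U) (U0 : U 0) (psiU : class_C (ord G a) U psi) (r00 : 0 < r0).
Hypothesis SP : forall y, N y < r0 -> S y <-> (U (col' a y) /\ y 0 a = psi (col' a y)).

Let N_bounded (K : R) : exists2 M : R, 0 < M & forall y : V, `|y| <= K -> N y < M.
Proof.
have [M M0 MP] := continuous_bounded K (@N_continuous _ _ _ G rho hrho).
exists (M + 1) => [|y /MP]; first by rewrite addr_gt0.
by rewrite ger0_norm ?(N_ge0 hrho)//; lra.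
Qed.

Let S_dil (M : R) : 0 < M -> \forall r \near (0 : R)^'+, forall z, N z < M ->
  S (dil G r z) <-> (U (wdil (ord_lift G a) r (col' a z)) /\
    r ^+ ord G a * z 0 a = psi (wdil (ord_lift G a) r (col' a z))).
Proof.
move=> M0; near=> r => z zM.
have r_gt0 : 0 < r by near: r; exact: nbhs_right_gt.
have rM : r < r0 / M by near: r; apply: nbhs_right_lt; exact: divr_gt0.
have cE : col' a (dil G r z) = wdil (ord_lift G a) r (col' a z) by apply/rowP => l; rewrite !mxE.
have -> : r ^+ ord G a * z 0 a = dil G r z 0 a by rewrite [dil G r z 0 a]mxE.
rewrite -cE; apply: SP; rewrite (N_dil hrho)//; apply: (@le_lt_trans _ _ (r * M)); first by rewrite ler_pM2l// ltW.
by rewrite -ltr_pdivlMr.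
Unshelve. all: by end_near. Qed.

(** Pointwise convergence of the rescaled functions puts the limit graph in the lower limit. Near a
    point off that graph, uniform convergence keeps the dilated surfaces away, so the upper limit
    contains nothing else. *)
Lemma blowup_flat : flat_to (ord_lift G a) (ord G a) psi ->
  lower_blowup G S = xgraph a (taylor_limit G a psi) /\
  upper_blowup G S = xgraph a (taylor_limit G a psi).
Proof.
move=> fl; set P := taylor_limit G a psi.
have c1 : xgraph a P `<=` lower_blowup G S.
  move=> y yP W Wy; pose v : 'rV[R]_m := col' a y.
  have yE : gr a P v = y := gr_col' yP.
  have gc := @gr_r_cvg _ _ _ G a psi U oU U0 psiU fl v.
  have n1 : \forall r \near (0 : R)^'+, W (gr a (psi_r G a psi r) v) by apply: gc; rewrite yE.
  have Nc : N (gr a (psi_r G a psi r) v) @[r --> (0 : R)^'+] --> N (gr a P v).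
    exact: (@N_gr_r_cvg _ _ _ G rho hrho a psi U oU U0 psiU fl v).
  pose M := N (gr a P v) + 1.
  have M0 : 0 < M by rewrite ltr_wpDl ?(N_ge0 hrho).
  have NM : N (gr a P v) < M by rewrite ltrDl.
  have n2 : \forall r \near (0 : R)^'+, N (gr a (psi_r G a psi r) v) < M := cvgr_lt _ Nc _ NM.
  have n3 := S_dil M0.
  have n4 := near_taylor oU U0 psiU fl (normr_ge0 v) (@ltr01 R).
  near=> r; have r_gt0 : 0 < r by near: r; exact: nbhs_right_gt.
  exists (gr a (psi_r G a psi r) v); split; first by near: r; exact: n1.
  apply/dil_invP => //.
  have SE : forall z, N z < M -> S (dil G r z) <-> (U (wdil (ord_lift G a) r (col' a z)) /\
    r ^+ ord G a * z 0 a = psi (wdil (ord_lift G a) r (col' a z))) by near: r; exact: n3.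
  apply/SE; first by near: r; exact: n2.
  have HU : forall w : 'rV[R]_m, `|w| <= `|v| -> [/\ U (wdil (ord_lift G a) r w),
      `|psi_r G a psi r w - P w| <= 1 & forall l, `|grad_r G a psi r w 0 l - grad P w 0 l| <= 1].
    by near: r; exact: n4.
  rewrite col'_gr gr_at; split; first by have [] := HU v (lexx _).
  by rewrite /psi_r mulrC divfK// expf_neq0// gt_eqF.
have c2 : upper_blowup G S `<=` xgraph a P.
  move=> y yu; apply: contrapT => yP.
  (* Half the vertical distance to the limit graph: points of [W] stay farther than [e] from it,
     while the rescaled surface is within [e]. *)
  pose e := `|y 0 a - P (col' a y)| / 2.
  have e0 : 0 < e by rewrite divr_gt0// normr_gt0 subr_eq0; exact/eqP.
  pose K := `|y| + 1.
  have K0 : 0 <= K by rewrite addr_ge0.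
  have [M M0 MP] := N_bounded K.
  pose D (z : V) : R := z 0 a - P (col' a z).
  pose W := [set z : V | `|z - y| < 1 /\ e < `|D z|].
  have Pc : continuous P := @taylor_poly_continuous _ _ (ord_lift G a) (ord G a) (ord G a) psi.
  have cc : continuous (fun z : V => col' a z : 'rV[R]_m).
    move=> z; apply: (@cvg_rV _ _ (nbhs z)) => l; rewrite mxE.
    have -> : (fun t : V => col' a t 0 l) = (fun t => t 0 (lift a l)) by apply/funext => t; rewrite mxE.
    exact: coord_continuous.
  have Wy : nbhs y W.
    have h1 : \forall z \near y, `|z - y| < 1 by apply/near_normP; exists 1.
    have h2 : \forall z \near y, e < `|D z|.
      have c1' : (fun z : V => z 0 a) @ nbhs y --> y 0 a by exact: coord_continuous.
      have c2' : (fun z : V => P (col' a z)) @ nbhs y --> P (col' a y).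
        exact: (cvg_comp _ _ (cc y) (Pc _)).
      have H : (fun z => `|D z|) @ nbhs y --> `|D y| by apply: cvg_norm; exact: (cvgB c1' c2').
      by apply: (cvgr_gt _ H); move: e0; rewrite /e /D; lra.
    have : \forall z \near y, `|z - y| < 1 /\ e < `|D z|.
      by near=> z; split; [near: z; exact: h1|near: z; exact: h2].
    by [].
  apply: (yu W Wy); have n3 := S_dil M0.
  have n4 := near_taylor oU U0 psiU fl K0 e0.
  near=> r; have r_gt0 : 0 < r by near: r; exact: nbhs_right_gt.
  have SE : forall z, N z < M -> S (dil G r z) <-> (U (wdil (ord_lift G a) r (col' a z)) /\
    r ^+ ord G a * z 0 a = psi (wdil (ord_lift G a) r (col' a z))) by near: r; exact: n3.
  have HU : forall w : 'rV[R]_m, `|w| <= K -> [/\ U (wdil (ord_lift G a) r w),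
      `|psi_r G a psi r w - P w| <= e & forall l, `|grad_r G a psi r w 0 l - grad P w 0 l| <= e].
    by near: r; exact: n4.
  apply/seteqP; split => // z [[zy ze]] /(dil_invP _ _ r_gt0) Sz.
  have zK : `|z| <= K by have := ler_normD (z - y) y; rewrite subrK /K; move: zy; lra.
  have [_ zp] := (SE z (MP z zK)).1 Sz.
  have cK : `|col' a z| <= K.
    by apply: norm_rV_le => // l; rewrite mxE; exact: le_trans (norm_coord_le _ _) zK.
  have [_ H _] := HU _ cK; move: H; rewrite /psi_r -zp mulrAC mulfV ?expf_neq0 ?gt_eqF// mul1r.
  by rewrite leNgt; move: ze; rewrite /D => ->.
have c3 := @lower_sub_upper S.
split; apply/seteqP; split => //.
- by move=> y /c3/c2.
- by move=> y /c1/c3.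
Unshelve. all: by end_near. Qed.

(* If d is the least weighted order of a nonzero derivative of psi, then the
   rescaled function is of size r^(d - i) where the Taylor polynomial of weight d
   does not vanish. *)
Lemma blowup_not_flat phi : psi 0 = 0 -> ~ flat_to (ord_lift G a) (ord G a) psi ->
  lower_blowup G S <> xgraph a phi.
Proof.
move=> psi0 nfl lo.
have exd : exists d, `[< exists s, wsum (ord_lift G a) s = d /\ iter_partial s psi 0 <> 0 >].
  apply: contrapT => no; apply: nfl => s _; apply: contrapT => ps; apply: no.
  by exists (wsum (ord_lift G a) s); apply/asboolP; exists s.
have [d /asboolP[s0 [s0d s00]] dmin] := ex_minnP exd.
have fd : flat_to (ord_lift G a) d psi.
  move=> s sd; apply: contrapT => ps; move: sd; rewrite ltnNge => /negP; apply; apply: dmin.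
  by apply/asboolP; exists s.
have di : (d < ord G a)%N.
  rewrite ltnNge; apply/negP => id; apply: nfl => s si; apply: fd; exact: leq_trans si id.
have psid : class_C d U psi := class_C_le (ltnW di) psiU.
have oa0 (l : 'I_m) : (0 < ord_lift G a l)%N := ord_gt0 G (lift a l).
pose Q := taylor_poly (ord_lift G a) d d psi.
have [v0 Qv0] : exists v0, Q v0 != 0.
  apply: contrapT => no; apply: s00; apply: (taylor_poly_nonzero oa0 oU U0 psid fd) s0d => v.
  by apply/eqP/negPn/negP => H; apply: no; exists v.
have Qc : continuous Q := @taylor_poly_continuous _ _ (ord_lift G a) d d psi.
(* A quarter of |Q v0|: near the candidate point |Q| exceeds 2 c, while the Taylor error is at most
   c and the rescaled function itself is below c. *)
pose c := `|Q v0| / 4.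
have c0 : 0 < c by rewrite divr_gt0// normr_gt0.
have qc : 2 * c < `|Q v0| by rewrite /c; move: c0; rewrite /c; lra.
pose y := gr a phi v0.
have yl : lower_blowup G S y by rewrite lo /xgraph/= /y gr_at col'_gr.
pose D (z : V) := `|Q (col' a z)|.
have cc : continuous (fun z : V => col' a z : 'rV[R]_m).
  move=> z; apply: (@cvg_rV _ _ (nbhs z)) => l; rewrite mxE.
  have -> : (fun t : V => col' a t 0 l) = (fun t => t 0 (lift a l)) by apply/funext => t; rewrite mxE.
  exact: coord_continuous.
pose K := `|y| + 1.
have K0 : 0 < K by rewrite ltr_wpDl.
have [M M0 MP] := N_bounded K.
pose W := [set z : V | `|z - y| < 1 /\ 2 * c < D z].
have Wy : nbhs y W.
  have h1 : \forall z \near y, `|z - y| < 1 by apply/near_normP; exists 1.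
  have h2 : \forall z \near y, 2 * c < D z.
    have H : D @ nbhs y --> D y.
      by apply: cvg_norm; exact: (cvg_comp _ _ (cc y) (Qc _)).
    by apply: (cvgr_gt _ H); rewrite /D /y col'_gr.
  have : \forall z \near y, `|z - y| < 1 /\ 2 * c < D z.
    by near=> z; split; [near: z; exact: h1|near: z; exact: h2].
  by [].
have n1 := yl W Wy; have n3 := S_dil M0.
have [r1 r10 H1] := taylor_estimate oa0 oU U0 psid fd (ltW K0) c0.
have : \forall r \near (0 : R)^'+, False.
  near=> r; have r_gt0 : 0 < r by near: r; exact: nbhs_right_gt.
  have rr1 : r < r1 by near: r; exact: nbhs_right_lt.
  have rlt1 : r < 1 by near: r; exact: nbhs_right_lt.
  have rc : r < c / K by near: r; apply: nbhs_right_lt; exact: divr_gt0.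
  have [z [[zy zD] /(dil_invP _ _ r_gt0) Sz]] : (W `&` dil G r^-1 @` S) !=set0 by near: r; exact: n1.
  have SE : forall z, N z < M -> S (dil G r z) <-> (U (wdil (ord_lift G a) r (col' a z)) /\
    r ^+ ord G a * z 0 a = psi (wdil (ord_lift G a) r (col' a z))) by near: r; exact: n3.
  have zK : `|z| <= K by have := ler_normD (z - y) y; rewrite subrK /K; move: zy; lra.
  have [_ zp] := (SE z (MP z zK)).1 Sz.
  have cK : `|col' a z| <= K.
    by apply: norm_rV_le => [|l]; [exact: ltW|rewrite mxE; exact: le_trans (norm_coord_le _ _) zK].
  have r01 : 0 < r < r1 by rewrite r_gt0.
  have := H1 r _ r01 cK; rewrite -zp -/(Q _).
  have -> : r ^+ ord G a * z 0 a / r ^+ d = r ^+ (ord G a - d)%N * z 0 a.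
    have E : r ^+ ord G a = r ^+ (ord G a - d)%N * r ^+ d by rewrite -exprD subnK// ltnW.
    by rewrite E; field; rewrite expf_neq0// gt_eqF.
  have rd : r ^+ (ord G a - d)%N <= r.
    rewrite -(subnSK di) exprS; apply: ler_piMr; first exact: ltW.
    by apply: exprn_ile1; exact: ltW.
  have xc : `|r ^+ (ord G a - d)%N * z 0 a| < c.
    rewrite normrM ger0_norm ?exprn_ge0 ?(ltW r_gt0)//.
    apply: (@le_lt_trans _ _ (r * K)); last by rewrite -ltr_pdivlMr.
    by apply: ler_pM => //; [exact: exprn_ge0 (ltW r_gt0)|exact: le_trans (norm_coord_le _ _) zK].
  set X := _ * z 0 a in xc *; move=> H2.
  have := ler_normB X (X - Q (col' a z)); rewrite opprB addrCA subrr addr0.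
  by move: zD; rewrite /D; lra.
by move/filter_ex => -[].
Unshelve. all: by end_near. Qed.

End Blowup.

End Surface.

Theorem theorem3p11 (R : realType) (n k : nat) (G : carnot_group R n k)
    (rho : 'rV[R]_n -> 'rV[R]_n -> R) (hrho : homogeneous_distance G rho)
    (sigma : {measure set 'rV[R]_n -> \bar R})
    (hsigma : riemannian_surface_measure G sigma)
    (S : set 'rV[R]_n) (hS : C1_hypersurface S) (x : 'rV[R]_n)
    (hx : surface_interior S x) :
  (* case (i) *)
  (~ char_set G S x ->
    asymp_at0 (fun r => sigma_H G sigma S (rball rho x r))
      (kappa_vert G sigma rho x (nu_H G S x)) (hom_dim G).-1) /\
  (* case (ii) *)
  (forall (alpha : 'I_n) (psi : 'rV[R]_n.-1 -> R) (V : set 'rV[R]_n.-1),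
    char_set G S x ->
    (2 <= ord G alpha)%N ->
    open V -> V 0 -> class_C (ord G alpha) V psi -> psi 0 = 0 ->
    (\forall r \near 0^'+,
      left_translate_inv G x S `&` rball rho 0 r `<=` xgraph alpha psi) ->
    (low_order_vanishing G alpha psi ->
      S_infty G alpha (left_translate_inv G x S) =
        xgraph alpha (psi_tilde G alpha psi) /\
      asymp_at0 (fun r => sigma_H G sigma S (rball rho x r))
        (kappa_char G sigma rho alpha S x) (hom_dim G).-1) /\
    (~ low_order_vanishing G alpha psi ->
      S_infty G alpha (left_translate_inv G x S) = set0 /\
      kappa_char G sigma rho alpha S x = 0%E)).
Proof.
case: n G rho hrho sigma hsigma S hS x hx => [|m] G rho hrho sigma hsigma S _ x hx.
  (* In dimension 0 the gradient is an empty row, so no point is interior to a hypersurface. *)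
  by have [_ [U [f [_ _ _ + _]]]] := hx; rewrite (thinmx0 (grad f x)) eqxx.
have Sx : S x by case: hx.
have [W [f [oW W0 fW f0 [gf SW]]]] := surface_interior_op G hx.
split=> [nchar|a psi V [_ ch] o2 oV V0 psiV psi0 nS].
  have hn : enorm (hnormal G S x) != 0 by apply/eqP => h0; apply: nchar.
  have [a [oa1 fa]] := horizontal_partial hrho oW W0 fW f0 gf SW hn.
  have [e [r [psi [e0 r0 psiC psi0 [_ SP]]]]] := surface_graph hrho oW W0 fW f0 fa SW.
  have oU := @norm_ball_open R m e.
  have U0 : `|0 : 'rV[R]_m| < e by rewrite normr0.
  (* In weight one flatness concerns only the empty word, that is, psi 0 = 0. *)
  have fl : flat_to (ord_lift G a) (ord G a) psi.
    rewrite oa1 => -[|j s]; first by rewrite /iter_partial.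
    by rewrite /wsum big_cons ltnNge (leq_trans _ (leq_addr _ _))// ord_gt0.
  apply: (sigma_H_asymp hrho hsigma oU U0 _ fl r0 SP); first by rewrite oa1.
  exact: (vertical_hyperplane_graph hrho oU U0 psiC psi0 oa1 r0 SP hn).
have [r1 [r10 nr1]] : exists r1 : R, 0 < r1 /\
    left_translate_inv G x S `&` rball rho 0 r1 `<=` xgraph a psi.
  apply: (@filter_ex _ _ (at_right_proper_filter 0)); near=> r.
  by split; near: r; [exact: nbhs_right_gt|exact: nS].
have Spsi y : rho 0 y < r1 -> S (mulG G x y) -> y 0 a = psi (col' a y).
  by move=> yr Sy; exact: nr1.
have psiV1 : class_C 1 V psi := class_C_le (ord_gt0 G a) psiV.
(* The given [psi] is tied to [S] in two moves: the direction [a] is transversal to [S], and then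
   [S] equals the graph near the point. *)
have fa := graph_partial hrho oW W0 fW f0 gf SW oV V0 psiV1 r10 Spsi.
have [U [r [oU U0 UV r0 SP]]] := graph_agree hrho oW W0 fW f0 fa SW oV V0 r10 Spsi.
have psiU := class_C_sub UV psiV.
split=> [/(low_order_vanishing_flat _ _ psi0) fl|nlov].
  have [lo up] := blowup_flat hrho oU U0 psiU r0 SP fl.
  have SE : S_infty G a (left_translate_inv G x S) = xgraph a (psi_tilde G a psi).
    rewrite psi_tilde_taylor; apply/seteqP; split=> [y [phi [lo' _ py]]|y yP].
      by rewrite -lo lo'.
    by exists (taylor_limit G a psi).
  split; first exact: SE.
  rewrite /kappa_char SE; apply: (sigma_H_asymp hrho hsigma oU U0 psiU fl r0 SP) => y.
  by rewrite op0l psi_tilde_taylor.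
have SE : S_infty G a (left_translate_inv G x S) = set0.
  (* A point of [S_infty] would make the lower limit a graph over the whole hyperplane, which the
     blow-up of a non-flat function excludes. *)
  apply/seteqP; split=> // y [phi [lo _ _]].
  have nfl : ~ flat_to (ord_lift G a) (ord G a) psi by move=> /(low_order_vanishing_flat _ _ psi0).
  exact: (blowup_not_flat hrho oU U0 psiU r0 SP psi0 nfl lo).
by split; [exact: SE|rewrite /kappa_char SE /sigma_H set0I integral_set0].
Unshelve. all: by end_near. Qed.
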